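(* Assume that $\omega$ is not an eigenfrequency of the limit problem in $\Omega_+$ (as defined in the context) with the insulating condition (I) on $\partial\Omega$. Then there are constants $\sigma_0>0$ and $C>0$ such that for all $\sigma\ge\sigma_0$ and all $\mathbf j\in \mathbf H_0(\mathrm{div},\Omega)$, the Maxwell problem $$\mathrm{curl}\,\mathbf E-i\omega\mu_0\mathbf H=0,\qquad \mathrm{curl}\,\mathbf H+(i\omega\varepsilon_0-\underline\sigma)\mathbf E=\mathbf j\quad\text{in }\Omega,$$ with boundary condition (I) on $\partial\Omega$ has a unique solution $(\mathbf E,\mathbf H)\in\mathbf L^2(\Omega)^2$, and it satisfies $$\|\mathbf E\|_{0,\Omega}+\|\mathbf H\|_{0,\Omega}+\sqrt\sigma\,\|\mathbf E\|_{0,\Omega_-}\le C\,\|\mathbf j\|_{\mathbf H(\mathrm{div},\Omega)}.$$ The same result holds with the conducting boundary condition (C) in place of (I) (both in the Maxwell problem and in the eigenfrequency assumption), for all data $\mathbf j\in\mathbf H(\mathrm{div},\Omega)$.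
   Context: $\Omega\subset\mathbb R^3$ is a smooth bounded simply connected domain with connected boundary $\partial\Omega$; $\Omega_-\subset\subset\Omega$ is a connected Lipschitz subdomain with boundary $\Sigma$; $\Omega_+=\Omega\setminus\overline{\Omega_-}$. The constants $\omega,\varepsilon_0,\mu_0>0$ are fixed. For $\sigma>0$, $\underline\sigma$ is the piecewise constant function equal to $0$ in $\Omega_+$ and $\sigma$ in $\Omega_-$. $\mathbf n$ is a unit normal on the surface considered (outer on $\partial\Omega$). $\mathbf L^2(\Omega)=L^2(\Omega)^3$ (complex valued), with norm $\|\cdot\|_{0,\Omega}$; $\mathbf H(\mathrm{div},\Omega)=\{\mathbf u\in\mathbf L^2(\Omega):\mathrm{div}\,\mathbf u\in L^2(\Omega)\}$ with its graph norm; $\mathbf H_0(\mathrm{div},\Omega)=\{\mathbf u\in\mathbf H(\mathrm{div},\Omega):\mathbf u\cdot\mathbf n=0\text{ on }\partial\Omega\}$. Differential equations are understood in the distributional sense on $\Omega$. Boundary conditions on $\partial\Omega$: (I) perfectly insulating: $\mathbf E\cdot\mathbf n=0$ and $\mathbf H\times\mathbf n=0$; (C) perfectly conducting: $\mathbf E\times\mathbf n=0$ and $\mathbf H\cdot\mathbf n=0$. Limit problem in $\Omega_+$: $\mathrm{curl}\,\mathbf E-i\omega\mu_0\mathbf H=0$ and $\mathrm{curl}\,\mathbf H+i\omega\varepsilon_0\mathbf E=0$ in $\Omega_+$; $\mathbf E\times\mathbf n=0$ and $\mathbf H\cdot\mathbf n=0$ on $\Sigma$; and (I), respectively (C), on $\partial\Omega$.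 ''$\omega$ is not an eigenfrequency'' means that this problem has only the zero solution $(\mathbf E,\mathbf H)\in\mathbf L^2(\Omega_+)^2$. *)

(* Defs.v *)
From HB Require Import structures.
From mathcomp Require Import all_boot all_order all_algebra.
From mathcomp Require Import complex.
From mathcomp Require Import all_classical all_reals all_analysis.

Set Implicit Arguments.
Unset Strict Implicit.
Unset Printing Implicit Defensive.

Import Order.TTheory GRing.Theory Num.Theory.
Import numFieldNormedType.Exports.

Local Open Scope classical_set_scope.
Local Open Scope ring_scope.

(* A point of R^3 is a triple, which carries the library's product topology,
   norm and product Lebesgue measure; values of vector fields are rows. *)
Notation R3 R := (R * R * R)%type.

(* Fields are total functions; only their values on the domain at hand matter,
   and two fields represent the same element of L^2 when they agree a.e. *)
Notation vfield R := (R3 R -> 'rV[R[i]]_3).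

Definition coords {R : realType} (x : R3 R) : 'rV[R]_3 :=
  \row_k [:: x.1.1; x.1.2; x.2]`_k.

Definition basis3 {R : realType} (k : 'I_3) : R3 R :=
  ((k == 0)%:R, (k == 1)%:R, (k == 2)%:R).

Definition boundary {T : topologicalType} (A : set T) : set T :=
  closure A `\` interior A.

(* All iterated directional derivatives exist everywhere and are continuous:
   on a finite-dimensional V this is C^infty. *)
Definition smooth {R : realType} {V W : normedModType R} (f : V -> W) : Prop :=
  forall s : seq V,
    let g := foldr (fun v h => 'D_v h) f s in
    continuous g /\ (forall x v, derivable g x v).

(* Near each of its boundary points, D is the strict subgraph of a function of
   class P in some orthonormal coordinate system. *)
Definition locally_subgraph {R : realType} (P : (R * R -> R) -> Prop)
    (D : set (R3 R)) : Prop :=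
  forall x0, boundary D x0 ->
    exists (A : 'M[R]_3) (g : R * R -> R) (U : set (R3 R)),
      [/\ A *m A^T = 1%:M, P g, open U, U x0 &
          forall x, U x ->
            let y := coords x *m A in
            D x <-> y 0 2 < g (y 0 0, y 0 1)].

Definition smooth_boundary {R : realType} (D : set (R3 R)) : Prop :=
  locally_subgraph (fun g : R * R -> R => smooth g) D.

Definition lipschitz_boundary {R : realType} (D : set (R3 R)) : Prop :=
  locally_subgraph (fun g : R * R -> R => lipschitz g) D.

Definition is_domain {T : topologicalType} (D : set T) : Prop :=
  [/\ open D, connected D & D !=set0].

(* Every loop is null-homotopic relative to its base point; path-connectedness
   is automatic for a domain of R^3. *)
Definition simply_connected {R : realType} (D : set (R3 R)) : Prop :=
  forall c : R -> R3 R,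
    {within `[0, 1], continuous c} -> c @` `[0, 1] `<=` D -> c 0 = c 1 ->
    exists h : R * R -> R3 R,
      [/\ {within `[0, 1] `*` `[0, 1], continuous h},
          h @` (`[0, 1] `*` `[0, 1]) `<=` D,
          (forall t, `[0, 1]%classic t -> h (0, t) = c t /\ h (1, t) = c 0) &
          (forall s, `[0, 1]%classic s -> h (s, 0) = c 0 /\ h (s, 1) = c 0)].

(* The library's Lebesgue measure lives on [measurableTypeR R], which is
   convertible to [R] with its Borel sets. *)
Definition leb3 {R : realType} :
    {measure set (measurableTypeR R * measurableTypeR R * measurableTypeR R)
       -> \bar R} :=
  (@lebesgue_measure R \x @lebesgue_measure R \x @lebesgue_measure R)%E.

Definition cintegral {R : realType} (D : set (R3 R)) (f : R3 R -> R[i]) :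
    R[i] :=
  Complex (\int[leb3]_(x in D) complex.Re (f x))
          (\int[leb3]_(x in D) complex.Im (f x)).

Definition sqnormc {R : realType} (z : R[i]) : R :=
  complex.Re z ^+ 2 + complex.Im z ^+ 2.

Definition inL2 {R : realType} (D : set (R3 R)) (f : R3 R -> R[i]) :
    Prop :=
  [/\ measurable_fun D (fun x => complex.Re (f x)),
      measurable_fun D (fun x => complex.Im (f x)) &
      leb3.-integrable D (fun x => (sqnormc (f x))%:E)].

Definition L2norm {R : realType} (D : set (R3 R)) (f : R3 R -> R[i]) :
    R :=
  Num.sqrt (\int[leb3]_(x in D) sqnormc (f x)).

Definition inL2v {R : realType} (D : set (R3 R)) (u : vfield R) : Prop :=
  forall k, inL2 D (fun x => u x 0 k).

Definition L2vnorm {R : realType} (D : set (R3 R)) (u : vfield R) : R :=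
  Num.sqrt (\sum_k L2norm D (fun x => u x 0 k) ^+ 2).

Definition ae_eq_on {R : realType} (D : set (R3 R)) (u v : vfield R) : Prop :=
  {ae leb3, forall x, D x -> u x = v x}.

Definition test_function {R : realType} {W : normedModType R} (U : set (R3 R))
    (phi : R3 R -> W) : Prop :=
  let supp := closure [set x | phi x != 0] in
  [/\ smooth phi, compact supp & supp `<=` U].

Definition grad {R : realType} (phi : R3 R -> R) (x : R3 R) : 'rV[R]_3 :=
  \row_k 'D_(basis3 k) phi x.

(* Indices are taken modulo 3 in the ring 'I_3. *)
Definition curl {R : realType} (phi : R3 R -> 'rV[R]_3) (x : R3 R) :
    'rV[R]_3 :=
  \row_k ('D_(basis3 (k + 1)) phi x 0 (k + 2)
          - 'D_(basis3 (k + 2)) phi x 0 (k + 1)).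

Definition dotc {R : realType} (u : 'rV[R[i]]_3) (v : 'rV[R]_3) : R[i] :=
  \sum_k u 0 k * (v 0 k)%:C%C.

(* [div u = g], resp. [curl u = g], in the sense of distributions on D; the
   distributions act on real-valued test functions, as the general case follows
   by linearity. *)
Definition is_wdiv {R : realType} (D : set (R3 R)) (u : vfield R)
    (g : R3 R -> R[i]) : Prop :=
  forall phi : R3 R -> R, test_function D phi ->
    cintegral D (fun x => g x * (phi x)%:C%C)
    = - cintegral D (fun x => dotc (u x) (grad phi x)).

Definition is_wcurl {R : realType} (D : set (R3 R)) (u g : vfield R) : Prop :=
  forall phi : R3 R -> 'rV[R]_3, test_function D phi ->
    cintegral D (fun x => dotc (g x) (phi x))
    = cintegral D (fun x => dotc (u x) (curl phi x)).

(* [u . n = 0] and [u x n = 0] on a part G of the boundary of D.  The traces are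
   those of H(div) and H(curl), defined by Green's formula: u has a square
   integrable divergence, resp. curl, on D near G, and the boundary term
   <u . n, phi> = \int (u . grad phi + (div u) phi), resp.
   <u x n, phi> = \int (u . curl phi - (curl u) . phi),
   vanishes for all phi smooth up to the boundary and supported near G. *)
Definition normal_trace0 {R : realType} (D G : set (R3 R)) (u : vfield R) :
    Prop :=
  exists (U : set (R3 R)) (g : R3 R -> R[i]),
    [/\ open U, G `<=` U, inL2 (D `&` U) g, is_wdiv (D `&` U) u g &
        forall phi : R3 R -> R, test_function U phi ->
          cintegral (D `&` U)
            (fun x => dotc (u x) (grad phi x) + g x * (phi x)%:C%C) = 0].

Definition tangential_trace0 {R : realType} (D G : set (R3 R))
    (u : vfield R) : Prop :=
  exists (U : set (R3 R)) (g : vfield R),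
    [/\ open U, G `<=` U, inL2v (D `&` U) g, is_wcurl (D `&` U) u g &
        forall phi : R3 R -> 'rV[R]_3, test_function U phi ->
          cintegral (D `&` U)
            (fun x => dotc (u x) (curl phi x) - dotc (g x) (phi x)) = 0].

Definition inHdiv {R : realType} (D : set (R3 R)) (u : vfield R) : Prop :=
  inL2v D u /\ exists g, inL2 D g /\ is_wdiv D u g.

Definition inH0div {R : realType} (D : set (R3 R)) (u : vfield R) : Prop :=
  inHdiv D u /\ normal_trace0 D (boundary D) u.

(* The L^2 divergence of u, unique up to a.e. equality on D (and 0 if u has
   none). *)
Definition wdiv {R : realType} (D : set (R3 R)) (u : vfield R) :
    R3 R -> R[i] :=
  @xget {classic (R3 R -> R[i])} (fun=> 0)
    [set g | inL2 D g /\ is_wdiv D u g].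

Definition Hdivnorm {R : realType} (D : set (R3 R)) (u : vfield R) : R :=
  Num.sqrt (L2vnorm D u ^+ 2 + L2norm D (wdiv D u) ^+ 2).

Inductive bc := Insulating | Conducting.

Definition boundary_condition {R : realType} (b : bc) (D G : set (R3 R))
    (E H : vfield R) : Prop :=
  match b with
  | Insulating => normal_trace0 D G E /\ tangential_trace0 D G H
  | Conducting => tangential_trace0 D G E /\ normal_trace0 D G H
  end.

Definition source_space {R : realType} (b : bc) (D : set (R3 R))
    (j : vfield R) : Prop :=
  match b with
  | Insulating => inH0div D j
  | Conducting => inHdiv D j
  end.

Section Maxwell.
Context {R : realType}.
Implicit Types (Om Omm : set (R3 R)) (E H j : vfield R).

Definition conductivity Omm (sigma : R) (x : R3 R) : R :=
  if x \in Omm then sigma else 0.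

(* curl E = i omega mu0 H  and  curl H = j - (i omega eps0 - sigma) E. *)
Definition maxwell_solution (b : bc) Om Omm (omega eps0 mu0 sigma : R) j E H :
    Prop :=
  [/\ inL2v Om E, inL2v Om H,
      is_wcurl Om E (fun x => Complex 0 (omega * mu0) *: H x),
      is_wcurl Om H (fun x =>
        j x - Complex (- conductivity Omm sigma x) (omega * eps0) *: E x) &
      boundary_condition b Om (boundary Om) E H].

Definition limit_solution (b : bc) Om Omm (omega eps0 mu0 : R) E H : Prop :=
  let Omp := Om `\` closure Omm in
  [/\ inL2v Omp E /\ inL2v Omp H,
      is_wcurl Omp E (fun x => Complex 0 (omega * mu0) *: H x),
      is_wcurl Omp H (fun x => - (Complex 0 (omega * eps0) *: E x)),
      tangential_trace0 Omp (boundary Omm) E /\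
      normal_trace0 Omp (boundary Omm) H &
      boundary_condition b Omp (boundary Om) E H].

Definition not_eigenfrequency (b : bc) Om Omm (omega eps0 mu0 : R) : Prop :=
  forall E H, limit_solution b Om Omm omega eps0 mu0 E H ->
    ae_eq_on (Om `\` closure Omm) E (fun=> 0) /\
    ae_eq_on (Om `\` closure Omm) H (fun=> 0).

End Maxwell.

(* Main.v *)
(* The estimate holds with the L^2 norm of j alone, and is proved by contradiction
   and compactness. Let (E_n, H_n) be solutions of norm one with sources tending
   to 0 and sigma_n tending to infinity. The energy balance
   gives sqrt(sigma_n) ||E_n||_{0,Omega_-} -> 0, so a weak limit vanishes in
   Omega_- and solves the limit problem in Omega_+; it is 0. Strong convergence is
   obtained locally. A fundamental solution of the divergence carried by a cone
   and cut into dyadic shells writes a field u with an L^2 curl as a gradient plus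
   a term compact in u and curl u, and near a boundary point the cone directions
   keep the gradient inside the domain. Near Sigma, E_n is first multiplied by a
   cutoff at the scale sigma_n^(-1/2), to absorb the part sigma_n E_n of curl H_n.
   Testing the equations with the gradient, which curls ignore, shows that E_n
   tends to 0 near every point; the energy balance then gives H_n -> 0, a
   contradiction.
   Existence: the range of the operator is closed by the estimate, and a right-hand
   side orthogonal to it yields, after exchange of E and H and changes of signs, a
   solution of the homogeneous problem, which is 0.
   Fields are extended by 0 and split into real and imaginary parts; the boundary
   condition on u x n then says that the curl of u on R^3 is the extension by 0 of
   its curl on Omega. *)
Require Import Defs.
From HB Require Import structures.
From mathcomp Require Import all_boot all_order all_algebra.
From mathcomp Require Import complex.
From mathcomp Require Import all_classical all_reals all_analysis.
From mathcomp Require Import measurable_realfun ring lra zify.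
Set Implicit Arguments.
Unset Strict Implicit.
Unset Printing Implicit Defensive.
Import Order.TTheory GRing.Theory Num.Theory.
Import numFieldNormedType.Exports.
Local Open Scope classical_set_scope.
Local Open Scope ring_scope.

(** The obstacle is the term [sigma E] of curl H in Omega_-: the energy balance controls
    [sqrt sigma * E] there, so a gradient can be tested against it only if its own norm on Omega_-
    is of order [1 / sqrt sigma]. One-sided kernels provide this. Near Sigma the cone is turned so
    that a point of Omega_- looks only deeper into Omega_-, where the cutoff has removed the field.
    Shells larger than the cutoff scale then contribute nothing on Omega_-, and the smaller ones
    have total mass of order [1 / sqrt sigma], since shell [m] has mass of order [2^-m]. Near the
    outer boundary the cone is turned so that the potential of a field supported in Omega is
    supported well inside Omega. Only the field whose zero extension has a square integrable curl
    can be decomposed up to that boundary; under the insulating condition it is H, and E is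
    recovered from H by one more local integration by parts. Of the geometry, only an interior cone
    at each boundary point enters; it also shows that Sigma is a null set. *)

(** * Complete spaces for a semidefinite form, Riesz representation *)

Section SemiHilbert.
Context {R : realType} {V : lmodType R}.
Implicit Types (P : V -> Prop) (B : V -> V -> R) (u v w : V).

(* A complete space for a positive semidefinite form: limits are only unique up
   to vectors of zero seminorm, as for square integrable functions. *)
Record semi_hilbert P B : Prop := SemiHilbert {
  sh_0 : P 0;
  sh_lin : forall a u v, P u -> P v -> P (a *: u + v);
  sh_sym : forall u v, B u v = B v u;
  sh_bilin : forall a u v w, P u -> P v -> P w ->
    B (a *: u + v) w = a * B u w + B v w;
  sh_ge0 : forall u, P u -> 0 <= B u u;
  sh_complete : forall u_ : nat -> V, (forall n, P (u_ n)) ->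
    (forall e : R, 0 < e -> exists N, forall m n, (N <= m)%N -> (N <= n)%N ->
      B (u_ m - u_ n) (u_ m - u_ n) <= e) ->
    exists2 l, P l & forall e : R, 0 < e -> exists N, forall n, (N <= n)%N ->
      B (u_ n - l) (u_ n - l) <= e }.

(** The value at the minimiser [- b / c] is the discriminant; for [c = 0] an affine function bounded
    below has slope zero. The Cauchy-Schwarz inequalities below come from it. *)
Lemma discr_le (b c e : R) : 0 <= c -> 0 <= e ->
  (forall t, 0 <= t ^+ 2 * c + t * b *+ 2 + e) -> b ^+ 2 <= c * e.
Proof.
move=> c0 e0 H.
have [c_eq|cn0] := eqVneq c 0.
  have [-> |bn0] := eqVneq b 0; first by rewrite expr0n /= mulr_ge0.
  have := H (- (e + 1) / (b *+ 2)); rewrite c_eq mulr0 add0r -mulrnAr mulrVK.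
    by lra.
  by rewrite unitfE mulrn_eq0.
have cp : 0 < c by rewrite lt_def cn0.
have := H (- b / c).
rewrite exprMn exprVn sqrrN.
have -> : b ^+ 2 * c ^- 2 * c + - b / c * b *+ 2 + e = (c * e - b ^+ 2) / c.
  by field; rewrite gt_eqF.
by rewrite pmulr_lge0 ?invr_gt0// subr_ge0.
Qed.

Section theory.
Context P B (h : semi_hilbert P B).

Let P0 := sh_0 h.
Let Pl := sh_lin h.

Lemma sh_scale a u : P u -> P (a *: u).
Proof. by move=> Pu; rewrite -[_ *: _]addr0; apply: Pl. Qed.

Lemma sh_add u v : P u -> P v -> P (u + v).
Proof. by move=> Pu Pv; rewrite -[u]scale1r; apply: Pl. Qed.

Lemma sh_sub u v : P u -> P v -> P (u - v).
Proof. by move=> Pu Pv; rewrite addrC -scaleN1r; apply: Pl. Qed.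

Lemma sh_Dl u v w : P u -> P v -> P w -> B (u + v) w = B u w + B v w.
Proof.
by move=> Pu Pv Pw; rewrite -{1}[u]scale1r (sh_bilin h)// mul1r.
Qed.

Lemma sh_B0 w : P w -> B 0 w = 0.
Proof.
move=> Pw; have := sh_bilin h 1 P0 P0 Pw.
by rewrite scale1r addr0 mul1r => /eqP; rewrite eq_sym addrC -subr_eq0 addrK => /eqP.
Qed.

Lemma sh_Zl a u w : P u -> P w -> B (a *: u) w = a * B u w.
Proof.
by move=> Pu Pw; rewrite -[a *: u]addr0 (sh_bilin h)// sh_B0// addr0.
Qed.

Lemma sh_Bl u v w : P u -> P v -> P w -> B (u - v) w = B u w - B v w.
Proof.
move=> Pu Pv Pw; rewrite addrC -scaleN1r (sh_bilin h)// mulN1r addrC//.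
Qed.

Lemma sh_line t u v : P u -> P v ->
  B (t *: u + v) (t *: u + v) = t ^+ 2 * B u u + t * B u v *+ 2 + B v v.
Proof.
move=> Pu Pv; rewrite (sh_bilin h)//; last exact: Pl.
rewrite (sh_sym h u) (sh_sym h v) !(sh_bilin h)//.
by rewrite (sh_sym h v u); ring.
Qed.

Lemma sh_CS u v : P u -> P v -> B u v ^+ 2 <= B u u * B v v.
Proof.
move=> Pu Pv; apply: discr_le; [exact: (sh_ge0 h)|exact: (sh_ge0 h)|].
by move=> t; rewrite -sh_line//; apply: (sh_ge0 h); apply: Pl.
Qed.

(** Dirichlet's principle: a minimising sequence of [J u = B u u - 2 * l u] is Cauchy, and its limit
    represents [l]. The limit need not be unique, as [B] is only semidefinite. *)
Lemma sh_riesz (l : V -> R) C :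
  (forall a u v, P u -> P v -> l (a *: u + v) = a * l u + l v) ->
  (forall u, P u -> l u ^+ 2 <= C * B u u) ->
  exists2 u, P u & forall v, P v -> B u v = l v.
Proof.
move=> llin lbd.
pose J u := B u u - 2 * l u.
have l0 : l 0 = 0.
  have := llin 1 0 0 P0 P0; rewrite scale1r addr0 mul1r => /eqP.
  by rewrite eq_sym addrC -subr_eq0 addrK => /eqP.
have JC u : P u -> - `|C| - 1 <= J u.
  move=> Pu; have := lbd _ Pu; have := sh_ge0 h Pu; rewrite /J => b0 bd.
  have C0 : C <= `|C| := ler_norm C.
  have CN : 0 <= `|C| := normr_ge0 C.
  have : l u ^+ 2 <= (`|C| + 1) * B u u by nra.
  have : 0 <= B u u + (`|C| + 1) by nra.
  set b := B u u in b0 *; set k := `|C| + 1; move=> bk lk.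
  suff : 2 * l u <= b + k by rewrite /k; lra.
  have [lu|lu] := ltP (2 * l u) 0; first by lra.
  rewrite -(@ler_pXn2r _ 2)// ?nnegrE//.
  by have := sqr_ge0 (b - k); rewrite exprMn; nra.
pose S := [set J u | u in P].
have hS : has_inf S.
  split; first by exists (J 0); exists 0.
  by exists (- `|C| - 1) => _ [u Pu <-]; exact: JC.
pose d := inf S.
have dJ u : P u -> d <= J u.
  by move=> Pu; apply: inf_lbound; [case: hS|exists u].
have /choice[u_ u_P] n : exists u, P u /\ J u <= d + n.+1%:R^-1.
  have : 0 < n.+1%:R^-1 :> R by rewrite invr_gt0.
  by move=> /(inf_adherent)/(_ hS)[_ [u Pu <-]] /ltW; exists u.
have Pu_ n : P (u_ n) by case: (u_P n).
have Ju n : J (u_ n) <= d + n.+1%:R^-1 by case: (u_P n).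
have lD u v : P u -> P v -> l (u + v) = l u + l v.
  by move=> Pu Pv; rewrite -{1}[u]scale1r llin// mul1r.
have lZ a u : P u -> l (a *: u) = a * l u.
  by move=> Pu; rewrite -[a *: u]addr0 llin// l0 addr0.
have inv_small (e : R) : 0 < e -> exists N, forall n, (N <= n)%N -> n.+1%:R^-1 <= e.
  move=> e0; exists (Num.truncn e^-1) => n Nn.
  rewrite -[e]invrK lef_pV2 ?posrE ?invr_gt0// ltW//.
  by rewrite (lt_le_trans (truncnS_gt _))// ler_nat.
(* Parallelogram identity: the midpoint also satisfies [J >= d], so two vectors with [J] at most
   [d + e / 4] are within [e] for the squared seminorm. *)
have cau (e : R) : 0 < e -> exists N, forall m n, (N <= m)%N -> (N <= n)%N ->
    B (u_ m - u_ n) (u_ m - u_ n) <= e.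
  move=> e0; have [N HN] := inv_small (e / 4) ltac:(by rewrite divr_gt0).
  exists N => m n Nm Nn.
  have := dJ _ (sh_scale 2^-1 (sh_add (Pu_ m) (Pu_ n))).
  rewrite /J lZ ?lD//; last exact: sh_add.
  have Pmn := sh_add (Pu_ m) (Pu_ n).
  rewrite (sh_Zl _ Pmn (sh_scale _ Pmn)) (sh_sym h) (sh_Zl _ Pmn Pmn).
  have := Ju m; have := Ju n; have := HN m Nm; have := HN n Nn.
  have h1 := sh_line 1 (Pu_ n) (Pu_ m); have h2 := sh_line (-1) (Pu_ n) (Pu_ m).
  rewrite scale1r addrC in h1; rewrite scaleN1r addrC in h2.
  rewrite /J h1 h2; set a1 := n.+1%:R^-1; set a2 := m.+1%:R^-1.
  by move: (B _ _) (B _ _) (B _ _) (l _) (l _) a1 a2 => *; lra.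
have [u Pu Hu] := sh_complete h Pu_ cau.
exists u => // v Pv; apply/eqP; rewrite -subr_eq0 -sqrf_eq0.
rewrite eq_le sqr_ge0 andbT; apply/ler_addgt0Pr => /= e e0; rewrite add0r.
have b0 := sh_ge0 h Pv.
(* The final error is a difference [x - y] whose two terms have squares at most [e' * B v v], and
   [(x - y)^2 <= 2 (x^2 + y^2)]; the [+ 1] allows [B v v = 0]. *)
pose e' := e / (4 * (B v v + 1)).
have e'0 : 0 < e' by rewrite divr_gt0// mulr_gt0//; lra.
have [N1 H1] := inv_small _ e'0; have [N2 H2] := Hu _ e'0.
pose n := maxn N1 N2.
have {H1} := H1 n (leq_maxl _ _); have {H2} := H2 n (leq_maxr _ _).
move=> Hun Hn.
(* For all [t], [J (t v + u_n) >= d >= J (u_n) - 1 / (n + 1)]: a quadratic polynomial in [t] is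
   nonnegative, and its discriminant gives the bound. *)
have D1 : (B (u_ n) v - l v) ^+ 2 <= B v v * n.+1%:R^-1.
  apply: discr_le => // t.
  have := dJ _ (Pl t Pv (Pu_ n)).
  rewrite /J sh_line// llin//.
  have := Ju n; rewrite /J (sh_sym h v); move: (n.+1%:R^-1) => a.
  by move: (B _ _) (B _ _) (B _ _) (l _) (l _) => *; nra.
have D2 := sh_CS (sh_sub (Pu_ n) Pu) Pv.
rewrite sh_Bl// in D2.
have : e' * (4 * (B v v + 1)) = e.
  by rewrite /e' mulfVK// gt_eqF// mulr_gt0//; lra.
have : B v v * n.+1%:R^-1 <= B v v * e' by rewrite ler_wpM2l.
have := ler_wpM2r b0 Hun.
set x := B (u_ n) v - l v in D1 *; set y := B (u_ n) v - B u v in D2 *.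
have -> : B u v - l v = x - y by rewrite /x /y; ring.
move: (n.+1%:R^-1) (B _ _) (B v v) D1 D2 b0 e'0 => c q b D1 D2 b0 e'0 h1 h2 <-.
by have := sqr_ge0 (x + y); nra.
Qed.

End theory.

(** The subspace is given as a complete space in its own right, which replaces a closedness
    condition: Riesz inside [S], applied to the functional [B x], yields the projection. *)
Lemma sh_proj (P S : V -> Prop) B x : semi_hilbert P B -> semi_hilbert S B ->
  P x -> (forall u, S u -> P u) ->
  exists2 s, S s & forall v, S v -> B (x - s) v = 0.
Proof.
move=> hP hS Px SP.
have [|u Pu|s Ss Hs] := @sh_riesz _ _ hS (B x) (B x x).
- move=> a u v Su Sv; rewrite !(sh_sym hP x) (sh_bilin hP) ?(sh_sym hP x)//; exact: SP.
- by apply: (sh_CS hP) => //; apply: SP.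
exists s => // v Sv.
by rewrite (sh_Bl hP) ?Hs ?subrr//; apply: SP.
Qed.

End SemiHilbert.

(** * Completeness of L^2 *)

Section SquareIntegrable.
Context d {T : measurableType d} {R : realType} (mu : {measure set T -> \bar R}).
Implicit Types f g : T -> R.

Definition L2 f := measurable_fun setT f /\
  mu.-integrable setT (fun x => (f x ^+ 2)%:E).

Definition ip f g := \int[mu]_x (f x * g x).

Lemma L2_mul f g : L2 f -> L2 g -> mu.-integrable setT (fun x => (f x * g x)%:E).
Proof.
move=> [mf f2] [mg g2].
apply: (@le_integrable _ _ _ _ _ measurableT _ ((fun x => (f x ^+ 2)%:E) \+ (fun x => (g x ^+ 2)%:E))%E).
- by apply/measurable_EFinP; apply: measurable_funM.
- move=> x _ /=; rewrite lee_fin (le_trans _ (ler_norm _))// ler_norml.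
  have := sqr_ge0 (f x - g x); have := sqr_ge0 (f x + g x).
  have := sqr_ge0 (f x); have := sqr_ge0 (g x).
  by move=> *; apply/andP; split; nra.
- exact: integrableD.
Qed.

Lemma L2_lin a f g : L2 f -> L2 g -> L2 (a *: f + g).
Proof.
move=> Lf Lg; have [mf f2] := Lf; have [mg g2] := Lg; split.
  by apply: measurable_funD => //; apply: measurable_funM.
rewrite [X in integrable _ _ X](_ : _ = (fun x => ((a ^+ 2)%:E * (f x ^+ 2)%:E
   + ((2 * a)%:E * (f x * g x)%:E + (g x ^+ 2)%:E))%E)).
  apply: integrableD => //; first exact: integrableZl.
  by apply: integrableD => //; apply: integrableZl => //; apply: L2_mul.
by apply/funext => x /=; rewrite -!EFinM -!EFinD; congr EFin; rewrite !fctE /GRing.scale /=; ring.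
Qed.

Lemma L2_0 : L2 0.
Proof.
split; first exact: measurable_cst.
rewrite [X in integrable _ _ X](_ : _ = cst 0%E); first exact: integrable0.
by apply/funext => x; rewrite -[(0 : T -> R) x]/(0 : R) expr0n.
Qed.

Lemma ip_sym f g : ip f g = ip g f.
Proof. by apply: eq_Rintegral => x _; rewrite mulrC. Qed.

Lemma ip_bilin a f g h : L2 f -> L2 g -> L2 h ->
  ip (a *: f + g) h = a * ip f h + ip g h.
Proof.
move=> Lf Lg Lh; rewrite /ip -RintegralZl//; last exact: L2_mul.
rewrite -RintegralD//; [|by apply: (integrableZl _ _ (L2_mul Lf Lh))|exact: L2_mul].
by apply: eq_Rintegral => x _; rewrite !fctE /GRing.scale /= mulrDl mulrA.
Qed.

Lemma ip_ge0 f : 0 <= ip f f.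
Proof. by apply: Rintegral_ge0 => x _; rewrite -expr2 sqr_ge0. Qed.

Lemma EFin_ip f : L2 f -> (ip f f)%:E = (\int[mu]_x (f x ^+ 2)%:E)%E.
Proof.
move=> [mf f2]; rewrite /ip /Rintegral fineK; last first.
  by apply: integrable_fin_num => //; apply: L2_mul.
by apply: eq_integral => x _; rewrite expr2.
Qed.

Lemma ip_eq0 f : L2 f -> ip f f = 0 -> {ae mu, forall x, f x = 0}.
Proof.
move=> Lf f0; have := EFin_ip Lf; rewrite f0 => /esym.
rewrite (eq_integral (fun x => `|(f x ^+ 2)%:E|)%E); last first.
  by move=> x _; rewrite gee0_abs// lee_fin sqr_ge0.
move/(ae_eq_integral_abs mu measurableT); case: Lf => mf _.
move=> H; have {H}: ae_eq mu setT (fun x => (f x ^+ 2)%:E) (cst 0%E).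
  by apply: H; apply/measurable_EFinP; apply: measurable_funX.
by apply: filterS => x /(_ I) [] /eqP; rewrite sqrf_eq0 => /eqP.
Qed.

Lemma L2_le f g : measurable_fun setT f -> (forall x, `|f x| <= `|g x|) ->
  L2 g -> L2 f.
Proof.
move=> mf fg [mg g2]; split=> //; apply: le_integrable g2 => //.
  by apply/measurable_EFinP; apply: measurable_funX.
move=> x _; rewrite /= lee_fin !normrX.
by rewrite lerXn2r ?nnegrE.
Qed.

(* Fast Cauchy subsequences: \sum_j 2^j |g_(j+1) - g_j|^2 is integrable, so that
   g converges almost everywhere. *)
Lemma L2_fast_cvg (g : nat -> T -> R) : (forall n, L2 (g n)) ->
  (forall j, ip (g j.+1 - g j) (g j.+1 - g j) <= (4^-1) ^+ j) ->
  exists A, [/\ measurable A, mu (~` A) = 0 &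
    forall x, A x -> cvgn (fun n => g n x)].
Proof.
move=> Lg gfast.
have Ld j : L2 (g j.+1 - g j).
  by rewrite addrC -scaleN1r; apply: L2_lin.
pose h j x := ((2 ^+ j)%:E * ((g j.+1 x - g j x) ^+ 2)%:E)%E.
have h0 j x : (0 <= h j x)%E.
  by rewrite mule_ge0// lee_fin ?sqr_ge0// exprn_ge0.
have mh j : measurable_fun setT (h j).
  apply/measurable_funeM/measurable_EFinP/measurable_funX.
  by case: (Ld j).
pose S x := (\sum_(0 <= j <oo) h j x)%E.
have mS : measurable_fun setT S by apply: ge0_emeasurable_sum => //.
have S0 x : (0 <= S x)%E by apply: nneseries_ge0 => *.
have intS : (\int[mu]_x S x < +oo)%E.
  rewrite integral_nneseries//.
  have bd j : (\int[mu]_x h j x <= ((2^-1) ^+ j)%:E)%E.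
    rewrite ge0_integralZl//; first last.
    - by move=> x _; rewrite lee_fin sqr_ge0.
    - by apply/measurable_EFinP/measurable_funX; case: (Ld j).
    rewrite -(EFin_ip (Ld j)) -EFinM lee_fin.
    have -> : (2^-1) ^+ j = 2 ^+ j * (4^-1) ^+ j :> R.
      by rewrite -exprMn; congr (_ ^+ _); lra.
    by rewrite ler_wpM2l// exprn_ge0.
  apply: (@le_lt_trans _ _ 2%:E); last exact: ltry.
  apply: (@le_trans _ _ (\sum_(0 <= j <oo) ((2^-1) ^+ j)%:E)%E).
    apply: lee_nneseries => *; [exact: integral_ge0|exact: bd].
  apply: lime_le.
    by apply: is_cvg_nneseries => *; rewrite lee_fin exprn_ge0.
  apply: nearW => n; rewrite sumEFin lee_fin.
  have -> : \sum_(0 <= i < n) (2^-1) ^+ i = 2 - 2 * (2^-1) ^+ n :> R.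
    elim: n => [|n IH]; first by rewrite big_geq// expr0; lra.
    by rewrite big_nat_recr//= IH exprS; lra.
  by rewrite gerBl mulr_ge0// exprn_ge0.
have iS : mu.-integrable setT S.
  apply/integrableP; split=> //.
  by under eq_integral do rewrite gee0_abs//.
pose A := [set x | (S x < +oo)%E].
have mA : measurable A.
  by rewrite -[A]setTI; apply: emeasurable_fun_infty_o => //; exact: mS.
exists A; split=> //.
  have [N [mN N0 NA]] := integrable_ae measurableT iS.
  apply/eqP; rewrite -measure_le0 -N0 le_measure ?inE//; first exact: measurableC.
  move=> x /= nA; apply: NA => /= /(_ I) Sf; apply: nA.
  by rewrite /A /= ltey_eq Sf.
move=> x Ax.
have : cvgn (series (fun j => g j.+1 x - g j x)).
  apply: normed_cvg.
  apply: nondecreasing_is_cvgn.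
    by apply: nondecreasing_series => *; rewrite normr_ge0.
  have Sf : S x \is a fin_num by rewrite ge0_fin_numE.
  (* The increments [a] satisfy [a <= 2^-j + 2^j a^2]: the first terms sum to at most 2, the second
     ones to at most [S x]. *)
  exists (2 + fine (S x)) => _ [n _ <-].
  rewrite /series /=.
  apply: (@le_trans _ _ (\sum_(0 <= j < n) ((2^-1) ^+ j + 2 ^+ j * (g j.+1 x - g j x) ^+ 2))).
    apply: ler_sum => j _.
    have p0 : 0 < 2 ^+ j :> R by rewrite exprn_gt0.
    have -> : (2^-1) ^+ j = (2 ^+ j)^-1 :> R by rewrite exprVn.
    set a := `|_|; have -> : (g j.+1 x - g j x) ^+ 2 = a ^+ 2 by rewrite /a real_normK// num_real.
    move: (2 ^+ j) p0 => p p0; rewrite -(ler_pM2l p0) mulrDr divff ?gt_eqF//.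
    have : 0 <= p * a by rewrite mulr_ge0 ?normr_ge0// ltW.
    have -> : p * (p * a ^+ 2) = (p * a) ^+ 2 by ring.
    by move: (p * a) => b b0; have := sqr_ge0 (b - 1); nra.
  rewrite big_split /=; apply: lerD.
    have -> : \sum_(0 <= i < n) (2^-1) ^+ i = 2 - 2 * (2^-1) ^+ n :> R.
      elim: n => [|n IH]; first by rewrite big_geq// expr0; lra.
      by rewrite big_nat_recr//= IH exprS; lra.
    by rewrite gerBl mulr_ge0// exprn_ge0.
  rewrite -lee_fin fineK// -sumEFin.
  under eq_bigr do rewrite EFinM.
  by rewrite /S; apply: (nneseries_lim_ge (u_ := h ^~ x)) => *; exact: h0.
move=> c; have -> : (fun n => g n x) = series (fun j => g j.+1 x - g j x) + cst (g 0%N x).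
  apply/funext => n; rewrite !fctE /series /=.
  by rewrite telescope_sumr// subrK.
by apply: is_cvgD => //; exact: is_cvg_cst.
Qed.

(** Riesz-Fischer. A subsequence with gaps [4^-j] converges on a set [A] of full measure; the limit
    is set to 0 off [A], so that it is the pointwise limit of measurable functions everywhere. *)
Lemma L2_semi_hilbert : semi_hilbert L2 ip.
Proof.
split; [exact: L2_0|exact: L2_lin|exact: ip_sym|exact: ip_bilin|by move=> *; exact: ip_ge0|].
move=> u Lu cau.
have LB f g : L2 f -> L2 g -> L2 (f - g).
  by move=> Lf Lg; rewrite addrC -scaleN1r; apply: L2_lin.
have /choice[N HN] j : exists N, forall m n, (N <= m)%N -> (N <= n)%N ->
    ip (u m - u n) (u m - u n) <= (4^-1) ^+ j.
  by apply: cau; rewrite exprn_gt0.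
pose k := fix k j := if j is j'.+1 then maxn (k j').+1 (N j) else N 0%N.
have kN j : (N j <= k j)%N by case: j => //= j; rewrite leq_maxr.
have kS j : (k j < k j.+1)%N by rewrite /= leq_maxl.
have kge j : (j <= k j)%N.
  by elim: j => // j IH; rewrite (leq_ltn_trans IH).
pose g j := u (k j).
have [||A [mA A0 Acvg]] := @L2_fast_cvg g.
- by move=> n; exact: Lu.
- by move=> j; apply: HN => //; rewrite (leq_trans (kN _))// ltnW.
pose gA n x := g n x * \1_A x.
pose l x := limn (fun n => gA n x).
have gAc x : gA n x @[n --> \oo] --> l x.
  have [Ax|nAx] := pselect (A x).
    have -> : (fun n => gA n x) = (fun n => g n x).
      by apply/funext => n; rewrite /gA indicE mem_set// mulr1.
    rewrite /l; have -> : (fun n => gA n x) = (fun n => g n x).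
      by apply/funext => n; rewrite /gA indicE mem_set// mulr1.
    exact: Acvg.
  have E : (fun n => gA n x) = cst 0.
    by apply/funext => n; rewrite /gA indicE memNset// mulr0.
  by rewrite /l E lim_cst//; exact: cvg_cst.
have mgA n : measurable_fun setT (gA n).
  by apply: measurable_funM; [case: (Lu (k n))|exact: measurable_indic].
have ml : measurable_fun setT l.
  exact: (measurable_realfun.measurable_fun_cvg mgA (fun x _ => gAc x)).
have aeA : {ae mu, forall x, A x}.
  exists (~` A); split => //; exact: measurableC.
(* Fatou along the fast subsequence carries the Cauchy bound from the differences [u n - g j] over
   to [u n - l]. *)
have key e : 0 < e -> exists M, forall n, (M <= n)%N ->
    (\int[mu]_x ((u n x - l x) ^+ 2)%:E <= e%:E)%E.
  move=> e0; have [M HM] := cau _ e0; exists M => n Mn.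
  have mq j : measurable_fun setT (fun x => ((u n x - gA j x) ^+ 2)%:E).
    by apply/measurable_EFinP/measurable_funX/measurable_funB => //; case: (Lu n).
  have := @fatou _ _ _ mu setT measurableT (fun j x => ((u n x - gA j x) ^+ 2)%:E) mq.
  move=> /(_ (fun j x _ => _)) H.
  have {H} := H ltac:(by move=> *; rewrite lee_fin sqr_ge0).
  rewrite (eq_integral (fun x => ((u n x - l x) ^+ 2)%:E)); last first.
    move=> x _; suff /cvg_limn_einf_sup[-> _] : (((u n x - gA j x) ^+ 2)%:E @[j --> \oo] -->
      ((u n x - l x) ^+ 2)%:E) by [].
    apply: cvg_EFin; first exact: nearW.
    have c : (u n x - gA j x) @[j --> \oo] --> u n x - l x.
      by apply: cvgB; [exact: cvg_cst|exact: gAc].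
    exact: (cvgM c c).
  move=> /le_trans; apply.
  rewrite limn_einf_lim; apply: lime_le; first exact: is_cvg_einfs.
  apply: nearW => m; apply: (@le_trans _ _ (\int[mu]_x ((u n x - gA (maxn m M) x) ^+ 2)%:E)%E).
    by apply: ereal_inf_lbound; exists (maxn m M) => //=; rewrite leq_maxl.
  rewrite (@ge0_ae_eq_integral _ _ _ _ _ _ (fun x => ((u n - g (maxn m M)) x ^+ 2)%:E))//.
  - rewrite -(EFin_ip (LB _ _ (Lu n) (Lu (k (maxn m M))))).
    rewrite lee_fin; apply: HM => //.
    by rewrite (leq_trans _ (kge _))// leq_maxr.
  - by apply/measurable_EFinP/measurable_funX; case: (LB _ _ (Lu n) (Lu (k (maxn m M)))).
  - by move=> *; rewrite lee_fin sqr_ge0.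
  - by move=> *; rewrite lee_fin sqr_ge0.
  - by apply: filterS aeA => x Ax _; rewrite /gA indicE mem_set// mulr1.
have [M0 HM0] := key 1 ltr01.
have Ll : L2 l.
  have Lul : L2 (l - u M0).
    split; first by apply: measurable_funB => //; case: (Lu M0).
    apply/integrableP; split.
      by apply/measurable_EFinP/measurable_funX/measurable_funB => //; case: (Lu M0).
    under eq_integral do rewrite gee0_abs ?lee_fin ?sqr_ge0//.
    apply: le_lt_trans (ltry 1); apply: le_trans (HM0 _ (leqnn _)).
    by under eq_integral do rewrite -sqrrN opprB.
  have -> : l = 1 *: (l - u M0) + u M0 by rewrite scale1r subrK.
  exact: L2_lin.
exists l => // e /key[M HM]; exists M => n /HM.
by rewrite -EFin_ip ?lee_fin//; exact: LB.
Qed.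

End SquareIntegrable.

(** * Weak compactness along ultrafilters *)

Lemma ultra_fmap (T U : Type) (f : T -> U) (F : set_system T) :
  UltraFilter F -> UltraFilter (f @ F).
Proof.
move=> UF; have PF : ProperFilter F by exact: ultra_proper.
have PfF : ProperFilter (f @ F) by exact: fmap_proper_filter.
apply: Build_UltraFilter => // G PG sG; rewrite eqEsubset; split=> // A GA.
have [//|nFA] := in_ultra_setVsetC (f @^-1` A) UF.
have GnA : G (~` A) by apply: sG.
by have [x [Ax]] := filter_ex (filterI GA GnA).
Qed.

Section SemiHilbertFamily.
Context {R : realType} {V : lmodType R} (P : V -> Prop) (B : V -> V -> R).
Hypothesis h : semi_hilbert P B.

(** Through this product, the twelve real components of a pair of complex vector fields are
    projected, or pass to a weak limit, all at once. *)
Lemma sh_fam (I : finType) :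
  semi_hilbert (fun u : I -> V => forall i, P (u i))
               (fun u v => \sum_i B (u i) (v i)).
Proof.
split.
- by move=> i; exact: (sh_0 h).
- by move=> a u v Pu Pv i; exact: (sh_lin h).
- by move=> u v; apply: eq_bigr => i _; exact: (sh_sym h).
- move=> a u v w Pu Pv Pw; rewrite mulr_sumr -big_split /=.
  by apply: eq_bigr => i _; exact: (sh_bilin h).
- by move=> u Pu; apply: sumr_ge0 => i _; exact: (sh_ge0 h).
move=> u Pu cau.
have hi i : exists l, P l /\ forall e : R, 0 < e -> exists N, forall n, (N <= n)%N ->
      B (u n i - l) (u n i - l) <= e.
  have [||l Pl Hl] := sh_complete h (u_ := fun n => u n i) _ _.
  - by move=> n; exact: Pu.
  - move=> e e0; have [N HN] := cau e e0; exists N => m n Nm Nn.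
    apply: le_trans (HN _ _ Nm Nn); rewrite (bigD1 i)//= lerDl.
    by apply: sumr_ge0 => j _; apply: (sh_ge0 h); apply: (sh_sub h).
  by exists l.
have [l Hl] := choice hi.
exists l => [i|e e0]; first by case: (Hl i).
have e'0 : 0 < e / (#|I|.+1)%:R by rewrite divr_gt0.
have /choice[N HN] i := (Hl i).2 _ e'0.
exists (\max_i N i) => n Nn.
apply: (@le_trans _ _ (\sum_(i : I) e / (#|I|.+1)%:R)).
  apply: ler_sum => i _; apply: HN; exact: leq_trans (leq_bigmax i) Nn.
rewrite sumr_const -[_ *+ _]mulr_natr -mulrA ler_piMr//; first exact: ltW.
by rewrite mulrC ler_pdivrMr// mul1r ler_nat.
Qed.

(** An ultrafilter finer than [\oo] takes the place of a diagonal subsequence: along it every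
    bounded real sequence [B (u n) v] converges, whatever the number of [v], and the limits form a
    bounded linear functional, to which Riesz applies. *)
Lemma sh_weak_limit (u : nat -> V) M : (forall n, P (u n)) ->
  (forall n, B (u n) (u n) <= M) ->
  exists F : set_system nat, [/\ ProperFilter F, \oo `<=` F &
    exists2 l, P l & forall v, P v -> B (u n) v @[n --> F] --> B l v].
Proof.
move=> Pu bd.
have [F [UF Foo]] := ultraFilterLemma eventually_filter.
have PF : ProperFilter F by exact: ultra_proper.
have FF : Filter F by exact: filter_filter.
exists F; split=> //.
have Bb v : P v -> forall n, B (u n) v ^+ 2 <= M * B v v.
  move=> Pv n; apply: le_trans (sh_CS h (Pu n) Pv) _.
  by rewrite ler_wpM2r// (sh_ge0 h).
have cvgB v : P v -> exists l : R, B (u n) v @[n --> F] --> l.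
  move=> Pv; pose C := M * B v v + 1.
  have UI : UltraFilter (B (u n) v @[n --> F]) by exact: ultra_fmap.
  have cC : compact (`[- C, C] : set R) by exact: segment_compact.
  move: cC; rewrite compact_ultra => /(_ _ UI) [].
    apply: (@filterS _ F _ setT _ _ filterT) => n _ /=.
    have := Bb v Pv n; rewrite in_itv /= /C; have := sqr_ge0 (B (u n) v - 1).
    have := sqr_ge0 (B (u n) v + 1).
    by move: (B _ _) (M * _) => b c *; apply/andP; split; nra.
  by move=> l [_ Hl]; exists l.
have /choice[l Hl] v : exists l : R, P v -> B (u n) v @[n --> F] --> l.
  have [Pv|nPv] := pselect (P v); last by exists 0.
  by have [l Hl] := cvgB v Pv; exists l.
have [|v Pv|x Px Hx] := sh_riesz h (l := l) (C := M).
- move=> a v w Pv Pw.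
  apply: (@cvg_unique _ _ (B (u n) (a *: v + w) @[n --> F])).
  + exact: norm_hausdorff.
  + by apply: Hl; apply: (sh_lin h).
  + have -> : (fun n => B (u n) (a *: v + w)) = (fun n => a * B (u n) v + B (u n) w).
      by apply/funext => n; rewrite !(sh_sym h (u n)) (sh_bilin h).
    by apply: cvgD; [apply: cvgMr; exact: Hl|exact: Hl].
- have c := @cvgM _ _ _ FF _ _ _ _ (Hl v Pv) (Hl v Pv).
  rewrite expr2 -(cvg_lim (@norm_hausdorff _ R^o) c); apply: limr_le.
    by apply/cvg_ex; exists (l v * l v).
  by apply: nearW => n; exact: Bb.
exists x => // v Pv; rewrite Hx//; exact: Hl.
Qed.

End SemiHilbertFamily.

(** * Lebesgue measure on R^3 and affine changes of variables *)

Section LebesgueR3.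
Context {R : realType}.

Notation T3 := (measurableTypeR R * measurableTypeR R * measurableTypeR R)%type.
Notation leb := (@lebesgue_measure R).

(** By uniqueness of Lebesgue measure: its image under the affine map, multiplied by the modulus of
    [c], gives the intervals []u, v]] their length. The sign of [c] decides which end of the
    preimage is closed. *)
Lemma lebesgue_affine (a c : R) (f : measurableTypeR R -> \bar R) : c != 0 ->
  measurable_fun setT f -> (forall x, 0 <= f x)%E ->
  (`|c|%:E * \int[leb]_x f (a + c * x)%R = \int[leb]_x f x)%E.
Proof.
move=> c0 mf f0.
pose phi (x : measurableTypeR R) : measurableTypeR R := a + c * x.
have mphi : measurable_fun setT phi.
  by apply: measurable_funD => //; apply: measurable_funM.
pose nu0 := mscale (NngNum (normr_ge0 c)) (pushforward leb phi).
pose nu := nu0 mphi.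
have E A : measurable A -> leb A = nu A.
  apply: lebesgue_measure_unique => X [[u v] _ <-].
  suff : leb `]u, v]%classic = (`|c|%:E * leb (phi @^-1` `]u, v]%classic))%E by [].
  have [c_lt|c_gt|//] := ltgtP c 0; last by move=> c_eq; rewrite c_eq eqxx in c0.
  - have -> : phi @^-1` `]u, v]%classic = `[(v - a) / c, (u - a) / c[%classic.
      apply/seteqP; split=> x; rewrite /= !in_itv /phi /=.
        by rewrite ler_ndivrMr// ltr_ndivlMr//; move=> /andP[? ?]; apply/andP; split; lra.
      by rewrite ler_ndivrMr// ltr_ndivlMr//; move=> /andP[? ?]; apply/andP; split; lra.
    rewrite !lebesgue_measure_itv /= !lte_fin.
    rewrite ltr_nM2r ?invr_lt0// ltrD2r.
    case: ifPn => uv; last by rewrite mule0.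
    by rewrite -!EFinD -EFinM; congr EFin; rewrite ltr0_norm//; field.
  - have -> : phi @^-1` `]u, v]%classic = `](u - a) / c, (v - a) / c]%classic.
      apply/seteqP; split=> x; rewrite /= !in_itv /phi /=.
        by rewrite ler_pdivlMr// ltr_pdivrMr//; move=> /andP[? ?]; apply/andP; split; lra.
      by rewrite ler_pdivlMr// ltr_pdivrMr//; move=> /andP[? ?]; apply/andP; split; lra.
    rewrite !lebesgue_measure_itv /= !lte_fin.
    rewrite ltr_pM2r ?invr_gt0// ltrD2r.
    case: ifPn => uv; last by rewrite mule0.
    by rewrite -!EFinD -EFinM; congr EFin; rewrite gtr0_norm//; field.
rewrite -(ge0_integral_pushforward mphi leb measurableT mf) /=; last by [].
rewrite -(ge0_integral_mscale _ measurableT (NngNum (normr_ge0 c)))//.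
apply/esym; apply: eq_measure_integral => A mA _; exact: E.
Qed.

End LebesgueR3.

(* The canonical sigma-finite structure of product measures is shadowed in the
   library by the one for subprobabilities; it is restored on fresh names. *)
Section ProductSigmaFinite.
Context d1 d2 (T1 : measurableType d1) (T2 : measurableType d2) (R : realType).
Variable m1 : {sigma_finite_measure set T1 -> \bar R}.
Variable m2 : {sigma_finite_measure set T2 -> \bar R}.

Definition sprod : set (T1 * T2) -> \bar R := (m1 \x m2)%E.

HB.instance Definition _ := Measure.copy sprod (m1 \x m2)%E.

Lemma sprod_sigma_finite : sigma_finite setT sprod.
Proof.
have /sigma_finiteP[F [TF ndF Foo]] := sigma_finiteT m1.
have /sigma_finiteP[G [TG ndG Goo]] := sigma_finiteT m2.
exists (fun n => F n `*` G n) => [|k].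
  rewrite -setXTT TF TG predeqE => -[x y]; split=> [|[n _ []/= ? ?]].
    move=> [/= [n _ Fnx] [k _ Gky]]; exists (maxn n k) => //; split.
    - by move: x Fnx; apply/subsetPset/ndF/leq_maxl.
    - by move: y Gky; apply/subsetPset/ndG/leq_maxr.
  by split; exists n.
have [mF Fk] := Foo k; have [mG Gk] := Goo k; split; first exact: measurableX.
have -> : sprod (F k `*` G k) = (m1 (F k) * m2 (G k))%E by exact: product_measure1E.
by rewrite lte_mul_pinfty// ge0_fin_numE.
Qed.

HB.instance Definition _ :=
  Measure_isSigmaFinite.Build _ _ _ sprod sprod_sigma_finite.

End ProductSigmaFinite.

Section LebesgueR3.
Context {R : realType}.

Notation T3 := (measurableTypeR R * measurableTypeR R * measurableTypeR R)%type.
Notation leb := (@lebesgue_measure R).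

Definition leb2 : {sigma_finite_measure set (measurableTypeR R * measurableTypeR R)%type -> \bar R} :=
  sprod leb leb.

Definition mu3 : {sigma_finite_measure set T3 -> \bar R} := sprod leb2 leb.

Lemma tonelli3 (f : T3 -> \bar R) : measurable_fun setT f -> (forall x, 0 <= f x)%E ->
  (\int[leb3]_x f x = \int[leb]_x \int[leb]_y \int[leb]_z f (x, y, z))%E.
Proof.
move=> mf f0.
transitivity (\int[leb2]_xy \int[leb]_z f (xy, z))%E.
  by have := fubini_tonelli1 (m1 := leb2) (m2 := leb) _ mf f0.
rewrite (fubini_tonelli1 (m1 := leb) (m2 := leb) (fun xy => \int[leb]_z f (xy, z))%E)//.
  exact: (measurable_fun_fubini_tonelli_F (m2 := leb) _ mf f0).
by move=> xy; exact: integral_ge0.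
Qed.

Lemma leb3_affine (a : R3 R) (c : R) (f : R3 R -> \bar R) : c != 0 ->
  measurable_fun setT (f : T3 -> \bar R) -> (forall x, 0 <= f x)%E ->
  (((`|c| ^+ 3)%:E * \int[leb3]_x f (a + c *: x)%R) = \int[leb3]_x f x)%E.
Proof.
move=> c0 mf f0.
have mfc : measurable_fun setT ((fun x : T3 => f (a + c *: (x : R3 R))) : T3 -> \bar R).
  apply: (measurableT_comp mf).
  apply: measurable_fun_pair; first apply: measurable_fun_pair;
    by apply: measurable_funD => //; apply: measurable_funM => //;
    repeat (apply: measurableT_comp => //).
rewrite (tonelli3 mfc)//.
change ((`|c| ^+ 3)%:E * \int[leb]_x \int[leb]_y \int[leb]_z
  f (a.1.1 + c * x, a.1.2 + c * y, a.2 + c * z)%R = \int[leb3]_x f x)%E.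
pose c1 : \bar R := `|c|%:E.
have -> : (`|c| ^+ 3)%:E = (c1 * c1 * c1)%E by rewrite /c1 -!EFinM !exprS expr0 mulr1 mulrA.
have c10 : (0 <= c1)%E by rewrite lee_fin.
pose f1 xy := (\int[leb]_z f (xy, z))%E.
have mf1 : measurable_fun setT f1 by exact: (measurable_fun_fubini_tonelli_F (m2 := leb) _ mf f0).
have f10 xy : (0 <= f1 xy)%E by exact: integral_ge0.
pose f2 x := (\int[leb]_y f1 (x, y))%E.
have mf2 : measurable_fun setT f2 by exact: (measurable_fun_fubini_tonelli_F (m2 := leb) _ mf1 f10).
have f20 x : (0 <= f2 x)%E by exact: integral_ge0.
have e1 x y : (c1 * \int[leb]_z f (x, y, a.2 + c * z)%R = f1 (x, y))%E.
  apply: (@lebesgue_affine R a.2 c (fun z => f (x, y, z))) => //.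
  by apply: (measurableT_comp mf); exact: measurable_fun_pair.
have e2 x : (c1 * \int[leb]_y f1 (x, a.1.2 + c * y)%R = f2 x)%E.
  apply: (@lebesgue_affine R a.1.2 c (fun y => f1 (x, y))) => //.
  by apply: (measurableT_comp mf1); exact: measurable_fun_pair.
rewrite (tonelli3 mf f0) -[RHS](lebesgue_affine a.1.1 c0 mf2 f20) -/c1.
pose h1 xy := (\int[leb]_z f (xy, a.2 + c * z)%R)%E.
have mh1 : measurable_fun setT h1.
  apply: (measurable_fun_fubini_tonelli_F (m2 := leb) (fun xyz : T3 => f (xyz.1, a.2 + c * xyz.2))) => //.
  apply: (measurableT_comp mf); apply: measurable_fun_pair => //.
  by apply: measurable_funD => //; apply: measurable_funM.
have h10 xy : (0 <= h1 xy)%E by exact: integral_ge0.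
pose h2 x := (\int[leb]_y h1 (x, a.1.2 + c * y)%R)%E.
have mh2 : measurable_fun setT h2.
  apply: (measurable_fun_fubini_tonelli_F (m2 := leb) (fun xy => h1 (xy.1, a.1.2 + c * xy.2))) => //.
  apply: (measurableT_comp mh1); apply: measurable_fun_pair => //.
  by apply: measurable_funD => //; apply: measurable_funM.
have h20 x : (0 <= h2 x)%E by exact: integral_ge0.
have e3 x : (c1 * c1 * h2 x = f2 x)%E.
  rewrite -muleA /h2 -ge0_integralZl//; last first.
    apply: (measurableT_comp mh1); apply: measurable_fun_pair => //.
    by apply: measurable_funD => //; apply: measurable_funM.
  by under eq_integral do rewrite e1; rewrite e2.
under [in RHS]eq_integral do rewrite -e3.
rewrite ge0_integralZl//; last 2 first.
- by apply: (measurableT_comp mh2); apply: measurable_funD => //; apply: measurable_funM.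
- by rewrite mule_ge0.
by rewrite !muleA.
Qed.

End LebesgueR3.

(** * Boxes, open sets and measurability in R^3 *)

Section BorelR3.
Context {R : realType}.
Notation T3 := (measurableTypeR R * measurableTypeR R * measurableTypeR R)%type.

Lemma norm3_lt (x : R3 R) e :
  (`|x| < e) = [&& `|x.1.1| < e, `|x.1.2| < e & `|x.2| < e].
Proof. by rewrite !prod_normE /= !gt_max -andbA. Qed.

Lemma norm3_le (x : R3 R) e :
  (`|x| <= e) = [&& `|x.1.1| <= e, `|x.1.2| <= e & `|x.2| <= e].
Proof. by rewrite !prod_normE /= !ge_max -andbA. Qed.

Definition box (a b : R3 R) : set (R3 R) :=
  [set x | [/\ a.1.1 < x.1.1 < b.1.1, a.1.2 < x.1.2 < b.1.2 & a.2 < x.2 < b.2]].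

Lemma measurable_box a b : measurable (box a b : set T3).
Proof.
have -> : box a b = (`]a.1.1, b.1.1[%classic `*` `]a.1.2, b.1.2[%classic `*` `]a.2, b.2[%classic).
  apply/seteqP; split=> x; rewrite /box /= !in_itv /=; first by case=> -> -> ->.
  by case=> -[-> ->] ->.
by apply: measurableX; [apply: measurableX|]; exact: measurable_itv.
Qed.

Lemma leb3_box a b : a.1.1 <= b.1.1 -> a.1.2 <= b.1.2 -> a.2 <= b.2 ->
  leb3 (box a b : set T3) =
  ((b.1.1 - a.1.1) * (b.1.2 - a.1.2) * (b.2 - a.2))%:E.
Proof.
move=> h1 h2 h3.
have -> : box a b = (`]a.1.1, b.1.1[%classic `*` `]a.1.2, b.1.2[%classic `*` `]a.2, b.2[%classic).
  apply/seteqP; split=> x; rewrite /box /= !in_itv /=; first by case=> -> -> ->.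
  by case=> -[-> ->] ->.
have itvE (u v : R) : u <= v -> lebesgue_measure `]u, v[%classic = (v - u)%:E.
  rewrite lebesgue_measure_itv /= lte_fin le_eqVlt => /predU1P[->|->].
    by rewrite ltxx subrr.
  by rewrite -EFinD.
have mI (u v : R) : measurable (`]u, v[%classic : set (measurableTypeR R)) by exact: measurable_itv.
transitivity (leb2 ((`]a.1.1, b.1.1[ `*` `]a.1.2, b.1.2[)%classic) * lebesgue_measure (`]a.2, b.2[%classic : set (measurableTypeR R)))%E.
  apply: (product_measure1E leb2 lebesgue_measure) => //; exact: measurableX.
rewrite itvE//.
have -> : leb2 ((`]a.1.1, b.1.1[ `*` `]a.1.2, b.1.2[)%classic) =
   (lebesgue_measure (`]a.1.1, b.1.1[%classic : set (measurableTypeR R)) *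
    lebesgue_measure (`]a.1.2, b.1.2[%classic : set (measurableTypeR R)))%E.
  exact: (product_measure1E lebesgue_measure lebesgue_measure).
by rewrite !itvE// -!EFinM.
Qed.

(** The measurable sets come from a product of Borel structures and the open sets from the product
    topology; they are linked by the countably many rational boxes contained in [A], whose union is
    [A]. *)
Lemma open_measurable3 (A : set (R3 R)) : open A -> measurable (A : set T3).
Proof.
move=> oA.
pose q3 (q : rat * rat * rat) : R3 R := (ratr q.1.1, ratr q.1.2, ratr q.2).
pose F (qq : (rat * rat * rat) * (rat * rat * rat)) : set T3 :=
  if `[< box (q3 qq.1) (q3 qq.2) `<=` A >] then box (q3 qq.1) (q3 qq.2) else set0.
have -> : A = \bigcup_k F k.
  apply/seteqP; split=> [x Ax|x [k _]]; last first.
    by rewrite /F; case: asboolP => // sA /sA.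
  have /nbhs_ballP[e /= e0 eA] : nbhs x A by exact: open_nbhs_nbhs.
  have lo (u : R) : exists q : rat, u - e < ratr q < u.
    have : u - e < u by rewrite gtrBl.
    by move=> /rat_in_itvoo[q]; rewrite in_itv /=; exists q.
  have hi (u : R) : exists q : rat, u < ratr q < u + e.
    have : u < u + e by rewrite ltrDl.
    by move=> /rat_in_itvoo[q]; rewrite in_itv /=; exists q.
  have [a1 /andP[a1l a1r]] := lo x.1.1; have [a2 /andP[a2l a2r]] := lo x.1.2.
  have [a3 /andP[a3l a3r]] := lo x.2.
  have [b1 /andP[b1l b1r]] := hi x.1.1; have [b2 /andP[b2l b2r]] := hi x.1.2.
  have [b3 /andP[b3l b3r]] := hi x.2.
  exists ((a1, a2, a3), (b1, b2, b3)); first exact: I.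
  rewrite /F; case: asboolP => [_|].
    by split; apply/andP; split.
  case=> y [/= /andP[? ?] /andP[? ?] /andP[? ?]]; apply: eA.
  rewrite -ball_normE /ball_ /= norm3_lt /= !ltr_norml.
  by apply/and3P; split; apply/andP; split; lra.
apply: countable_bigcupT_measurable => [|q]; first exact: countableP.
by rewrite /F; case: asboolP => _; [exact: measurable_box|exact: measurable0].
Qed.

Lemma continuous_measurable3 (f : R3 R -> R) : continuous f ->
  measurable_fun setT (f : T3 -> R).
Proof.
move=> /continuousP cf.
apply: (measurability _ (@measurable_realfun.RGenOpens.measurableE R)).
move=> _ [_ [a [b ->]] <-]; rewrite setTI.
by apply: open_measurable3; apply: cf; exact: interval_open.
Qed.

End BorelR3.

(** * Stability properties of smooth functions *)

Section SmoothTheory.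
Context {R : realType}.
Implicit Types V W : normedModType R.

(** A coinduction principle: as [smooth] quantifies over all iterated derivatives, it suffices to
    belong to some class stable under directional derivatives. The span predicates below are such
    classes. *)
Lemma smooth_class V W (C : (V -> W) -> Prop) :
  (forall f, C f -> continuous f /\ forall x v, derivable f x v) ->
  (forall f v, C f -> C ('D_v f)) -> forall f, C f -> smooth f.
Proof.
move=> Cd CD f Cf s.
suff /Cd[] : C (foldr (fun v h => 'D_v h) f s) by [].
by elim: s => //= v s; exact: CD.
Qed.

Lemma smooth_continuous V W (f : V -> W) : smooth f -> continuous f.
Proof. by move=> /(_ [::])[]. Qed.

Lemma smooth_derivable V W (f : V -> W) x v : smooth f -> derivable f x v.
Proof. by move=> /(_ [::])[_]; exact. Qed.

Lemma smooth_derive V W (f : V -> W) v : smooth f -> smooth ('D_v f).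
Proof. by move=> sf s; have := sf (rcons s v); rewrite foldr_rcons. Qed.

Lemma smooth_cst V W (a : W) : smooth (cst a : V -> W).
Proof.
apply: (@smooth_class _ _ (fun f => exists a, f = cst a)); last by exists a.
  move=> _ [b ->]; split; first exact: cst_continuous.
  by move=> x v; exact: derivable_cst.
move=> _ v [b ->]; exists 0; apply/funext => x; exact: derive_cst.
Qed.

Lemma derivable_mul V (f g : V -> R) x v :
  derivable f x v -> derivable g x v -> derivable (fun y => f y * g y) x v.
Proof. by move=> df dg; exact: (@derivableM R V f g x v df dg). Qed.

Lemma derive_mul V (f g : V -> R) x v :
  derivable f x v -> derivable g x v ->
  'D_v (fun y => f y * g y) x = f x * 'D_v g x + g x * 'D_v f x.
Proof. by move=> df dg; exact: (@deriveM R V f g x v df dg). Qed.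

Lemma derivable_add V W (f g : V -> W) x v :
  derivable f x v -> derivable g x v -> derivable (fun y => f y + g y) x v.
Proof. by move=> df dg; exact: (@derivableD R V W f g x v df dg). Qed.

Lemma derive_add V W (f g : V -> W) x v :
  derivable f x v -> derivable g x v ->
  'D_v (fun y => f y + g y) x = 'D_v f x + 'D_v g x.
Proof. by move=> df dg; exact: (@deriveD R V W f g x v df dg). Qed.

Lemma smoothD V W (f g : V -> W) : smooth f -> smooth g ->
  smooth (fun x => f x + g x).
Proof.
move=> sf sg.
apply: (@smooth_class _ _ (fun h => exists f g, [/\ smooth f, smooth g & h = fun x => f x + g x])); last by exists f, g.
  move=> _ [f1 [g1 [sf1 sg1 ->]]]; split.
    by move=> x; apply: cvgD; exact: smooth_continuous.
  by move=> x v; apply: derivable_add; exact: smooth_derivable.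
move=> _ v [f1 [g1 [sf1 sg1 ->]]]; exists ('D_v f1), ('D_v g1).
split; [exact: smooth_derive|exact: smooth_derive|].
by apply/funext => x; apply: derive_add; exact: smooth_derivable.
Qed.

Lemma smooth_sum V W (I : Type) (s : seq I) (f : I -> V -> W) :
  (forall i, smooth (f i)) -> smooth (fun x => \sum_(i <- s) f i x).
Proof.
move=> sf; elim: s => [|i s IH].
  have -> : (fun x : V => \sum_(i <- [::]) f i x) = cst 0.
    by apply/funext => x; rewrite big_nil.
  exact: smooth_cst.
have -> : (fun x : V => \sum_(j <- i :: s) f j x) = fun x => f i x + \sum_(j <- s) f j x.
  by apply/funext => x; rewrite big_cons.
exact: smoothD.
Qed.

(** Products alone are not stable under derivatives; by the Leibniz rule their sums are. *)
Inductive prod_span V : (V -> R) -> Prop :=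
| PSprod (f g : V -> R) : smooth f -> smooth g -> prod_span (fun x => f x * g x)
| PSadd (f g : V -> R) : prod_span f -> prod_span g -> prod_span (fun x => f x + g x).

Lemma prod_span_derive V (h : V -> R) v : prod_span h ->
  [/\ continuous h, forall x, derivable h x v & prod_span ('D_v h)].
Proof.
elim=> [f g sf sg|f g _ [cf df Pf] _ [cg dg Pg]]; split.
- by move=> x; apply: cvgM; [exact: (smooth_continuous sf)|exact: (smooth_continuous sg)].
- by move=> x; apply: derivable_mul; [exact: (smooth_derivable sf)|exact: (smooth_derivable sg)].
- have -> : 'D_v (fun x => f x * g x) = (fun x => (f x * 'D_v g x) + (g x * 'D_v f x)).
    apply/funext => x; apply: derive_mul; [exact: (smooth_derivable sf)|exact: (smooth_derivable sg)].
  exact: (PSadd (PSprod sf (smooth_derive v sg)) (PSprod sg (smooth_derive v sf))).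
- by move=> x; apply: cvgD; [exact: cf|exact: cg].
- by move=> x; exact: derivable_add.
- have -> : 'D_v (fun x => f x + g x) = fun x => 'D_v f x + 'D_v g x.
    by apply/funext => x; exact: derive_add.
  exact: PSadd.
Qed.

Lemma smoothM V (f g : V -> R) : smooth f -> smooth g ->
  smooth (fun x => f x * g x).
Proof.
move=> sf sg; apply: (@smooth_class _ _ (@prod_span V)); last exact: PSprod.
  by move=> h0 hp; split=> [|x v]; [have [] := prod_span_derive 0 hp|have [] := prod_span_derive v hp].
by move=> h v /(prod_span_derive v)[].
Qed.

Lemma smoothZ V (f : V -> R) (c : R) : smooth f -> smooth (fun x => c * f x).
Proof. by move=> sf; exact: (@smoothM V (cst c) f (@smooth_cst V R c) sf). Qed.

Lemma derive_affine V V' W (l : V -> V') (a : V') (f : V' -> W) x v :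
  (forall (h : R) u w, l (h *: u + w) = h *: l u + l w) ->
  (derivable (fun y => f (a + l y)) x v <-> derivable f (a + l x) (l v)) /\
  'D_v (fun y => f (a + l y)) x = 'D_(l v) f (a + l x).
Proof.
move=> lin.
have E : (fun h : R => h^-1 *: (((fun y => f (a + l y)) \o shift x) (h *: v) - f (a + l x)))
  = (fun h => h^-1 *: ((f \o shift (a + l x)) (h *: l v) - f (a + l x))).
  by apply/funext => h /=; rewrite lin addrCA.
by split; rewrite /derivable /derive E.
Qed.

Lemma smooth_affine V V' W (l : V -> V') (a : V') (f : V' -> W) :
  (forall (h : R) u w, l (h *: u + w) = h *: l u + l w) -> continuous l ->
  smooth f -> smooth (fun y => f (a + l y)).
Proof.
move=> lin cl sf.
apply: (@smooth_class _ _ (fun h => exists f, smooth f /\ h = (fun y => f (a + l y)))); last by exists f.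
  move=> _ [f1 [sf1 ->]]; split.
    move=> x; apply: (@continuous_comp _ _ _ (fun y => a + l y) f1); last exact: smooth_continuous.
    by apply: cvgD; [exact: cvg_cst|exact: cl].
  by move=> x v; apply/(derive_affine a f1 x v lin).1; exact: smooth_derivable.
move=> _ v [f1 [sf1 ->]]; exists ('D_(l v) f1); split; first exact: smooth_derive.
by apply/funext => x; exact: (derive_affine a f1 x v lin).2.
Qed.

(** The chain rule turns [f (u x) * g x] into a sum of two products of the same form, with other [f]
    and [g], so this class is stable under derivatives. *)
Inductive comp_span (u : R -> R) : (R -> R) -> Prop :=
| CSprod (f g : R -> R) : smooth f -> smooth g -> comp_span u (fun x => f (u x) * g x)
| CSadd (f g : R -> R) : comp_span u f -> comp_span u g -> comp_span u (fun x => f x + g x).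

Lemma derive_dir1 (f : R -> R) x v : derivable f x 1 ->
  derivable f x v /\ 'D_v f x = v * 'D_1 f x.
Proof.
move=> /derivable1_diffP df; split; first exact: diff_derivable.
by rewrite !deriveE// -[in LHS](mulr1 v) linearZ.
Qed.

Lemma comp_span_derive (u h : R -> R) v : smooth u -> comp_span u h ->
  [/\ continuous h, forall x, derivable h x v & comp_span u ('D_v h)].
Proof.
move=> su; elim=> [f g sf sg|f g _ [cf df Pf] _ [cg dg Pg]]; last first.
  split.
  - by move=> x; apply: cvgD; [exact: cf|exact: cg].
  - by move=> x; exact: derivable_add.
  - have -> : 'D_v (fun x => f x + g x) = fun x => 'D_v f x + 'D_v g x.
      by apply/funext => x; exact: derive_add.
    exact: CSadd.
have dfu x : is_derive x (1:R) (fun y => f (u y)) ('D_1 f (u x) * 'D_1 u x).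
  apply: (@is_derive1_comp R f u); apply: DeriveDef => //.
    exact: (smooth_derivable sf).
  exact: (smooth_derivable su).
have dfu1 x : derivable (fun y => f (u y)) x 1 by have [] := dfu x.
split.
- move=> x; apply: cvgM; last exact: (smooth_continuous sg).
  by apply: (@continuous_comp _ _ _ u f); [exact: (smooth_continuous su)|exact: (smooth_continuous sf)].
- move=> x; apply: derivable_mul; last exact: (smooth_derivable sg).
  by have [] := derive_dir1 v (dfu1 x).
have -> : 'D_v (fun x => f (u x) * g x) =
    fun x => f (u x) * 'D_v g x + 'D_1 f (u x) * (v * ('D_1 u x * g x)).
  apply/funext => x; have [dv Dv] := derive_dir1 v (dfu1 x).
  rewrite (derive_mul dv (smooth_derivable sg)).
  by rewrite Dv; have [_ ->] := dfu x; ring.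
apply: (CSadd (CSprod u sf (smooth_derive v sg))).
apply: (@CSprod u ('D_1 f) (fun x => v * ('D_1 u x * g x))); first exact: (@smooth_derive R R f (1 : R) sf).
exact: (smoothZ _ (smoothM (@smooth_derive R R u (1 : R) su) sg)).
Qed.

Lemma smooth_comp1 (f u : R -> R) : smooth f -> smooth u -> smooth (fun x => f (u x)).
Proof.
move=> sf su; apply: (@smooth_class _ _ (comp_span u)); last first.
- have -> : (fun x => f (u x)) = (fun x => f (u x) * cst 1 x).
    by apply/funext => x; rewrite mulr1.
  exact: (CSprod u sf (@smooth_cst R R 1)).
- by move=> h v /(comp_span_derive v su)[].
- by move=> h hp; split=> [|x v]; [have [] := comp_span_derive 0 su hp|have [] := comp_span_derive v su hp].
Qed.

End SmoothTheory.

(** * The flat function exp(-1/t) and its derivatives *)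

Section FlatFunction.
Context {R : realType}.

Lemma is_derive_lim (f : R -> R) (x l : R) :
  (forall e : R, 0 < e -> exists2 d : R, 0 < d & forall h : R, h != 0 -> `|h| < d ->
     `|l - h^-1 * (f (h + x) - f x)| <= e) -> is_derive x (1 : R) f l.
Proof.
move=> H.
have c : h^-1 *: ((f \o shift x) (h *: (1 : R)) - f x) @[h --> 0^'] --> l.
  apply/cvgrPdist_le => /= e /H[d d0 Hd].
  exists d => //= h; rewrite /ball_ /= sub0r normrN => hd h0.
  by have := Hd h h0 hd; rewrite /shift /= [h *: 1]mulr1.
by apply: DeriveDef; [apply/cvg_ex; exists l|exact/cvg_lim].
Qed.

Lemma is_derive_near (f g : R -> R) (x l : R) :
  (\forall y \near x, f y = g y) -> is_derive x (1 : R) g l -> is_derive x (1 : R) f l.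
Proof.
move=> fg [dg <-]; apply: DeriveDef; last exact: near_eq_derive.
have fx : f x = g x by exact: (nbhs_singleton fg).
suff : (h^-1 *: ((f \o shift x) (h *: (1 : R)) - f x) @[h --> 0^']) `=>`
   (h^-1 *: ((g \o shift x) (h *: (1 : R)) - g x) @[h --> 0^']).
  by move=> fgc; move: dg => /cvg_ex[l' Hl']; apply/cvg_ex; exists l'; exact: cvg_trans fgc Hl'.
apply: near_eq_cvg; near=> h => /=; rewrite fx; congr (_ *: (_ - _)).
apply/esym; near: h.
have : (h *: (1:R) + x @[h --> 0^']) --> x.
  have : (h *: (1:R) + x @[h --> (0:R)]) --> (0:R) *: (1:R) + x.
    by apply: cvgD; [apply: cvgZl; exact: cvg_id|exact: cvg_cst].
  by rewrite scale0r add0r; apply: cvg_within_filter.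
by move=> /(_ _ fg).
Unshelve. all: by end_near. Qed.

(** The powers of [1 / t] in front of the exponential are those produced by differentiation: the
    derivative of [flat n] is a combination of [flat n.+1] and [flat n.+2]. *)
Definition flat (n : nat) (t : R) : R :=
  if 0 < t then t^-1 ^+ n * expR (- t^-1) else 0.

(** One term of the exponential series at [1 / t] dominates [t^-(n+2)]. The quadratic bound makes
    the derivative at 0 vanish, for every [n]. *)
Lemma flat_le n : exists2 K : R, 0 < K & forall t, `|flat n t| <= K * t ^+ 2.
Proof.
exists (n.+2`!%:R) => [|t]; first by rewrite ltr0n fact_gt0.
rewrite /flat; case: ifPn => [t0|_]; last by rewrite normr0 mulr_ge0// sqr_ge0.
have ti : 0 < t^-1 by rewrite invr_gt0.
rewrite ger0_norm; last by rewrite mulr_ge0 ?expR_ge0// exprn_ge0// ltW.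
have := expR_ge1Dxn n.+1 (ltW ti).
set F := (n.+2)`!%:R; have F0 : 0 < F :> R by rewrite ltr0n fact_gt0.
move=> H; have {}H : t^-1 ^+ n.+2 <= F * expR t^-1.
  rewrite -ler_pdivrMl// mulrC; apply: le_trans H; lra.
rewrite expRN ler_pdivrMr ?expR_gt0//.
have -> : t^-1 ^+ n = t^-1 ^+ n.+2 * t ^+ 2.
  by rewrite !exprS expr0; field; rewrite gt_eqF.
by rewrite [leRHS]mulrAC ler_wpM2r// sqr_ge0.
Qed.

Lemma is_derive_flat n t :
  is_derive t (1 : R) (flat n) (- n%:R * flat n.+1 t + flat n.+2 t).
Proof.
have [t0|t0|->] := ltgtP t 0.
- have E m s : s < 0 -> flat m s = 0 by move=> s0; rewrite /flat ltNge (ltW s0).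
  rewrite !E// mulr0 addr0.
  apply: (@is_derive_near _ (cst 0)).
  by near=> s; rewrite E//; near: s; exact: lt_nbhsl.
- apply: (@is_derive_near _ (fun s => s^-1 ^+ n * expR (- s^-1))).
    by near=> s; rewrite /flat ifT//; near: s; exact: lt_nbhsr.
  rewrite /flat t0.
  have t_neq0 : t != 0 by rewrite gt_eqF.
  have dV : is_derive t (1:R) (fun s : R => s^-1) (- (t^-1 * t^-1)).
    have H := @is_deriveV R id t 1 1 t_neq0 (is_derive_id _ _); apply: (is_derive_eq H).
    by rewrite [LHS]mulr1 -exprVn expr2.
  have dVn : is_derive t (1:R) (fun s : R => s^-1 ^+ n) (- n%:R * t^-1 ^+ n.+1).
    elim: n => [|n IH].
      by rewrite oppr0 mul0r; exact: (@is_derive_cst R R R _ _ 1).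
    have -> : (fun s : R => s^-1 ^+ n.+1) = (fun s => s^-1 * s^-1 ^+ n).
      by apply/funext => s; rewrite exprS.
    have := @is_deriveM R R (fun s => s^-1) (fun s => s^-1 ^+ n) t 1 _ _ dV IH.
    move=> H; apply: (is_derive_eq H).
    transitivity (t^-1 * (- n%:R * t^-1 ^+ n.+1) + t^-1 ^+ n * (- (t^-1 * t^-1))); first by [].
    by rewrite -(natr1 n) !exprS; ring.
  have dE : is_derive t (1:R) (fun s : R => expR (- s^-1)) (expR (- t^-1) * (t^-1 * t^-1)).
    apply: (@is_derive1_comp R expR (fun s => - s^-1)).
    by have := @is_deriveN R R R _ t 1 _ dV; rewrite opprK.
  have H := @is_deriveM R R _ _ t 1 _ _ dVn dE; apply: (is_derive_eq H).
  transitivity (t^-1 ^+ n * (expR (- t^-1) * (t^-1 * t^-1)) + expR (- t^-1) * (- n%:R * t^-1 ^+ n.+1)); first by [].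
  by rewrite !exprS; ring.
have f0 m : flat m 0 = 0 by rewrite /flat ltxx.
rewrite !f0 mulr0 addr0.
have [K K0 HK] := flat_le n.
apply: is_derive_lim => e e0; exists (e / K); first by rewrite divr_gt0.
move=> h h0 hd; rewrite addr0 f0 subr0 sub0r normrN normrM normfV.
rewrite ler_pdivrMl ?normr_gt0// (le_trans (HK h))//.
rewrite -real_normK ?num_real// expr2 mulrA mulrC ler_wpM2l//.
by rewrite mulrC -ler_pdivlMr// ltW.
Unshelve. all: by end_near. Qed.

Inductive flat_span : (R -> R) -> Prop :=
| FSflat n : flat_span (flat n)
| FSscale (c : R) f : flat_span f -> flat_span (fun x => c * f x)
| FSadd f g : flat_span f -> flat_span g -> flat_span (fun x => f x + g x).

Lemma flat_span_derive f : flat_span f -> exists2 g, flat_span g &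
  forall x, is_derive x (1 : R) f (g x).
Proof.
elim=> [n|c {}f sf [g sg dg]|{}f1 f2 sf1 [g1 sg1 dg1] sf2 [g2 sg2 dg2]].
- exists (fun x => - n%:R * flat n.+1 x + flat n.+2 x).
    by apply: FSadd; [apply: FSscale|]; exact: FSflat.
  by move=> x; exact: is_derive_flat.
- exists (fun x => c * g x); first exact: FSscale.
  by move=> x; exact: (@is_deriveZ R R R f c x 1 _ (dg x)).
- exists (fun x => g1 x + g2 x); first exact: FSadd.
  by move=> x; exact: (@is_deriveD R R R f1 f2 x 1 _ _ (dg1 x) (dg2 x)).
Qed.

Lemma smooth_flat n : smooth (flat n).
Proof.
apply: (@smooth_class R R R flat_span); last exact: FSflat.
  move=> f /flat_span_derive[g sg dg]; split.
    move=> x; apply: differentiable_continuous; apply/derivable1_diffP.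
    by have [] := dg x.
  by move=> x v; apply: (derive_dir1 _ _).1; have [] := dg x.
move=> f v /flat_span_derive[g sg dg].
have -> : 'D_v f = fun x => v * g x.
  apply/funext => x; have [df <-] := dg x.
  by have [] := derive_dir1 v df.
exact: FSscale.
Qed.

End FlatFunction.

(** * Cutoff functions and coordinates on R^3 *)

Section Bumps.
Context {R : realType}.

Definition hump (t : R) : R := expR 1 * flat 0 t.

Lemma hump_le0 t : t <= 0 -> hump t = 0.
Proof. by move=> t0; rewrite /hump /flat ltNge t0 mulr0. Qed.

Lemma hump_gt0 t : 0 < t -> hump t = expR (1 - t^-1).
Proof. by move=> t0; rewrite /hump /flat t0 expr0 mul1r -expRD. Qed.

Lemma hump_nd : {homo hump : s t / s <= t}.
Proof.
move=> s t st; have [s0|s0] := leP s 0.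
  rewrite hump_le0//; have [t0|t0] := leP t 0; first by rewrite hump_le0.
  by rewrite hump_gt0// expR_ge0.
have t0 : 0 < t by exact: lt_le_trans st.
by rewrite !hump_gt0// ler_expR lerD2l lerN2 lef_pV2 ?posrE.
Qed.

Lemma hump1 : hump 1 = 1.
Proof. by rewrite hump_gt0// invr1 subrr expR0. Qed.

Lemma smooth_hump : smooth hump.
Proof. exact: (smoothZ _ (smooth_flat 0)). Qed.

(** A smooth step without a quotient: [hump] is nondecreasing, 0 on the negative axis and at least 1
    from 1 on, so composing it with its own reflection saturates at both ends. *)
Definition step (t : R) : R := 1 - hump (1 - hump t).

Lemma step_le0 t : t <= 0 -> step t = 0.
Proof. by move=> t0; rewrite /step (hump_le0 t0) subr0 hump1 subrr. Qed.

Lemma step_ge1 t : 1 <= t -> step t = 1.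
Proof.
move=> t1; rewrite /step [hump (1 - _)]hump_le0 ?subr0//.
by rewrite subr_le0 -hump1 hump_nd.
Qed.

Lemma step_nd : {homo step : s t / s <= t}.
Proof.
by move=> s t st; rewrite /step lerD2l lerN2 hump_nd// lerD2l lerN2 hump_nd.
Qed.

Lemma step_ge0 t : 0 <= step t.
Proof.
have [t0|t0] := leP t 0; first by rewrite step_le0.
by rewrite -(step_le0 (lexx 0)) step_nd// ltW.
Qed.

Lemma step_le1 t : step t <= 1.
Proof.
have [t0|t0] := leP 1 t; first by rewrite step_ge1.
by rewrite -(step_ge1 (lexx 1)) step_nd// ltW.
Qed.

Lemma smooth_step : smooth step.
Proof.
have s1 : smooth (fun t => 1 + (-1) * hump t).
  exact: (smoothD (@smooth_cst R R R 1) (smoothZ _ smooth_hump)).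
have s2 := smooth_comp1 smooth_hump s1.
have s3 := smoothD (@smooth_cst R R R 1) (smoothZ (-1) s2).
have -> : step = (fun t => cst 1 t + (-1) * hump (1 + (-1) * hump t)).
  by apply/funext => t; rewrite /step !mulN1r.
exact: s3.
Qed.

Lemma linear_id1 (c : R) (h u w : R) : c * (h *: u + w) = h *: (c * u) + c * w.
Proof. by rewrite /GRing.scale /= mulrDr mulrCA. Qed.

Lemma smooth_rescale (f : R -> R) (a c : R) : smooth f -> smooth (fun t : R => f (a + c * t)).
Proof.
move=> sf; apply: (@smooth_affine R R R R (fun t => c * t) a f) => //.
  exact: linear_id1.
by move=> x; apply: cvgMr; exact: cvg_id.
Qed.

Definition plateau (t : R) : R := step (2 + t) * step (2 - t).

Lemma smooth_plateau : smooth plateau.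
Proof.
have -> : plateau = (fun t => step (2 + 1 * t) * step (2 + (-1) * t)).
  by apply/funext => t; rewrite /plateau mul1r mulN1r.
exact: (smoothM (smooth_rescale 2 1 smooth_step) (smooth_rescale 2 (-1) smooth_step)).
Qed.

Lemma plateau_eq1 t : `|t| <= 1 -> plateau t = 1.
Proof.
by rewrite ler_norml => /andP[t1 t2]; rewrite /plateau !step_ge1 ?mulr1//; lra.
Qed.

Lemma plateau_eq0 t : 2 <= `|t| -> plateau t = 0.
Proof.
rewrite ler_normr => /orP[t2|t2]; rewrite /plateau.
  by rewrite [step (2 - t)]step_le0 ?mulr0//; lra.
by rewrite [step (2 + t)]step_le0 ?mul0r//; lra.
Qed.

Lemma plateau_ge0 t : 0 <= plateau t.
Proof. by rewrite mulr_ge0// step_ge0. Qed.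

Lemma plateau_le1 t : plateau t <= 1.
Proof. by rewrite mulr_ile1// ?step_ge0// step_le1. Qed.

Definition coord (k : 'I_3) (x : R3 R) : R := coords x 0 k.

Lemma coordE k x : coord k x = [:: x.1.1; x.1.2; x.2]`_k.
Proof. by rewrite /coord mxE. Qed.

Lemma coord_lin k (h : R) (u w : R3 R) : coord k (h *: u + w) = h *: coord k u + coord k w.
Proof. by rewrite !coordE; case: k => -[|[|[|//]]] lt. Qed.

Lemma coordD k (u w : R3 R) : coord k (u + w) = coord k u + coord k w.
Proof. by rewrite -[u]scale1r coord_lin !scale1r. Qed.

Lemma coordZ k (h : R) (u : R3 R) : coord k (h *: u) = h * coord k u.
Proof. by rewrite !coordE; case: k => -[|[|[|//]]] lt. Qed.

Lemma coordN k (u : R3 R) : coord k (- u) = - coord k u.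
Proof. by rewrite !coordE; case: k => -[|[|[|//]]] lt. Qed.

Lemma coordB k (u w : R3 R) : coord k (u - w) = coord k u - coord k w.
Proof. by rewrite coordD coordN. Qed.

Lemma coord_basis k j : coord k (basis3 j : R3 R) = (k == j)%:R.
Proof.
rewrite coordE; case: k => -[|[|[|//]]] kl; case: j => -[|[|[|//]]] jl; by [].
Qed.

Lemma norm3_coord (x : R3 R) e : (`|x| <= e) <-> forall k, `|coord k x| <= e.
Proof.
rewrite norm3_le; split=> [/and3P[h1 h2 h3] k|H].
  by rewrite coordE; case: k => -[|[|[|//]]] lt.
apply/and3P; split; [have := H 0|have := H 1|have := H 2]; by rewrite coordE.
Qed.

Lemma le_coord_norm k (x : R3 R) : `|coord k x| <= `|x|.
Proof. exact: (norm3_coord x `|x|).1. Qed.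

Lemma coord_inj (x y : R3 R) : (forall k, coord k x = coord k y) -> x = y.
Proof.
move=> H; have := H 0; have := H 1; have := H 2; rewrite !coordE /=.
by case: x {H} => -[? ?] ?; case: y => -[? ?] ? /= -> -> ->.
Qed.

Lemma coord_continuous k : continuous (coord k).
Proof.
move=> x; apply/cvgrPdist_le => e e0.
have := @nbhsx_ballx _ (R3 R) x e e0; apply: filterS => y.
rewrite -ball_normE /ball_ /= => /ltW xy; rewrite -coordB.
exact: le_trans (le_coord_norm _ _) xy.
Qed.

Lemma compact_cube (a : R3 R) r : compact [set x : R3 R | `|x - a| <= r].
Proof.
have -> : [set x : R3 R | `|x - a| <= r] =
   (`[a.1.1 - r, a.1.1 + r] `*` `[a.1.2 - r, a.1.2 + r] `*` `[a.2 - r, a.2 + r])%classic.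
  apply/seteqP; split=> x; rewrite /= norm3_le /= !in_itv /= !ler_norml.
    by move=> /and3P[/andP[? ?] /andP[? ?] /andP[? ?]]; split; [split|]; apply/andP; split; lra.
  by move=> [[/andP[? ?] /andP[? ?]] /andP[? ?]]; apply/and3P; split; apply/andP; split; lra.
by apply: compact_setX; [apply: compact_setX|]; exact: segment_compact.
Qed.

Lemma test_functionP (U : set (R3 R)) (K : set (R3 R)) (f : R3 R -> R) :
  smooth f -> compact K -> K `<=` U -> (forall x, ~ K x -> f x = 0) ->
  test_function U f.
Proof.
move=> sf cK KU f0.
have clK : closed K by apply: compact_closed => //; exact: norm_hausdorff.
have sK : closure [set x | f x != 0] `<=` K.
  rewrite [X in _ `<=` X]((closure_id K).1 clK); apply: closureS => x /= /eqP fx.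
  by apply: contrapT => /f0.
split => //; last exact: subset_trans KU.
exact: (subclosed_compact (@closed_closure _ _) cK sK).
Qed.

Lemma test_function_smooth (U : set (R3 R)) (f : R3 R -> R) :
  test_function U f -> smooth f.
Proof. by case. Qed.

Lemma test_function0 (U : set (R3 R)) (f : R3 R -> R) x :
  test_function U f -> ~ U x -> f x = 0.
Proof.
move=> [_ _ sU] nUx; apply/eqP; apply: contrapT => /negP fx; apply: nUx; apply: sU.
exact: subset_closure.
Qed.

Lemma test_function_sub (U U' : set (R3 R)) (f : R3 R -> R) :
  U `<=` U' -> test_function U f -> test_function U' f.
Proof. by move=> UU' [? ? sU]; split=> //; exact: subset_trans UU'. Qed.

Definition bump (a : R3 R) (r : R) (x : R3 R) : R :=
  \prod_(k < 3) plateau (coord k (x - a) / r).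

Lemma smooth_coord_comp (f : R -> R) k : smooth f -> smooth (fun x : R3 R => f (coord k x)).
Proof.
move=> sf.
have -> : (fun x : R3 R => f (coord k x)) = (fun x => f (0 + coord k x)).
  by apply/funext => x; rewrite add0r.
apply: (@smooth_affine R (R3 R) R R (coord k) 0 f) => //; first exact: coord_lin.
exact: coord_continuous.
Qed.

Lemma smooth_prod3 (V : normedModType R) (f : 'I_3 -> V -> R) :
  (forall k, smooth (f k)) -> smooth (fun x => \prod_(k < 3) f k x).
Proof.
move=> sf.
have -> : (fun x => \prod_(k < 3) f k x) = (fun x => f 0 x * (f 1 x * f 2 x)).
  apply/funext => x; rewrite !big_ord_recl big_ord0 mulr1.
  by congr (f _ x * (f _ x * f _ x)); apply/val_inj.
exact: (smoothM (sf 0) (smoothM (sf 1) (sf 2))).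
Qed.

Lemma smooth_bump a r : smooth (bump a r).
Proof.
apply: smooth_prod3 => k.
have := smooth_coord_comp k (smooth_rescale (- coord k a / r) r^-1 smooth_plateau).
congr smooth; apply/funext => x; congr plateau; rewrite coordB mulrBl mulNr.
by rewrite addrC mulrC.
Qed.

Lemma bump_ge0 a r x : 0 <= bump a r x.
Proof. by apply: prodr_ge0 => k _; exact: plateau_ge0. Qed.

Lemma bump_eq1 a r x : 0 < r -> `|x - a| <= r -> bump a r x = 1.
Proof.
move=> r0 xa; apply: big1 => k _; apply: plateau_eq1.
rewrite normrM normfV (gtr0_norm r0) ler_pdivrMr// mul1r.
exact: le_trans (le_coord_norm _ _) xa.
Qed.

Lemma bump_eq0 a r x : 0 < r -> 2 * r <= `|x - a| -> bump a r x = 0.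
Proof.
move=> r0 xa; apply/eqP; rewrite prodf_seq_eq0; apply/hasP.
have [k kx] : exists k, 2 * r <= `|coord k (x - a)|.
  apply: contrapT => H; suff : `|x - a| < 2 * r by rewrite ltNge xa.
  rewrite norm3_lt.
  have lt k : `|coord k (x - a)| < 2 * r.
    by rewrite ltNge; apply/negP => h; apply: H; exists k.
  by apply/and3P; split; [have := lt 0|have := lt 1|have := lt 2]; rewrite coordE.
exists k; first by rewrite mem_index_enum.
apply/eqP/plateau_eq0; rewrite normrM normfV (gtr0_norm r0) ler_pdivlMr//.
Qed.

Lemma bump_test a r (U : set (R3 R)) : 0 < r ->
  [set x | `|x - a| <= 2 * r] `<=` U -> test_function U (bump a r).
Proof.
move=> r0 sU; apply: (test_functionP (smooth_bump a r) (@compact_cube a (2 * r)) sU).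
by move=> x /negP; rewrite -ltNge => /ltW; exact: bump_eq0.
Qed.

End Bumps.

Lemma sum3 (V : nmodType) (M : 'I_3 -> V) : \sum_k M k = M 0 + M 1 + M 2.
Proof.
rewrite !big_ord_recl big_ord0 addr0 addrA.
by congr (M _ + M _ + M _); apply/val_inj.
Qed.

(** * Mean values, mixed derivatives and bounds on test functions *)

Section SmoothR3.
Context {R : realType}.

Lemma is_derive_line (V : normedModType R) (f : V -> R) (x v : V) (t : R) : smooth f ->
  is_derive t (1 : R) (fun s : R => f (x + s *: v)) ('D_v f (x + t *: v)).
Proof.
move=> sf.
have lin (h : R) (u w : R) : (h *: u + w) *: v = h *: (u *: v) + w *: v.
  by rewrite scalerDl scalerA.
have [D1 D2] := @derive_affine R R V R (fun s : R => s *: v) x f t 1 lin.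
apply: DeriveDef; first by apply/D1; exact: smooth_derivable sf.
by rewrite D2 scale1r.
Qed.

Lemma continuous_line (V : normedModType R) (f : V -> R) (x v : V) : smooth f ->
  continuous (fun s : R => f (x + s *: v)).
Proof.
move=> sf t; apply: differentiable_continuous; apply/derivable1_diffP.
by have [] := is_derive_line x v t sf.
Qed.

Lemma MVT_line (V : normedModType R) (f : V -> R) (x v : V) (t : R) : smooth f -> 0 <= t ->
  exists s : R, [/\ 0 <= s, s <= t & f (x + t *: v) - f x = t * 'D_v f (x + s *: v)].
Proof.
move=> sf t0.
have [|s|s Hs E] := @MVT_segment R (fun s : R => f (x + s *: v)) (fun s => 'D_v f (x + s *: v)) 0 t t0.
- by move=> s _; exact: is_derive_line.
- by apply: continuous_subspaceT; exact: continuous_line.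
move: Hs; rewrite in_itv /= => /andP[s0 st]; exists s; split => //.
by move: E; rewrite scale0r addr0 subr0 => ->; rewrite mulrC.
Qed.

Lemma derive_dirZ (V : normedModType R) (f : V -> R) (x v : V) (c : R) : smooth f ->
  'D_(c *: v) f x = c * 'D_v f x.
Proof.
move=> sf.
have lin (h : R) (u w : R) : (h *: u + w) *: v = h *: (u *: v) + w *: v.
  by rewrite scalerDl scalerA.
have [D1 D2] := @derive_affine R R V R (fun s : R => s *: v) x f 0 c lin.
have [dl dlE] := is_derive_line x v 0 sf; have [_ D4] := derive_dir1 c dl.
by move: D2; rewrite D4 dlE scale0r addr0 => <-.
Qed.

Lemma cvg_uniqR (T : Type) (F : set_system T) {PF : ProperFilter F} (u : T -> R) (a b : R) :
  u n @[n --> F] --> a -> u n @[n --> F] --> b -> a = b.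
Proof.
move=> ca cb; rewrite -(cvg_lim (@norm_hausdorff _ R) ca).
by rewrite (cvg_lim (@norm_hausdorff _ R) cb).
Qed.

(** The mean value theorem twice: in direction [v] for the increment of [f] by [t *: w], then in
    direction [w] for ['D_v f]. *)
Lemma second_difference (V : normedModType R) (f : V -> R) (x v w : V) (t : R) :
  smooth f -> 0 < t -> exists s r : R, [/\ 0 <= s <= t, 0 <= r <= t &
   f (x + t *: v + t *: w) - f (x + t *: v) - (f (x + t *: w) - f x) =
   t * t * 'D_w ('D_v f) (x + s *: v + r *: w)].
Proof.
move=> sf t0.
pose h y := f (t *: w + y).
have sh : smooth h.
  exact: (@smooth_affine R V V R id (t *: w) f (fun _ _ _ => erefl) (fun y => cvg_id) sf).
have Dh y : 'D_v h y = 'D_v f (t *: w + y).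
  by have [_ E1] := @derive_affine R V V R id (t *: w) f y v (fun _ _ _ => erefl).
pose g y := h y + (-1) * f y.
have sg : smooth g by exact: (smoothD sh (smoothZ (-1) sf)).
have Dg y : 'D_v g y = 'D_v f (t *: w + y) - 'D_v f y.
  rewrite /g (derive_add (smooth_derivable sh) (smooth_derivable (smoothZ (-1) sf))) Dh.
  rewrite (derive_mul (@derivable_cst R V R (-1) y v) (smooth_derivable sf)).
  by rewrite derive_cst mulr0 addr0 mulN1r.
have [s [s0 st E]] := MVT_line x v sg (ltW t0).
have [r [r0 rt E2]] := MVT_line (x + s *: v) w (smooth_derive v sf) (ltW t0).
exists s, r; rewrite s0 st r0 rt; split=> //.
rewrite -mulrA -E2 [x + s *: v + t *: w]addrC -Dg -E /g /h !mulN1r.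
rewrite ![t *: w + _]addrC; move: (f _) (f _) (f _) (f _) => a b c d.
by ring.
Qed.

Lemma small_shift_cvg (V : normedModType R) (g : V -> R) (x v w : V) (s r : nat -> R) :
  smooth g -> (forall n, 0 <= s n <= n.+1%:R^-1) -> (forall n, 0 <= r n <= n.+1%:R^-1) ->
  g (x + s n *: v + r n *: w) @[n --> \oo] --> g x.
Proof.
move=> sg sn rn.
have to0 (q : nat -> R) : (forall n, 0 <= q n <= n.+1%:R^-1) -> q n @[n --> \oo] --> (0 : R).
  move=> qn; apply: (squeeze_cvgr (f := cst 0) (h := fun n => n.+1%:R^-1)).
  - by apply: nearW => n; exact: qn.
  - exact: cvg_cst.
  - exact: cvg_harmonic.
have c : x + s n *: v + r n *: w @[n --> \oo] --> x.
  have -> : nbhs x = nbhs (x + 0 *: v + 0 *: w) by rewrite !scale0r !addr0.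
  apply: cvgD; last by apply: cvgZl; exact: to0.
  by apply: cvgD; [exact: cvg_cst|apply: cvgZl; exact: to0].
by apply: (continuous_cvg _ _ c); exact: (smooth_continuous sg).
Qed.

Lemma second_difference_alg (a b c d k X Y : R) : k != 0 ->
  a - b - (c - d) = k * X -> a - c - (b - d) = k * Y -> Y = X.
Proof.
by move=> k0 E1 E2; apply: (mulfI k0); rewrite -E1 -E2; ring.
Qed.

(** The second difference is symmetric in [v] and [w]. Divided by [t^2], with [t = 1 / (n + 1)], it
    equals either mixed derivative at points that tend to [x]. *)
Lemma smooth_schwarz (V : normedModType R) (f : V -> R) (v w : V) : smooth f ->
  'D_v ('D_w f) = 'D_w ('D_v f).
Proof.
move=> sf; apply/funext => x.
have sDwv := smooth_derive w (smooth_derive v sf).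
have sDvw := smooth_derive v (smooth_derive w sf).
have n0 (n : nat) : 0 < n.+1%:R^-1 :> R by rewrite invr_gt0.
have /choice[s /choice[r Hsr]] n := second_difference x v w sf (n0 n).
have /choice[s' /choice[r' Hsr']] n := second_difference x w v sf (n0 n).
have hs n : 0 <= s n <= n.+1%:R^-1 by case: (Hsr n).
have hr n : 0 <= r n <= n.+1%:R^-1 by case: (Hsr n).
have hs' n : 0 <= s' n <= n.+1%:R^-1 by case: (Hsr' n).
have hr' n : 0 <= r' n <= n.+1%:R^-1 by case: (Hsr' n).
have c1 := @small_shift_cvg V ('D_w ('D_v f)) x v w s r sDwv hs hr.
have c2 := @small_shift_cvg V ('D_v ('D_w f)) x w v s' r' sDvw hs' hr'.
have E : (fun n => 'D_v ('D_w f) (x + s' n *: w + r' n *: v)) =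
            (fun n => 'D_w ('D_v f) (x + s n *: v + r n *: w)); last first.
  by rewrite E in c2; exact: (cvg_uniqR c2 c1).
apply/funext => n; have [_ _ E1] := Hsr n; have [_ _ E2] := Hsr' n.
have nn : (n.+1%:R^-1 * n.+1%:R^-1 : R) != 0 by rewrite mulf_neq0// gt_eqF.
have H : x + n.+1%:R^-1 *: w + n.+1%:R^-1 *: v = x + n.+1%:R^-1 *: v + n.+1%:R^-1 *: w.
  by rewrite addrAC.
rewrite H in E2; exact: (second_difference_alg nn E1 E2).
Qed.

Lemma test_derive (U : set (R3 R)) (f : R3 R -> R) v :
  test_function U f -> test_function U ('D_v f).
Proof.
move=> [sf cK sK]; apply: (test_functionP (smooth_derive v sf) cK sK) => x nK.
have : \forall y \near x, f y = cst 0 y.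
  have oC : open (~` closure [set x | f x != 0]) by apply: closed_openC; exact: closed_closure.
  have := open_nbhs_nbhs (conj oC nK); apply: filterS => y ny.
  by apply/eqP; apply: contrapT => /negP fy; apply: ny; exact: subset_closure.
by move/(near_eq_derive v) => ->; rewrite derive_cst.
Qed.

Lemma test_mul (U : set (R3 R)) (f g : R3 R -> R) :
  test_function U f -> smooth g -> test_function U (fun x => g x * f x).
Proof.
move=> [sf cK sK] sg; apply: (test_functionP (smoothM sg sf) cK sK) => x nK.
have -> : f x = 0; last by rewrite mulr0.
by apply/eqP; apply: contrapT => /negP fy; apply: nK; exact: subset_closure.
Qed.

Lemma test_add (U : set (R3 R)) (f g : R3 R -> R) :
  test_function U f -> test_function U g -> test_function U (fun x => f x + g x).
Proof.
move=> tf tg; have [sf cK sK] := tf; have [sg cL sL] := tg.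
apply: (test_functionP (smoothD sf sg) (compactU cK cL)); first by rewrite subUset.
move=> x nKL.
have z (h : R3 R -> R) : ~ closure [set x | h x != 0] x -> h x = 0.
  by move=> nh; apply/eqP; apply: contrapT => /negP hx; apply: nh; exact: subset_closure.
by rewrite !z ?addr0// => h; apply: nKL; [right|left].
Qed.

Lemma test_bounded (U : set (R3 R)) (f : R3 R -> R) :
  test_function U f -> exists2 M : R, 0 <= M & forall x, `|f x| <= M.
Proof.
move=> [sf cK sK].
have : compact (f @` closure [set x | f x != 0]).
  by apply: continuous_compact cK; apply: continuous_subspaceT; exact: smooth_continuous.
move=> /compact_bounded[M [_ HM]].
exists (`|M| + 1); first by rewrite addr_ge0.
move=> x; have [Kx|nK] := pselect (closure [set x | f x != 0] x).
  by apply: HM; [rewrite (le_lt_trans (ler_norm _))// ltrDl|exists x].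
have -> : f x = 0.
  by apply/eqP; apply: contrapT => /negP fy; apply: nK; exact: subset_closure.
by rewrite normr0 addr_ge0.
Qed.

(** The segment from [y] to [x] is replaced by three moves parallel to the axes, each no longer than
    the sup norm of [x - y]. *)
Lemma test_lipschitz (U : set (R3 R)) (f : R3 R -> R) :
  test_function U f -> exists2 L : R, 0 <= L & forall x y, `|f x - f y| <= L * `|x - y|.
Proof.
move=> tf; have sf := test_function_smooth tf.
have /choice[M HM] k : exists M : R, 0 <= M /\ forall x, `|'D_(basis3 k) f x| <= M.
  by have [M M0 HM] := test_bounded (test_derive (basis3 k) tf); exists M.
exists (\sum_k M k); first by apply: sumr_ge0 => k _; case: (HM k).
have step1 k (x : R3 R) (t : R) : `|f (x + t *: basis3 k) - f x| <= M k * `|t|.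
  have pos (y : R3 R) (s : R) : 0 <= s -> `|f (y + s *: basis3 k) - f y| <= M k * `|s|.
    move=> s0; have [r [_ _ ->]] := MVT_line y (basis3 k) sf s0.
    by rewrite normrM mulrC ler_wpM2r//; case: (HM k).
  have [t0|t0] := leP 0 t; first exact: pos.
  have := pos (x + t *: basis3 k) (- t); rewrite scaleNr addrK normrN distrC.
  by apply; rewrite oppr_ge0 ltW.
move=> x y; pose d k := coord k (x - y).
have -> : x = y + d 0 *: basis3 0 + d 1 *: basis3 1 + d 2 *: basis3 2.
  by apply: coord_inj => k; rewrite !coordD !coordZ !coord_basis /d !coordB;
    case: k => -[|[|[|//]]] kl; rewrite ?mulr0 ?mulr1 ?addr0 !coordE /=; ring.
set y1 := y + _; set y2 := y1 + _.
have -> : f (y2 + d 2 *: basis3 2) - f y =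
   (f (y2 + d 2 *: basis3 2) - f y2) + (f y2 - f y1) + (f y1 - f y) by ring.
have -> : y2 + d 2 *: basis3 2 - y = x - y.
  apply: coord_inj => k; rewrite /y2 /y1 !coordB !coordD !coordZ !coord_basis /d !coordB.
  by case: k => -[|[|[|//]]] kl; rewrite ?mulr0 ?mulr1 ?addr0 !coordE /=; ring.
have dn k : `|d k| <= `|x - y| by exact: le_coord_norm.
have B k z : `|f (z + d k *: basis3 k) - f z| <= M k * `|x - y|.
  by apply: le_trans (step1 _ _ _) _; rewrite ler_wpM2l//; case: (HM k).
have -> : \sum_k M k = M 2 + M 1 + M 0.
  by rewrite sum3; ring.
rewrite 2!mulrDl; apply: le_trans (ler_normD _ _) _; apply: lerD; last exact: B.
by apply: le_trans (ler_normD _ _) _; apply: lerD; exact: B.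
Qed.

End SmoothR3.

(** * The L^2 seminorm *)

Section Norm.
Context d {T : measurableType d} {R : realType} (mu : {measure set T -> \bar R}).
Implicit Types f g : T -> R.
Let H := L2_semi_hilbert mu.

Definition nrm f := Num.sqrt (ip mu f f).

Lemma nrm_ge0 f : 0 <= nrm f.
Proof. exact: sqrtr_ge0. Qed.

Lemma sqr_nrm f : nrm f ^+ 2 = ip mu f f.
Proof. by rewrite sqr_sqrtr// ip_ge0. Qed.

Lemma ip_nrm f g : L2 mu f -> L2 mu g -> `|ip mu f g| <= nrm f * nrm g.
Proof.
move=> Lf Lg; rewrite -(@ler_pXn2r _ 2)// ?nnegrE ?mulr_ge0 ?nrm_ge0//.
by rewrite exprMn !sqr_nrm real_normK ?num_real//; exact: (sh_CS H).
Qed.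

Lemma nrmZ a f : L2 mu f -> nrm (a *: f) = `|a| * nrm f.
Proof.
move=> Lf; have La : L2 mu (a *: f) by exact: (sh_scale H).
by rewrite /nrm (sh_Zl H)// (sh_sym H) (sh_Zl H)// mulrA -expr2 sqrtrM ?sqr_ge0// sqrtr_sqr.
Qed.

Lemma nrmD f g : L2 mu f -> L2 mu g -> nrm (f + g) <= nrm f + nrm g.
Proof.
move=> Lf Lg; rewrite -(@ler_pXn2r _ 2)// ?nnegrE ?addr_ge0 ?nrm_ge0//.
rewrite sqr_nrm -[f + g]addr0 -{1 2}[f]scale1r addr0 (sh_line H)//.
rewrite expr1n !mul1r sqrrD !sqr_nrm lerD2r lerD2l.
rewrite lerMn2r /= (le_trans (ler_norm _))//; exact: ip_nrm.
Qed.

Lemma L2Z a f : L2 mu f -> L2 mu (a *: f).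
Proof. exact: (sh_scale H). Qed.

Lemma L2D f g : L2 mu f -> L2 mu g -> L2 mu (f + g).
Proof. exact: (sh_add H). Qed.

Lemma L2B f g : L2 mu f -> L2 mu g -> L2 mu (f - g).
Proof. exact: (sh_sub H). Qed.

Lemma L2_sum (I : Type) (s : seq I) (P : pred I) (F : I -> T -> R) :
  (forall i, P i -> L2 mu (F i)) -> L2 mu (\sum_(i <- s | P i) F i).
Proof. by move=> LF; elim/big_ind: _ => //; [exact: L2_0|exact: L2D]. Qed.

Lemma nrm0 : nrm 0 = 0.
Proof. by rewrite /nrm (sh_B0 H) ?sqrtr0//; exact: L2_0. Qed.

Lemma nrm_sum (I : Type) (s : seq I) (P : pred I) (F : I -> T -> R) :
  (forall i, P i -> L2 mu (F i)) ->
  nrm (\sum_(i <- s | P i) F i) <= \sum_(i <- s | P i) nrm (F i).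
Proof.
move=> LF.
suff [] : L2 mu (\sum_(i <- s | P i) F i) /\
  nrm (\sum_(i <- s | P i) F i) <= \sum_(i <- s | P i) nrm (F i) by [].
elim/big_ind2: _ => [|f x g y [Lf fx] [Lg gy]|i Pi].
- by rewrite nrm0; split=> //; exact: L2_0.
- by split; [exact: L2D|exact: le_trans (nrmD Lf Lg) (lerD fx gy)].
- by split; [exact: LF|].
Qed.

Lemma ip_disjoint f g : (forall x, f x * g x = 0) -> ip mu f g = 0.
Proof.
move=> fg; rewrite /ip; have -> : (fun x => f x * g x) = cst 0 by apply/funext.
by rewrite Rintegral_cst// mul0r.
Qed.

Lemma ip_linr a f g h : L2 mu f -> L2 mu g -> L2 mu h ->
  ip mu h (a *: f + g) = a * ip mu h f + ip mu h g.
Proof. by move=> *; rewrite !(ip_sym mu h) ip_bilin. Qed.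

Lemma ip_Bl f g h : L2 mu f -> L2 mu g -> L2 mu h ->
  ip mu (f - g) h = ip mu f h - ip mu g h.
Proof. exact: (sh_Bl H). Qed.

Lemma ip_Dl f g h : L2 mu f -> L2 mu g -> L2 mu h ->
  ip mu (f + g) h = ip mu f h + ip mu g h.
Proof. exact: (sh_Dl H). Qed.

Lemma ip_Zl a f h : L2 mu f -> L2 mu h -> ip mu (a *: f) h = a * ip mu f h.
Proof. exact: (sh_Zl H). Qed.

Lemma nrm_le f g : measurable_fun setT f -> (forall x, `|f x| <= `|g x|) -> L2 mu g ->
  nrm f <= nrm g.
Proof.
move=> mf fg Lg; have Lf := L2_le mf fg Lg.
rewrite ler_sqrt ?ip_ge0//; apply: le_Rintegral => //.
- exact: L2_mul.
- exact: L2_mul.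
- by move=> x _; rewrite -!expr2 -[f x ^+ 2]real_normK ?num_real// -[g x ^+ 2]real_normK ?num_real// lerXn2r ?nnegrE.
Qed.

End Norm.

(** * Convolution with test functions *)

Section Convolution.
Context {R : realType}.
Notation T3 := (measurableTypeR R * measurableTypeR R * measurableTypeR R)%type.
Notation L2_3 := (@L2 _ T3 R leb3).
Notation ip3 := (@ip _ T3 R leb3).
Notation nrm3 := (@nrm _ T3 R leb3).
Notation testf := (@test_function R R setT).
Implicit Types (u v kap : R3 R -> R).

Definition bsupp u := exists r : R, forall x, r < `|x| -> u x = 0.

(** On a bounded support L^2 is contained in L^1 ([L2c_int]), so a convolution may be differentiated
    under the integral sign. *)
Definition L2c u := L2_3 u /\ bsupp u.

Lemma bsupp_lin a u v : bsupp u -> bsupp v -> bsupp (a *: u + v).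
Proof.
move=> [r ru] [s sv]; exists (Num.max r s) => x; rewrite gt_max => /andP[h1 h2].
by rewrite -[LHS]/(a * u x + v x) ru// sv// mulr0 addr0.
Qed.

Lemma L2c_lin a u v : L2c u -> L2c v -> L2c (a *: u + v).
Proof. by move=> [? ?] [? ?]; split; [exact: L2_lin|exact: bsupp_lin]. Qed.

Definition cube (r : R) : set (R3 R) := box (- r, - r, - r) (r, r, r).

Lemma cubeP r x : cube r x <-> `|x| < r.
Proof.
rewrite norm3_lt !ltr_norml /cube /box /=.
by split=> [[-> -> ->]|/and3P[-> -> ->]].
Qed.

Lemma measurable_cube r : measurable (cube r : set T3).
Proof. exact: measurable_box. Qed.

Lemma leb3_cube r : 0 <= r -> leb3 (cube r : set T3) = ((r *+ 2) ^+ 3)%:E.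
Proof.
move=> r0; rewrite leb3_box /=; [|lra..].
by congr EFin; rewrite !exprS expr0; ring.
Qed.

Lemma cube_int r (c : R) : 0 <= r -> (leb3 : {measure set T3 -> \bar R}).-integrable setT
   (fun x => (c * \1_(cube r) x)%:E).
Proof.
move=> r0.
have -> : (fun x : T3 => (c * \1_(cube r) x)%:E) = (fun x => c%:E * (\1_(cube r) x)%:E)%E.
  by apply/funext => x.
apply: integrableZl => //; apply/integrableP; split.
  by apply/measurable_EFinP; exact: measurable_indic (measurable_cube r).
under eq_integral do rewrite gee0_abs ?lee_fin//.
rewrite integral_indic ?setIT//; last exact: measurable_cube.
by have := leb3_cube r0; rewrite /leb3 => -> /=; rewrite ltry.
Qed.

Lemma L2c_bounded u (M r : R) : measurable_fun setT (u : T3 -> R) ->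
  (forall x, `|u x| <= M) -> (forall x, r < `|x| -> u x = 0) -> L2c u.
Proof.
move=> mu uM ur; split; last by exists r.
split=> //; pose r' : R := `|r| + 1.
have r'0 : 0 <= r' by rewrite addr_ge0.
apply: (le_integrable measurableT _ _ (cube_int (M ^+ 2) r'0)).
  by apply/measurable_EFinP; exact: measurable_funX.
move=> x _; rewrite /= lee_fin indicE; have [Cx|nc] := pselect (cube r' x).
  by rewrite mem_set// mulr1 !normrX lerXn2r ?nnegrE// (le_trans (uM x))// ler_norm.
rewrite memNset// ur ?expr0n ?normr0 ?mulr0 ?normr0//.
have : ~ `|x| < r' by move/cubeP.
move/negP; rewrite -leNgt; apply: lt_le_trans; rewrite /r'.
by rewrite (le_lt_trans (ler_norm r))// ltrDl.
Qed.

Lemma testf_bsupp kap : testf kap -> bsupp kap.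
Proof.
move=> [sk ck _]; have [M [_ HM]] := compact_bounded ck.
exists (`|M| + 1) => x Mx; apply/eqP; apply: contrapT => /negP kx.
have Kx : closure [set x | kap x != 0] x by exact: subset_closure.
have := HM (`|M| + 1) ltac:(by rewrite (le_lt_trans (ler_norm _))// ltrDl) x Kx.
by rewrite /= leNgt Mx.
Qed.

Lemma testf_measurable kap : testf kap -> measurable_fun setT (kap : T3 -> R).
Proof. by move=> [sk _ _]; apply: continuous_measurable3; exact: smooth_continuous. Qed.

Lemma testf_L2c kap : testf kap -> L2c kap.
Proof.
move=> tk; have [r hr] := testf_bsupp tk; have [M _ hM] := test_bounded tk.
exact: L2c_bounded (testf_measurable tk) hM hr.
Qed.

Lemma testf_of kap (r : R) : smooth kap -> (forall x, r < `|x| -> kap x = 0) -> testf kap.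
Proof.
move=> sk kr; apply: (test_functionP sk (@compact_cube R 0 r)) => // x.
by rewrite /= subr0 => /negP; rewrite -ltNge; exact: kr.
Qed.

Lemma L2c_int u : L2c u -> (leb3 : {measure set T3 -> \bar R}).-integrable setT (fun x => (u x)%:E).
Proof.
move=> [[mu u2] [r ur]]; pose r' : R := `|r| + 1.
have r'0 : 0 <= r' by rewrite addr_ge0.
apply: (@le_integrable _ T3 R leb3 setT measurableT (fun x => (u x)%:E)
  (fun x => ((1 * \1_(cube r') x)%:E + (u x ^+ 2)%:E)%E)).
- exact/measurable_EFinP.
- move=> x _; rewrite /= lee_fin mul1r indicE.
  rewrite [leRHS]ger0_norm; last by rewrite addr_ge0// sqr_ge0.
  have [Cx|nc] := pselect (cube r' x).
    have -> : u x ^+ 2 = `|u x| ^+ 2 by rewrite real_normK ?num_real.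
    rewrite (mem_set Cx) /= mulr1n; move: `|u x| => a.
    by have := sqr_ge0 (a - 1); nra.
  rewrite memNset// ur ?expr0n ?normr0 ?addr0//.
  have : ~ `|x| < r' by move/cubeP.
  move/negP; rewrite -leNgt; apply: lt_le_trans; rewrite /r'.
  by rewrite (le_lt_trans (ler_norm r))// ltrDl.
- by apply: integrableD => //; exact: cube_int.
Qed.

(** The kernel as seen from [x]. A convolution is an inner product with it, so that weak convergence
    gives pointwise convergence of convolutions; and it is the test function inserted into weak
    curls. *)
Definition refl kap (x y : R3 R) := kap (x - y).

Lemma opp_lin (h : R) (u w : R3 R) : - (h *: u + w) = h *: - u + - w.
Proof. by rewrite opprD scalerN. Qed.

Lemma refl_smooth kap x : smooth kap -> smooth (refl kap x).
Proof.
move=> sk; apply: (@smooth_affine R (R3 R) (R3 R) R -%R x kap) => //.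
  exact: opp_lin.
exact: opp_continuous.
Qed.

Lemma refl_derive kap x (v : R3 R) y : smooth kap ->
  'D_v (refl kap x) y = - refl ('D_v kap) x y.
Proof.
move=> sk; have [_ E] := @derive_affine R (R3 R) (R3 R) R -%R x kap y v opp_lin.
transitivity ('D_(- v) kap (x - y)); first exact: E.
by rewrite -(scaleN1r v) (derive_dirZ _ _ _ sk) mulN1r.
Qed.

Lemma refl_testf kap x : testf kap -> testf (refl kap x).
Proof.
move=> tk; have [r hr] := testf_bsupp tk.
apply: (@testf_of _ (r + `|x|)); first by apply: refl_smooth; case: tk.
move=> y yr; apply: hr.
have : `|y| <= `|x - y| + `|x|; last by lra.
by rewrite distrC -{1}[y](subrK x) ler_normD.
Qed.

Definition conv kap u (x : R3 R) := ip3 (refl kap x) u.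

Lemma conv_linr kap a u v x : testf kap -> L2_3 u -> L2_3 v ->
  conv kap (a *: u + v) x = a * conv kap u x + conv kap v x.
Proof.
move=> tk Lu Lv; have [Lk _] := testf_L2c (refl_testf x tk).
exact: (ip_linr a Lu Lv Lk).
Qed.

Lemma conv_eq0 kap u x : (forall y, kap (x - y) = 0 \/ u y = 0) -> conv kap u x = 0.
Proof.
move=> H; apply: ip_disjoint => y.
by rewrite /refl; case: (H y) => ->; rewrite ?mul0r ?mulr0.
Qed.

(** The modulus depends on [u] only through its L^1 norm: this is the equicontinuity behind
    [conv_compact]. *)
Lemma conv_lip kap u L : testf kap -> L2c u -> 0 <= L ->
  (forall x y, `|kap x - kap y| <= L * `|x - y|) ->
  forall x x', `|conv kap u x - conv kap u x'| <= L * `|x - x'| * \int[leb3]_(y in setT) `|u y|.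
Proof.
move=> tk Lu L0 HL x x'; have [Lu2 _] := Lu.
have [Lk _] := testf_L2c (refl_testf x tk); have [Lk' _] := testf_L2c (refl_testf x' tk).
have -> : conv kap u x - conv kap u x' = ip3 (refl kap x - refl kap x') u.
  by apply/esym; exact: (ip_Bl Lk Lk' Lu2).
have iu : (leb3 : {measure set T3 -> \bar R}).-integrable setT (fun y => (`|u y|)%:E).
  by have := integrable_norm (L2c_int Lu).
apply: le_trans (le_normr_Rintegral measurableT (L2_mul (L2B Lk Lk') Lu2)) _.
rewrite -RintegralZl//; apply: le_Rintegral => //.
- by have := integrable_norm (L2_mul (L2B Lk Lk') Lu2).
- have -> : (EFin \o (fun t => L * `|x - x'| * `|u t|)) = (fun t => (L * `|x - x'|)%:E * (`|u t|)%:E)%E.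
    by apply/funext => t.
  exact: integrableZl.
- move=> y _; rewrite normrM ler_wpM2r//.
  by apply: le_trans (HL _ _) _; rewrite opprB addrA subrK.
Qed.

Lemma conv_continuous kap u : testf kap -> L2c u -> continuous (conv kap u).
Proof.
move=> tk Lu; have [L L0 HL] := test_lipschitz tk.
set A := \int[leb3]_(y in setT) `|u y|.
have A0 : 0 <= A by exact: Rintegral_ge0.
move=> x; apply/cvgrPdist_le => e e0.
have d0 : 0 < e / (L * A + 1) by rewrite divr_gt0// ltr_wpDl// mulr_ge0.
have := @nbhsx_ballx _ (R3 R) x _ d0; apply: filterS => y.
rewrite -ball_normE /ball_ /= => /ltW xy.
apply: le_trans (conv_lip tk Lu L0 HL x y) _.
rewrite -/A mulrAC; apply: (@le_trans _ _ ((L * A + 1) * `|x - y|)).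
  by rewrite ler_wpM2r// lerDl.
by rewrite mulrC -ler_pdivlMr// ltr_wpDl// mulr_ge0.
Qed.

Lemma conv_derive kap u x (v : R3 R) : testf kap -> L2c u ->
  derivable (conv kap u) x v /\ 'D_v (conv kap u) x = conv ('D_v kap) u x.
Proof.
move=> tk Lu; have sk : smooth kap by case: tk.
have tD := test_derive v tk; have [M M0 HM] := test_bounded tD.
have [Lu2 _] := Lu.
pose f (t : R) (y : T3) : R := kap (x - y + t *: v) * u y.
have lin (h : R) (a b : R) : (h *: a + b) *: v = h *: (a *: v) + b *: v.
  by rewrite scalerDl scalerA.
have [D1 D2] := @derive_affine R R (R3 R) R (fun t : R => t *: v) x (conv kap u) 0 1 lin.
have fE t : conv kap u (x + t *: v) = \int[leb3]_(y in setT) f t y.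
  by apply: eq_Rintegral => y _; rewrite /f /refl addrAC.
have df t y : is_derive t (1 : R) (f ^~ y) ('D_v kap (x - y + t *: v) * u y).
  have H := is_derive_line (x - y) v t sk.
  have := @is_deriveM R R _ (cst (u y)) t 1 _ _ H (is_derive_cst _ _ _).
  by move=> H'; apply: (is_derive_eq H'); rewrite scaler0 add0r [LHS]mulrC.
have d1E t y : partial1of2 f t y = 'D_v kap (x - y + t *: v) * u y.
  by rewrite partial1of2E; have [_ ->] := df t y.
have iG : (leb3 : {measure set T3 -> \bar R}).-integrable setT (EFin \o (fun y => M * `|u y|)).
  have -> : EFin \o (fun y => M * `|u y|) = (fun y : T3 => M%:E * (`|u y|)%:E)%E.
    by apply/funext => t.
  by apply: integrableZl => //; have := integrable_norm (L2c_int Lu).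
have If (t : R) : (`](-1), 1[%classic : set R) t -> (leb3 : {measure set T3 -> \bar R}).-integrable setT (EFin \o f t).
  move=> _.
  have [Lk _] := testf_L2c (refl_testf (x + t *: v) tk).
  have -> : EFin \o f t = (fun y : T3 => (refl kap (x + t *: v) y * u y)%:E).
    by apply/funext => y; rewrite /f /refl /= addrAC.
  exact: L2_mul.
have I0 : (`](-1), 1[%classic : set R) 0 by rewrite /= in_itv /=; apply/andP; split; lra.
have dI (t : R) (y : T3) : (`](-1), 1[%classic : set R) t -> [set: T3] y -> derivable (f ^~ y) t 1.
  by move=> _ _; have [] := df t y.
have bI (t : R) (y : T3) : (`](-1), 1[%classic : set R) t -> [set: T3] y -> `|partial1of2 f t y| <= M * `|u y|.
  by move=> _ _; rewrite d1E normrM ler_wpM2r.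
have G0 (y : T3) : 0 <= M * `|u y| by rewrite mulr_ge0.
have := @derivable_under_integral R _ T3 leb3 f setT measurableT 0 (-1) 1 I0 If dI _ G0 iG bI.
have := @differentiation_under_integral R _ T3 leb3 f setT measurableT 0 (-1) 1 I0 If dI _ G0 iG bI.
have -> : (fun t => \int[leb3]_(y in setT) f t y) = (fun t : R => conv kap u (x + t *: v)).
  by apply/funext => t; rewrite fE.
rewrite derive1E D2 scale0r addr0 scale1r => E dd; split.
  by move/D1: dd; rewrite scale0r addr0 scale1r.
rewrite E; apply: eq_Rintegral => y _; rewrite d1E scale0r addr0//.
Qed.

Lemma conv_smooth kap u : testf kap -> L2c u -> smooth (conv kap u).
Proof.
move=> tk Lu; apply: (@smooth_class R (R3 R) R (fun f => exists2 k, testf k & f = conv k u)); last by exists kap.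
  move=> _ [k t ->]; split; first exact: conv_continuous.
  by move=> x v; have [] := conv_derive x v t Lu.
move=> _ v [k t ->]; exists ('D_v k); first exact: test_derive.
by apply/funext => x; have [] := conv_derive x v t Lu.
Qed.

Lemma conv_testf kap u : testf kap -> L2c u -> testf (conv kap u).
Proof.
move=> tk Lu; have [r hr] := testf_bsupp tk; have [_ [s hs]] := Lu.
apply: (@testf_of _ (r + s)); first exact: conv_smooth.
move=> x xr; apply: conv_eq0 => y; have [ys|ys] := ltP s `|y|; first by right; exact: hs.
left; apply: hr; have : `|x| <= `|x - y| + `|y|; last by lra.
by rewrite -{1}[x](subrK y) ler_normD.
Qed.

End Convolution.

(** * Young's inequality and compactness of convolutions *)

Section Young.
Context {R : realType}.
Notation T3 := (measurableTypeR R * measurableTypeR R * measurableTypeR R)%type.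
Notation L2_3 := (@L2 _ T3 R leb3).
Notation ip3 := (@ip _ T3 R leb3).
Notation nrm3 := (@nrm _ T3 R leb3).
Notation testf := (@test_function R R setT).
Notation integ f := ((leb3 : {measure set T3 -> \bar R}).-integrable setT (f : T3 -> \bar R)).
Implicit Types (u kap : R3 R -> R).

Definition nrm1 kap := \int[leb3]_(x in setT) `|kap x|.

Lemma nrm1_ge0 kap : 0 <= nrm1 kap.
Proof. exact: Rintegral_ge0. Qed.

Lemma testf_int_norm kap : testf kap -> integ (fun x => (`|kap x|)%:E).
Proof. by move=> tk; have := integrable_norm (L2c_int (testf_L2c tk)). Qed.

Lemma EFin_nrm1 kap : testf kap -> ((nrm1 kap)%:E = \int[leb3]_(x in setT) (`|kap x|)%:E)%E.
Proof.
move=> tk; rewrite /nrm1 /Rintegral fineK//.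
exact: (integrable_fin_num measurableT (testf_int_norm tk)).
Qed.

Lemma leb3_reflect (f : R3 R -> \bar R) (x : R3 R) :
  measurable_fun setT (f : T3 -> \bar R) -> (forall y, 0 <= f y)%E ->
  (\int[leb3]_(y in setT) f (x - y)%R = \int[leb3]_(y in setT) f y)%E.
Proof.
move=> mf f0; have N1 : -1 != 0 :> R by rewrite oppr_eq0 oner_eq0.
rewrite -[RHS](leb3_affine x N1 mf f0) normrN normr1 expr1n mul1e.
by apply: eq_integral => y _; rewrite scaleN1r.
Qed.

Lemma nrm1_refl kap x : testf kap -> nrm1 (refl kap x) = nrm1 kap.
Proof.
move=> tk; congr fine; apply: (leb3_reflect (f := fun y => (`|kap y|)%:E)) => //.
apply/measurable_EFinP; apply: measurableT_comp => //; exact: testf_measurable.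
Qed.

(** Cauchy-Schwarz for the weight given by the modulus of [kap (x - y)]: the polynomial in [t] is
    the integral of the weight times the square of [t] plus the modulus of [u y]. *)
Lemma conv_sqr_le kap u x : testf kap -> L2c u ->
  (conv kap u x) ^+ 2 <= nrm1 kap * \int[leb3]_(y in setT) (`|kap (x - y)| * u y ^+ 2).
Proof.
move=> tk Lu; have [Lu2 _] := Lu; have [mu u2] := Lu2.
have tr := refl_testf x tk; have [Lk _] := testf_L2c tr.
have [M M0 HM] := test_bounded tr.
pose k := refl kap x; have mk : measurable_fun setT (k : T3 -> R) by exact: testf_measurable.
have mak : measurable_fun setT ((fun y => `|k y|) : T3 -> R) by exact: measurableT_comp.
have i1 : integ (fun y => (`|k y|)%:E) by exact: testf_int_norm.
have i2 : integ (fun y => (`|k y| * `|u y|)%:E).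
  have -> : (fun y => (`|k y| * `|u y|)%:E) = (fun y => (`|k y * u y|)%:E).
    by apply/funext => y; rewrite normrM.
  by have := integrable_norm (L2_mul Lk Lu2).
have i3 : integ (fun y => (`|k y| * u y ^+ 2)%:E).
  apply: (@le_integrable _ T3 R leb3 setT measurableT _ (fun y => (M%:E * (u y ^+ 2)%:E)%E)).
  - by apply/measurable_EFinP/measurable_funM => //; exact: measurable_funX.
  - move=> y _; rewrite /= lee_fin !normrM !normr_id (ger0_norm M0).
    by rewrite ler_wpM2r.
  - exact: integrableZl.
have -> : nrm1 kap = \int[leb3]_(y in setT) `|k y| by rewrite -(nrm1_refl x tk).
apply: (@le_trans _ _ ((\int[leb3]_(y in setT) (`|k y| * `|u y|)) ^+ 2)).
  rewrite -[leLHS]real_normK ?num_real// lerXn2r ?nnegrE// ?Rintegral_ge0//.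
  apply: le_trans (le_normr_Rintegral measurableT (L2_mul Lk Lu2)) _.
  by rewrite le_eqVlt; apply/orP; left; apply/eqP/eq_Rintegral => y _; rewrite normrM.
apply: discr_le => [||t].
- exact: Rintegral_ge0.
- by apply: Rintegral_ge0 => y _; rewrite mulr_ge0// sqr_ge0.
have i2t : integ (fun y => ((t *+ 2) * (`|k y| * `|u y|))%:E).
  have -> : (fun y => ((t *+ 2) * (`|k y| * `|u y|))%:E) = (fun y => ((t *+ 2)%:E * (`|k y| * `|u y|)%:E)%E).
    by apply/funext.
  exact: integrableZl.
have i1t : integ (fun y => (t ^+ 2 * `|k y|)%:E).
  have -> : (fun y => (t ^+ 2 * `|k y|)%:E) = (fun y => ((t ^+ 2)%:E * (`|k y|)%:E)%E).
    by apply/funext.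
  exact: integrableZl.
have -> : t ^+ 2 * \int[leb3]_(y in setT) `|k y| + t * \int[leb3]_(y in setT) (`|k y| * `|u y|) *+ 2
   + \int[leb3]_(y in setT) (`|k y| * u y ^+ 2) =
   \int[leb3]_(y in setT) (t ^+ 2 * `|k y| + (t *+ 2) * (`|k y| * `|u y|) + `|k y| * u y ^+ 2).
  rewrite RintegralD//; last by apply: (integrableD measurableT i1t i2t).
  rewrite RintegralD// !RintegralZl// -mulrnAl; congr (_ + _ + _).
apply: Rintegral_ge0 => y _.
have -> : u y ^+ 2 = `|u y| ^+ 2 by rewrite real_normK ?num_real.
have := normr_ge0 (k y); move: `|k y| `|u y| => a b a0.
have -> : t ^+ 2 * a + t *+ 2 * (a * b) + a * b ^+ 2 = a * (t + b) ^+ 2 by ring.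
by rewrite mulr_ge0// sqr_ge0.
Qed.

(** The pointwise bound is integrated in [x] and the integrals are exchanged. Only the L^1 norm of
    the kernel remains, which is geometrically small for the fine shells of a cone kernel. *)
Lemma young kap u : testf kap -> L2c u ->
  L2_3 (conv kap u) /\ nrm3 (conv kap u) <= nrm1 kap * nrm3 u.
Proof.
move=> tk Lu; have [Lu2 _] := Lu; have [mu u2] := Lu2.
have tc := conv_testf tk Lu; have [Lc _] := testf_L2c tc; split=> //.
have N0 := nrm1_ge0 kap.
rewrite -(@ler_pXn2r _ 2)// ?nnegrE ?mulr_ge0 ?nrm_ge0//.
rewrite exprMn !sqr_nrm -lee_fin EFinM (EFin_ip Lc) (EFin_ip Lu2).
have mkap := testf_measurable tk.
pose F (p : T3 * T3) : \bar R := (`|kap (p.1 - p.2)| * u p.2 ^+ 2)%:E.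
have mF : measurable_fun setT F.
  apply/measurable_EFinP; apply: measurable_funM.
    apply: measurableT_comp => //.
    apply: (measurableT_comp mkap).
    apply: measurable_fun_pair; first apply: measurable_fun_pair;
      by apply: measurable_funB; repeat (apply: measurableT_comp => //).
  by apply: measurable_funX; exact: measurableT_comp.
have F0 p : (0 <= F p)%E by rewrite lee_fin mulr_ge0// sqr_ge0.
apply: (@le_trans _ _ (\int[mu3]_x ((nrm1 kap)%:E * fubini_F mu3 F x))%E).
  apply: ge0_le_integral => //.
  - by move=> x _; rewrite lee_fin sqr_ge0.
  - by apply/measurable_EFinP/measurable_funX; case: Lc.
  - apply: emeasurable_funM => //; exact: (measurable_fun_fubini_tonelli_F (m2 := mu3) _ mF F0).
  move=> x _.
  have -> : fubini_F mu3 F x = (\int[leb3]_(y in setT) (`|kap (x - y)| * u y ^+ 2))%:E.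
    rewrite /fubini_F /Rintegral fineK//.
    have [M M0 HM] := test_bounded (refl_testf x tk).
    apply: (integrable_fin_num measurableT).
    apply: (@le_integrable _ T3 R leb3 setT measurableT _ (fun y => (M%:E * (u y ^+ 2)%:E)%E)).
    + apply/measurable_EFinP/measurable_funM => //; last exact: measurable_funX.
      by apply: measurableT_comp => //; exact: (testf_measurable (refl_testf x tk)).
    + move=> y _; rewrite /= lee_fin !normrM !normr_id (ger0_norm M0).
      by rewrite ler_wpM2r//; exact: HM.
    + exact: integrableZl.
  by rewrite -EFinM lee_fin; exact: conv_sqr_le.
rewrite ge0_integralZl//; last 2 first.
- exact: (measurable_fun_fubini_tonelli_F (m2 := mu3) _ mF F0).
- by move=> x _; apply: integral_ge0.
rewrite (fubini_tonelli (m1 := mu3) (m2 := mu3) _ mF F0).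
have E y : (\int[mu3]_x F (x, y) = (nrm1 kap)%:E * (u y ^+ 2)%:E)%E.
  have mk1 : measurable_fun setT ((fun x => (`|kap x|)%:E) : T3 -> \bar R).
    by apply/measurable_EFinP; exact: measurableT_comp.
  have -> : (\int[mu3]_x F (x, y) = \int[leb3]_(x in setT) ((u y ^+ 2)%:E * (`|kap (- y + 1 *: x)%R|)%:E))%E.
    apply: eq_integral => x _; rewrite /F scale1r /= -EFinM mulrC.
    by rewrite [in RHS]addrC.
  rewrite ge0_integralZl//; last 2 first.
  - apply/measurable_EFinP; apply: measurableT_comp => //; apply: (measurableT_comp mkap).
    have -> : (fun x : T3 => (- y + 1 *: (x : R3 R) : R3 R)) = (fun x => - y + x).
      by apply/funext => x; rewrite scale1r.
    apply: measurable_fun_pair; first apply: measurable_fun_pair;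
      by apply: measurable_funD => //; repeat (apply: measurableT_comp => //).
  - by rewrite lee_fin sqr_ge0.
  rewrite muleC; congr (_ * _)%E; rewrite EFin_nrm1//.
  have := @leb3_affine R (- y) 1 (fun x => (`|kap x|)%:E) (oner_neq0 _) mk1 (fun x => normr_ge0 _).
  by rewrite normr1 expr1n mul1e.
have -> : (\int[mu3]_y \int[mu3]_x F (x, y) = (nrm1 kap)%:E * \int[leb3]_x (u x ^+ 2)%:E)%E.
  under eq_integral do rewrite E.
  rewrite ge0_integralZl// => [|x _]; last by rewrite lee_fin sqr_ge0.
  by apply/measurable_EFinP; exact: measurable_funX.
by rewrite muleA -EFinM -expr2.
Qed.

(** Weak convergence makes the convolutions tend to 0 at each point, and they share a Lipschitz
    constant, hence they tend to 0 uniformly on a compact cube. The covering form of compactness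
    lets this argument run along any filter, without subsequences. *)
Lemma conv_compact (F : set_system nat) {FF : Filter F} kap (u : nat -> R3 R -> R) (r A : R) :
  testf kap -> (forall n, L2_3 (u n)) -> (forall n x, r < `|x| -> u n x = 0) ->
  (forall n, nrm3 (u n) <= A) ->
  (forall v, L2_3 v -> ip3 v (u n) @[n --> F] --> (0 : R)) ->
  nrm3 (conv kap (u n)) @[n --> F] --> (0 : R).
Proof.
move=> tk Lu ur uA weak.
have Lcu n : L2c (u n) by split=> //; exists r => x; exact: ur.
have [L L0 HL] := test_lipschitz tk.
have [s ks] := testf_bsupp tk.
(* All [u n] and all their convolutions vanish off the cube of radius [q], so uniform smallness on
   it is smallness in L^2. *)
pose q : R := `|r| + `|s| + 1; have q0 : 0 <= q by rewrite !addr_ge0.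
have rq : r < q by have := ler_norm r; have := normr_ge0 s; rewrite /q; lra.
pose I := (fun x => 1 * \1_(cube q) x : R).
have LI : L2_3 I.
  have [] // : L2c I; apply: (@L2c_bounded _ I 1 q).
  - by apply: measurable_funM => //; exact: measurable_indic (measurable_cube q).
  - by move=> x; rewrite /I mul1r indicE; case: (x \in _); rewrite ?normr1 ?normr0.
  - move=> x qx; rewrite /I indicE memNset ?mulr0// => /cubeP.
    by move=> /(lt_trans qx); rewrite ltxx.
pose A1 := nrm3 I * A.
have u1 n : \int[leb3]_(y in setT) `|u n y| <= A1.
  have mun : measurable_fun setT ((fun y => `|u n y|) : T3 -> R).
    by apply: measurableT_comp => //; case: (Lu n).
  have Lun : L2_3 (fun y => `|u n y|).
    by apply: (L2_le mun _ (Lu n)) => x; rewrite normr_id.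
  have -> : \int[leb3]_(y in setT) `|u n y| = ip3 I (fun y => `|u n y|).
    apply: eq_Rintegral => y _; rewrite /I mul1r indicE.
    have [Cy|nc] := pselect (cube q y); first by rewrite mem_set// mul1r.
    rewrite memNset// mul0r ur ?normr0//.
    have /negP : ~ `|y| < q by move/cubeP.
    by rewrite -leNgt; exact: lt_le_trans.
  apply: le_trans (ler_norm _) _; apply: le_trans (ip_nrm LI Lun) _.
  rewrite ler_wpM2l ?nrm_ge0//; apply: le_trans (uA n).
  by apply: (nrm_le mun _ (Lu n)) => x; rewrite normr_id.
have A10 : 0 <= A1 by apply: le_trans (u1 0%N); exact: Rintegral_ge0.
have lip n x x' : `|conv kap (u n) x - conv kap (u n) x'| <= L * A1 * `|x - x'|.
  apply: le_trans (conv_lip tk (Lcu n) L0 HL x x') _.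
  by rewrite mulrAC ler_wpM2r// ler_wpM2l.
have ptw x : conv kap (u n) x @[n --> F] --> (0 : R).
  by apply: weak; have [] := testf_L2c (refl_testf x tk).
have unif (e : R) : 0 < e -> \forall n \near F, forall x, `|x - 0| <= q -> `|conv kap (u n) x| <= e.
  move=> e0.
  have := (compact_near_coveringP [set x : R3 R | `|x - 0| <= q]).1 (@compact_cube R 0 q).
  apply=> x _.
  have e2 : 0 < e / 2 by rewrite divr_gt0.
  have d0 : 0 < (e / 2) / (L * A1 + 1) by rewrite divr_gt0// ltr_wpDl// mulr_ge0.
  have n1 : \forall n \near F, `|conv kap (u n) x| <= e / 2.
    have /cvgrPdist_le := ptw x => /(_ _ e2); apply: filterS => n.
    by rewrite sub0r normrN.
  have x1 := @nbhsx_ballx _ (R3 R) x _ d0.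
  exists (ball x (e / 2 / (L * A1 + 1)), [set n | `|conv kap (u n) x| <= e / 2]) => //.
  move=> [x' n] [/= + Hn]; rewrite -ball_normE /ball_ /= => /ltW xx'.
  have : L * A1 * `|x' - x| <= e / 2.
    rewrite distrC; apply: (@le_trans _ _ ((L * A1 + 1) * `|x - x'|)).
      by rewrite ler_wpM2r// lerDl.
    by rewrite mulrC -ler_pdivlMr// ltr_wpDl// mulr_ge0.
  move=> H; have := lip n x' x; have := ler_normD (conv kap (u n) x' - conv kap (u n) x) (conv kap (u n) x).
  by rewrite subrK; lra.
apply/cvgrPdist_le => e e0.
have c0 : 0 < e / (nrm3 I + 1) by rewrite divr_gt0// ltr_wpDl// nrm_ge0.
have := unif _ c0; apply: filterS => n Hn.
rewrite sub0r normrN ger0_norm ?nrm_ge0//.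
have Lc := (testf_L2c (conv_testf tk (Lcu n))).1.
set c := e / _ in c0 Hn.
have LcI := L2Z c LI.
apply: (@le_trans _ _ (nrm3 (c *: I))).
  apply: (nrm_le _ _ LcI); first by case: Lc.
  move=> x; have -> : (c *: I) x = c * I x by [].
  have [Cx|nc] := pselect (cube q x).
    rewrite /I indicE mem_set// !mulr1 (ger0_norm (ltW c0)).
    by apply: Hn; rewrite subr0 ltW//; apply/cubeP.
  rewrite conv_eq0 ?normr0// => y.
  have /negP : ~ `|x| < q by move/cubeP.
  rewrite -leNgt => qx; have [ys|ys] := ltP r `|y|; first by right; exact: ur.
  left; apply: ks; have : `|x| <= `|x - y| + `|y| by rewrite -{1}[x](subrK y) ler_normD.
  by have := ler_norm r; have := ler_norm s; rewrite /q in qx; have := normr_ge0 r; lra.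
rewrite nrmZ// (ger0_norm (ltW c0)) /c mulrAC ler_pdivrMr; last by rewrite ltr_wpDl// nrm_ge0.
by rewrite ler_pM2l// lerDl.
Qed.

End Young.

Lemma ae_imp d (T : measurableType d) (R : realType) (mu : {measure set T -> \bar R})
  (P Q : T -> Prop) : (forall x, P x -> Q x) ->
  {ae mu, forall x, P x} -> {ae mu, forall x, Q x}.
Proof. by move=> PQ; apply: filterS. Qed.

Lemma ae_all d (T : measurableType d) (R : realType) (mu : {measure set T -> \bar R})
  (P : nat -> T -> Prop) : (forall n, {ae mu, forall x, P n x}) ->
  {ae mu, forall x, forall n, P n x}.
Proof. exact: ae_foralln. Qed.

Lemma nrm_ae0 d (T : measurableType d) (R : realType) (mu : {measure set T -> \bar R})
  (u : T -> R) : measurable_fun setT u -> {ae mu, forall x, u x = 0} -> nrm mu u = 0.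
Proof.
move=> mfu u0; rewrite /nrm /ip /Rintegral (ae_eq_integral (cst 0%E))//.
- by rewrite integral_cst// mul0e sqrtr0.
- by apply/measurable_EFinP/measurable_funM.
- by apply: filterS u0 => x -> _; rewrite mulr0.
Qed.

(** * Test functions determine and approximate L^2 functions *)

Section FundamentalLemma.
Context {R : realType}.
Notation T3 := (measurableTypeR R * measurableTypeR R * measurableTypeR R)%type.
Notation L2_3 := (@L2 _ T3 R leb3).
Notation ip3 := (@ip _ T3 R leb3).
Notation nrm3 := (@nrm _ T3 R leb3).
Notation testf := (@test_function R R setT).
Notation mes := (leb3 : {measure set T3 -> \bar R}).
Notation integ f := (mes.-integrable setT (f : T3 -> \bar R)).

Definition boxes : set (set (R3 R)) := [set A | exists a b, A = box a b].

Lemma boxes_setI : setI_closed boxes.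
Proof.
move=> _ _ [a [b ->]] [a' [b' ->]].
exists (Num.max a.1.1 a'.1.1, Num.max a.1.2 a'.1.2, Num.max a.2 a'.2).
exists (Num.min b.1.1 b'.1.1, Num.min b.1.2 b'.1.2, Num.min b.2 b'.2).
apply/seteqP; split=> x; rewrite /box /= !gt_max !lt_min.
  by move=> [[/andP[-> ->] /andP[-> ->] /andP[-> ->]] [/andP[-> ->] /andP[-> ->] /andP[-> ->]]].
move=> [/andP[/andP[-> ->] /andP[-> ->]] /andP[/andP[-> ->] /andP[-> ->]] /andP[/andP[-> ->] /andP[-> ->]]].
by [].
Qed.

Lemma measurable_boxes : (measurable : set (set T3)) = <<s boxes>>.
Proof.
apply/seteqP; split; last first.
  apply: smallest_sub; first exact: sigma_algebra_measurable.
  by move=> _ [a [b ->]]; exact: measurable_box.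
pose S := g_sigma_algebraType boxes.
have mcoord (c : R3 R -> R) : (forall u v : R, exists F : nat -> set (R3 R),
    (forall n, boxes (F n)) /\ c @^-1` `]u, v[%classic = \bigcup_n F n) ->
    measurable_fun setT (c : S -> R).
  move=> H; apply: (measurability _ (@measurable_realfun.RGenOpens.measurableE R)).
  move=> _ [_ [u [v ->]] <-]; rewrite setTI.
  have [F [bF ->]] := H u v; apply: bigcup_measurable => n _.
  by apply: sub_sigma_algebra; exact: bF.
have arch (x y : R) : exists n : nat, - n%:R < x < n%:R /\ - n%:R < y < n%:R.
  exists (Num.truncn (`|x| + `|y|)).+1.
  have H : `|x| + `|y| < (Num.truncn (`|x| + `|y|)).+1%:R by exact: truncnS_gt.
  have [h1 h2] : `|x| < (Num.truncn (`|x| + `|y|)).+1%:R /\ `|y| < (Num.truncn (`|x| + `|y|)).+1%:R.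
    by split; apply: le_lt_trans H; rewrite ?lerDl ?lerDr.
  by rewrite -!ltr_norml.
have m1 : measurable_fun setT ((fun x => x.1.1) : S -> R).
  apply: mcoord => u v; exists (fun n => box (u, - n%:R, - n%:R) (v, n%:R, n%:R)).
  split; first by move=> n; exists (u, - n%:R, - n%:R), (v, n%:R, n%:R).
  apply/seteqP; split=> x /=; rewrite in_itv /=; last by case=> n _ [].
  by move=> ux; have [n [h1 h2]] := arch x.1.2 x.2; exists n.
have m2 : measurable_fun setT ((fun x => x.1.2) : S -> R).
  apply: mcoord => u v; exists (fun n => box (- n%:R, u, - n%:R) (n%:R, v, n%:R)).
  split; first by move=> n; exists (- n%:R, u, - n%:R), (n%:R, v, n%:R).
  apply/seteqP; split=> x /=; rewrite in_itv /=; last by case=> n _ [].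
  by move=> ux; have [n [h1 h2]] := arch x.1.1 x.2; exists n.
have m3 : measurable_fun setT ((fun x => x.2) : S -> R).
  apply: mcoord => u v; exists (fun n => box (- n%:R, - n%:R, u) (n%:R, n%:R, v)).
  split; first by move=> n; exists (- n%:R, - n%:R, u), (n%:R, n%:R, v).
  apply/seteqP; split=> x /=; rewrite in_itv /=; last by case=> n _ [].
  by move=> ux; have [n [h1 h2]] := arch x.1.1 x.1.2; exists n.
have mid : measurable_fun setT ((fun x => (x.1.1, x.1.2, x.2)) : S -> T3).
  by apply: measurable_fun_pair => //; exact: measurable_fun_pair.
move=> A mA; have := mid measurableT A mA; rewrite setTI.
congr (_ _); apply/seteqP; split=> -[[x y] z] //.
Qed.

(* An integrable function orthogonal to the test functions has zero integral on
   each box, hence vanishes a.e. *)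
Lemma test_orth_ae0 (f : R3 R -> R) : integ (fun x => (f x)%:E) ->
  (forall phi, testf phi -> \int[leb3]_(x in setT) (f x * phi x) = 0) ->
  {ae leb3, forall x, f x = 0}.
Proof.
move=> If Hf.
(* Dominated convergence: orthogonality to the test functions passes to the indicator of a set that
   they approximate pointwise. *)
have lim (A : set T3) (phi : nat -> R3 R -> R) : measurable A ->
    (forall n, testf (phi n)) -> (forall n x, 0 <= phi n x <= 1) ->
    (forall x, phi n x @[n --> \oo] --> (\1_A x : R)) ->
    (\int[leb3]_(x in A) (f x)%:E = 0)%E.
  move=> mA tphi phi1 cphi.
  have mf : measurable_fun setT (f : T3 -> R).
    by apply/measurable_EFinP; case/integrableP: If.
  have c : (\int[leb3]_(x in setT) (f x * phi n x)%:E)%E @[n --> \oo] -->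
           (\int[leb3]_(x in setT) (f x * \1_A x)%:E)%E.
    apply: (@dominated_cvg _ T3 R leb3 setT measurableT (fun n x => (f x * phi n x)%:E) _ (fun x => (`|f x|)%:E)).
    - move=> n; apply/measurable_EFinP/measurable_funM => //; exact: testf_measurable.
    - move=> x _; apply: cvg_EFin; first exact: nearW.
      by apply: cvgMr; exact: cphi.
    - by [].
    - by have := integrable_norm If.
    - move=> n x _; rewrite /= lee_fin normrM ler_piMr//.
      by have /andP[h0 h1] := phi1 n x; rewrite ger0_norm.
  have z n : (\int[leb3]_(x in setT) (f x * phi n x)%:E = 0)%E.
    have Ifp : integ (fun x => (f x * phi n x)%:E).
      apply: (@le_integrable _ T3 R leb3 setT measurableT _ (fun x => (f x)%:E)) => //.
        by apply/measurable_EFinP/measurable_funM => //; exact: testf_measurable.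
      move=> x _; rewrite lee_fin normrM ler_piMr//.
      by have /andP[h0 h1] := phi1 n x; rewrite ger0_norm.
    have := Hf _ (tphi n); rewrite /Rintegral => H.
    by rewrite -[LHS]fineK ?H//; exact: (integrable_fin_num measurableT Ifp).
  rewrite integral_mkcond.
  have -> : (\int[leb3]_x ((fun x => (f x)%:E) \_ A) x = \int[leb3]_(x in setT) (f x * \1_A x)%:E)%E.
    apply: eq_integral => x _; rewrite patchE indicE.
    by case: (x \in A); rewrite ?mulr1 ?mulr0.
  apply/esym; move: c; under eq_fun do rewrite z.
  by move=> c; apply: (@cvg_unique _ _ _ _ _ _ _ c); [exact: ereal_hausdorff|exact: cvg_cst].
have mf : measurable_fun setT (f : T3 -> R).
  by apply/measurable_EFinP; case/integrableP: If.
suff H A : measurable (A : set T3) -> (\int[leb3]_(x in A) (f x)%:E = 0)%E.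
  have := @integral_ae_eq _ T3 R leb3 setT measurableT (cst 0%E) (fun x => (f x)%:E) If.
  move=> /(_ (measurable_cst _)) h.
  have {h}: ae_eq leb3 setT (fun x : T3 => (f x)%:E) (cst 0%E).
    by apply: h => E _ mE; rewrite H// integral0.
  by apply: (ae_imp _) => x /(_ I) [].
(* The whole space comes before the induction on measurable sets, where the integral over a
   complement is obtained by subtraction from it. *)
have PT : (\int[leb3]_(x in setT) (f x)%:E = 0)%E.
  apply: (lim _ (fun n => bump 0 n.+1%:R)) => //.
  + by move=> n; apply: bump_test => //; rewrite ltr0n.
  + move=> n x; rewrite bump_ge0 /=; apply: prodr_ile1 => k _.
    by rewrite plateau_ge0 plateau_le1.
  + move=> x; rewrite indicE in_setT; apply: cvg_near_cst.
    exists (Num.truncn `|x|) => // n /= Nn; apply: bump_eq1; rewrite ?ltr0n// subr0.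
    by rewrite ltW// (lt_le_trans (truncnS_gt _))// ler_nat.
move=> mA; apply: (@dynkin_induction _ T3 boxes (fun A => \int[leb3]_(x in A) (f x)%:E = 0)%E
  measurable_boxes boxes_setI PT); last by rewrite -measurable_boxes.
- move=> _ [a [b ->]].
  (* The slopes have width [1 / n] and lie inside the box: [phi n] vanishes off the open box and is
     eventually 1 at each of its points. *)
  pose phi (n : nat) (x : R3 R) : R := \prod_(k < 3) (step (- (n%:R * coord k a) + n%:R * coord k x)
       * step (n%:R * coord k b + (- n%:R) * coord k x)).
  have f01 (n : nat) (x : R3 R) (k : 'I_3) : 0 <= step (- (n%:R * coord k a) + n%:R * coord k x)
       * step (n%:R * coord k b + (- n%:R) * coord k x) <= 1.
    by rewrite mulr_ge0 ?step_ge0//= mulr_ile1 ?step_ge0 ?step_le1.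
  have out (n : nat) (x : R3 R) (k : 'I_3) : ~ (coord k a < coord k x < coord k b) -> phi n x = 0.
    move=> H; rewrite /phi; apply/eqP; rewrite prodf_seq_eq0; apply/hasP; exists k; first by rewrite mem_index_enum.
    rewrite /= mulf_eq0; move/negP: H; rewrite negb_and -!leNgt => /orP[h|h]; apply/orP; [left|right]; apply/eqP/step_le0.
      by rewrite addrC subr_le0 ler_wpM2l.
    by rewrite mulNr subr_le0 ler_wpM2l.
  apply: (lim _ phi); first exact: measurable_box.
  + move=> n; apply: (@testf_of R _ (`|a| + `|b|)).
      apply: smooth_prod3 => k; apply: smoothM;
        exact: (smooth_coord_comp k (smooth_rescale _ _ smooth_step)).
    move=> x xab; have [k Hk] : exists k, ~ (coord k a < coord k x < coord k b).
      apply: contrapT => H; suff : `|x| <= `|a| + `|b| by rewrite leNgt xab.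
      apply/norm3_coord => k.
      have /andP[h1 h2] : coord k a < coord k x < coord k b.
        by apply: contrapT => h; apply: H; exists k.
      have := le_coord_norm k a; have := le_coord_norm k b.
      have := ler_norm (coord k b); have := ler_norm (- coord k a); rewrite normrN.
      have := normr_ge0 (a : R3 R); have := normr_ge0 (b : R3 R).
      by move=> *; rewrite ler_norml; apply/andP; split; lra.
    exact: out Hk.
  + move=> n x; apply/andP; split; first by apply: prodr_ge0 => k _; case/andP: (f01 n x k).
    by apply: prodr_ile1 => k _; exact: f01.
  + move=> x; have [bx|nbx] := pselect (box a b x); last first.
      rewrite indicE memNset//; apply: cvg_near_cst; apply: nearW => n.
      apply: contrapT => phi0; apply: nbx.
      have H k : coord k a < coord k x < coord k b.
        by apply: contrapT => h; apply: phi0; exact: out h.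
      have := H 0; have := H 1; have := H 2; rewrite !coordE /=.
      by split.
    rewrite indicE mem_set//; apply: cvg_near_cst.
    have hx k : coord k a < coord k x < coord k b.
      by case: bx => h1 h2 h3; rewrite !coordE; case: k => -[|[|[|//]]].
    pose N k := Num.truncn ((coord k x - coord k a)^-1 + (coord k b - coord k x)^-1).
    exists (\max_k N k).+1 => // n /= Nn; apply: big1 => k _.
    have /andP[h1 h2] := hx k.
    have p1 : 0 < (coord k x - coord k a)^-1 by rewrite invr_gt0 subr_gt0.
    have p2 : 0 < (coord k b - coord k x)^-1 by rewrite invr_gt0 subr_gt0.
    have nk : (coord k x - coord k a)^-1 + (coord k b - coord k x)^-1 <= n%:R.
      rewrite ltW// (lt_le_trans (truncnS_gt _))// ler_nat (leq_trans _ Nn)// ltnS.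
      exact: (leq_bigmax k).
    rewrite !step_ge1 ?mulr1//.
      rewrite mulNr -mulrBr -[leLHS](@mulVf _ (coord k b - coord k x)) ?subr_eq0 ?gt_eqF//.
      by rewrite ler_pM2r ?subr_gt0// (le_trans _ nk)// lerDr ltW.
    rewrite addrC -mulrBr -[leLHS](@mulVf _ (coord k x - coord k a)) ?subr_eq0 ?gt_eqF//.
    by rewrite ler_pM2r ?subr_gt0// (le_trans _ nk)// lerDl ltW.
- move=> S mS S0.
  have := @integral_setU _ T3 R leb3 S (~` S) (fun x => (f x)%:E) mS (measurableC mS).
  rewrite setUv PT S0 add0e => <- //; first exact/measurable_EFinP.
  by apply/disj_set2P; rewrite setICr.
- move=> S mS tS S0.
  rewrite (integral_bigcup (mu := mes) tS mS); last first.
    by apply: (integrableS measurableT) If => //; exact: bigcup_measurable.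
  by apply: eseries0 => n _ _; exact: S0.
Qed.

(** Multiplied by a bump supported in [D], [w] is orthogonal to all test functions and integrable,
    so it vanishes a.e. where the bump is 1. Rational centres and radii give countably many bumps,
    which suffice to cover [D]. *)
Lemma test_orth_ae0_on (D : set (R3 R)) (w : R3 R -> R) : open D -> L2_3 w ->
  (forall phi, test_function D phi -> ip3 w phi = 0) ->
  {ae leb3, forall x, D x -> w x = 0}.
Proof.
move=> oD Lw Hw.
pose q3 (q : rat * rat * rat) : R3 R := (ratr q.1.1, ratr q.1.2, ratr q.2).
pose P (k : nat) (x : T3) : Prop :=
  if unpickle k is Some (q, r) then
    test_function D (bump (q3 q) (ratr r)) -> w x * bump (q3 q) (ratr r) x = 0
  else True.
have aeP k : {ae leb3, forall x, P k x}.
  rewrite /P; case: unpickle => [[q r]|]; last exact: aeW.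
  have [tb|ntb] := pselect (test_function D (bump (q3 q) (ratr r))); last first.
    by apply: aeW => x /ntb.
  have tbT : testf (bump (q3 q) (ratr r)) by exact: test_function_sub tb.
  have [Lb _] := testf_L2c tbT.
  have If : integ (fun x => (w x * bump (q3 q) (ratr r) x)%:E) by exact: L2_mul.
  have Hphi phi : testf phi -> \int[leb3]_(x in setT) (w x * bump (q3 q) (ratr r) x * phi x) = 0.
    move=> tphi; have sphi : smooth phi by case: tphi.
    rewrite -[RHS](Hw _ (test_mul tb sphi)); apply: eq_Rintegral => x _.
    by rewrite mulrAC mulrA.
  by apply: (ae_imp _ (test_orth_ae0 If Hphi)) => x wx _.
apply: (ae_imp _ (ae_all aeP)) => x Px Dx.
have /nbhs_ballP[e /= e0 eD] : nbhs x D by exact: open_nbhs_nbhs.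
(* The bump is supported at distance [2 r] from its centre, which is within [r] of [x]: [3 r < e]
   keeps it in [D]. *)
have [r] : exists r : rat, ratr r \in `]0, (e / 3)[ by apply: rat_in_itvoo; rewrite divr_gt0.
rewrite in_itv /= => /andP[r0 re].
have near_rat (u : R) : exists q : rat, `|u - ratr q| <= ratr r.
  have : u - ratr r < u by rewrite gtrBl.
  move=> /rat_in_itvoo[q]; rewrite in_itv /= => /andP[h1 h2]; exists q.
  by rewrite ler_norml; apply/andP; split; lra.
have [q1 h1] := near_rat x.1.1; have [q2 h2] := near_rat x.1.2; have [q3' h3] := near_rat x.2.
pose q := (q1, q2, q3').
have xq : `|x - q3 q| <= ratr r by rewrite norm3_le /= h1 h2 h3.
have := Px (pickle (q, r)); rewrite /P pickleK (bump_eq1 r0 xq) mulr1; apply.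
apply: bump_test => // y /= yq; apply: eD; rewrite -ball_normE /ball_ /=.
have -> : x - y = (x - q3 q) - (y - q3 q) by rewrite opprB addrA subrK.
by rewrite (le_lt_trans (ler_normB _ _))//; lra.
Qed.

(* The closure of the test functions is a closed subspace with trivial
   orthogonal complement. *)
Lemma test_dense (u : R3 R -> R) (e : R) : L2_3 u -> 0 < e ->
  exists2 phi, testf phi & nrm3 (u - phi) <= e.
Proof.
move=> Lu e0; have H := @L2_semi_hilbert _ T3 R leb3.
pose S (w : R3 R -> R) := L2_3 w /\ forall e : R, 0 < e -> exists2 phi, testf phi & nrm3 (w - phi) <= e.
have HS : semi_hilbert S ip3.
  split.
  - split; first exact: L2_0.
    move=> e1 e10; exists (fun=> 0); last by rewrite subr0 nrm0 ltW.
    by apply: (@testf_of R _ 0) => //; exact: (@smooth_cst R (R3 R) R 0).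
  - move=> a v w [Lv Sv] [Lw Sw]; split; first exact: L2_lin.
    move=> e1 e10.
    have [p1 t1 h1] := Sv (e1 / 2 / (`|a| + 1)) ltac:(by rewrite !divr_gt0// ltr_wpDl).
    have [p2 t2 h2] := Sw (e1 / 2) ltac:(by rewrite divr_gt0).
    have L1 := (testf_L2c t1).1; have L2' := (testf_L2c t2).1.
    exists (fun x => a * p1 x + p2 x).
      by apply: test_add => //; apply: (@test_mul R setT p1 (cst a)) => //; exact: (@smooth_cst R (R3 R) R a).
    have -> : a *: v + w - (fun x => a * p1 x + p2 x) = a *: (v - p1) + (w - p2).
      by apply/funext => x; rewrite !fctE /GRing.scale /=; ring.
    apply: le_trans (nrmD (L2Z a (L2B Lv L1)) (L2B Lw L2')) _.
    rewrite nrmZ; last exact: L2B.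
    have : `|a| * nrm3 (v - p1) <= e1 / 2.
      apply: (@le_trans _ _ ((`|a| + 1) * nrm3 (v - p1))).
        by rewrite ler_wpM2r ?nrm_ge0// lerDl.
      by rewrite mulrC -ler_pdivlMr// ltr_wpDl.
    by lra.
  - exact: (sh_sym H).
  - by move=> a v w z [? _] [? _] [? _]; exact: ip_bilin.
  - by move=> v _; exact: ip_ge0.
  - move=> v Sv cau.
    have [l Ll Hl] := sh_complete H (fun n => (Sv n).1) cau.
    exists l => //; split=> // e1 e10.
    have e20 : 0 < (e1 / 2) ^+ 2 by rewrite exprn_gt0// divr_gt0.
    have [N HN] := Hl _ e20; have [LN SN] := Sv N.
    have [phi tphi hphi] := SN (e1 / 2) ltac:(by rewrite divr_gt0).
    have Lphi := (testf_L2c tphi).1.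
    exists phi => //.
    have -> : l - phi = (-1) *: (v N - l) + (v N - phi).
      by apply/funext => x; rewrite !fctE /GRing.scale /=; ring.
    apply: le_trans (nrmD (L2Z _ (L2B LN Ll)) (L2B LN Lphi)) _.
    rewrite nrmZ ?normrN1 ?mul1r; last exact: L2B.
    have : nrm3 (v N - l) <= e1 / 2.
      have e1h : 0 <= e1 / 2 by rewrite ltW// divr_gt0.
      rewrite -(@ler_pXn2r _ 2)// ?nnegrE ?nrm_ge0// sqr_nrm.
      exact: (HN N (leqnn N)).
    by lra.
have [s [Ls Ss] Hs] := sh_proj H HS Lu (fun w Sw => Sw.1).
have ae0 : {ae leb3, forall x, (u - s) x = 0}.
  have := @test_orth_ae0_on setT (u - s) openT (L2B Lu Ls).
  move=> h; apply: (ae_imp _ (h _)) => [x hx|phi tphi]; first exact: hx.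
  apply: Hs; split; first exact: (testf_L2c tphi).1.
  by move=> e1 e10; exists phi => //; rewrite subrr nrm0 ltW.
have [phi tphi hphi] := Ss e e0; exists phi => //.
have Lphi := (testf_L2c tphi).1.
have -> : u - phi = (u - s) + (s - phi) by rewrite addrA subrK.
apply: le_trans (nrmD (L2B Lu Ls) (L2B Ls Lphi)) _.
by rewrite nrm_ae0 ?add0r//; case: (L2B Lu Ls).
Qed.

End FundamentalLemma.

(** * The divergence kernel carried by a cone *)

Section ConeKernel.
Context {R : realType}.
Notation T3 := (measurableTypeR R * measurableTypeR R * measurableTypeR R)%type.
Notation L2_3 := (@L2 _ T3 R leb3).
Notation nrm3 := (@nrm _ T3 R leb3).
Notation testf := (@test_function R R setT).

(* A compactly supported fundamental solution of the divergence, carried by the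
   cone spanned by the W k and cut into dyadic shells: the K m sum up to a
   primitive of rho N - rho 0, and rho N tends to the Dirac mass. *)
Record cone_kernel (W : 'I_3 -> R3 R) (K : nat -> 'I_3 -> R3 R -> R)
    (rho : nat -> R3 R -> R) (C : R) : Prop := ConeKernel {
  ck_K : forall m i, testf (K m i);
  ck_rho : forall m, testf (rho m);
  ck_div : forall m z, \sum_i 'D_(basis3 i) (K m i) z = rho m.+1 z - rho m z;
  ck_nrm : forall m i, nrm1 (K m i) <= C * 2^-1 ^+ m;
  ck_rho0 : forall m z, 0 <= rho m z;
  ck_int : forall m, nrm1 (rho m) = 1;
  ck_supp : forall m i z, K m i z != 0 \/ rho m z != 0 ->
    exists2 a : 'I_3 -> R, (forall k, 2^-1 ^+ m / 2 <= a k <= 2^-1 ^+ m * 2) &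
      z = \sum_k a k *: W k }.

Lemma ae_eq0_continuous (f : R3 R -> R) : continuous f ->
  {ae leb3, forall x : T3, f x = 0} -> forall x, f x = 0.
Proof.
move=> cf [N [mN N0 NN]] x; apply/eqP; apply: contrapT => /negP fx.
have : \forall y \near x, f y != 0.
  by have := cf x _ (open_nbhs_nbhs (conj (@open_neq R 0) fx)); apply.
case/nbhs_ballP => e /= e0 H.
pose d : R3 R := (e, e, e).
have sub : (box (x - d) (x + d) : set T3) `<=` N.
  move=> y; rewrite /box /= => -[h1 h2 h3]; apply: NN => /= fy.
  suff /H : ball x e y by rewrite /= fy eqxx.
  rewrite -ball_normE /ball_ /= norm3_lt !ltr_norml /=.
  by apply/and3P; split; lra.
have := @le_measure _ _ T3 (leb3 : {measure set T3 -> \bar R}) (box (x - d) (x + d)) N.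
move=> /(_ (mem_set (measurable_box _ _)) (mem_set mN) sub) L.
have : (leb3 (box (x - d)%R (x + d)%R : set T3) <= 0)%E by rewrite -N0; exact: L.
rewrite leb3_box /=; [|lra..].
rewrite lee_fin leNgt => /negP; apply.
by rewrite !mulr_gt0//; lra.
Qed.

(** [bstep] rises from 0 to 1 on [1, 2], [bd] is its density and [bd2] that density dilated by 2.
    The two densities have the same mass, so the primitive [bdiff] of [bd2 - bd] has compact
    support, in [1/2, 2]. *)
Definition bstep (t : R) : R := step (- 1 + 1 * t).
Definition bd : R -> R := 'D_(1 : R) bstep.
Definition bdiff (t : R) : R := bstep (0 + 2 * t) + (-1) * bstep t.
Definition bd2 (t : R) : R := 2 * bd (0 + 2 * t).

Lemma smooth_bstep : smooth bstep.
Proof. exact: (smooth_rescale (-1) 1 smooth_step). Qed.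

Lemma smooth_bd : smooth bd.
Proof. exact: (@smooth_derive R R R bstep (1 : R) smooth_bstep). Qed.

Lemma smooth_bdiff : smooth bdiff.
Proof. exact: (smoothD (smooth_rescale 0 2 smooth_bstep) (smoothZ (-1) smooth_bstep)). Qed.

Lemma smooth_bd2 : smooth bd2.
Proof. exact: (smoothZ 2 (smooth_rescale 0 2 smooth_bd)). Qed.

Lemma bstep_le1 t : t <= 1 -> bstep t = 0.
Proof. by move=> t1; rewrite /bstep step_le0//; lra. Qed.

Lemma bstep_ge2 t : 2 <= t -> bstep t = 1.
Proof. by move=> t1; rewrite /bstep step_ge1//; lra. Qed.

Lemma bd_eq0 t : ~ (1 <= t <= 2) -> bd t = 0.
Proof.
move=> /negP; rewrite negb_and -!ltNge => /orP[t1|t2].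
  rewrite /bd (@near_eq_derive R R R bstep (cst (0:R)) t 1 _) ?derive_cst//.
  by near=> s; apply: bstep_le1; apply: ltW; near: s; exact: lt_nbhsl.
rewrite /bd (@near_eq_derive R R R bstep (cst (1:R)) t 1 _) ?derive_cst//.
by near=> s; apply: bstep_ge2; apply: ltW; near: s; exact: lt_nbhsr.
Unshelve. all: by end_near. Qed.

Lemma bdiff_eq0 t : ~ (2^-1 <= t <= 2) -> bdiff t = 0.
Proof.
move=> /negP; rewrite negb_and -!ltNge => /orP[t1|t2]; rewrite /bdiff.
  by rewrite !bstep_le1; lra.
by rewrite !bstep_ge2; lra.
Qed.

Lemma bd2_eq0 t : ~ (2^-1 <= t <= 2) -> bd2 t = 0.
Proof.
move=> /negP H; rewrite /bd2 bd_eq0 ?mulr0// => /andP[h1 h2]; move/negP: H; apply.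
by apply/andP; split; lra.
Qed.

Lemma bd_eq0' t : ~ (2^-1 <= t <= 2) -> bd t = 0.
Proof.
move=> /negP H; apply: bd_eq0 => /andP[h1 h2]; move/negP: H; apply.
by apply/andP; split; lra.
Qed.

Lemma bd_ge0 t : 0 <= bd t.
Proof.
have dv : derivable bstep t (1 : R) := smooth_derivable smooth_bstep.
have c : h^-1 *: ((bstep \o shift t) (h *: (1 : R)) - bstep t) @[h --> 0^'] --> bd t := dv.
rewrite -(cvg_lim (@norm_hausdorff _ R) c); apply: limr_ge.
  by apply/cvg_ex; exists (bd t).
near=> h => /=; have h0 : h != 0 by near: h; exact: nbhs_dnbhs_neq.
have nd : {homo bstep : s u / s <= u} by move=> s u su; apply: step_nd; lra.
rewrite /GRing.scale /= mulr1.
have [hp|hn|h00] := ltgtP h 0; last by rewrite h00 eqxx in h0.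
  have d0 : bstep (h + t) - bstep t <= 0 by rewrite subr_le0; apply: nd; lra.
  by rewrite -mulrNN mulr_ge0// ?oppr_ge0// invr_le0 ltW.
have d0 : 0 <= bstep (h + t) - bstep t by rewrite subr_ge0; apply: nd; lra.
by rewrite mulr_ge0// invr_ge0 ltW.
Unshelve. all: by end_near. Qed.

Lemma bd_pos : exists t, 0 < bd t.
Proof.
apply: contrapT => H.
have bd0 t : bd t = 0.
  by apply/eqP; rewrite eq_le bd_ge0 andbT leNgt; apply/negP => h; apply: H; exists t.
have [s [_ _]] := @MVT_line R R bstep 1 1 1 smooth_bstep ler01.
have -> : (1 + 1 *: (1 : R) : R) = 2 by rewrite /GRing.scale /=; lra.
rewrite -[X in _ = 1 * X]/(bd _) bd0 bstep_ge2// bstep_le1// mulr0 subr0.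
by move/eqP; rewrite oner_eq0.
Qed.

Lemma bdiff_derive t : 'D_(1 : R) bdiff t = bd2 t - bd t.
Proof.
have s2 : smooth (fun t : R => bstep (0 + 2 * t)) by exact: (smooth_rescale 0 2 smooth_bstep).
rewrite /bdiff (derive_add (smooth_derivable s2) (smooth_derivable (smoothZ (-1) smooth_bstep))).
congr (_ + _).
  have [_ E] := @derive_affine R R R R (fun t => 2 * t) 0 bstep t 1 (@linear_id1 R 2).
  have dd : derivable bstep (0 + 2 * t) 1 := smooth_derivable smooth_bstep.
  have [_ E2] := derive_dir1 (2 * 1) dd.
  by rewrite E E2 mulr1.
rewrite (derive_mul (@derivable_cst R R R (-1) t 1) (smooth_derivable smooth_bstep)).
by rewrite derive_cst mulr0 addr0 mulN1r.
Qed.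

Section Basis.
Variables (W : 'I_3 -> R3 R) (l : 'I_3 -> 'I_3 -> R).

(** The coordinate along [W k], with [l] the dual basis: in these coordinates the cone is an octant
    and the kernel a tensor product. *)
Definition form (k : 'I_3) (x : R3 R) : R := \sum_j l k j * coord j x.

Hypothesis dual : forall k m, form k (W m) = (k == m)%:R.
Hypothesis expand : forall x, x = \sum_k form k x *: W k.

Lemma form_lin k (h : R) (u w : R3 R) : form k (h *: u + w) = h *: form k u + form k w.
Proof.
rewrite /form scaler_sumr -big_split; apply: eq_bigr => j _ /=.
by rewrite coord_lin mulrDr /GRing.scale /= mulrCA.
Qed.

Lemma formZ k (h : R) (u : R3 R) : form k (h *: u) = h * form k u.
Proof.
rewrite /form mulr_sumr; apply: eq_bigr => j _ /=.
by rewrite coordZ mulrCA.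
Qed.

Lemma form_continuous k : continuous (form k).
Proof.
have -> : form k = (fun x => l k 0 * coord 0 x + l k 1 * coord 1 x + l k 2 * coord 2 x).
  by apply/funext => x; rewrite /form sum3.
have c j : continuous (fun x => l k j * coord j x).
  by move=> x; apply: cvgMr; exact: coord_continuous.
by move=> x; apply: cvgD; [apply: cvgD|]; exact: c.
Qed.

Lemma smooth_form (f : R -> R) k : smooth f -> smooth (fun x => f (0 + form k x)).
Proof.
move=> sf; apply: (@smooth_affine R (R3 R) R R (form k) 0 f) => //; first exact: form_lin.
exact: form_continuous.
Qed.

Lemma derive_form (f : R -> R) k (v z : R3 R) : smooth f ->
  'D_v (fun x => f (0 + form k x)) z = form k v * 'D_(1 : R) f (0 + form k z).
Proof.
move=> sf.
have [_ ->] := @derive_affine R (R3 R) R R (form k) 0 f z v (form_lin k).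
have dd : derivable f (0 + form k z) 1 := smooth_derivable sf.
by have [_ ->] := derive_dir1 (form k v) dd.
Qed.

Definition tensor (f : 'I_3 -> R -> R) (z : R3 R) : R :=
  f 0 (0 + form 0 z) * (f 1 (0 + form 1 z) * f 2 (0 + form 2 z)).

Definition upd (f : 'I_3 -> R -> R) (k : 'I_3) (g : R -> R) (j : 'I_3) : R -> R :=
  if j == k then g else f j.

Lemma smooth_tensor f : (forall k, smooth (f k)) -> smooth (tensor f).
Proof.
move=> sf; exact: (smoothM (smooth_form 0 (sf 0)) (smoothM (smooth_form 1 (sf 1)) (smooth_form 2 (sf 2)))).
Qed.

Lemma derive_tensor f (v z : R3 R) : (forall k, smooth (f k)) ->
  'D_v (tensor f) z = \sum_k form k v * tensor (upd f k ('D_(1 : R) (f k))) z.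
Proof.
move=> sf; have s0 := smooth_form 0 (sf 0); have s1 := smooth_form 1 (sf 1).
have s2 := smooth_form 2 (sf 2).
rewrite /tensor (derive_mul (smooth_derivable s0) (smooth_derivable (smoothM s1 s2))).
rewrite (derive_mul (smooth_derivable s1) (smooth_derivable s2)) !derive_form//.
by rewrite sum3 /upd /=; ring.
Qed.

(** The factors of a telescoping sum: the triple product of [bd2] becomes that of [bd] by changing
    one factor at a time, and at the stage [m] the changed factor [bd2 - bd] is the derivative of
    [bdiff]. *)
Definition shell_fac (m k : 'I_3) : R -> R :=
  if (k < m)%N then bd else if k == m then bdiff else bd2.

Lemma smooth_shell_fac m k : smooth (shell_fac m k).
Proof.
by rewrite /shell_fac; case: ifP => _; [exact: smooth_bd|case: ifP => _; [exact: smooth_bdiff|exact: smooth_bd2]].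
Qed.

Definition shell (i : 'I_3) (z : R3 R) : R := \sum_m coord i (W m) * tensor (shell_fac m) z.

Definition shell_rho (z : R3 R) : R := tensor (fun=> bd) z.

Lemma smooth_shell i : smooth (shell i).
Proof.
apply: smooth_sum => m; apply: smoothZ; apply: smooth_tensor => k; exact: smooth_shell_fac.
Qed.

Lemma smooth_shell_rho : smooth shell_rho.
Proof. by apply: smooth_tensor => _; exact: smooth_bd. Qed.

Lemma derive_sum3 (f : 'I_3 -> R3 R -> R) v z : (forall m, smooth (f m)) ->
  'D_v (fun x => \sum_m f m x) z = \sum_m 'D_v (f m) z.
Proof.
move=> sf; rewrite sum3.
have -> : (fun x => \sum_m f m x) = (fun x => f 0 x + f 1 x + f 2 x).
  by apply/funext => x; rewrite sum3.
rewrite (derive_add (smooth_derivable (smoothD (sf 0) (sf 1))) (smooth_derivable (sf 2))).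
by rewrite (derive_add (smooth_derivable (sf 0)) (smooth_derivable (sf 1))).
Qed.

Lemma derive_scal (f : R3 R -> R) c v z : smooth f -> 'D_v (fun x => c * f x) z = c * 'D_v f z.
Proof.
move=> sf; rewrite (derive_mul (@derivable_cst R (R3 R) R c z v) (smooth_derivable sf)).
by rewrite derive_cst mulr0 addr0.
Qed.

Lemma form_expand k (x : R3 R) : \sum_i coord i x * form k (basis3 i) = form k x.
Proof.
rewrite /form; apply: eq_bigr => i _.
rewrite (bigD1 i)//= big1 => [|j ji]; first by rewrite coord_basis eqxx mulr1 addr0 mulrC.
by rewrite coord_basis (negbTE ji) mulr0.
Qed.

(** By duality the derivative along [W m] acts on the factor [m] only, and the sum over [m]
    telescopes. The factor 8 comes from the three dilations by 2 in [bd2]. *)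
Lemma shell_div z : \sum_i 'D_(basis3 i) (shell i) z = 8 * shell_rho (2 *: z) - shell_rho z.
Proof.
have sT m : smooth (tensor (shell_fac m)) by apply: smooth_tensor => k; exact: smooth_shell_fac.
pose d m k := tensor (upd (shell_fac m) k ('D_(1 : R) (shell_fac m k))) z.
have -> : \sum_i 'D_(basis3 i) (shell i) z = \sum_i \sum_m coord i (W m) * \sum_k form k (basis3 i) * d m k.
  apply: eq_bigr => i _; rewrite derive_sum3 => [|m]; last by apply: smoothZ.
  apply: eq_bigr => m _; rewrite derive_scal// derive_tensor// => k.
  exact: smooth_shell_fac.
have -> : \sum_i \sum_m coord i (W m) * \sum_k form k (basis3 i) * d m k = \sum_m d m m.
  rewrite exchange_big; apply: eq_bigr => m _ /=.
  under eq_bigr do rewrite mulr_sumr.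
  rewrite exchange_big /= (bigD1 m)//= [X in _ + X]big1 ?addr0 => [|k km].
    transitivity (form m (W m) * d m m); last by rewrite dual eqxx mul1r.
    rewrite -form_expand mulr_suml.
    by apply: eq_bigr => i _; rewrite mulrA.
  transitivity (form k (W m) * d m k); last by rewrite dual (negbTE km) mul0r.
  by rewrite -form_expand mulr_suml; apply: eq_bigr => i _; rewrite mulrA.
rewrite sum3 /d /tensor /upd /shell_fac /= !bdiff_derive /shell_rho /tensor.
rewrite !formZ /bd2 !add0r.
by move: (bd _) (bd _) (bd _) (bd _) (bd _) (bd _) => b0 b1 b2 c0 c1 c2; ring.
Qed.

Lemma tensor_eq0 f z k : f k (0 + form k z) = 0 -> tensor f z = 0.
Proof.
rewrite /tensor; have : k = 0 \/ k = 1 \/ k = 2.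
  by case: k => -[|[|[|//]]] kl; [left|right; left|right; right]; exact/val_inj.
by move=> [->|[->|->]] ->; rewrite ?mul0r ?mulr0.
Qed.

Lemma shell_supp i z : shell i z != 0 \/ shell_rho z != 0 -> forall k, 2^-1 <= form k z <= 2.
Proof.
move=> H k; apply: contrapT => nk.
have nk0 : ~ (2^-1 <= 0 + form k z <= 2) by rewrite add0r.
have E1 : shell i z = 0.
  apply: big1 => m _; rewrite (@tensor_eq0 _ _ k) ?mulr0// /shell_fac.
  by case: ifP => _; [exact: bd_eq0'|case: ifP => _; [exact: bdiff_eq0|exact: bd2_eq0]].
have E2 : shell_rho z = 0 by apply: (@tensor_eq0 _ _ k); exact: bd_eq0'.
by rewrite E1 E2 eqxx in H; case: H.
Qed.

Lemma shell_bsupp (f : R3 R -> R) i : (forall z, f z != 0 -> shell i z != 0 \/ shell_rho z != 0) ->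
  forall x, \sum_k 2 * `|W k| < `|x| -> f x = 0.
Proof.
move=> Hf x Hx; apply/eqP; apply: contrapT => /negP /Hf /shell_supp fx.
move: Hx; rewrite ltNge => /negP; apply.
rewrite {1}(expand x) (le_trans (ler_norm_sum _ _ _))//; apply: ler_sum => k _.
rewrite normrZ ler_wpM2r//; have /andP[h1 h2] := fx k.
by rewrite ger0_norm//; lra.
Qed.

Lemma testf_shell i : testf (shell i).
Proof. by apply: (testf_of (smooth_shell i)) => x; apply: (shell_bsupp (i := i)) => z h; left. Qed.

Lemma testf_shell_rho : testf shell_rho.
Proof. by apply: (testf_of smooth_shell_rho) => x; apply: (shell_bsupp (i := 0)) => z h; right. Qed.

Lemma shell_rho_ge0 z : 0 <= shell_rho z.
Proof. by rewrite /shell_rho /tensor !mulr_ge0// bd_ge0. Qed.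

Lemma shell_rho_int : 0 < nrm1 shell_rho.
Proof.
rewrite lt_def nrm1_ge0 andbT; apply/eqP => H.
have mr := testf_measurable testf_shell_rho.
have : {ae leb3, forall x, shell_rho x = 0}.
  apply: (@test_orth_ae0 R shell_rho).
    by have := L2c_int (testf_L2c testf_shell_rho).
  move=> phi tphi; have [M M0 HM] := test_bounded tphi.
  apply/eqP; rewrite -normr_le0.
  have Lr := (testf_L2c testf_shell_rho).1; have Lp := (testf_L2c tphi).1.
  apply: le_trans (le_normr_Rintegral measurableT (L2_mul Lr Lp)) _.
  have -> : 0 = M * nrm1 shell_rho by rewrite H mulr0.
  have In := testf_int_norm testf_shell_rho.
  rewrite -RintegralZl//; apply: le_Rintegral => //.
  - by have := integrable_norm (L2_mul Lr Lp).
  - have -> : EFin \o (fun t => M * `|shell_rho t|) = (fun t : T3 => M%:E * (`|shell_rho t|)%:E)%E by apply/funext.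
    exact: integrableZl.
  - by move=> x _; rewrite normrM mulrC ler_wpM2r.
move=> /(ae_eq0_continuous (smooth_continuous smooth_shell_rho)) E.
have [t bt] := bd_pos; have := E (\sum_k t *: W k).
have -> : shell_rho (\sum_k t *: W k) = bd t * (bd t * bd t).
  have fk k : 0 + form k (\sum_k t *: W k) = t.
    rewrite add0r sum3 -[t *: W 2]addr0 -!addrA !form_lin !dual /GRing.scale /=.
    have -> : form k 0 = 0 by rewrite -(scale0r (0 : R3 R)) formZ mul0r.
    have : k = 0 \/ k = 1 \/ k = 2.
      by case: k => -[|[|[|//]]] kl; [left|right; left|right; right]; exact/val_inj.
    by move=> [->|[->|->]] /=; rewrite ?eqxx /=; ring.
  by rewrite /shell_rho /tensor !fk.
by move/eqP; rewrite !mulf_eq0 (gt_eqF bt).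
Qed.

(** The amplitude [8^m] keeps the mass of [rho] equal to 1 under dilation by [2^m] in dimension
    three. A derivative of the kernel gains [2^m], so the kernel itself carries [4^m], and its L^1
    norm decays like [2^-m]. *)
Definition scaled_K (m : nat) (i : 'I_3) (z : R3 R) : R :=
  ((nrm1 shell_rho)^-1 * 4 ^+ m) * shell i (0 + (2 ^+ m : R) *: z).
Definition scaled_rho (m : nat) (z : R3 R) : R :=
  ((nrm1 shell_rho)^-1 * 8 ^+ m) * shell_rho (0 + (2 ^+ m : R) *: z).

Lemma smooth_dilate (f : R3 R -> R) (t : R) : smooth f -> smooth (fun z : R3 R => f (0 + t *: z)).
Proof.
move=> sf; apply: (@smooth_affine R (R3 R) (R3 R) R (fun z => t *: z) 0 f) => //.
  by move=> h u w; rewrite scalerDr !scalerA mulrC.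
exact: scaler_continuous.
Qed.

Lemma testf_dilate (f : R3 R -> R) (a t : R) : 0 < t -> testf f ->
  testf (fun z : R3 R => a * f (0 + t *: z)).
Proof.
move=> t0 tf; have [r fr] := testf_bsupp tf; have sf : smooth f by case: tf.
apply: (@testf_of _ _ (t^-1 * r)); first exact: (smoothZ a (smooth_dilate t sf)).
move=> x xr; rewrite fr ?mulr0// add0r normrZ (gtr0_norm t0).
by rewrite -ltr_pdivrMl.
Qed.

Lemma nrm1_dilate (f : R3 R -> R) (a t : R) : 0 < t -> testf f ->
  nrm1 (fun z : R3 R => a * f (0 + t *: z)) = `|a| * t^-1 ^+ 3 * nrm1 f.
Proof.
move=> t0 tf; apply: EFin_inj; rewrite EFin_nrm1; last exact: testf_dilate.
rewrite EFinM EFin_nrm1//.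
have mf : measurable_fun setT (fun x : T3 => (`|f x|)%:E).
  by apply/measurable_EFinP; apply: measurableT_comp => //; exact: testf_measurable.
have tn0 : t != 0 by rewrite gt_eqF.
have f0 (x : T3) : (0 <= (`|f x|)%:E)%E by rewrite lee_fin.
rewrite -(leb3_affine (0 : R3 R) tn0 mf f0).
rewrite muleA -EFinM (gtr0_norm t0) -mulrA -exprMn mulVf ?gt_eqF// expr1n mulr1.
rewrite -ge0_integralZl//.
- by apply: eq_integral => x _; rewrite normrM EFinM.
- have tg := testf_dilate 1 t0 tf.
  apply/measurable_EFinP; apply: measurableT_comp => //.
  have := testf_measurable tg; congr measurable_fun; apply/funext => x; exact: mul1r.
Qed.

Lemma derive_dilate (f : R3 R -> R) (t : R) (v z : R3 R) : smooth f ->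
  'D_v (fun z : R3 R => f (0 + t *: z)) z = t * 'D_v f (0 + t *: z).
Proof.
move=> sf.
have lin (h : R) (u w : R3 R) : t *: (h *: u + w) = h *: (t *: u) + t *: w.
  by rewrite scalerDr !scalerA mulrC.
have [_ ->] := @derive_affine R (R3 R) (R3 R) R (fun z => t *: z) 0 f z v lin.
exact: derive_dirZ.
Qed.

Lemma cone_kernel_shell :
  cone_kernel W scaled_K scaled_rho (\sum_i (nrm1 shell_rho)^-1 * nrm1 (shell i)).
Proof.
have c0 := shell_rho_int; have p2 m : 0 < (2 : R) ^+ m by exact: exprn_gt0.
have ci0 : 0 < (nrm1 shell_rho)^-1 by rewrite invr_gt0.
split.
- by move=> m i; apply: testf_dilate => //; exact: testf_shell.
- by move=> m; apply: testf_dilate => //; exact: testf_shell_rho.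
- move=> m z; set a := (nrm1 shell_rho)^-1.
  have E i : 'D_(basis3 i) (scaled_K m i) z =
      (a * 4 ^+ m * 2 ^+ m) * 'D_(basis3 i) (shell i) (0 + (2 ^+ m : R) *: z).
    rewrite /scaled_K (derive_scal _ _ _ (smooth_dilate _ (smooth_shell i))).
    by rewrite (derive_dilate _ _ _ (smooth_shell i)) mulrA.
  under eq_bigr do rewrite E.
  rewrite -mulr_sumr shell_div /scaled_rho -/a !add0r scalerA -exprS.
  rewrite mulrBr [8 * _]mulrC mulrCA mulrA [in RHS]exprS.
  have -> : (8 : R) ^+ m = 4 ^+ m * 2 ^+ m by rewrite -exprMn; congr (_ ^+ _); lra.
  by move: (4 ^+ m) (2 ^+ m) (shell_rho _) (shell_rho _) => p q X Y; ring.
- move=> m i; rewrite nrm1_dilate//; last exact: testf_shell.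
  have a0 : 0 <= (nrm1 shell_rho)^-1 * 4 ^+ m by rewrite mulr_ge0 ?exprn_ge0// ltW.
  rewrite (ger0_norm a0) -exprVn.
  have -> : (nrm1 shell_rho)^-1 * 4 ^+ m * (((2 : R)^-1 ^+ m) ^+ 3) =
            (nrm1 shell_rho)^-1 * 2^-1 ^+ m.
    rewrite -mulrA; congr (_ * _).
    have -> : (4 : R) ^+ m = 2 ^+ m * 2 ^+ m by rewrite -exprMn; congr (_ ^+ _); lra.
    by rewrite exprAC -!exprMn; congr (_ ^+ _); field.
  rewrite mulrAC ler_wpM2r ?exprn_ge0 ?invr_ge0// (bigD1 i)//= lerDl.
  by apply: sumr_ge0 => j _; rewrite mulr_ge0 ?nrm1_ge0// ltW.
- by move=> m z; rewrite mulr_ge0 ?shell_rho_ge0// mulr_ge0 ?exprn_ge0// ltW.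
- move=> m; rewrite nrm1_dilate//; last exact: testf_shell_rho.
  have a0 : 0 <= (nrm1 shell_rho)^-1 * 8 ^+ m by rewrite mulr_ge0 ?exprn_ge0// ltW.
  rewrite (ger0_norm a0).
  have -> : (8 : R) ^+ m = 2 ^+ m * 2 ^+ m * 2 ^+ m by rewrite -!exprMn; congr (_ ^+ _); lra.
  by field; rewrite !gt_eqF.
- move=> m i z H; exists (fun k => form k z); last exact: expand.
  move=> k; have /shell_supp /(_ k) : shell i (0 + (2 ^+ m : R) *: z) != 0 \/
      shell_rho (0 + (2 ^+ m : R) *: z) != 0.
    by case: H; rewrite mulf_eq0 negb_or => /andP[_ h]; [left|right].
  rewrite add0r formZ exprVn => /andP[h1 h2].
  by rewrite ler_pdivrMl// ler_pdivlMl// h1 h2.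
Qed.

End Basis.
End ConeKernel.

(** * Restriction to a set *)

Section Restriction.
Context d (T : measurableType d) (R : realType) (mu : {measure set T -> \bar R}).

Definition res (D : set T) (f : T -> R) (x : T) : R := \1_D x * f x.

Lemma res_in (D : set T) f x : D x -> res D f x = f x.
Proof. by move=> Dx; rewrite /res indicE mem_set// mul1r. Qed.

Lemma res_out (D : set T) f x : ~ D x -> res D f x = 0.
Proof. by move=> Dx; rewrite /res indicE memNset// mul0r. Qed.

Lemma resT f : res setT f = f.
Proof. by apply/funext => x; rewrite res_in. Qed.

Lemma resD (D : set T) f g : res D (f + g) = res D f + res D g.
Proof. by apply/funext => x; rewrite /res -[(f + g) x]/(f x + g x) mulrDr. Qed.

Lemma resZ (D : set T) a f : res D (a *: f) = a *: res D f.
Proof. by apply/funext => x; rewrite /res -[(a *: f) x]/(a * f x) mulrCA. Qed.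

Lemma res_le (D : set T) f x : `|res D f x| <= `|f x|.
Proof.
rewrite /res normrM ler_piMl// indicE; case: (_ \in _); rewrite ?normr1 ?normr0//.
Qed.

Lemma measurable_res (D : set T) f : measurable D -> measurable_fun setT f ->
  measurable_fun setT (res D f).
Proof. by move=> mD mf; apply: measurable_funM => //; exact: measurable_indic. Qed.

Lemma L2_res (D : set T) f : measurable D -> L2 mu f -> L2 mu (res D f).
Proof.
by move=> mD Lf; apply: (L2_le _ (@res_le D f) Lf); apply: measurable_res => //; exact: Lf.1.
Qed.

Lemma nrm_res (D : set T) f : measurable D -> L2 mu f -> nrm mu (res D f) <= nrm mu f.
Proof.
by move=> mD Lf; apply: nrm_le => //; [apply: measurable_res => //; exact: Lf.1|exact: res_le].
Qed.

Lemma ip_res (D : set T) f g : ip mu (res D f) g = ip mu f (res D g).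
Proof. by congr Rintegral; apply/funext => x; rewrite /res mulrCA mulrA. Qed.

Lemma ip_res2 (D : set T) f g : ip mu (res D f) g = ip mu (res D f) (res D g).
Proof.
congr Rintegral; apply/funext => x; rewrite /res indicE.
by case: (_ \in _); rewrite ?mul0r ?mul1r.
Qed.

Lemma nrm_res_sum (I : Type) (s : seq I) (P : pred I) (D : set T) (F : I -> T -> R) :
  measurable D -> (forall i, P i -> L2 mu (F i)) ->
  nrm mu (res D (\sum_(i <- s | P i) F i)) <= \sum_(i <- s | P i) nrm mu (res D (F i)).
Proof.
move=> mD LF.
have -> : res D (\sum_(i <- s | P i) F i) = \sum_(i <- s | P i) res D (F i).
  elim/big_rec2: _ => [|i u v _ <-]; last by rewrite resD.
  by apply/funext => x; rewrite /res mulr0.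
by apply: nrm_sum => i Pi; apply: L2_res => //; exact: LF.
Qed.

Lemma nrmN f : L2 mu f -> nrm mu (- f) = nrm mu f.
Proof. by move=> Lf; rewrite -scaleN1r nrmZ// normrN normr1 mul1r. Qed.

Lemma L2N f : L2 mu f -> L2 mu (- f).
Proof. by move=> Lf; rewrite -scaleN1r; exact: L2Z. Qed.

Lemma nrmB f g : L2 mu f -> L2 mu g -> nrm mu (f - g) <= nrm mu f + nrm mu g.
Proof. by move=> Lf Lg; rewrite -(nrmN Lg); apply: nrmD => //; exact: L2N. Qed.

Lemma resN (D : set T) f : res D (- f) = - res D f.
Proof. by rewrite -scaleN1r resZ scaleN1r. Qed.

Lemma resB (D : set T) f g : res D (f - g) = res D f - res D g.
Proof. by rewrite resD resN. Qed.

End Restriction.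

(** * A field as a gradient plus a compact remainder *)

Section ConeDecomposition.
Context {R : realType}.
Notation T3 := (measurableTypeR R * measurableTypeR R * measurableTypeR R)%type.
Notation L2_3 := (@L2 _ T3 R leb3).
Notation ip3 := (@ip _ T3 R leb3).
Notation nrm3 := (@nrm _ T3 R leb3).
Notation testf := (@test_function R R setT).

(* A test field whose only component is [phi], in position k, turns [is_wcurl]
   into this identity. *)
Definition wcurl (U : set (R3 R)) (u g : 'I_3 -> R3 R -> R) : Prop :=
  forall phi : R3 R -> R, test_function U phi -> forall k,
    ip3 (g k) phi = ip3 (u (k + 1)) ('D_(basis3 (k + 2)) phi)
                    - ip3 (u (k + 2)) ('D_(basis3 (k + 1)) phi).

Lemma I3_cases (i : 'I_3) : i = 0 \/ i = 1 \/ i = 2.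
Proof.
by case: i => -[|[|[|//]]] kl; [left|right; left|right; right]; exact/val_inj.
Qed.

Lemma I3_cyc (i : 'I_3) : [/\ i + 1 + 1 = i + 2, i + 1 + 2 = i, i + 2 + 1 = i & i + 2 + 2 = i + 1].
Proof. by case: (I3_cases i) => [->|[->|->]]; split; exact/val_inj. Qed.

Lemma sum3_cyc (V : nmodType) (M : 'I_3 -> V) (i : 'I_3) : \sum_k M k = M i + M (i + 1) + M (i + 2).
Proof.
have [E1 E2 E3 E4] : [/\ 1 + 1 = 2 :> 'I_3, 1 + 2 = 0 :> 'I_3, 2 + 1 = 0 :> 'I_3 & 2 + 2 = 1 :> 'I_3].
  by split; exact/val_inj.
rewrite sum3; case: (I3_cases i) => [->|[->|->]]; rewrite ?add0r ?E1 ?E2 ?E3 ?E4//.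
- by rewrite [RHS]addrC addrA.
- by rewrite addrC addrA.
Qed.

Lemma two_le_sum33 (f : 'I_3 -> 'I_3 -> R) (i : 'I_3) : (forall j k, 0 <= f j k) ->
  f (i + 2) (i + 1) + f (i + 1) (i + 2) <= \sum_j \sum_k f j k.
Proof.
move=> n0; rewrite (sum3_cyc _ i) (sum3_cyc (f i) i) (sum3_cyc (f (i + 1)) i) (sum3_cyc (f (i + 2)) i).
move: (n0 i i) (n0 i (i+1)) (n0 i (i+2)) (n0 (i+1) i) (n0 (i+1) (i+1)) (n0 (i+2) i) (n0 (i+2) (i+2)).
lra.
Qed.

Lemma testf_sum (I : Type) (s : seq I) (f : I -> R3 R -> R) : (forall i, testf (f i)) ->
  testf (fun x => \sum_(i <- s) f i x) /\
  forall v x, 'D_v (fun x => \sum_(i <- s) f i x) x = \sum_(i <- s) 'D_v (f i) x.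
Proof.
move=> tf; elim: s => [|i s [tt IH]].
  have -> : (fun x => \sum_(i <- [::]) f i x) = cst (0 : R) by apply/funext => x; rewrite big_nil.
  split; last by move=> v x; rewrite big_nil derive_cst.
  by apply: (@testf_of _ _ 0) => //; exact: (@smooth_cst R (R3 R) R 0).
have -> : (fun x => \sum_(i <- i :: s) f i x) = (fun x => f i x + \sum_(i <- s) f i x).
  by apply/funext => x; rewrite big_cons.
split; first exact: test_add.
have [s1 s2] : smooth (f i) /\ smooth (fun x => \sum_(i <- s) f i x).
  by split; [case: (tf i)|case: tt].
move=> v x; rewrite big_cons -IH.
exact: (derive_add (smooth_derivable s1) (smooth_derivable s2)).
Qed.

Lemma conv_kerD kap kap' u x : testf kap -> testf kap' -> L2_3 u ->
  conv (fun z => kap z + kap' z) u x = conv kap u x + conv kap' u x.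
Proof.
move=> tk tk' Lu; have [Lk _] := testf_L2c (refl_testf x tk).
have [Lk' _] := testf_L2c (refl_testf x tk').
exact: (ip_Dl Lk Lk' Lu).
Qed.

Lemma curl_conv U u g kap k x : wcurl U u g -> (forall j, L2_3 (u j)) -> smooth kap -> test_function U (refl kap x) ->
  conv kap (g k) x = conv ('D_(basis3 (k + 1)) kap) (u (k + 2)) x
                     - conv ('D_(basis3 (k + 2)) kap) (u (k + 1)) x.
Proof.
move=> ug Lu sk tk; rewrite {1}/conv ip_sym (ug _ tk k).
have tk' : testf (refl kap x) by exact: (test_function_sub (@subsetT _ U) tk).
have E j w : L2_3 w -> ip3 w ('D_(basis3 j) (refl kap x)) = - conv ('D_(basis3 j) kap) w x.
  move=> Lw; have [LD _] := testf_L2c (test_derive (basis3 j) tk').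
  have F : refl ('D_(basis3 j) kap) x = (-1) *: 'D_(basis3 j) (refl kap x).
    by apply/funext => y; rewrite -[RHS]/(-1 * _) refl_derive// mulrNN mul1r.
  by rewrite /conv F (ip_Zl (-1) LD Lw) mulN1r opprK ip_sym.
by rewrite !E// opprK addrC.
Qed.

Variables (W : 'I_3 -> R3 R) (K : nat -> 'I_3 -> R3 R -> R) (rho : nat -> R3 R -> R) (C : R).
Hypothesis ck : cone_kernel W K rho C.

Lemma ck_C0 : 0 <= C.
Proof.
have := ck_nrm ck 0 0; rewrite expr0 mulr1; apply: le_trans; exact: nrm1_ge0.
Qed.

(** By [ck_div] the left side is the divergence of [K m] convolved with [u i]. Exchanging the index
    of the derivative with that of the field gives the derivative along [basis3 i] of the sum of the
    [K m j] convolved with [u j]; the antisymmetric remainder is [K m] convolved with the curl. *)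
Lemma rho_step u g m i x : wcurl setT u g -> (forall j, L2_3 (u j)) ->
  conv (rho m.+1) (u i) x - conv (rho m) (u i) x =
  \sum_j conv ('D_(basis3 i) (K m j)) (u j) x +
  (conv (K m (i + 2)) (g (i + 1)) x - conv (K m (i + 1)) (g (i + 2)) x).
Proof.
move=> ug Lu.
have tK j v : testf ('D_v (K m j)) by apply: test_derive; exact: (ck_K ck).
have -> : conv (rho m.+1) (u i) x - conv (rho m) (u i) x =
          \sum_j conv ('D_(basis3 j) (K m j)) (u i) x.
  rewrite sum3 -!conv_kerD//; last exact: test_add.
  have E : rho m.+1 = (fun z => ('D_(basis3 0) (K m 0) z + 'D_(basis3 1) (K m 1) z
      + 'D_(basis3 2) (K m 2) z) + rho m z).
    by apply/funext => z; have := ck_div ck m z; rewrite sum3 => ->; rewrite subrK.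
  have tr : testf (rho m) by exact: (ck_rho ck).
  have tS := test_add (test_add (tK 0 (basis3 0)) (tK 1 (basis3 1))) (tK 2 (basis3 2)).
  by rewrite {1}E (conv_kerD x tS tr (Lu i)) addrK.
have sK j : smooth (K m j) by case: (ck_K ck m j).
have tr j : testf (refl (K m j) x) by apply: refl_testf; exact: (ck_K ck).
rewrite !(sum3_cyc _ i) (curl_conv (i + 1) ug Lu (sK _) (tr _)) (curl_conv (i + 2) ug Lu (sK _) (tr _)).
have [-> -> -> ->] := I3_cyc i.
by move: (conv _ _ _) (conv _ _ _) (conv _ _ _) (conv _ _ _) (conv _ _ _) => *; ring.
Qed.

(** [rho N] is nonnegative of mass 1, so the convolution is an average of values of [phi] at
    distance at most [r] from [x]. *)
Lemma rho_conv_close N phi x r L : testf phi -> 0 <= L ->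
  (forall x y, `|phi x - phi y| <= L * `|x - y|) ->
  (forall z, rho N z != 0 -> `|z| <= r) -> `|conv (rho N) phi x - phi x| <= L * r.
Proof.
move=> tp L0 HL Hr; have tr := refl_testf x (ck_rho ck N).
have [Lr _] := testf_L2c tr; have [Lp _] := testf_L2c tp.
have E (c : R) : \int[leb3]_(y in setT) (c * refl (rho N) x y) = c.
  have E1 : \int[leb3]_(y in setT) (refl (rho N) x y) = 1.
    rewrite -(ck_int ck N) -(nrm1_refl x (ck_rho ck N)).
    by apply: eq_Rintegral => y _; rewrite ger0_norm//; exact: (ck_rho0 ck).
  by rewrite RintegralZl// ?E1 ?mulr1//; exact: L2c_int (testf_L2c tr).
have Ic (c : R) : (leb3 : {measure set T3 -> \bar R}).-integrable setT (fun y : T3 => (c * refl (rho N) x y)%:E).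
  have := integrableZl measurableT c (L2c_int (testf_L2c tr)).
  by apply: eq_integrable.
have Ip := L2_mul Lr Lp.
have key y : refl (rho N) x y != 0 -> `|phi y - phi x| <= L * r.
  move=> /Hr h; apply: le_trans (HL _ _) _; rewrite ler_wpM2l//.
  by rewrite distrC.
have r0 y : 0 <= refl (rho N) x y by exact: (ck_rho0 ck).
rewrite ler_distl; apply/andP; split.
  rewrite -[X in X <= _]E; apply: le_Rintegral => //; first exact: Ic.
  move=> y _; rewrite mulrC.
  have [->|/key h] := eqVneq (refl (rho N) x y) 0; first by rewrite !mul0r.
  by rewrite ler_wpM2l//; move: h; rewrite ler_distl => /andP[].
rewrite -[X in _ <= X]E; apply: le_Rintegral => //; first exact: Ic.
move=> y _; rewrite [X in _ <= X]mulrC.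
have [->|/key h] := eqVneq (refl (rho N) x y) 0; first by rewrite !mul0r.
by rewrite ler_wpM2l//; move: h; rewrite ler_distl => /andP[].
Qed.

Lemma rho_small N z : rho N z != 0 -> `|z| <= 2^-1 ^+ N * (2 * \sum_k `|W k|).
Proof.
move=> rz; have [a Ha ->] := ck_supp ck (m := N) (i := 0) (z := z) (or_intror rz).
apply: le_trans (ler_norm_sum _ _ _) _; rewrite mulrA mulr_sumr; apply: ler_sum => k _.
rewrite normrZ ler_wpM2r//; have /andP[h1 h2] := Ha k.
rewrite ger0_norm//; apply: le_trans h1; rewrite divr_ge0// exprn_ge0//.
Qed.

Lemma half_pow_small (e : R) : 0 < e -> exists N : nat, forall n, (N <= n)%N -> 2^-1 ^+ n <= e.
Proof.
move=> e0; have h : (`|2^-1 : R| < 1) by rewrite ger0_norm ?invr_ge0//; lra.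
have /cvgrPdist_le /(_ _ e0) [N _ HN] := cvg_expr h.
exists N => n /HN /=; rewrite sub0r normrN ger0_norm// exprn_ge0//.
Qed.

Lemma nrm_bounded_supp (f : R3 R -> R) (M r : R) : measurable_fun setT (f : T3 -> R) -> 0 <= M ->
  (forall x, `|f x| <= M) -> (forall x, r < `|x| -> f x = 0) ->
  nrm3 f <= M * nrm3 (\1_(cube (`|r| + 1))).
Proof.
move=> mf M0 fM fr.
have L1 : L2_3 (\1_(cube (`|r| + 1))).
  apply: (proj1 (@L2c_bounded R _ 1 (`|r| + 1) _ _ _)).
  - by apply: measurable_indic; exact: measurable_cube.
  - by move=> x; rewrite indicE; case: (_ \in _); rewrite ?normr1 ?normr0.
  - by move=> x xr; rewrite indicE memNset// => /cubeP h; move: (lt_trans xr h); rewrite ltxx.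
rewrite -[M in leRHS]ger0_norm// -nrmZ//; apply: nrm_le => //; last exact: L2Z.
move=> x; rewrite -[X in _ <= `|X|]/(M * _) indicE.
have [h|h] := ltP `|x| (`|r| + 1).
  by rewrite mem_set ?mulr1 ?(ger0_norm M0)//; exact/cubeP.
rewrite fr ?normr0// (lt_le_trans _ h)// (le_lt_trans (ler_norm r))//; lra.
Qed.

(** A test function approximates [u], and Young's inequality with a kernel of mass 1 preserves this
    error. For the test function the convergence is uniform, on a fixed bounded support. *)
Lemma rho_approx u e : L2c u -> 0 < e ->
  exists N : nat, forall n, (N <= n)%N -> nrm3 (u - conv (rho n) u) <= e.
Proof.
move=> Lu e0; have e3 : 0 < e / 3 by lra.
have [phi tp Hp] := test_dense Lu.1 e3.
have [L L0 HL] := test_lipschitz tp; have [s hs] := testf_bsupp tp.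
set S := 2 * \sum_k `|W k|; have S0 : 0 <= S by rewrite mulr_ge0// sumr_ge0.
pose B := nrm3 (\1_(cube (`|s + S| + 1))); have B0 : 0 <= B by exact: nrm_ge0.
have e3' : 0 < e / 3 / (L * S * B + 1).
  apply: divr_gt0 => //; have := mulr_ge0 (mulr_ge0 L0 S0) B0.
  by move: (L * S * B) => q q0; lra.
have [N HN] := half_pow_small e3'.
exists N => n Nn; have tr := ck_rho ck n.
have Lp := testf_L2c tp; have Lup : L2c (u - phi).
  by have := L2c_lin (-1) Lp Lu; rewrite scaleN1r addrC.
have [Lcp _] := young tr Lp; have [Lcu _] := young tr Lu.
have [Lcup Hcup] := young tr Lup.
have E : u - conv (rho n) u = (u - phi) + ((phi - conv (rho n) phi) - conv (rho n) (u - phi)).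
  apply/funext => x; rewrite -[LHS]/(u x - conv (rho n) u x).
  rewrite -[RHS]/((u x - phi x) + ((phi x - conv (rho n) phi x) - conv (rho n) (u - phi) x)).
  have -> : conv (rho n) (u - phi) x = -1 * conv (rho n) phi x + conv (rho n) u x.
    by rewrite -conv_linr//; [rewrite scaleN1r addrC|case: Lp|case: Lu].
  by ring.
rewrite E; have h1 : nrm3 (conv (rho n) (u - phi)) <= e / 3.
  by apply: le_trans Hcup _; rewrite (ck_int ck) mul1r.
have h2 : nrm3 (phi - conv (rho n) phi) <= e / 3.
  apply: le_trans (@nrm_bounded_supp _ (L * (2^-1 ^+ n * S)) (s + S) _ _ _ _) _.
  - by apply: measurable_funB; [case: Lp => -[]|case: Lcp].
  - by apply: mulr_ge0 => //; apply: mulr_ge0 => //; exact: exprn_ge0.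
  - move=> x; rewrite distrC; apply: rho_conv_close => // z; exact: rho_small.
  - move=> x xs; rewrite -[LHS]/(phi x - conv (rho n) phi x) hs ?sub0r.
      apply/eqP; rewrite oppr_eq0; apply/eqP/conv_eq0 => y.
      have [ys|ys] := ltP s `|y|; [by right; exact: hs|left].
      apply/eqP; apply: contrapT => /negP /rho_small h.
      have : `|x| <= `|x - y| + `|y| by rewrite -{1}(subrK y x) ler_normD.
      have p1 : 2^-1 ^+ n * S <= S by rewrite ler_piMl// exprn_ile1//; lra.
      by rewrite leNgt => /negP; apply; apply: le_lt_trans xs; apply: (le_trans (lerD h ys)); rewrite -/S; lra.
    by apply: le_lt_trans xs; lra.
  - rewrite -/B; have -> : L * (2^-1 ^+ n * S) * B = 2^-1 ^+ n * (L * S * B).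
      by move: (_ ^+ _) => t; ring.
    apply: (@le_trans _ _ (2^-1 ^+ n * (L * S * B + 1))).
      by rewrite ler_wpM2l ?exprn_ge0//; lra.
    rewrite -ler_pdivlMr; first exact: HN.
    by have := mulr_ge0 (mulr_ge0 L0 S0) B0; move: (L * S * B) => q q0; lra.
have LpB : L2_3 (phi - conv (rho n) phi) by apply: L2B => //; case: Lp.
apply: le_trans (nrmD _ _) _; [by case: Lup|by apply: L2B|].
apply: (@le_trans _ _ (e / 3 + (e / 3 + e / 3))); last lra.
apply: lerD => //; apply: le_trans (nrmB LpB Lcup) _; exact: lerD.
Qed.

Definition in_shell (m : nat) (a : 'I_3 -> R) := forall k, 2^-1 ^+ m / 2 <= a k <= 2^-1 ^+ m * 2.

Lemma conv_shell_eq0 (kap : R3 R -> R) m (v : R3 R -> R) x :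
  (forall z, kap z != 0 -> K m 0 z != 0 \/ K m 1 z != 0 \/ K m 2 z != 0 \/ rho m z != 0) ->
  (forall a, in_shell m a -> v (x - \sum_k a k *: W k) = 0) -> conv kap v x = 0.
Proof.
move=> Hk Hv; apply: conv_eq0 => y; have [->|/Hk h] := eqVneq (kap (x - y)) 0; [by left|right].
have [a Ha E] : exists2 a, in_shell m a & x - y = \sum_k a k *: W k.
  by case: h => [|[|[]]] h;
    [exact: (ck_supp ck (or_introl h))|exact: (ck_supp ck (or_introl h))
    |exact: (ck_supp ck (or_introl h))|exact: (ck_supp ck (i := 0) (or_intror h))].
by rewrite -(Hv a Ha) -E opprB addrC subrK.
Qed.

Lemma conv_K_eq0 m j (v : R3 R -> R) x :
  (forall a, in_shell m a -> v (x - \sum_k a k *: W k) = 0) -> conv (K m j) v x = 0.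
Proof.
apply: conv_shell_eq0 => z; case: (I3_cases j) => [->|[->|->]] h.
- by left.
- by right; left.
- by right; right; left.
Qed.

Lemma conv_rho_eq0 m (v : R3 R -> R) x :
  (forall a, in_shell m a -> v (x - \sum_k a k *: W k) = 0) -> conv (rho m) v x = 0.
Proof. by apply: conv_shell_eq0 => z h; right; right; right. Qed.

Definition potential m0 N (u : 'I_3 -> R3 R -> R) (x : R3 R) : R :=
  \sum_(m0 <= m < N) \sum_j conv (K m j) (u j) x.

Lemma testf_potential m0 N u : (forall j, L2c (u j)) -> testf (potential m0 N u).
Proof.
move=> Lu; apply: (testf_sum _ _).1 => m; apply: (testf_sum _ _).1 => j.
by apply: conv_testf => //; exact: (ck_K ck).
Qed.

(** Summing [rho_step] telescopes the mollifiers: up to the curl terms, the gradient of the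
    potential is [u] at scale [N] minus [u] at scale [m0]. *)
Lemma derive_potential m0 N u g i x : wcurl setT u g -> (forall j, L2c (u j)) -> (m0 <= N)%N ->
  'D_(basis3 i) (potential m0 N u) x = conv (rho N) (u i) x - conv (rho m0) (u i) x -
  \sum_(m0 <= m < N) (conv (K m (i + 2)) (g (i + 1)) x - conv (K m (i + 1)) (g (i + 2)) x).
Proof.
move=> ug Lu mN.
have tc m j : testf (conv (K m j) (u j)) by apply: conv_testf => //; exact: (ck_K ck).
have E1 m : 'D_(basis3 i) (fun x => \sum_j conv (K m j) (u j) x) x =
    \sum_j conv ('D_(basis3 i) (K m j)) (u j) x.
  rewrite ((testf_sum _ (tc m)).2 (basis3 i) x); apply: eq_bigr => j _.
  exact: (conv_derive x (basis3 i) (ck_K ck m j) (Lu j)).2.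
have ts m : testf (fun x => \sum_j conv (K m j) (u j) x) := (testf_sum _ (tc m)).1.
rewrite ((testf_sum _ ts).2 (basis3 i) x) -(telescope_sumr (fun m => conv (rho m) (u i) x) mN) -sumrB.
apply: eq_bigr => m _; rewrite E1 (rho_step m i x ug) ?addrK// => j.
by have [] := Lu j.
Qed.

Lemma potential_supp m0 N u x : potential m0 N u x != 0 ->
  exists j m a, [/\ (m0 <= m < N)%N, in_shell m a & u j (x - \sum_k a k *: W k) != 0].
Proof.
move=> px; apply: contrapT => H; move/eqP: px; apply.
rewrite /potential big1_seq// => m; rewrite mem_index_iota => /andP[_ m0m].
apply: big1 => j _.
apply: conv_K_eq0 => a Ha; apply/eqP; apply: contrapT => /negP ux.
by apply: H; exists j, m, a.
Qed.

Lemma geometric_half (m N : nat) : (m <= N)%N ->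
  \sum_(m <= k < N) (2^-1 : R) ^+ k <= 2 * 2^-1 ^+ m.
Proof.
move=> mN; suff -> : \sum_(m <= k < N) (2^-1 : R) ^+ k = 2 * 2^-1 ^+ m - 2 * 2^-1 ^+ N.
  by rewrite gerBl mulr_ge0// exprn_ge0.
rewrite -(subnKC mN); elim: (N - m)%N => [|n IH]; first by rewrite addn0 big_geq// subrr.
by rewrite addnS big_nat_recr ?leq_addr//= IH exprS; field.
Qed.

(** The remainder is cut at a free scale [m1]: the coarse shells are kept as they act on [D], where
    they are compact or vanish, and the fine ones are summed by Young's inequality. The depth [N] of
    the potential exceeds [Mx], so one and the same [p] serves all scales [m1] and all sets [D]. *)
Lemma cone_potential u g m0 Mx e : wcurl setT u g -> (forall j, L2c (u j)) ->
  (forall j, L2c (g j)) -> 0 < e ->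
  exists p, [/\ testf p,
    exists N : nat, forall x, p x != 0 ->
      exists j m a, [/\ (m0 <= m < N)%N, in_shell m a & u j (x - \sum_k a k *: W k) != 0] &
    forall i (D : set T3) m1, measurable D -> (m0 <= m1 <= Mx)%N ->
      nrm3 (res D (u i - 'D_(basis3 i) p)) <= e + nrm3 (res D (conv (rho m0) (u i)))
        + \sum_(m0 <= m < m1) \sum_j \sum_k nrm3 (res D (conv (K m j) (g k)))
        + 2 * C * 2^-1 ^+ m1 * \sum_k nrm3 (g k)].
Proof.
move=> ug Lu Lg e0; have /choice[Ni HN] i := rho_approx (Lu i) e0.
pose N := maxn (maxn m0 Mx) (\max_i Ni i).
exists (potential m0 N u); split; [exact: testf_potential|exists N; exact: potential_supp|].
move=> i D m1 mD /andP[m0m1 m1M].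
have NM : (maxn m0 Mx <= N)%N by exact: leq_maxl.
have m0N : (m0 <= N)%N by apply: leq_trans NM; exact: leq_maxl.
have m1N : (m1 <= N)%N by apply: leq_trans NM; apply: leq_trans m1M _; exact: leq_maxr.
have HNi : nrm3 (u i - conv (rho N) (u i)) <= e.
  by apply: HN; apply: leq_trans (leq_maxr _ _); exact: leq_bigmax.
have LK m j k : L2_3 (conv (K m j) (g k)) := (young (ck_K ck m j) (Lg k)).1.
have Lr m : L2_3 (conv (rho m) (u i)) := (young (ck_rho ck m) (Lu i)).1.
pose T m := conv (K m (i + 2)) (g (i + 1)) - conv (K m (i + 1)) (g (i + 2)).
have LT m : L2_3 (T m) by apply: L2B.
have Lui : L2_3 (u i) by case: (Lu i).
have E : u i - 'D_(basis3 i) (potential m0 N u) =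
    (u i - conv (rho N) (u i)) + (conv (rho m0) (u i) + \sum_(m0 <= m < N) T m).
  apply/funext => x; rewrite -[LHS]/(u i x - 'D_(basis3 i) (potential m0 N u) x).
  rewrite (derive_potential i x ug Lu m0N).
  rewrite -[RHS]/((u i x - conv (rho N) (u i) x) + (conv (rho m0) (u i) x + (\sum_(m0 <= m < N) T m) x)).
  have -> : (\sum_(m0 <= m < N) T m) x = \sum_(m0 <= m < N)
      (conv (K m (i + 2)) (g (i + 1)) x - conv (K m (i + 1)) (g (i + 2)) x) by rewrite fct_sumE.
  by move: (\sum_(m0 <= m < N) _) (u i x) (conv _ _ _) (conv _ _ _) => s a b c; ring.
rewrite E resD (resD D (conv (rho m0) (u i))).
have LTs : L2_3 (\sum_(m0 <= m < N) T m) by apply: L2_sum.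
apply: le_trans (nrmD _ _) _.
- by apply: L2_res => //; apply: L2B.
- by apply: L2D; apply: L2_res.
rewrite -!addrA; apply: lerD; first by apply: le_trans HNi; apply: nrm_res => //; apply: L2B.
apply: le_trans (nrmD _ _) _; [exact: L2_res|exact: L2_res|].
rewrite lerD2l; apply: (le_trans (@nrm_res_sum _ _ _ leb3 _ _ _ D T mD (fun m _ => LT m))).
have HT m : nrm3 (res D (T m)) <= nrm3 (res D (conv (K m (i + 2)) (g (i + 1)))) +
                         nrm3 (res D (conv (K m (i + 1)) (g (i + 2)))).
  by rewrite /T resB; apply: nrmB; exact: L2_res.
rewrite (big_cat_nat m0m1 m1N) /=; apply: lerD.
  apply: ler_sum => m _.
  apply: le_trans (HT m) _.
  apply: (two_le_sum33 (f := fun j k => nrm3 (res D (conv (K m j) (g k))))) => j k.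
  exact: nrm_ge0.
have Bd m j k : nrm3 (res D (conv (K m j) (g k))) <= C * 2^-1 ^+ m * nrm3 (g k).
  apply: le_trans (nrm_res mD (LK m j k)) _.
  apply: le_trans (young (ck_K ck m j) (Lg k)).2 _.
  by rewrite ler_wpM2r ?nrm_ge0//; exact: (ck_nrm ck).
apply: (@le_trans _ _ (\sum_(m1 <= m < N) (C * \sum_k nrm3 (g k)) * 2^-1 ^+ m)).
  apply: ler_sum => m _.
  apply: le_trans (HT m) _.
  apply: le_trans (lerD (Bd _ _ _) (Bd _ _ _)) _.
  rewrite (sum3_cyc _ i) -mulrDr mulrAC ler_wpM2r ?exprn_ge0// ler_wpM2l ?ck_C0//.
  by have := nrm_ge0 leb3 (g i); lra.
rewrite -mulr_sumr; have CS : 0 <= C * \sum_k nrm3 (g k).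
  by rewrite mulr_ge0 ?ck_C0//; apply: sumr_ge0 => k _; exact: nrm_ge0.
apply: le_trans (ler_wpM2l CS (geometric_half m1N)) _.
by rewrite le_eqVlt; apply/orP; left; apply/eqP; move: (\sum_k _) (_ ^+ _) => s t; ring.
Qed.

Lemma cvg0_sum (I : Type) (s : seq I) (F : set_system nat) {FF : Filter F} (f : I -> nat -> R) :
  (forall i, f i n @[n --> F] --> (0 : R)) -> \sum_(i <- s) f i n @[n --> F] --> (0 : R).
Proof.
move=> f0; elim: s => [|i s IH].
  by under eq_fun do rewrite big_nil; exact: cvg_cst.
have E : (fun n => \sum_(j <- i :: s) f j n) = (fun n => f i n + \sum_(j <- s) f j n).
  by apply/funext => n; rewrite big_cons.
by have := cvgD (f0 i) IH; rewrite addr0 E; apply.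
Qed.

(** Against a test function the derivatives move onto it, so the weak convergence of [u] suffices;
    density and the uniform bound [A] extend this to all of L^2. *)
Lemma weak_curl (F : set_system nat) {FF : Filter F} (u g : nat -> 'I_3 -> R3 R -> R) (A : R) :
  (forall n, wcurl setT (u n) (g n)) -> (forall n j, L2_3 (u n j)) -> (forall n j, L2_3 (g n j)) ->
  (forall n j, nrm3 (g n j) <= A) ->
  (forall j v, L2_3 v -> ip3 v (u n j) @[n --> F] --> (0 : R)) ->
  forall j v, L2_3 v -> ip3 v (g n j) @[n --> F] --> (0 : R).
Proof.
move=> ug Lu Lg gA wu j v Lv; apply/cvgrPdist_le => e e0.
have A0 : 0 <= A by apply: le_trans (gA 0%N 0); exact: nrm_ge0.
have e0' : 0 < e / 2 / (A + 1) by apply: divr_gt0; lra.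
have [phi tp Hp] := test_dense Lv e0'.
have Lp := (testf_L2c tp).1; have LD k := (testf_L2c (test_derive (basis3 k) tp)).1.
have c : ip3 phi (g n j) @[n --> F] --> (0 : R).
  have -> : (fun n => ip3 phi (g n j)) = (fun n => ip3 ('D_(basis3 (j + 2)) phi) (u n (j + 1))
      - ip3 ('D_(basis3 (j + 1)) phi) (u n (j + 2))).
    apply/funext => n; rewrite ip_sym (ug n phi tp j).
    by congr (_ - _); exact: ip_sym.
  have := cvgB (wu (j + 1) _ (LD (j + 2))) (wu (j + 2) _ (LD (j + 1))).
  by rewrite subr0; apply.
have e2 : 0 < e / 2 by lra.
have := c; move/cvgrPdist_le => /(_ _ e2); apply: filterS => n; rewrite !sub0r !normrN => h.
have -> : ip3 v (g n j) = ip3 (v - phi) (g n j) + ip3 phi (g n j).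
  by rewrite (ip_Bl Lv Lp (Lg n j)) subrK.
apply: le_trans (ler_normD _ _) _.
have h2 : `|ip3 (v - phi) (g n j)| <= e / 2.
  apply: le_trans (ip_nrm (L2B Lv Lp) (Lg n j)) _.
  apply: (@le_trans _ _ (e / 2 / (A + 1) * (A + 1))); last by rewrite divfK//; lra.
  by apply: ler_pM; rewrite ?nrm_ge0//; apply: le_trans (gA n j) _; lra.
by move: h h2; lra.
Qed.

(** Two bounds for one potential. Globally the remainder is small, because finitely many
    convolutions tend to 0 and the others have small mass. On a set [D] from which the shells before
    [M n] see only zeros, the remainder consists of the shells from [M n] on, of mass [2^-(M n)],
    where [M n] may tend to infinity with [n]. *)
Lemma cone_compact (F : set_system nat) {FF : Filter F} (u g : nat -> 'I_3 -> R3 R -> R)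
    (r A : R) m0 (M : nat -> nat) d :
  (forall n, wcurl setT (u n) (g n)) ->
  (forall n j, L2_3 (u n j) /\ L2_3 (g n j)) ->
  (forall n j x, r < `|x| -> u n j x = 0 /\ g n j x = 0) ->
  (forall n j, nrm3 (u n j) <= A /\ nrm3 (g n j) <= A) ->
  (forall j v, L2_3 v -> ip3 v (u n j) @[n --> F] --> (0 : R)) ->
  (forall n, m0 < M n)%N -> 0 < d ->
  \forall n \near F, exists p, [/\ testf p,
    exists N : nat, forall x, p x != 0 ->
      exists j m a, [/\ (m0 <= m < N)%N, in_shell m a & u n j (x - \sum_k a k *: W k) != 0],
    forall i, nrm3 (u n i - 'D_(basis3 i) p) <= d &
    forall D : set T3, measurable D ->
      (forall x m a j, D x -> (m0 <= m < M n)%N -> in_shell m a ->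
         u n j (x - \sum_k a k *: W k) = 0 /\ g n j (x - \sum_k a k *: W k) = 0) ->
      forall i, nrm3 (res D (u n i - 'D_(basis3 i) p)) <= (1 + 6 * C * A) * 2^-1 ^+ M n].
Proof.
move=> ug Lug sug bug wu m0M d0.
have wg : forall j v, L2_3 v -> ip3 v (g n j) @[n --> F] --> (0 : R).
  apply: (weak_curl ug) wu => [n j|n j|n j]; [by case: (Lug n j)|by case: (Lug n j)|].
  by case: (bug n j) => _; exact.
have Lu n j : L2c (u n j) by split; [case: (Lug n j)|exists r => x /(sug n j)[]].
have Lg n j : L2c (g n j) by split; [case: (Lug n j)|exists r => x /(sug n j)[]].
have A0 : 0 <= A by apply: le_trans (bug 0%N 0).1; exact: nrm_ge0.
have CA : 0 <= C * A by rewrite mulr_ge0 ?ck_C0.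
have d4 : 0 < d / 4 by lra.
have d4' : 0 < d / 4 / (6 * (C * A) + 1) by apply: divr_gt0; lra.
have [M1 HM1] := half_pow_small d4'.
pose M1' := maxn M1 m0.
pose h i n := nrm3 (conv (rho m0) (u n i)).
pose H n := \sum_(m0 <= m < M1') \sum_j \sum_k nrm3 (conv (K m j) (g n k)).
have ch i : h i n @[n --> F] --> (0 : R).
  by apply: (conv_compact (ck_rho ck m0) _ _ (fun n => (bug n i).1) (wu i)) => [n|n x /(sug n i)[]//]; case: (Lug n i).
have cH : H n @[n --> F] --> (0 : R).
  apply: cvg0_sum => m; apply: cvg0_sum => j; apply: cvg0_sum => k.
  by apply: (conv_compact (ck_K ck m j) _ _ (fun n => (bug n k).2) (wg k)) => [n|n x /(sug n k)[]//]; case: (Lug n k).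
have small (f : nat -> R) : f n @[n --> F] --> (0 : R) -> \forall n \near F, f n <= d / 4.
  move=> /cvgrPdist_le /(_ _ d4); apply: filterS => n; rewrite sub0r normrN.
  exact: le_trans (ler_norm _).
have nh : \forall n \near F, forall i, h i n <= d / 4 by apply: filter_forall => i; exact: small.
apply: filterS2 nh (small _ cH) => n hn Hn.
(* The mollification error enters both bounds: it must lie below [d / 4] and below the scale
   [2^-(M n)]. *)
have e0 : 0 < Num.min (d / 4) (2^-1 ^+ M n) by rewrite lt_min d4 exprn_gt0.
have [p [tp sp Hp]] := cone_potential m0 (maxn M1' (M n)) (ug n) (Lu n) (Lg n) e0.
have Sg : \sum_k nrm3 (g n k) <= 3 * A.
  rewrite sum3; have [_ a0] := bug n 0; have [_ a1] := bug n 1; have [_ a2] := bug n 2; lra.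
have C0 := ck_C0.
have tail m1 : 2 * C * 2^-1 ^+ m1 * \sum_k nrm3 (g n k) <= 6 * (C * A) * 2^-1 ^+ m1.
  have q0 : 0 <= 2 * C * 2^-1 ^+ m1 by rewrite !mulr_ge0 ?exprn_ge0.
  apply: le_trans (ler_wpM2l q0 Sg) _.
  by rewrite le_eqVlt; apply/orP; left; apply/eqP; move: (_ ^+ _) => t; ring.
exists p; split=> //.
  move=> i; have := Hp i setT M1' measurableT; rewrite leq_maxr leq_maxl => /(_ isT).
  rewrite !resT => /le_trans; apply.
  apply: (@le_trans _ _ (d / 4 + d / 4 + d / 4 + d / 4)); last by lra.
  apply: lerD; [apply: lerD; [apply: lerD|]|] => //.
  - by rewrite ge_min lexx.
  - exact: hn.
  - apply: le_trans Hn; rewrite le_eqVlt; apply/orP; left; apply/eqP.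
    by apply: eq_bigr => m _; apply: eq_bigr => j _; apply: eq_bigr => k _; rewrite resT.
  - apply: le_trans (tail _) _.
    have h2 : 2^-1 ^+ M1' <= d / 4 / (6 * (C * A) + 1) by apply: HM1; exact: leq_maxl.
    apply: (@le_trans _ _ ((6 * (C * A) + 1) * 2^-1 ^+ M1')).
      by rewrite ler_wpM2r ?exprn_ge0//; lra.
    by rewrite mulrC -ler_pdivlMr//; lra.
move=> D mD blind i; have := Hp i D (M n) mD; rewrite leq_maxr (ltnW (m0M n)) => /(_ isT).
have z0 : res D (conv (rho m0) (u n i)) = 0.
  apply/funext => x; have [Dx|Dx] := pselect (D x); last by rewrite res_out.
  rewrite res_in//; apply: (conv_rho_eq0 (m := m0)) => a Ha.
  by have [] := blind x m0 a i Dx _ Ha; rewrite ?leqnn ?m0M.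
have zK : \sum_(m0 <= m < M n) \sum_j \sum_k nrm3 (res D (conv (K m j) (g n k))) = 0.
  rewrite big1_seq// => m; rewrite mem_index_iota => /andP[_ /andP[m1 m2]].
  apply: big1 => j _; apply: big1 => k _.
  suff -> : res D (conv (K m j) (g n k)) = 0 by exact: nrm0.
  apply/funext => x; have [Dx|Dx] := pselect (D x); last by rewrite res_out.
  rewrite res_in//; apply: (conv_K_eq0 (m := m)) => a Ha.
  by have [] := blind x m a k Dx _ Ha; rewrite ?m1 ?m2.
rewrite z0 zK nrm0 !addr0 => /le_trans; apply.
have -> : (1 + 6 * C * A) * 2^-1 ^+ M n = 2^-1 ^+ M n + 6 * (C * A) * 2^-1 ^+ M n.
  by move: (_ ^+ _) => t; ring.
apply: lerD; last exact: tail.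
by rewrite ge_min lexx orbT.
Qed.

End ConeDecomposition.

(** * Weak curls: cutoffs, gradients and Green's formula *)

Section CurlCalculus.
Context {R : realType}.
Notation T3 := (measurableTypeR R * measurableTypeR R * measurableTypeR R)%type.
Notation L2_3 := (@L2 _ T3 R leb3).
Notation ip3 := (@ip _ T3 R leb3).
Notation nrm3 := (@nrm _ T3 R leb3).
Notation testf := (@test_function R R setT).

Lemma ip_mul (a u v : R3 R -> R) : ip3 (fun x => a x * u x) v = ip3 u (fun x => a x * v x).
Proof. by congr Rintegral; apply/funext => x; rewrite mulrCA mulrA. Qed.

Lemma nrm_mulb (a u : R3 R -> R) (M : R) : measurable_fun setT (a : T3 -> R) ->
  (forall x, `|a x| <= M) -> L2_3 u ->
  L2_3 (fun x => a x * u x) /\ nrm3 (fun x => a x * u x) <= M * nrm3 u.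
Proof.
move=> ma aM Lu; have M0 : 0 <= M := le_trans (normr_ge0 _) (aM (0 : R3 R)).
have mp : measurable_fun setT ((fun x => a x * u x) : T3 -> R).
  by apply: measurable_funM => //; case: Lu.
have le x : `|a x * u x| <= `|(M *: u) x|.
  by rewrite -[X in _ <= `|X|]/(M * u x) !normrM ler_wpM2r// (ger0_norm M0).
split; first exact: L2_le mp le (L2Z M Lu).
by have := nrm_le mp le (L2Z M Lu); rewrite nrmZ// (ger0_norm M0).
Qed.

Lemma L2_mult (a u : R3 R -> R) : testf a -> L2_3 u -> L2_3 (fun x => a x * u x).
Proof.
move=> ta Lu; have [M _ HM] := test_bounded ta.
by have [] := nrm_mulb (testf_measurable ta) HM Lu.
Qed.

Lemma wcurl_sub U V (u g : 'I_3 -> R3 R -> R) : U `<=` V -> wcurl V u g -> wcurl U u g.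
Proof. by move=> UV H phi tp; apply: H; exact: test_function_sub UV tp. Qed.

(** The Leibniz formula: [psi] times the curl, plus the cross product of the gradient of [psi] with
    the field. *)
Definition mulcurl (psi : R3 R -> R) (u g : 'I_3 -> R3 R -> R) (k : 'I_3) (x : R3 R) : R :=
  psi x * g k x + ('D_(basis3 (k + 1)) psi x * u (k + 2) x
                   - 'D_(basis3 (k + 2)) psi x * u (k + 1) x).

Definition mulfield (psi : R3 R -> R) (u : 'I_3 -> R3 R -> R) (k : 'I_3) (x : R3 R) : R :=
  psi x * u k x.

Lemma mulcurl_eq0 psi u g k x : (forall j, u j x = 0) -> g k x = 0 -> mulcurl psi u g k x = 0.
Proof. by move=> u0 g0; rewrite /mulcurl !u0 g0 !mulr0 subr0 addr0. Qed.

Lemma mulcurl_const psi c u g k x : psi x = c -> (forall j, 'D_(basis3 j) psi x = 0) ->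
  mulcurl psi u g k x = c * g k x.
Proof. by move=> p1 p0; rewrite /mulcurl p1 !p0 !mul0r subr0 addr0. Qed.

Lemma near_cst_derive (psi : R3 R -> R) (c : R) (x : R3 R) (v : R3 R) (e : R) : 0 < e ->
  (forall y, `|x - y| < e -> psi y = c) -> 'D_v psi x = 0.
Proof.
move=> e0 pc; have pn : \forall t \near x, psi t = cst c t.
  apply/nbhs_ballP; exists e => //= t; rewrite -ball_normE /ball_ /=; exact: pc.
by rewrite (@near_eq_derive R (R3 R) R psi (cst c) x v pn) derive_cst.
Qed.

Lemma L2_mulfield psi u k : testf psi -> L2_3 (u k) -> L2_3 (mulfield psi u k).
Proof. exact: L2_mult. Qed.

Lemma L2_mulcurl psi u g k : testf psi -> (forall j, L2_3 (u j)) -> (forall j, L2_3 (g j)) ->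
  L2_3 (mulcurl psi u g k).
Proof.
move=> tp Lu Lg; have tD j := test_derive (basis3 j) tp.
exact: (L2D (L2_mult tp (Lg k)) (L2B (L2_mult (tD (k + 1)) (Lu (k + 2))) (L2_mult (tD (k + 2)) (Lu (k + 1))))).
Qed.

(** The test function [psi * phi] is supported in [U] for every [phi], so cutting by [psi] turns an
    equation on [U] into one on the whole space. *)
Lemma wcurl_mul U (u g : 'I_3 -> R3 R -> R) psi : wcurl U u g -> test_function U psi ->
  (forall j, L2_3 (u j)) -> (forall j, L2_3 (g j)) ->
  wcurl setT (mulfield psi u) (mulcurl psi u g).
Proof.
move=> ug tpU Lu Lg phi tphi k.
have tp : testf psi := test_function_sub (@subsetT _ U) tpU.
have tD j := test_derive (basis3 j) tp.
have sp : smooth psi by case: tp.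
have sphi : smooth phi := test_function_smooth tphi.
have Lphi : L2_3 phi := (testf_L2c tphi).1.
have LDphi j : L2_3 ('D_(basis3 j) phi) := (testf_L2c (test_derive (basis3 j) tphi)).1.
have L1 := L2_mult tp (Lg k).
have L2 := L2_mult (tD (k + 1)) (Lu (k + 2)); have L3 := L2_mult (tD (k + 2)) (Lu (k + 1)).
have tpp : test_function U (fun x => psi x * phi x).
  have := test_mul tpU sphi; congr test_function; apply/funext => x; exact: mulrC.
have -> : ip3 (mulcurl psi u g k) phi = ip3 (fun x => psi x * g k x) phi
    + (ip3 (fun x => 'D_(basis3 (k + 1)) psi x * u (k + 2) x) phi
      - ip3 (fun x => 'D_(basis3 (k + 2)) psi x * u (k + 1) x) phi).
  by rewrite -(ip_Bl L2 L3 Lphi) -(ip_Dl L1 (L2B L2 L3) Lphi).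
rewrite !ip_mul (ug _ tpp k).
have E i j : ip3 (u i) ('D_(basis3 j) (fun x => psi x * phi x)) =
    ip3 (u i) (fun x => 'D_(basis3 j) psi x * phi x) + ip3 (mulfield psi u i) ('D_(basis3 j) phi).
  have -> : 'D_(basis3 j) (fun x => psi x * phi x) =
      (fun x => 'D_(basis3 j) psi x * phi x) + (fun x => psi x * 'D_(basis3 j) phi x).
    apply/funext => x; rewrite (derive_mul (smooth_derivable sp) (smooth_derivable sphi)).
    by rewrite addrC [phi x * _]mulrC.
  rewrite ip_sym (ip_Dl (L2_mult (tD j) Lphi) (L2_mult tp (LDphi j)) (Lu i)).
  congr (_ + _); first exact: ip_sym.
  by rewrite /mulfield ip_mul; exact: ip_sym.
have F i j : ip3 (mulfield psi u i) ('D_(basis3 j) phi) =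
  ip3 (u i) (fun x => psi x * 'D_(basis3 j) phi x) := ip_mul _ _ _.
rewrite !E !F.
by move: (ip3 _ _) (ip3 _ _) (ip3 _ _) (ip3 _ _) => *; ring.
Qed.

Lemma cyclic_sum (P : 'I_3 -> 'I_3 -> 'I_3 -> R) :
  \sum_k (P k (k + 1) (k + 2) - P k (k + 2) (k + 1)) =
  \sum_k (P (k + 1) (k + 2) k - P (k + 2) (k + 1) k).
Proof.
have [E1 E2 E3 E4] : [/\ 1 + 1 = 2 :> 'I_3, 1 + 2 = 0 :> 'I_3, 2 + 1 = 0 :> 'I_3 & 2 + 2 = 1 :> 'I_3].
  by split; exact/val_inj.
by rewrite !sum3 !E1 !E2 !E3 !E4 !add0r; ring.
Qed.

(** The derivatives of [p] serve as test functions, and the mixed second derivatives cancel in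
    pairs. *)
Lemma curl_grad U (w g : 'I_3 -> R3 R -> R) p : wcurl U w g -> test_function U p ->
  \sum_k ip3 (g k) ('D_(basis3 k) p) = 0.
Proof.
move=> wg tp; have sp := test_function_smooth tp.
under eq_bigr => k _ do rewrite (wg _ (test_derive (basis3 k) tp) k).
rewrite -(cyclic_sum (fun i j k => ip3 (w i) ('D_(basis3 j) ('D_(basis3 k) p)))).
have aux (v A B : R3 R -> R) : A = B -> ip3 v A - ip3 v B = 0 by move=> ->; rewrite subrr.
by apply: big1 => k _; apply: aux; exact: (smooth_schwarz (basis3 (k + 1)) (basis3 (k + 2)) sp).
Qed.

(** A uniform interior cone condition near [x0]. The margin proportional to the shell size keeps a
    convolution supported at positive distance from the complement of [D], hence makes it a test
    function in [D]. *)
Definition cone_at (D : set (R3 R)) (W : 'I_3 -> R3 R) (x0 : R3 R) : Prop :=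
  exists (m0 : nat) (r d : R), [/\ 0 < r, 0 < d &
    forall y m a x, D y -> `|y - x0| < r -> (m0 <= m)%N -> in_shell m a ->
      `|x - (y + \sum_k a k *: W k)| < d * 2^-1 ^+ m -> D x].

Lemma near_supp_test (U : set (R3 R)) (p : R3 R -> R) (e : R) : testf p -> 0 < e ->
  (forall x y, p y != 0 -> `|x - y| < e -> U x) -> test_function U p.
Proof.
move=> [sp cp _] e0 H; split=> // x /(_ (ball x e) (nbhsx_ballx x e e0)) [y [/= py]].
by rewrite -ball_normE /ball_ /= => /(H x y py).
Qed.

Lemma compact_closure (D : set (R3 R)) : bounded_set D -> compact (closure D).
Proof.
move=> [M [_ HM]]; pose M' : R := `|M| + 1.
have MM : M < M' by rewrite /M'; have := ler_norm M; lra.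
apply: (@subclosed_compact _ (closure D) [set x : R3 R | `|x - 0| <= M']).
- exact: closed_closure.
- exact: compact_cube.
have cl : closed [set x : R3 R | `|x - 0| <= M'].
  apply: compact_closed; [exact: norm_hausdorff|exact: compact_cube].
by rewrite [X in _ `<=` X]((closure_id _).1 cl); apply: closureS => x /(HM M' MM) /= h; rewrite subr0.
Qed.

(** The filter generated by the lists containing a given finite list turns the filter form of
    compactness into the extraction of a finite subcover. *)
Lemma finite_cover (A : set (R3 R)) (r : R3 R -> R) : compact A -> (forall y, A y -> 0 < r y) ->
  exists s : seq (R3 R), (forall x, x \in s -> A x) /\
    forall x, A x -> exists2 y, y \in s & `|x - y| < r y.
Proof.
move=> /compact_near_coveringP cA r0.
pose F : set_system (seq (R3 R)) := [set S | exists s0 : seq (R3 R), (forall x, x \in s0 -> A x) /\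
  forall s : seq (R3 R), {subset s0 <= s} -> S s].
have FF : Filter F.
  split.
  - by exists [::].
  - move=> P Q [s1 [A1 H1]] [s2 [A2 H2]]; exists (s1 ++ s2); split.
      by move=> x; rewrite mem_cat => /orP[/A1|/A2].
    move=> s ss; split; [apply: H1|apply: H2] => x xs; apply: ss; rewrite mem_cat xs ?orbT//.
  - by move=> P Q PQ [s1 [A1 H1]]; exists s1; split=> // s /H1 /PQ.
have := cA _ F (fun s x => exists2 y, y \in s & `|x - y| < r y) FF; case.
  move=> x Ax; exists (ball x (r x), [set s : seq (R3 R) | x \in s]).
    split; first exact: (nbhsx_ballx x _ (r0 x Ax)).
    exists [:: x]; split=> [y|s /(_ x (mem_head _ _))]//.
    by rewrite inE => /eqP ->.
  move=> [x' s] /= [xx' xs]; exists x => //.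
  by move: xx'; rewrite -ball_normE /ball_ /= distrC.
move=> s0 [A0 H0]; exists s0; split=> // x Ax; exact: (H0 s0 _ x Ax).
Qed.

Section Green.
Variables (W : 'I_3 -> R3 R) (K : nat -> 'I_3 -> R3 R -> R) (rho : nat -> R3 R -> R) (C : R).
Hypothesis ck : cone_kernel W K rho C.

(** The mollifier [rho N] is carried by the cone, so it pushes the support of [z] inside [Om] and
    makes it a test field for the equation of [v]. For such fields Green's formula is the definition
    of the weak curl; then [N] tends to infinity. *)
Lemma green_local (Om : set (R3 R)) x0 : cone_at Om W x0 -> exists2 r : R, 0 < r &
  forall z cz v cv : 'I_3 -> R3 R -> R,
  (forall j, L2c (z j)) -> (forall j, L2c (cz j)) -> (forall j, L2_3 (v j)) ->
  (forall j, L2_3 (cv j)) ->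
  wcurl setT z cz -> wcurl Om v cv ->
  (forall j x, z j x != 0 -> Om x /\ `|x - x0| < r) ->
  \sum_k ip3 (cz k) (v k) = \sum_k ip3 (z k) (cv k).
Proof.
move=> [m0 [r [d [r0 d0 Hc]]]]; exists r => // z cz v cv Lz Lcz Lv Lcv wz wv zs.
have Lr N j : L2_3 (conv (rho N) (z j)) := (young (ck_rho ck N) (Lz j)).1.
have Lrc N j : L2_3 (conv (rho N) (cz j)) := (young (ck_rho ck N) (Lcz j)).1.
have key N : (m0 <= N)%N ->
    \sum_k ip3 (conv (rho N) (cz k)) (v k) = \sum_k ip3 (conv (rho N) (z k)) (cv k).
  move=> m0N.
  have tphi j : test_function Om (conv (rho N) (z j)).
    apply: (@near_supp_test _ _ (d * 2^-1 ^+ N)).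
    - by apply: conv_testf => //; exact: (ck_rho ck).
    - by rewrite mulr_gt0// exprn_gt0.
    move=> x y /eqP cy xy.
    have [a Ha /eqP za] : exists2 a, in_shell N a & z j (y - \sum_k a k *: W k) != 0.
      apply: contrapT => H; apply: cy; apply: (conv_rho_eq0 ck (m := N)) => a Ha.
      by apply/eqP; apply: contrapT => /negP h; apply: H; exists a.
    have /zs[h1 h2] : z j (y - \sum_k a k *: W k) != 0 by exact/eqP.
    by apply: (Hc _ N a x h1 h2 m0N Ha); rewrite subrK.
  have sr : smooth (rho N) by case: (ck_rho ck N).
  have Ec k : conv (rho N) (cz k) =
      'D_(basis3 (k + 1)) (conv (rho N) (z (k + 2))) - 'D_(basis3 (k + 2)) (conv (rho N) (z (k + 1))).
    apply/funext => x.
    rewrite (curl_conv k wz (fun j => (Lz j).1) sr (refl_testf x (ck_rho ck N))).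
    rewrite -[RHS]/('D_(basis3 (k + 1)) (conv (rho N) (z (k + 2))) x
                    - 'D_(basis3 (k + 2)) (conv (rho N) (z (k + 1))) x).
    by rewrite !(conv_derive x _ (ck_rho ck N) (Lz _)).2.
  have LD i j : L2_3 ('D_(basis3 i) (conv (rho N) (z j))).
    exact: (testf_L2c (test_derive (basis3 i) (test_function_sub (@subsetT _ Om) (tphi j)))).1.
  have E2 k : ip3 (conv (rho N) (cz k)) (v k) =
      ip3 (v k) ('D_(basis3 (k + 1)) (conv (rho N) (z (k + 2))))
      - ip3 (v k) ('D_(basis3 (k + 2)) (conv (rho N) (z (k + 1)))).
    by rewrite Ec (ip_Bl (LD _ _) (LD _ _) (Lv k)); congr (_ - _); exact: ip_sym.
  have E3 k : ip3 (conv (rho N) (z k)) (cv k) =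
      ip3 (v (k + 1)) ('D_(basis3 (k + 2)) (conv (rho N) (z k)))
      - ip3 (v (k + 2)) ('D_(basis3 (k + 1)) (conv (rho N) (z k))).
    by rewrite -(wv _ (tphi k) k); exact: ip_sym.
  under eq_bigr => k _ do rewrite E2.
  under [RHS]eq_bigr => k _ do rewrite E3.
  exact: (cyclic_sum (fun i j k => ip3 (v i) ('D_(basis3 j) (conv (rho N) (z k))))).
suff H (e : R) : 0 < e -> `|\sum_k ip3 (cz k) (v k) - \sum_k ip3 (z k) (cv k)| <= e.
  by apply/eqP; rewrite -subr_eq0 -normr_le0; apply/ler_addgt0Pr => e e0; rewrite add0r; exact: H.
move=> e0.
pose S := \sum_k nrm3 (v k) + \sum_k nrm3 (cv k).
have S1 : 0 <= \sum_k nrm3 (v k) by apply: sumr_ge0 => k _; exact: nrm_ge0.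
have S2 : 0 <= \sum_k nrm3 (cv k) by apply: sumr_ge0 => k _; exact: nrm_ge0.
have Sp : 0 < S + 1 by apply: ltr_wpDl => //; exact: addr_ge0.
have e0' : 0 < e / (S + 1) by exact: divr_gt0.
have /choice[N1 HN1] k := rho_approx ck (Lz k) e0'.
have /choice[N2 HN2] k := rho_approx ck (Lcz k) e0'.
pose N := maxn m0 (maxn (\max_k N1 k) (\max_k N2 k)).
have h1 k : nrm3 (z k - conv (rho N) (z k)) <= e / (S + 1).
  apply: HN1; apply: leq_trans (leq_maxr _ _); apply: leq_trans (leq_maxl _ _); exact: leq_bigmax.
have h2 k : nrm3 (cz k - conv (rho N) (cz k)) <= e / (S + 1).
  apply: HN2; apply: leq_trans (leq_maxr _ _); apply: leq_trans (leq_maxr _ _); exact: leq_bigmax.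
have -> : \sum_k ip3 (cz k) (v k) - \sum_k ip3 (z k) (cv k) =
    \sum_k ip3 (cz k - conv (rho N) (cz k)) (v k) - \sum_k ip3 (z k - conv (rho N) (z k)) (cv k).
  have F1 k : ip3 (cz k - conv (rho N) (cz k)) (v k) = ip3 (cz k) (v k) - ip3 (conv (rho N) (cz k)) (v k).
    exact: (ip_Bl (Lcz k).1 (Lrc N k) (Lv k)).
  have F2 k : ip3 (z k - conv (rho N) (z k)) (cv k) = ip3 (z k) (cv k) - ip3 (conv (rho N) (z k)) (cv k).
    exact: (ip_Bl (Lz k).1 (Lr N k) (Lcv k)).
  under [X in _ = X - _]eq_bigr do rewrite F1.
  under [X in _ = _ - X]eq_bigr do rewrite F2.
  by rewrite !sumrB (key N (leq_maxl _ _)); move: (\sum_k _) (\sum_k _) (\sum_k _) => *; ring.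
apply: le_trans (ler_normB _ _) _.
apply: (@le_trans _ _ (e / (S + 1) * (\sum_k nrm3 (v k)) + e / (S + 1) * (\sum_k nrm3 (cv k)))).
  apply: lerD; rewrite mulr_sumr; apply: le_trans (ler_norm_sum _ _ _) _; apply: ler_sum => k _.
    apply: le_trans (ip_nrm (L2B (Lcz k).1 (Lrc N k)) (Lv k)) _.
    by rewrite ler_wpM2r ?nrm_ge0//; exact: h2.
  apply: le_trans (ip_nrm (L2B (Lz k).1 (Lr N k)) (Lcv k)) _.
  by rewrite ler_wpM2r ?nrm_ge0//; exact: h1.
rewrite -mulrDr -/S mulrAC ler_pdivrMr//.
by rewrite ler_wpM2l ?(ltW e0)// lerDl.
Qed.

End Green.

(* Cutting [w] by a finite family of bumps whose complements have a vanishing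
   product reduces Green's formula to fields supported near a point. *)
Lemma green (Om : set (R3 R)) : bounded_set Om ->
  (forall x0, closure Om x0 -> exists W K rho C, cone_kernel W K rho C /\ cone_at Om W x0) ->
  forall w cw v cv : 'I_3 -> R3 R -> R,
  (forall j, L2_3 (w j)) -> (forall j, L2_3 (cw j)) -> (forall j, L2_3 (v j)) ->
  (forall j, L2_3 (cv j)) -> wcurl setT w cw -> wcurl Om v cv ->
  (forall j x, ~ Om x -> w j x = 0) -> (forall j x, ~ Om x -> cw j x = 0) ->
  \sum_k ip3 (cw k) (v k) = \sum_k ip3 (w k) (cv k).
Proof.
move=> bOm HC w cw v cv Lw Lcw Lv Lcv wcw wcv wOm cwOm.
have cOm := compact_closure bOm.
pose good (x0 : R3 R) (r : R) := 0 < r /\ forall z cz, (forall j, L2c (z j)) ->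
   (forall j, L2c (cz j)) -> wcurl setT z cz ->
   (forall j x, z j x != 0 -> Om x /\ `|x - x0| < r) ->
   \sum_k ip3 (cz k) (v k) = \sum_k ip3 (z k) (cv k).
have /choice[r Hr] (x0 : R3 R) : exists r : R, closure Om x0 -> good x0 r.
  have [c|c] := pselect (closure Om x0); last by exists 0.
  have [W [K [rho [C [ck ca]]]]] := HC x0 c.
  have [r r0 H] := green_local ck ca; exists r => _; split=> // z cz Lz Lcz wz sz.
  exact: H.
have [s [sOm sC]] : exists s : seq (R3 R), (forall x, x \in s -> closure Om x) /\
    forall x, closure Om x -> exists2 y, y \in s & `|x - y| < r y / 2.
  have r20 y : closure Om y -> 0 < r y / 2 by move=> /Hr[? _]; lra.
  exact: (finite_cover cOm r20).
pose G (z cz : 'I_3 -> R3 R -> R) := \sum_k ip3 (cz k) (v k) - \sum_k ip3 (z k) (cv k).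
suff : G w cw = 0 by move/eqP; rewrite subr_eq0 => /eqP.
(* Induction on the centres: the fields and their curls vanish off the balls still listed.
   Subtracting the part cut by the bump at [y] clears the ball of [y], where this bump is 1 with
   zero gradient. *)
have main : forall s' : seq (R3 R), (forall x, x \in s' -> closure Om x) ->
    forall w cw : 'I_3 -> R3 R -> R,
    (forall j, L2_3 (w j)) -> (forall j, L2_3 (cw j)) -> wcurl setT w cw ->
    (forall j x, ~ Om x -> w j x = 0) -> (forall j x, ~ Om x -> cw j x = 0) ->
    (forall x, Om x -> (exists2 y, y \in s' & `|x - y| < r y / 2) \/
       ((forall j, w j x = 0) /\ (forall j, cw j x = 0))) -> G w cw = 0.
  elim=> [_|y s' IH ys'] w' cw' Lw' Lcw' wcw' wO cwO cov.
    rewrite /G !big1 ?subr0// => k _; apply: ip_disjoint => x.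
      have [Ox|Ox] := pselect (Om x); last by rewrite wO// mul0r.
      by case: (cov x Ox) => [[]//|[-> _]]; rewrite mul0r.
    have [Ox|Ox] := pselect (Om x); last by rewrite cwO// mul0r.
    by case: (cov x Ox) => [[]//|[_ ->]]; rewrite mul0r.
  have [ry Hy] := Hr y (ys' y (mem_head _ _)).
  pose psi := bump y (r y / 2); have r2 : 0 < r y / 2 by lra.
  have tp : testf psi by exact: bump_test.
  have Lz j := L2_mulfield tp (Lw' j); have Lcz k := L2_mulcurl k tp Lw' Lcw'.
  have wz := wcurl_mul wcw' tp Lw' Lcw'.
  have bO f : (forall x : R3 R, ~ Om x -> f x = 0 :> R) -> bsupp f.
    have [M [_ HM]] := bOm => fO; exists (`|M| + 1) => x xM; apply: fO => Ox.
    have MM : M < `|M| + 1 by have := ler_norm M; lra.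
    by have := HM _ MM x Ox; rewrite /= leNgt xM.
  have zO j x : ~ Om x -> mulfield psi w' j x = 0 by move=> Ox; rewrite /mulfield wO// mulr0.
  have czO k x : ~ Om x -> mulcurl psi w' cw' k x = 0.
    by move=> Ox; apply: mulcurl_eq0 => [j|]; [exact: wO|exact: cwO].
  have E1 : G (mulfield psi w') (mulcurl psi w' cw') = 0.
    apply/eqP; rewrite subr_eq0; apply/eqP; apply: Hy => //.
    - by move=> j; split=> //; apply: bO; exact: zO.
    - by move=> j; split=> //; apply: bO; exact: czO.
    move=> j x; rewrite /mulfield mulf_eq0 negb_or => /andP[px wx]; split.
      by apply: contrapT => Ox; rewrite wO ?eqxx in wx.
    rewrite ltNge; apply/negP => h; move: px; rewrite /psi bump_eq0 ?eqxx//; lra.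
  pose w2 j := w' j - mulfield psi w' j; pose cw2 k := cw' k - mulcurl psi w' cw' k.
  have E2 : G w2 cw2 = 0.
    apply: IH.
    - by move=> x xs; apply: ys'; rewrite inE xs orbT.
    - by move=> j; exact: L2B.
    - by move=> j; exact: L2B.
    - move=> phi tphi k.
      have Lphi := (testf_L2c tphi).1; have LD j := (testf_L2c (test_derive (basis3 j) tphi)).1.
      rewrite (ip_Bl (Lcw' k) (Lcz k) Lphi) !(ip_Bl (Lw' _) (Lz _) (LD _)) (wcw' _ tphi k) (wz _ tphi k).
      by move: (ip3 _ _) (ip3 _ _) (ip3 _ _) (ip3 _ _) => *; ring.
    - by move=> j x Ox; rewrite -[LHS]/(w' j x - mulfield psi w' j x) wO// zO// subr0.
    - by move=> j x Ox; rewrite -[LHS]/(cw' j x - mulcurl psi w' cw' j x) cwO// czO// subr0.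
    move=> x Ox; case: (cov x Ox) => [[y']|[h1 h2]].
      rewrite inE => /orP[/eqP ->|y's] xy; last by left; exists y'.
      right; have p1 : psi x = 1 by apply: bump_eq1 => //; exact: ltW.
      have D0 j : 'D_(basis3 j) psi x = 0.
        apply: (@near_cst_derive _ 1 _ _ (r y / 2 - `|x - y|)); first lra.
        move=> t xt; apply: bump_eq1 => //.
        have := ler_distD x t y; rewrite (distrC t x).
        lra.
      split=> j.
        by rewrite -[LHS]/(w' j x - psi x * w' j x) p1 mul1r subrr.
      rewrite -[LHS]/(cw' j x - mulcurl psi w' cw' j x).
      by rewrite (mulcurl_const _ _ _ p1 D0) mul1r subrr.
    right; split=> j.
      by rewrite -[LHS]/(w' j x - psi x * w' j x) h1 mulr0 subrr.
    by rewrite -[LHS]/(cw' j x - mulcurl psi w' cw' j x) h2 mulcurl_eq0// subrr.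
  have : G w2 cw2 = G w' cw' - G (mulfield psi w') (mulcurl psi w' cw').
    rewrite /G.
    have F1 k : ip3 (cw2 k) (v k) = ip3 (cw' k) (v k) - ip3 (mulcurl psi w' cw' k) (v k).
      exact: (ip_Bl (Lcw' k) (Lcz k) (Lv k)).
    have F2 k : ip3 (w2 k) (cv k) = ip3 (w' k) (cv k) - ip3 (mulfield psi w' k) (cv k).
      exact: (ip_Bl (Lw' k) (Lz k) (Lcv k)).
    under [X in X - _ = _]eq_bigr do rewrite F1.
    under [X in _ - X = _]eq_bigr do rewrite F2.
    by rewrite !sumrB; move: (\sum_k _) (\sum_k _) (\sum_k _) (\sum_k _) => *; ring.
  by rewrite E2 E1 subr0 => <-.
apply: (main s) => // x Ox; left; apply: sC; exact: subset_closure.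
Qed.

End CurlCalculus.

(** * Maxwell's system for the real components *)

Section RealMaxwell.
Context {R : realType}.
Notation T3 := (measurableTypeR R * measurableTypeR R * measurableTypeR R)%type.
Notation L2_3 := (@L2 _ T3 R leb3).
Notation ip3 := (@ip _ T3 R leb3).
Notation nrm3 := (@nrm _ T3 R leb3).
Notation testf := (@test_function R R setT).
Variables (Om Omm : set (R3 R)) (a : bool -> R) (hb : bool).
Hypothesis mOmm : measurable (Omm : set T3).

(* [u h c] is the real ([c = false]) or imaginary ([c = true]) part of the
   electric ([h = false]) or magnetic ([h = true]) field, and [hb] tells which
   of the two has no tangential trace on the boundary of [Om], that is, has its
   curl on the whole space after extension by zero. *)
Definition fields := bool -> bool -> 'I_3 -> R3 R -> R.

(** The signs of multiplication by i in the curl of E and by -i in the curl of H, written on real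
    and imaginary parts; both multiplications exchange the two parts. *)
Definition sgn (h c : bool) : R := if h == c then -1 else 1.

Definition rhs (s : R) (u f : fields) (h c : bool) (k : 'I_3) : R3 R -> R :=
  (if h then s else 0) *: res Omm (u false c k)
  + (sgn h c * a h) *: u (~~ h) (~~ c) k + f h c k.

Definition dom (h : bool) : set (R3 R) := if h == hb then setT else Om.

Definition msys (s : R) (f u : fields) : Prop :=
  forall h c, wcurl (dom h) (u h c) (rhs s u f h c).

Definition L2f (u : fields) := forall h c k, L2_3 (u h c k).

Lemma ip_subr (v w z : R3 R -> R) : L2_3 v -> L2_3 w -> L2_3 z ->
  ip3 z (v - w) = ip3 z v - ip3 z w.
Proof. by move=> Lv Lw Lz; rewrite ip_sym (ip_Bl Lv Lw Lz); congr (_ - _); exact: ip_sym. Qed.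

Lemma normr_sgn h c : `|sgn h c| = 1.
Proof. by rewrite /sgn; case: (h == c); rewrite ?normrN normr1. Qed.

Lemma L2_rhs s u f h c k : L2f u -> L2f f -> L2_3 (rhs s u f h c k).
Proof.
move=> Lu Lf; apply: L2D; [apply: L2D; apply: L2Z|exact: Lf]; last exact: Lu.
by apply: L2_res => //; exact: Lu.
Qed.

Lemma ip_rhs s u f h c k v : L2f u -> L2f f -> L2_3 v ->
  ip3 (rhs s u f h c k) v = (if h then s else 0) * ip3 (res Omm (u false c k)) v
    + sgn h c * a h * ip3 (u (~~ h) (~~ c) k) v + ip3 (f h c k) v.
Proof.
move=> Lu Lf Lv; have Lr : L2_3 (res Omm (u false c k)) by apply: L2_res => //; exact: Lu.
rewrite (ip_Dl (L2D (L2Z _ Lr) (L2Z _ (Lu _ _ _))) (Lf h c k) Lv).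
by rewrite (ip_Dl (L2Z _ Lr) (L2Z _ (Lu _ _ _)) Lv) !ip_Zl.
Qed.

(** * Decay of one field near a point, for abstract cutoffs *)

Section Local.
Variables (W : 'I_3 -> R3 R) (K : nat -> 'I_3 -> R3 R -> R) (rho : nat -> R3 R -> R) (C : R).
Hypothesis ck : cone_kernel W K rho C.
Variables (F : set_system nat) (q : nat -> R) (u f : nat -> fields) (h : bool).
Hypothesis PF : ProperFilter F.
Hypothesis q1 : forall n, 1 <= q n.
Hypothesis Lu : forall n, L2f (u n).
Hypothesis Lf : forall n, L2f (f n).
Hypothesis u1 : forall n h c k, nrm3 (u n h c k) <= 1.
Hypothesis f1 : forall n h c k, nrm3 (f n h c k) <= 1.
Hypothesis d1 : forall n c k, q n * nrm3 (res Omm (u n false c k)) <= 1.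
Hypothesis uO : forall n h c k x, ~ Om x -> u n h c k x = 0.
Hypothesis weak : forall h c k v, L2_3 v -> ip3 v (u n h c k) @[n --> F] --> (0 : R).
Hypothesis diss : forall c k, q n * nrm3 (res Omm (u n false c k)) @[n --> F] --> (0 : R).
Hypothesis f0 : forall h c k, nrm3 (f n h c k) @[n --> F] --> (0 : R).
Hypothesis sys : forall n, msys (q n ^+ 2) (f n) (u n).
Hypothesis a0 : forall h, 0 < a h.

(** [psi n] is the cutoff and [chi] its value off [Omm]. Its gradient may grow like [q n] inside
    [Omm], where the electric field is of size [1 / q n]. By [blind], the shells from [m0] to [M n]
    seen from [Omm] meet only zeros of the cutoff; [Mq] puts the first other shell at scale
    [1 / q n]; [supp] keeps the potential in the domain where the equation of the other field may be
    tested. *)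
Variables (chi : R3 R -> R) (psi : nat -> R3 R -> R) (B d r0 : R) (m0 : nat) (M : nat -> nat).
Hypothesis tchi : testf chi.
Hypothesis tpsi : forall n, test_function (dom h) (psi n).
Hypothesis psi1 : forall n x, `|psi n x| <= 1.
Hypothesis chi1 : forall x, `|chi x| <= 1.
Hypothesis psichi : forall n x, ~ Omm x -> psi n x = chi x.
Hypothesis Dpsi1 : forall n k x, ~ Omm x -> `|'D_(basis3 k) (psi n) x| <= B.
Hypothesis Dpsi2 : forall n k x, `|'D_(basis3 k) (psi n) x| <= B * q n.
Hypothesis magn : h -> forall n x, psi n = chi /\
  (Omm x -> chi x = 0 /\ forall k, 'D_(basis3 k) chi x = 0).
Hypothesis psir : forall n x, r0 < `|x| -> psi n x = 0 /\ forall k, 'D_(basis3 k) (psi n) x = 0.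
Hypothesis m0M : forall n, (m0 < M n)%N.
Hypothesis Mq : forall n, 2^-1 ^+ M n * q n <= B.
Hypothesis blind : \forall n \near F, forall x m b, Omm x -> (m0 <= m < M n)%N -> in_shell m b ->
  psi n (x - \sum_k b k *: W k) = 0 /\
  forall k, 'D_(basis3 k) (psi n) (x - \sum_k b k *: W k) = 0.
Hypothesis d0 : 0 < d.
Hypothesis supp : forall n y m b x, psi n y != 0 -> Om y -> (m0 <= m)%N -> in_shell m b ->
  `|x - (y + \sum_k b k *: W k)| < d * 2^-1 ^+ m -> dom (~~ h) x.

Let ps n : testf (psi n) := test_function_sub (@subsetT _ (dom h)) (tpsi n).

Lemma B_ge0 : 0 <= B.
Proof.
have := Dpsi2 0 0 0; have := q1 0; move: (normr_ge0 ('D_(basis3 0) (psi 0) 0)).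
move=> h0 h1 h2; have := le_trans h0 h2; rewrite pmulr_lge0//; lra.
Qed.

(** Off [Omm] the gradient of the cutoff is bounded; inside, its growth [q n] is compensated by the
    bound [d1] on the electric field. A magnetic field is only cut by a [chi] that is flat on
    [Omm]. *)
Lemma local_grad_bound n c k j :
  nrm3 (fun x => 'D_(basis3 j) (psi n) x * u n h c k x) <= 2 * B.
Proof.
have B0 := B_ge0; have tD := test_derive (basis3 j) (ps n).
have mD := testf_measurable tD.
set g := 'D_(basis3 j) (psi n); set v := u n h c k; have Lv : L2_3 v by exact: Lu.
have Lvc : L2_3 (res (~` Omm) v) by apply: L2_res => //; exact: measurableC.
have Lvm : L2_3 (res Omm v) by exact: L2_res.
have E : (fun x => g x * v x) = (fun x => g x * res (~` Omm) v x) + (fun x => g x * res Omm v x).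
  apply/funext => x; rewrite -[RHS]/(g x * res (~` Omm) v x + g x * res Omm v x) -mulrDr; congr (_ * _).
  have [ox|ox] := pselect (Omm x); first by rewrite (res_in _ ox) res_out ?add0r//= => /(_ ox).
  by rewrite (res_out _ ox) res_in ?addr0.
have mm (w : R3 R -> R) : L2_3 w -> measurable_fun setT ((fun x => g x * w x) : T3 -> R).
  by move=> [mw _]; exact: measurable_funM.
have b1 x : `|g x * res (~` Omm) v x| <= `|(B *: v) x|.
  rewrite -[X in _ <= `|X|]/(B * v x) (normrM (g x)) (normrM B) (ger0_norm B0).
  have [ox|ox] := pselect (Omm x).
    by rewrite res_out ?normr0 ?mulr0 ?mulr_ge0//= => /(_ ox).
  by rewrite (res_in _ ox) ler_wpM2r//; exact: Dpsi1.
have b2 x : `|g x * res Omm v x| <= `|((if h then 0 else B * q n) *: res Omm v) x|.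
  rewrite -[X in _ <= `|X|]/(_ * res Omm v x) (normrM (g x)) (normrM _ (res Omm v x)).
  have [ox|ox] := pselect (Omm x); last by rewrite res_out// normr0 !mulr0.
  rewrite ler_wpM2r//; have := magn; case: (h) => [/(_ isT n x) [E2 /(_ ox) [_ D0]]|_].
    by rewrite /g E2 D0 normr0.
  rewrite (ger0_norm (_ : 0 <= B * q n)) ?mulr_ge0//; first exact: Dpsi2.
  by have := q1 n; lra.
rewrite E; apply: le_trans (nrmD (L2_le (mm _ Lvc) b1 (L2Z _ Lv)) (L2_le (mm _ Lvm) b2 (L2Z _ Lvm))) _.
have -> : 2 * B = B + B by lra.
apply: lerD.
  apply: le_trans (nrm_le (mm _ Lvc) b1 (L2Z _ Lv)) _.
  by rewrite nrmZ// (ger0_norm B0) ler_piMr//; exact: u1.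
apply: le_trans (nrm_le (mm _ Lvm) b2 (L2Z _ Lvm)) _; rewrite nrmZ//.
rewrite /v; case: (h); first by rewrite normr0 mul0r.
rewrite ger0_norm; last by rewrite mulr_ge0//; have := q1 n; lra.
by rewrite -mulrA ler_piMr//; exact: d1.
Qed.

Let A : R := a h + 2 + 4 * B.

(** The conductivity term, which has no uniform bound, occurs only in the curl of the magnetic
    field, and there [chi] vanishes on [Omm]. *)
Lemma local_curl_bound n c k :
  nrm3 (mulcurl (psi n) (u n h c) (rhs (q n ^+ 2) (u n) (f n) h c) k) <= A.
Proof.
have B0 := B_ge0; have mp := testf_measurable (ps n).
have E : (fun x => psi n x * rhs (q n ^+ 2) (u n) (f n) h c k x) =
    (fun x => psi n x * ((sgn h c * a h) *: u n (~~ h) (~~ c) k + f n h c k) x).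
  apply/funext => x.
  suff : psi n x * ((if h then q n ^+ 2 else 0) * res Omm (u n false c k) x) = 0.
    move=> z; rewrite -[rhs _ _ _ _ _ _ x]/((if h then q n ^+ 2 else 0) * res Omm (u n false c k) x
       + (sgn h c * a h) * u n (~~ h) (~~ c) k x + f n h c k x).
    rewrite -[((sgn h c * a h) *: u n (~~ h) (~~ c) k + f n h c k) x]/((sgn h c * a h) * u n (~~ h) (~~ c) k x + f n h c k x).
    by rewrite -addrA mulrDr z add0r.
  have [ox|ox] := pselect (Omm x); last by rewrite res_out// !mulr0.
  have := magn; case: (h) => [/(_ isT n x) [-> /(_ ox) [-> _]]|_]; first by rewrite mul0r.
  by rewrite mul0r mulr0.
have Lw : L2_3 ((sgn h c * a h) *: u n (~~ h) (~~ c) k + f n h c k).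
  by apply: L2D; [apply: L2Z; exact: Lu|exact: Lf].
have L1 := L2_mult (ps n) (L2_rhs (q n ^+ 2) h c k (Lu n) (Lf n)).
have LD i j : L2_3 (fun x => 'D_(basis3 i) (psi n) x * u n h c j x).
  by apply: L2_mult; [exact: test_derive|exact: Lu].
apply: le_trans (nrmD L1 (L2B (LD _ _) (LD _ _))) _.
have h1 : nrm3 (fun x => psi n x * rhs (q n ^+ 2) (u n) (f n) h c k x) <= a h + 1.
  rewrite E; apply: le_trans (nrm_mulb mp (psi1 n) Lw).2 _; rewrite mul1r.
  apply: le_trans (nrmD (L2Z _ (Lu _ _ _ _)) (Lf _ _ _ _)) _.
  rewrite nrmZ ?normrM ?normr_sgn ?mul1r; last exact: Lu.
  apply: lerD; last exact: f1.
  by rewrite (gtr0_norm (a0 h)) ler_piMr ?(ltW (a0 h))//; exact: u1.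
have h2 := le_trans (nrmB (LD _ _) (LD _ _)) (lerD (local_grad_bound n c (k + 2) (k + 1)) (local_grad_bound n c (k + 1) (k + 2))).
by apply: le_trans (lerD h1 h2) _; rewrite /A; lra.
Qed.

(** The cutoffs vary with [n] only inside [Omm], where the electric field tends to 0 strongly;
    elsewhere the fixed cutoff [chi] may be moved onto [v]. *)
Lemma local_weak c k v : L2_3 v ->
  ip3 v (mulfield (psi n) (u n h c) k) @[n --> F] --> (0 : R).
Proof.
move=> Lv; have Lcv := L2_mult tchi Lv.
have Lpv n : L2_3 (fun x => psi n x * v x) := L2_mult (ps n) Lv.
have E n : ip3 v (mulfield (psi n) (u n h c) k) = ip3 (fun x => chi x * v x) (u n h c k)
    + ip3 ((fun x => psi n x * v x) - (fun x => chi x * v x)) (u n h c k).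
  rewrite (ip_Bl (Lpv n) Lcv (Lu _ _ _ _)) addrC subrK ip_mul.
  by congr Rintegral.
have small n : `|ip3 ((fun x => psi n x * v x) - (fun x => chi x * v x)) (u n h c k)|
    <= 2 * nrm3 v * (q n * nrm3 (res Omm (u n false c k))).
  set w := (fun x => psi n x * v x) - (fun x => chi x * v x).
  have Lw : L2_3 w by exact: L2B.
  have wx x : w x = (psi n x - chi x) * v x by rewrite -[LHS]/(psi n x * v x - chi x * v x) mulrBl.
  have := magn; have qn := q1 n; have Lm : L2_3 (res Omm (u n false c k)) by apply: L2_res => //; exact: Lu.
  case: (h) => [/(_ isT n) E2|_].
    have w0 : ip3 w (u n true c k) = 0.
      by apply: ip_disjoint => x; rewrite wx (E2 x).1 subrr !mul0r.
    by rewrite w0 normr0 !mulr_ge0 ?nrm_ge0//; lra.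
  have -> : ip3 w (u n false c k) = ip3 w (res Omm (u n false c k)).
    congr Rintegral; apply/funext => x; have [ox|ox] := pselect (Omm x); first by rewrite res_in.
    by rewrite wx psichi// subrr !mul0r.
  apply: le_trans (ip_nrm Lw Lm) _.
  have w2 : nrm3 w <= 2 * nrm3 v.
    have wm : measurable_fun setT (w : T3 -> R) by case: Lw.
    have le x : `|w x| <= `|(2 *: v) x|.
      rewrite wx -[X in _ <= `|X|]/(2 * v x) !normrM ler_wpM2r// (ger0_norm (ler0n R 2)).
      by apply: le_trans (ler_normB _ _) _; have := psi1 n x; have := chi1 x; lra.
    by apply: le_trans (nrm_le wm le (L2Z _ Lv)) _; rewrite nrmZ// ger0_norm.
  apply: ler_pM => //; rewrite ?nrm_ge0// ler_peMl// nrm_ge0//.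
have -> : (fun n => ip3 v (mulfield (psi n) (u n h c) k)) = (fun n => ip3 (fun x => chi x * v x) (u n h c k)
    + ip3 ((fun x => psi n x * v x) - (fun x => chi x * v x)) (u n h c k)) by apply/funext => n; exact: E.
have c2 : 2 * nrm3 v * (q n * nrm3 (res Omm (u n false c k))) @[n --> F] --> (0 : R).
  by rewrite -(mulr0 (2 * nrm3 v)); apply: cvgMr; exact: diss.
have c3 : ip3 ((fun x => psi n x * v x) - (fun x => chi x * v x)) (u n h c k) @[n --> F] --> (0 : R).
  apply/cvgrPdist_le => e e0; move/cvgrPdist_le: c2 => /(_ _ e0); apply: filterS => n.
  rewrite !sub0r !normrN => /(le_trans (ler_norm _)); exact: le_trans (small n).
by have := cvgD (weak h c k Lcv) c3; rewrite addr0; apply.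
Qed.

(** Write [psi u] as the gradient of [p] plus a small [r]. The curl of the other field contains a
    multiple of [u] and is orthogonal to this gradient, hence [u] paired with the gradient, and so
    with [psi u], is small up to the source and the conductivity term. *)
Lemma local_decay c :
  \sum_k ip3 (u n h c k) (mulfield (psi n) (u n h c) k) @[n --> F] --> (0 : R).
Proof.
have B0 := B_ge0; have C0 := ck_C0 ck; have A0 : 0 <= A by rewrite /A; have := a0 h; lra.
pose e n := mulfield (psi n) (u n h c).
pose g n := mulcurl (psi n) (u n h c) (rhs (q n ^+ 2) (u n) (f n) h c).
have Lrh n j : L2_3 (rhs (q n ^+ 2) (u n) (f n) h c j) by apply: L2_rhs.
have we n : wcurl setT (e n) (g n).
  by apply: wcurl_mul (tpsi n) _ _ => [|j|j]; [exact: sys|exact: Lu|exact: Lrh].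
have Le n j : L2_3 (e n j) by apply: L2_mulfield (ps n) _; exact: Lu.
have Lg n j : L2_3 (g n j) by apply: (L2_mulcurl _ (ps n)) => k; [exact: Lu|exact: Lrh].
have e1 n j : nrm3 (e n j) <= 1.
  apply: le_trans (nrm_mulb (testf_measurable (ps n)) (psi1 n) (Lu n h c j)).2 _.
  by rewrite mul1r; exact: u1.
have eg n j x : r0 < `|x| -> e n j x = 0 /\ g n j x = 0.
  move=> /(psir n)[p0 D0]; split; first by rewrite /e /mulfield p0 mul0r.
  by rewrite /g (mulcurl_const _ _ _ p0 D0) mul0r.
pose B' := (1 + 6 * C * A) * B; have B'0 : 0 <= B' by rewrite !mulr_ge0// addr_ge0// !mulr_ge0.
have FF : Filter F by exact: _.
apply/cvgrPdist_le => eps eps0.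
(* Each of the three components contributes an error [a hh * dd], and the sources with the
   conductivity term a fourth one. *)
pose dd : R := eps / 4; have dd0 : 0 < dd by rewrite /dd; lra.
pose hh := ~~ h; pose cc := ~~ c.
pose En n := \sum_k (nrm3 (f n hh cc k) * (1 + dd)
   + (q n * nrm3 (res Omm (u n false cc k))) * (1 + B')).
have cE : En n @[n --> F] --> (0 : R).
  apply: cvg0_sum => k; rewrite -(addr0 0); apply: cvgD.
    by rewrite -(mul0r (1 + dd)); apply: cvgMl; exact: f0.
  by rewrite -(mul0r (1 + B')); apply: cvgMl; exact: diss.
have Edd : \forall n \near F, En n <= a hh * dd.
  have ad : 0 < a hh * dd by rewrite mulr_gt0.
  move/cvgrPdist_le: cE => /(_ _ ad); apply: filterS => n; rewrite sub0r normrN.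
  exact: le_trans (ler_norm _).
have bnd n j : nrm3 (e n j) <= Num.max 1 A /\ nrm3 (g n j) <= Num.max 1 A.
  by rewrite !le_max e1 (local_curl_bound n c j) orbT.
have A1 : Num.max 1 A = A by apply/max_idPr; rewrite /A; have := a0 h; lra.
rewrite A1 in bnd.
have := @cone_compact R W K rho C ck F FF e g r0 A m0 M dd we (fun n j => conj (Le n j) (Lg n j)) eg bnd
  (fun j v Lv => local_weak c j Lv) m0M dd0.
apply: filterS3 Edd blind => n En_dd bl [p [tp [N sp] rp rpD]].
rewrite sub0r normrN.
(* [p] lives on shells shot from points of [Om] where [psi n] is nonzero; the shells stop before
   [N], so the margin of the last one serves for all. *)
have tpD : test_function (dom hh) p.
  apply: (@near_supp_test _ _ _ (d * 2^-1 ^+ N)) => //; first by rewrite mulr_gt0// exprn_gt0.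
  move=> x y /sp[j [m [b [/andP[m0m mN] Hb ey]]]] xy.
  move: ey; rewrite /e /mulfield mulf_eq0 negb_or => /andP[py uy].
  have Oy : Om (y - \sum_k b k *: W k) by apply: contrapT => Oy; rewrite uO ?eqxx in uy.
  apply: (supp py Oy m0m Hb); rewrite subrK; apply: lt_le_trans xy _.
  by rewrite ler_wpM2l ?(ltW d0)// ler_wiXn2l// ?invr_ge0// ?(ltnW mN)//; lra.
have LDp k : L2_3 ('D_(basis3 k) p) := (testf_L2c (test_derive (basis3 k) tp)).1.
pose r k := e n k - 'D_(basis3 k) p.
have Lr k : L2_3 (r k) by exact: L2B.
have blD := rpD Omm mOmm.
have {}blD k : nrm3 (res Omm (r k)) * q n <= B'.
  have := blD _ k; rewrite -/(r k) => H.
  apply: (@le_trans _ _ ((1 + 6 * C * A) * 2^-1 ^+ M n * q n)).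
    rewrite ler_wpM2r//; first by have := q1 n; lra.
    apply: H => x m b j ox mm Hb; have [p0 D0] := bl x m b ox mm Hb; split.
      by rewrite /e /mulfield p0 mul0r.
    by rewrite /g (mulcurl_const _ _ _ p0 D0) mul0r.
  by rewrite -mulrA ler_wpM2l// ?addr_ge0// ?mulr_ge0.
have Z := curl_grad (@sys n hh cc) tpD.
have Dn k : nrm3 ('D_(basis3 k) p) <= 1 + dd.
  have -> : 'D_(basis3 k) p = e n k - r k by rewrite /r opprB addrC subrK.
  by apply: le_trans (nrmB (Le n k) (Lr k)) _; apply: lerD => //; exact: rp.
have key k : `|ip3 (rhs (q n ^+ 2) (u n) (f n) hh cc k) ('D_(basis3 k) p)
      - sgn hh cc * a hh * ip3 (u n h c k) (e n k)| <=
    a hh * dd + (nrm3 (f n hh cc k) * (1 + dd) + (q n * nrm3 (res Omm (u n false cc k))) * (1 + B')).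
  rewrite (ip_rhs _ _ _ _ (Lu n) (Lf n) (LDp k)) /hh /cc !negbK -/hh -/cc.
  have -> : ip3 (u n h c k) ('D_(basis3 k) p) = ip3 (u n h c k) (e n k) - ip3 (u n h c k) (r k).
    rewrite -(ip_subr (Le n k) (Lr k) (Lu n h c k)); congr (ip3 _ _).
    by rewrite /r opprB addrC subrK.
  set X := ip3 (u n h c k) (e n k); set Y := ip3 (u n h c k) (r k).
  set Zt := (if hh then q n ^+ 2 else 0) * _; set V := ip3 (f n hh cc k) _.
  have -> : Zt + sgn hh cc * a hh * (X - Y) + V - sgn hh cc * a hh * X = - (sgn hh cc * a hh * Y) + (V + Zt) by ring.
  apply: le_trans (ler_normD _ _) _; apply: lerD.
    rewrite normrN !normrM normr_sgn mul1r (gtr0_norm (a0 hh)) ler_wpM2l ?(ltW (a0 hh))//.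
    apply: le_trans (ip_nrm (Lu n h c k) (Lr k)) _; rewrite -(mul1r dd).
    by apply: ler_pM; rewrite ?nrm_ge0//; exact: rp.
  apply: le_trans (ler_normD _ _) _; apply: lerD.
    apply: le_trans (ip_nrm (Lf n hh cc k) (LDp k)) _.
    by rewrite ler_wpM2l ?nrm_ge0.
  have qn : 0 <= q n by have := q1 n; lra.
  have dn : 0 <= q n * nrm3 (res Omm (u n false cc k)) * (1 + B').
    by rewrite !mulr_ge0 ?nrm_ge0 ?addr_ge0.
  rewrite /Zt; case Eh : hh; last by rewrite mul0r normr0.
  have hf : h = false by move: Eh; rewrite /hh; case: (h).
  have Lm : L2_3 (res Omm (u n false cc k)) by apply: L2_res => //; exact: Lu.
  rewrite ip_res2 normrM (ger0_norm (sqr_ge0 _)).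
  (* One factor [q n] goes to each side. The gradient is [e - r]: on [Omm], [q n] times [e] is
     bounded by [d1] and [q n] times [r] by blindness. The remaining factor, [q n] times the
     electric field on [Omm], tends to 0. *)
  have n1 : nrm3 (res Omm ('D_(basis3 k) p)) * q n <= 1 + B'.
    have -> : 'D_(basis3 k) p = e n k - r k by rewrite /r opprB addrC subrK.
    rewrite resB; have Lre : L2_3 (res Omm (e n k)) by exact: L2_res.
    have Lrr : L2_3 (res Omm (r k)) by exact: L2_res.
    apply: le_trans (ler_wpM2r qn (nrmB Lre Lrr)) _; rewrite mulrDl; apply: lerD => //.
    apply: le_trans (d1 n c k); rewrite mulrC ler_wpM2l//.
    have -> : res Omm (e n k) = (fun x => psi n x * res Omm (u n false c k) x).
      by apply/funext => x; rewrite /e hf /mulfield /res mulrCA.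
    have Lmc : L2_3 (res Omm (u n false c k)) by apply: L2_res => //; exact: Lu.
    by have := (nrm_mulb (testf_measurable (ps n)) (psi1 n) Lmc).2; rewrite mul1r.
  have LmD : L2_3 (res Omm ('D_(basis3 k) p)) by exact: L2_res.
  apply: le_trans (ler_wpM2l (sqr_ge0 _) (ip_nrm Lm LmD)) _.
  have -> : q n ^+ 2 * (nrm3 (res Omm (u n false cc k)) * nrm3 (res Omm ('D_(basis3 k) p))) =
     q n * nrm3 (res Omm (u n false cc k)) * (nrm3 (res Omm ('D_(basis3 k) p)) * q n).
    by move: (nrm3 _) (nrm3 _) => x1 x2; ring.
  by rewrite ler_wpM2l ?mulr_ge0 ?nrm_ge0.
have sum1 : `|\sum_k (sgn hh cc * a hh * ip3 (u n h c k) (e n k))| <= 3 * (a hh * dd) + En n.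
  have -> : \sum_k (sgn hh cc * a hh * ip3 (u n h c k) (e n k)) =
      - \sum_k (ip3 (rhs (q n ^+ 2) (u n) (f n) hh cc k) ('D_(basis3 k) p)
                - sgn hh cc * a hh * ip3 (u n h c k) (e n k)).
    by rewrite sumrB Z sub0r opprK.
  rewrite normrN; apply: le_trans (ler_norm_sum _ _ _) _.
  apply: le_trans (ler_sum _ (fun k _ => key k)) _; rewrite big_split /= lerD2r.
  by rewrite sum3; move: (a hh * dd) => t; lra.
move: sum1; rewrite -mulr_sumr !normrM normr_sgn mul1r (gtr0_norm (a0 hh)) => H.
rewrite -(ler_pM2l (a0 hh)); apply: le_trans H _.
have -> : a hh * eps = 3 * (a hh * dd) + a hh * dd by rewrite /dd; field.
by rewrite lerD2l.
Qed.

End Local.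
End RealMaxwell.

(** * Cones at the boundary points of subgraph domains *)

Section Geometry.
Context {R : realType}.
Notation T3 := (measurableTypeR R * measurableTypeR R * measurableTypeR R)%type.

(** The common property of the smooth graphs of the outer boundary and the Lipschitz graphs of
    Sigma; it is all that the cones require. *)
Definition loc_lip (g : R * R -> R) (z0 : R * R) : Prop :=
  exists L e : R, [/\ 0 <= L, 0 < e & forall z z', `|z - z0| < e -> `|z' - z0| < e ->
    `|g z - g z'| <= L * `|z - z'|].

Lemma lipschitz_loc g z0 : lipschitz g -> loc_lip g z0.
Proof.
move=> [M [_ HM]]; exists (`|M| + 1), 1; split=> //.
move=> z z' _ _; have MM : M < `|M| + 1 by have := ler_norm M; lra.
exact: (HM _ MM (z, z')).
Qed.

Lemma norm2_lt (z : R * R) e : (`|z| < e) = (`|z.1| < e) && (`|z.2| < e).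
Proof. by rewrite prod_normE gt_max. Qed.

Lemma le_norm2 (z : R * R) : `|z.1| <= `|z| /\ `|z.2| <= `|z|.
Proof. by rewrite !prod_normE !le_max !lexx orbT. Qed.

Lemma MVT_abs (f : R * R -> R) (x v : R * R) (t M : R) : smooth f ->
  (forall s, (0 <= s <= t) || (t <= s <= 0) -> `|'D_v f (x + s *: v)| <= M) ->
  `|f (x + t *: v) - f x| <= M * `|t|.
Proof.
move=> sf HM; have [t0|t0] := leP 0 t.
  have [s [s0 st ->]] := MVT_line x v sf t0.
  by rewrite normrM mulrC ler_wpM2r// HM// s0 st.
have t0' : 0 <= - t by lra.
have [s [s0 st E]] := MVT_line (x + t *: v) v sf t0'.
rewrite distrC; move: E; rewrite scaleNr addrK => ->.
rewrite normrM normrN mulrC ler_wpM2r// -addrA -scalerDl; apply: HM.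
by apply/orP; right; apply/andP; split; lra.
Qed.

Lemma smooth_loc_lip (g : R * R -> R) z0 : smooth g -> loc_lip g z0.
Proof.
move=> sg.
have B v : exists M e : R, [/\ 0 <= M, 0 < e & forall z, `|z - z0| < e -> `|'D_v g z| <= M].
  have cD : continuous ('D_v g) := smooth_continuous (smooth_derive v sg).
  have /nbhs_ballP[e /= e0 He] : \forall z \near z0, `|'D_v g z - 'D_v g z0| < 1.
    have := cD z0 => /cvgrPdist_lt /(_ _ ltr01); apply: filterS => z; by rewrite distrC.
  exists (`|'D_v g z0| + 1), e; split=> //.
  move=> z zz; have /= h : ball z0 e z by rewrite -ball_normE /ball_ /= distrC.
  have := He z h; have := ler_normD ('D_v g z - 'D_v g z0) ('D_v g z0); rewrite subrK /=.
  lra.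
have [M1 [e1 [M10 e10 H1]]] := B (1, 0); have [M2 [e2 [M20 e20 H2]]] := B (0, 1).
have em : 0 < Num.min e1 e2 by rewrite lt_min e10.
exists (M1 + M2), (Num.min e1 e2); split=> //; first exact: addr_ge0.
move=> [z1 z2] [w1 w2]; rewrite !norm2_lt /= => /andP[hz1 hz2] /andP[hw1 hw2].
have E1 : ((z1, z2) : R * R) = (w1, z2) + (z1 - w1) *: ((1, 0) : R * R).
  by congr pair; rewrite /= /GRing.scale /=; lra.
have E2 : ((w1, z2) : R * R) = (w1, w2) + (z2 - w2) *: ((0, 1) : R * R).
  by congr pair; rewrite /= /GRing.scale /=; lra.
have between (a b c s e : R) : `|a - c| < e -> `|b - c| < e ->
    (0 <= s <= a - b) || (a - b <= s <= 0) -> `|b + s - c| < e.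
  rewrite !ltr_norml => /andP[h1 h2] /andP[h3 h4] /orP[] /andP[h5 h6]; apply/andP; split; lra.
have b1 : `|g (z1, z2) - g (w1, z2)| <= M1 * `|z1 - w1|.
  rewrite {1}E1; apply: MVT_abs => // s sz; apply: H1; apply: lt_le_trans (_ : Num.min e1 e2 <= e1); last by rewrite ge_min lexx.
  rewrite norm2_lt /= [s *: 1]mulr1 [s *: 0]mulr0 addr0 hz2 andbT.
  exact: between hz1 hw1 sz.
have b2 : `|g (w1, z2) - g (w1, w2)| <= M2 * `|z2 - w2|.
  rewrite {1}E2; apply: MVT_abs => // s sz; apply: H2; apply: lt_le_trans (_ : Num.min e1 e2 <= e2); last by rewrite ge_min lexx orbT.
  rewrite norm2_lt /= [s *: 1]mulr1 [s *: 0]mulr0 addr0 hw1 /=.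
  exact: between hz2 hw2 sz.
have [n1 n2] := le_norm2 ((z1, z2) - (w1, w2)).
have -> : g (z1, z2) - g (w1, w2) = (g (z1, z2) - g (w1, z2)) + (g (w1, z2) - g (w1, w2)) by ring.
apply: le_trans (ler_normD _ _) _; rewrite mulrDl; apply: lerD.
  by apply: le_trans b1 _; rewrite ler_wpM2l.
by apply: le_trans b2 _; rewrite ler_wpM2l.
Qed.

Definition dual_basis (W : 'I_3 -> R3 R) (l : 'I_3 -> 'I_3 -> R) : Prop :=
  (forall k m, form l k (W m) = (k == m)%:R) /\ (forall x, x = \sum_k form l k x *: W k).

Lemma form_opp (l : 'I_3 -> 'I_3 -> R) k x : form (fun k j => - l k j) k x = - form l k x.
Proof. by rewrite /form -sumrN; apply: eq_bigr => j _; rewrite mulNr. Qed.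

Lemma form_oppr (l : 'I_3 -> 'I_3 -> R) k x : form l k (- x) = - form l k x.
Proof. by rewrite /form -sumrN; apply: eq_bigr => j _; rewrite coordN mulrN. Qed.

Lemma dual_basis_opp W l : dual_basis W l ->
  dual_basis (fun k => - W k) (fun k j => - l k j).
Proof.
move=> [H1 H2]; split=> [k m|x]; first by rewrite form_opp form_oppr opprK.
by rewrite {1}(H2 x); apply: eq_bigr => k _; rewrite form_opp scalerN scaleNr opprK.
Qed.

Lemma dual_basis_kernel W l : dual_basis W l -> exists K rho C, cone_kernel W K rho C.
Proof.
move=> [H1 H2]; exists (scaled_K W l), (scaled_rho l).
by eexists; exact: (cone_kernel_shell H1 H2).
Qed.

Lemma std_dual_basis : dual_basis basis3 (fun k j => (k == j)%:R).
Proof.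
have F k x : form (fun k j : 'I_3 => (k == j)%:R) k x = coord k x.
  rewrite /form (bigD1 k)//= big1 ?addr0 ?eqxx ?mul1r// => j jk.
  by rewrite eq_sym (negbTE jk) mul0r.
split=> [k m|x]; first by rewrite F coord_basis.
apply: coord_inj => k; rewrite (_ : \sum_k _ = \sum_j coord j x *: basis3 j); last by apply: eq_bigr => j _; rewrite F.
rewrite sum3 !coordD !coordZ !coord_basis.
by case: (I3_cases k) => [->|[->|->]]; rewrite /= ?mulr1 ?mulr0 ?addr0 ?add0r.
Qed.

Lemma sum_shell_small (W : 'I_3 -> R3 R) m a : in_shell m a ->
  `|\sum_k a k *: W k| <= 2^-1 ^+ m * (2 * \sum_k `|W k|).
Proof.
move=> Ha; apply: le_trans (ler_norm_sum _ _ _) _; rewrite mulrA mulr_sumr; apply: ler_sum => k _.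
rewrite normrZ ler_wpM2r//; have /andP[h1 h2] := Ha k.
by rewrite ger0_norm//; apply: le_trans h1; rewrite divr_ge0// exprn_ge0//.
Qed.

Lemma cone_at_interior (D : set (R3 R)) W x0 : interior D x0 -> cone_at D W x0.
Proof.
move=> /nbhs_ballP[e /= e0 He]; set S := 2 * \sum_k `|W k|.
have S0 : 0 <= S by apply: mulr_ge0 => //; apply: sumr_ge0.
have S1 : 0 < S + 1 by apply: ltr_wpDl.
have e3 : 0 < e / 3 / (S + 1) by apply: divr_gt0 => //; apply: divr_gt0.
have [N HN] := half_pow_small e3.
exists N, (e / 3), 1; split=> [||y m a x _ yx Nm Ha]; [exact: divr_gt0|by []|].
rewrite mul1r => h; apply: He; rewrite -ball_normE /ball_ /= distrC.
have := HN m Nm; rewrite ler_pdivlMr// => h1.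
have h2 := sum_shell_small W Ha; rewrite -/S in h2.
have -> : x - x0 = (x - (y + \sum_k a k *: W k)) + ((y - x0) + \sum_k a k *: W k).
  by rewrite [y - x0 + _]addrAC addrA subrK.
apply: le_lt_trans (ler_normD _ _) _.
have h3 := ler_normD (y - x0) (\sum_k a k *: W k).
move: h1 h2 h3 h yx; rewrite mulrDr mulr1.
move: (2^-1 ^+ m * S) (`|_ + _|) (`|\sum_k _|) (`|y - x0|) (`|_ - (_ + _)|) (2^-1 ^+ m) => t1 t2 t3 t4 t5 t6; lra.
Qed.

Section Subgraph.
Variables (A : 'M[R]_3) (s : R).
Hypothesis AAT : A *m A^T = 1%:M.
Hypothesis s0 : 0 < s.

Definition yc (x : R3 R) (j : 'I_3) : R := (coords x *m A) 0 j.

Lemma ycE x j : yc x j = \sum_i coord i x * A i j.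
Proof. by rewrite /yc mxE. Qed.

Lemma ycD x y j : yc (x + y) j = yc x j + yc y j.
Proof. by rewrite !ycE -big_split; apply: eq_bigr => i _; rewrite coordD mulrDl. Qed.

Lemma ycZ (h : R) x j : yc (h *: x) j = h * yc x j.
Proof. by rewrite !ycE mulr_sumr; apply: eq_bigr => i _; rewrite coordZ mulrA. Qed.

Lemma ycB x y j : yc (x - y) j = yc x j - yc y j.
Proof. by rewrite ycD -scaleN1r ycZ mulN1r. Qed.

Lemma yc_le x j : `|yc x j| <= 3 * `|x|.
Proof.
have A1 i : `|A i j| <= 1.
  have : (A *m A^T) i i = 1 by rewrite AAT mxE eqxx.
  rewrite mxE sum3 !mxE => E.
  have sq : A i j ^+ 2 <= 1.
    have := sqr_ge0 (A i 0); have := sqr_ge0 (A i 1); have := sqr_ge0 (A i 2).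
    by move: E; rewrite !expr2; case: (I3_cases j) => [->|[->|->]]; move=> E h1 h2 h3; lra.
  by rewrite -(@ler_pXn2r _ 2)// ?nnegrE// expr1n real_normK ?num_real.
have b i : `|coord i x * A i j| <= `|x|.
  rewrite normrM -[X in _ <= X]mulr1; apply: ler_pM => //; exact: le_coord_norm.
rewrite ycE sum3; have := b 0; have := b 1; have := b 2.
have := ler_normD (coord 0 x * A 0 j + coord 1 x * A 1 j) (coord 2 x * A 2 j).
have := ler_normD (coord 0 x * A 0 j) (coord 1 x * A 1 j); lra.
Qed.

Definition of_row (v : 'rV[R]_3) : R3 R := (v 0 0, v 0 1, v 0 2).

Lemma coords_of_row v : coords (of_row v) = v.
Proof.
apply/rowP => k; rewrite mxE /of_row.
by case: (I3_cases k) => [->|[->|->]].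
Qed.

(** In the rotated coordinates the three directions are (1, 0, -s), (0, 1, -s) and (0, 0, -s): a
    cone pointing below the graph, with slope [s] larger than its Lipschitz constant. *)
Definition wrow (k : 'I_3) : 'rV[R]_3 :=
  \row_j if j == 2 then - s else (j == k)%:R.

Definition Wsub (k : 'I_3) : R3 R := of_row (wrow k *m A^T).

Lemma yc_Wsub k j : yc (Wsub k) j = if j == 2 then - s else (j == k)%:R.
Proof. by rewrite /yc /Wsub coords_of_row -mulmxA (mulmx1C AAT) mulmx1 mxE. Qed.

Definition lsub (k j : 'I_3) : R :=
  if k == 2 then - (A j 2 / s) - A j 0 - A j 1 else A j k.

Lemma form_lsub k x : form lsub k x = if k == 2 then - (yc x 2 / s) - yc x 0 - yc x 1 else yc x k.
Proof.
rewrite /form !ycE /lsub; case: ifP => _; last by apply: eq_bigr => i _; rewrite mulrC.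
rewrite mulr_suml -!sumrN -!big_split; apply: eq_bigr => i _ /=; ring.
Qed.

Lemma yc_inj x y : (forall j, yc x j = yc y j) -> x = y.
Proof.
move=> H; have E : coords x *m A = coords y *m A by apply/rowP => j; exact: H.
have : coords x = coords y.
  by rewrite -[coords x]mulmx1 -AAT mulmxA E -mulmxA AAT mulmx1.
by move=> /rowP h; apply: coord_inj => k; have := h k.
Qed.

Lemma dual_basis_sub : dual_basis Wsub lsub.
Proof.
have sn : s != 0 by rewrite gt_eqF.
split=> [k m|x].
  rewrite form_lsub !yc_Wsub.
  case: (I3_cases k) => [->|[->|->]]; case: (I3_cases m) => [->|[->|->]] /=;
    rewrite ?eqxx /=; try by []; by field.
apply: yc_inj => j; rewrite sum3 !ycD !ycZ !yc_Wsub !form_lsub /=.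
by case: (I3_cases j) => [->|[->|->]] /=; field.
Qed.

Lemma yc_shell p (a : 'I_3 -> R) j : yc (p + \sum_k a k *: Wsub k) j =
  yc p j + (if j == 2 then - s * (a 0 + a 1 + a 2) else a j).
Proof.
rewrite ycD; congr (_ + _); rewrite sum3 !ycD !ycZ !yc_Wsub.
by case: (I3_cases j) => [->|[->|->]] /=; ring.
Qed.

End Subgraph.

Lemma abs_shift (x p b e : R) : `|x - (p + b)| <= e -> 0 <= b -> `|p - x| <= b + e.
Proof. by rewrite !ler_norml => /andP[h1 h2] b0; apply/andP; split; lra. Qed.

(** On a shell the point falls by [s * (a 0 + a 1 + a 2)], while the graph falls by at most [L]
    times the horizontal displacement, that is [L * (a 0 + a 1)] up to the margin. With [s = L + 1]
    the gain exceeds the error. *)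
Lemma cone_at_subgraph (D U : set (R3 R)) (A : 'M[R]_3) (g : R * R -> R) x0 :
  A *m A^T = 1%:M -> open U -> U x0 ->
  (forall x, U x -> D x <-> yc A x 2 < g (yc A x 0, yc A x 1)) ->
  loc_lip g (yc A x0 0, yc A x0 1) ->
  exists W l, dual_basis W l /\ cone_at D W x0.
Proof.
move=> AAT oU Ux0 DU [L [e [L0 e0 gL]]].
pose s := L + 1; have s0 : 0 < s by rewrite /s; lra.
exists (Wsub A s), (lsub A s); split; first exact: dual_basis_sub.
have /nbhs_ballP[rho /= rho0 Hrho] : nbhs x0 U by exact: open_nbhs_nbhs.
set W := Wsub A s; set S := 2 * \sum_k `|W k|.
have S0 : 0 <= S by apply: mulr_ge0 => //; apply: sumr_ge0.
(* The factor 3 of [yc_le] makes the total error [3 (L + 1) d 2^-m]; this [d] equates it to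
   [2^-m / 4], below the gain [a 0 + a 1 + a 2 >= 3 * 2^-m / 2]. *)
pose d : R := (12 * (L + 1))^-1.
have d0 : 0 < d by rewrite invr_gt0; lra.
have dE : 3 * (L + 1) * d = 4^-1 by rewrite /d; field; apply/eqP; lra.
have d1 : d <= 1 by rewrite invf_le1; lra.
pose r : R := Num.min (rho / 2) (e / 6).
have r0 : 0 < r by rewrite lt_min !divr_gt0.
have r1 : 2 * r <= rho by have : r <= rho / 2; [rewrite ge_min lexx|lra].
have r2 : 3 * (2 * r) <= e by have : r <= e / 6; [rewrite ge_min lexx orbT|lra].
have rS : 0 < r / (S + 1) by apply: divr_gt0 => //; apply: ltr_wpDl.
have [N HN] := half_pow_small rS.
exists N, r, d; split=> // p m a x Dp px Nm Ha xq.
pose t : R := 2^-1 ^+ m; have t0 : 0 < t by exact: exprn_gt0.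
have tS : t * (S + 1) <= r by rewrite -ler_pdivlMr ?(ltr_wpDl S0)//; exact: HN.
have hS : `|\sum_k a k *: W k| <= t * S by exact: sum_shell_small.
rewrite -/t in xq; set q := p + \sum_k a k *: W k in xq.
have px2 : `|p - x0| < 2 * r by lra.
have xx0 : `|x - x0| < 2 * r.
  have -> : x - x0 = (x - q) + ((p - x0) + \sum_k a k *: W k).
    by rewrite [p - x0 + _]addrAC addrA subrK.
  apply: le_lt_trans (ler_normD _ _) _; have h3 := ler_normD (p - x0) (\sum_k a k *: W k).
  have dt : d * t <= t by rewrite ler_piMl// ltW.
  move: tS h3 hS xq; rewrite mulrDr mulr1; move: (`|_ + _|) (`|\sum_k _|) (`|x - q|) (t * S) => *; lra.
have inU z : `|z - x0| < 2 * r -> U z.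
  by move=> h; apply: Hrho; rewrite -ball_normE /ball_ /= distrC; lra.
have zz z : `|z - x0| < 2 * r -> `|(yc A z 0, yc A z 1) - (yc A x0 0, yc A x0 1)| < e.
  move=> h; rewrite norm2_lt /= -!ycB.
  by have := yc_le AAT (z - x0) 0; have := yc_le AAT (z - x0) 1; move=> h1 h2; apply/andP; split; lra.
apply/(DU _ (inU _ xx0)); move/(DU _ (inU _ px2)): Dp => Dp.
have Lg := gL _ _ (zz _ px2) (zz _ xx0).
have yq j : yc A q j = yc A p j + (if j == 2 then - s * (a 0 + a 1 + a 2) else a j).
  by rewrite /q /W (@yc_shell A s AAT p a j).
have yx j : `|yc A x j - yc A q j| <= 3 * (d * t).
  by rewrite -ycB; apply: le_trans (yc_le AAT _ _) _; rewrite ler_wpM2l// ltW.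
have y0 := yx 0; have y1 := yx 1; have y2 := yx 2; rewrite !yq /= in y0 y1 y2.
have /andP[a0 _] := Ha 0; have /andP[a1 _] := Ha 1; have /andP[a2 _] := Ha 2.
rewrite -/t in a0 a1 a2.
have nz : `|(yc A p 0, yc A p 1) - (yc A x 0, yc A x 1)| <= a 0 + a 1 + 3 * (d * t).
  have b0 : 0 <= a 0 by apply: le_trans a0; rewrite divr_ge0// ltW.
  have b1 : 0 <= a 1 by apply: le_trans a1; rewrite divr_ge0// ltW.
  rewrite prod_normE ge_max /=; apply/andP; split.
    by apply: le_trans (abs_shift y0 b0) _; rewrite lerD2r lerDl.
  by apply: le_trans (abs_shift y1 b1) _; rewrite lerD2r lerDr.
have Lb : g (yc A p 0, yc A p 1) <= g (yc A x 0, yc A x 1) + L * (a 0 + a 1 + 3 * (d * t)).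
  have := le_trans Lg (ler_wpM2l L0 nz); rewrite ler_norml => /andP[_]; lra.
have dt4 : 3 * (L + 1) * (d * t) = t / 4 by rewrite mulrA dE mulrC.
move: y2; rewrite ler_norml => /andP[_ y2].
have La : 0 <= L * a 2 by rewrite mulr_ge0//; lra.
have LE : L * (a 0 + a 1 + 3 * (d * t)) = L * a 0 + L * a 1 + 3 * (L * (d * t)) by ring.
have sE : - s * (a 0 + a 1 + a 2) = - (L * a 0) - L * a 1 - L * a 2 - a 0 - a 1 - a 2 by rewrite /s; ring.
have dE4 : 3 * (L * (d * t)) + 3 * (d * t) = t / 4 by rewrite -dt4; ring.
rewrite LE in Lb; rewrite sE in y2.
move: Lb y2 dE4 La Dp a0 a1 a2; move: (L * a 0) (L * a 1) (L * a 2) (L * (d * t)) (d * t) => X0 X1 X2 X3 X4.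
move: (g _) (g _) (yc A p 2) (yc A x 2) (a 0) (a 1) (a 2) => g1 g2 p2 x2 b0 b1 b2.
lra.
Qed.

Lemma cone_at_closure (P : (R * R -> R) -> Prop) (D : set (R3 R)) x0 :
  (forall g z, P g -> loc_lip g z) -> locally_subgraph P D -> closure D x0 ->
  exists W l, dual_basis W l /\ cone_at D W x0.
Proof.
move=> PL DP cx; have [ix|ix] := pselect (interior D x0).
  exists basis3, (fun k j => (k == j)%:R); split; first exact: std_dual_basis.
  exact: cone_at_interior.
have [A [g [U [AAT Pg oU Ux0 H]]]] := DP x0 (conj cx ix).
apply: (cone_at_subgraph AAT oU Ux0 _ (PL g _ Pg)) => x Ux; exact: H.
Qed.

(** The margin is an open condition, so a point of the closure can be replaced by a nearby point of
    [D]. Thus cones with vertex on the boundary also lie inside. *)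
Lemma cone_at_closed (D : set (R3 R)) W x0 : cone_at D W x0 ->
  exists (m0 : nat) (r d : R), [/\ 0 < r, 0 < d &
    forall y m a x, closure D y -> `|y - x0| < r -> (m0 <= m)%N -> in_shell m a ->
      `|x - (y + \sum_k a k *: W k)| < d * 2^-1 ^+ m -> D x].
Proof.
move=> [m0 [r [d [r0 d0 H]]]]; exists m0, r, d; split=> // y m a x cy yr mm Ha xq.
set q := \sum_k a k *: W k in xq.
pose e := Num.min (r - `|y - x0|) (d * 2^-1 ^+ m - `|x - (y + q)|).
have e0 : 0 < e by rewrite lt_min !subr_gt0 yr.
have [p [Dp]] := cy _ (nbhsx_ballx y e e0).
rewrite -ball_normE /ball_ /= lt_min => /andP[h1 h2].
apply: (H p m a x Dp _ mm Ha).
  have := ler_distD y p x0; rewrite (distrC p y); lra.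
rewrite -/q; have := ler_distD (y + q) x (p + q).
have -> : y + q - (p + q) = y - p by rewrite opprD addrACA subrr addr0.
lra.
Qed.

(** A piece [S] of the boundary is translated by [2^-(m0+j)] along a cone direction. The translates
    are disjoint: otherwise a cone would join two boundary points, and its far end would be
    interior. They are infinitely many, have equal measure and lie in a bounded set, so this measure
    is 0. *)
Lemma boundary_null (D : set (R3 R)) : open D -> bounded_set D ->
  (forall x0, boundary D x0 -> exists W, cone_at D W x0) -> leb3 (boundary D : set T3) = 0%E.
Proof.
move=> oD bD HC.
have mB : measurable (boundary D : set T3).
  apply: measurableD; last by apply: open_measurable3; exact: open_interior.
  rewrite -[closure D]setCK; apply: measurableC; apply: open_measurable3.
  by apply: closed_openC; exact: closed_closure.
have loc x0 : boundary D x0 -> exists2 r : R, 0 < r &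
    leb3 (boundary D `&` [set x | `|x - x0| < r] : set T3) = 0%E.
  move=> bx0; have [W /cone_at_closed [m0 [r [d [r0 d0 H]]]]] := HC x0 bx0.
  exists r => //; set S := _ `&` _.
  have mS : measurable (S : set T3).
    apply: measurableI => //; apply: open_measurable3.
    have -> : [set x : R3 R | `|x - x0| < r] = ball x0 r.
      by apply/seteqP; split=> x; rewrite -ball_normE /ball_ /= distrC.
    exact: ball_open.
  pose v := \sum_k W k; pose t j : R := 2^-1 ^+ (m0 + j).
  pose T (j : nat) : set T3 := [set x | S (- (t j *: v) + 1 *: x)].
  have TS j x : T j x = S (x - t j *: v) by rewrite /T /= scale1r addrC.
  have mf : measurable_fun setT (fun x : T3 => (\1_S x)%:E : \bar R).
    by apply/measurable_EFinP; exact: measurable_indic.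
  have mT j : measurable (T j).
    have -> : T j = (fun x : T3 => x - t j *: v) @^-1` (S : set T3).
      by apply/seteqP; split=> x; rewrite TS.
    have mt : measurable_fun setT ((fun x : R3 R => x - t j *: v) : T3 -> T3).
      apply: measurable_fun_pair; first apply: measurable_fun_pair.
      - by apply: measurable_funB => //; apply: measurableT_comp => //.
      - by apply: measurable_funB => //; apply: measurableT_comp => //.
      - by apply: measurable_funB => //.
    by rewrite -[X in measurable X]setTI; exact: mt.
  have lT j : leb3 (T j) = leb3 (S : set T3).
    have f0 (x : T3) : (0 <= (\1_S x)%:E :> \bar R)%E by rewrite lee_fin.
    have N1 : 1 != 0 :> R by exact: oner_neq0.
    have I1 (X : set T3) : measurable X -> (\int[leb3]_(x in setT) (\1_X x)%:E)%E = leb3 X.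
      by move=> mX; rewrite integral_indic// setIT.
    have H1 := leb3_affine (- (t j *: v)) N1 mf f0.
    have one : ((`|1 : R| ^+ 3)%:E = 1%E :> \bar R) by rewrite normr1 expr1n.
    rewrite one mul1e in H1; rewrite -(I1 _ (mT j)) -(I1 _ mS) -H1.
    apply: eq_integral => x _; congr EFin; rewrite !indicE; congr (_%:R); congr nat_of_bool.
  have triv : trivIset setT T.
    apply/trivIsetP => i j _ _; wlog ij : i j / (i < j)%N.
      move=> H1 ne; have [h|h|h] := ltngtP i j; first exact: H1.
        by rewrite setIC; apply: H1 => //; rewrite eq_sym.
      by rewrite h eqxx in ne.
    move=> _; apply/seteqP; split=> // x []; rewrite !TS => -[[cy _] yr] [[_ niy'] _].
    apply: niy'; apply/nbhs_ballP.
    (* The difference of two dyadic steps lies between half of the larger one and the whole of it,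
       hence within the shell of the larger. *)
    have tij : in_shell (m0 + i) (fun=> t i - t j).
      move=> k; have tj : t j <= t i / 2.
        rewrite /t -[j](subnKC (ltnW ij)) addnA exprD ler_wpM2l ?exprn_ge0//.
        by rewrite -subn_gt0 in ij; case: (j - i)%N ij => // n _; rewrite exprS ler_piMr// ?invr_ge0// exprn_ile1//; lra.
      have ti : 0 < t i by exact: exprn_gt0.
      have tj0 : 0 < t j by exact: exprn_gt0.
      by rewrite -/(t i); apply/andP; split; lra.
    exists (d * 2^-1 ^+ (m0 + i)) => /=; first by rewrite mulr_gt0// exprn_gt0.
    move=> z; rewrite -ball_normE /ball_ /= distrC => hz.
    apply: (H _ _ _ _ cy yr (leq_addr i m0) tij).
    rewrite -scaler_sumr -/v scalerBl addrA subrK.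
    exact: hz.
  have [M [_ HM]] := bD; pose M' : R := `|M| + 1.
  have MM : M < M' by rewrite /M'; have := ler_norm M; lra.
  have M'0 : 0 <= M' by exact: addr_ge0.
  pose Q : R := M' + `|v| + 1; have Q0 : 0 <= Q by rewrite /Q; have := normr_ge0 v; lra.
  have cM y : closure D y -> `|y| <= M'.
    move=> cy; rewrite leNgt; apply/negP => h.
    have h0 : 0 < `|y| - M' by lra.
    have [p [Dp]] := cy _ (nbhsx_ballx y _ h0); rewrite -ball_normE /ball_ /=.
    have := HM _ MM p Dp; have := ler_normB y p; have := ler_normD (y - p) p; rewrite subrK /=; lra.
  have TQ j : T j `<=` (cube Q : set T3).
    move=> x; rewrite TS => -[[cy _] _]; apply/cubeP.
    have := cM _ cy; have := ler_normD (x - t j *: v) (t j *: v); rewrite subrK normrZ.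
    have t1 : `|t j| <= 1 by rewrite ger0_norm ?exprn_ge0// exprn_ile1//; lra.
    have : `|t j| * `|v| <= `|v| by rewrite ler_piMl.
    rewrite /Q; lra.
  apply/eqP; rewrite eq_le measure_ge0 andbT leNgt; apply/negP => S0.
  have Sfin : (leb3 (S : set T3) < +oo)%E.
    rewrite -(lT 0%N); apply: le_lt_trans (le_measure leb3 (mem_set (mT 0%N)) (mem_set (measurable_cube _)) (TQ 0%N)) _.
    by rewrite [X in (X < _)%E](leb3_cube Q0) ltry.
  have [c cE c0] : exists2 c : R, leb3 (S : set T3) = c%:E & 0 < c.
    exists (fine (leb3 (S : set T3))); first by rewrite fineK// ge0_fin_numE.
    by rewrite fine_gt0// S0 Sfin.
  have key n : n%:R * c <= (Q *+ 2) ^+ 3.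
    have LQ : leb3 (cube Q : set T3) = ((Q *+ 2) ^+ 3)%:E := leb3_cube Q0.
    rewrite -lee_fin -LQ.
    have -> : (n%:R * c)%:E = leb3 (\big[setU/set0]_(i < n) T i).
      rewrite measure_semi_additive//; last exact: bigsetU_measurable.
      transitivity (\sum_(i < n) c%:E)%E.
        by rewrite sumEFin sumr_const card_ord mulr_natl.
      by apply: eq_bigr => i _; exact: (esym (etrans (lT i) cE)).
    apply: le_measure; rewrite ?inE//.
    - exact: bigsetU_measurable.
    - exact: measurable_cube.
    - by elim/big_ind: _ => [|A1 B1 h1 h2|i _]; [exact: sub0set|rewrite subUset|exact: TQ].
  have := key (Num.truncn ((Q *+ 2) ^+ 3 / c)).+1.
  rewrite leNgt => /negP; apply; rewrite -ltr_pdivrMr//; exact: truncnS_gt.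
have cB : compact (boundary D).
  apply: (@subclosed_compact _ (boundary D) (closure D)); last by move=> x [].
  - rewrite /boundary setDE; apply: closedI; first exact: closed_closure.
    by apply: open_closedC; exact: open_interior.
  - exact: compact_closure.
have /choice[r Hr] (x0 : R3 R) : exists r : R, boundary D x0 -> 0 < r /\
    leb3 (boundary D `&` [set x | `|x - x0| < r] : set T3) = 0%E.
  have [b|b] := pselect (boundary D x0); last by exists 0.
  by have [r ? ?] := loc x0 b; exists r.
have [s [sB sC]] := finite_cover cB (fun y By => (Hr y By).1).
have sub : (boundary D : set T3) `<=` \big[setU/set0]_(y <- s) (boundary D `&` [set x | `|x - y| < r y]).
  move=> x Bx; have [y ys xy] := sC x Bx.
  by rewrite (big_rem y)//=; left.
apply: (subset_measure0 mB _ sub).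
  apply: bigsetU_measurable => y _; apply: measurableI => //; apply: open_measurable3.
  have -> : [set x : R3 R | `|x - y| < r y] = ball y (r y).
    by apply/seteqP; split=> x; rewrite -ball_normE /ball_ /= distrC.
  have [r0|r0] := ltP 0 (r y); first exact: ball_open.
  have -> : ball y (r y) = set0; last exact: open0.
  apply/seteqP; split=> // x; rewrite -ball_normE /ball_ /= => h.
  by have := normr_ge0 (y - x); lra.
have m2 y : measurable ((boundary D `&` [set x | `|x - y| < r y]) : set T3).
  apply: measurableI => //; apply: open_measurable3.
  have -> : [set x : R3 R | `|x - y| < r y] = ball y (r y).
    by apply/seteqP; split=> x; rewrite -ball_normE /ball_ /= distrC.
  have [r0|r0] := ltP 0 (r y); first exact: ball_open.
  have -> : ball y (r y) = set0; last exact: open0.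
  apply/seteqP; split=> // x; rewrite -ball_normE /ball_ /= => h.
  by have := normr_ge0 (y - x); lra.
clear sub sC; elim: s sB => [|y s IH] sB; first by rewrite big_nil measure0.
have U0 (X Y : set T3) : measurable X -> measurable Y -> leb3 X = 0%E -> leb3 Y = 0%E ->
    leb3 (X `|` Y) = 0%E.
  by move=> mX mY X0 Y0; rewrite measureU0.
rewrite big_cons; apply: U0 => //.
- exact: bigsetU_measurable.
- by have [] := Hr y (sB y (mem_head _ _)).
- by apply: IH => x xs; apply: sB; rewrite inE xs orbT.
Qed.

End Geometry.

(** * Cutoffs at a dyadic scale *)

Section Cutoff.
Context {R : realType}.
Notation T3 := (measurableTypeR R * measurableTypeR R * measurableTypeR R)%type.
Notation L2_3 := (@L2 _ T3 R leb3).
Notation ip3 := (@ip _ T3 R leb3).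
Notation nrm3 := (@nrm _ T3 R leb3).
Notation testf := (@test_function R R setT).

Lemma L2c_indic (A : set T3) (M : R) : measurable A -> (forall x : R3 R, A x -> `|x| <= M) ->
  L2c (\1_A : R3 R -> R).
Proof.
move=> mA AM; apply: (@L2c_bounded R _ 1 M).
- exact: measurable_indic.
- by move=> x; rewrite indicE; case: (_ \in _); rewrite ?normr1 ?normr0.
- by move=> x xM; rewrite indicE memNset// => /AM; rewrite leNgt xM.
Qed.

Lemma derive_scaled_dilate (f : R3 R -> R) (a t : R) (v z : R3 R) : smooth f ->
  'D_v (fun z : R3 R => a * f (0 + t *: z)) z = (a * t) * 'D_v f (0 + t *: z).
Proof.
by move=> sf; rewrite (derive_scal _ _ _ (smooth_dilate t sf)) (derive_dilate _ _ _ sf) mulrA.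
Qed.

Lemma conv_indic_le kap (A : set T3) x : testf kap -> L2c (\1_A : R3 R -> R) ->
  `|conv kap (\1_A : R3 R -> R) x| <= nrm1 kap.
Proof.
move=> tk LA; have tr := refl_testf x tk.
have I1 := L2_mul (testf_L2c tr).1 LA.1.
apply: le_trans (le_normr_Rintegral measurableT I1) _.
rewrite -(nrm1_refl x tk); apply: le_Rintegral => //.
- exact: (integrable_norm I1).
- exact: testf_int_norm.
move=> y _; rewrite normrM ler_piMr// indicE; case: (_ \in _); rewrite ?normr1 ?normr0//.
Qed.

Lemma conv_indic_full kap (A : set T3) x : testf kap -> (forall z, 0 <= kap z) ->
  (forall y, kap (x - y) != 0 -> A y) -> conv kap (\1_A : R3 R -> R) x = nrm1 kap.
Proof.
move=> tk k0 H; rewrite -(nrm1_refl x tk); apply: eq_Rintegral => y _.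
rewrite ger0_norm; last exact: k0.
have [->|/H Ay] := eqVneq (refl kap x y) 0; first by rewrite mul0r.
by rewrite indicE mem_set// mulr1.
Qed.

Lemma conv_indic_ge0 (kap : R3 R -> R) (A : set T3) x : (forall z, 0 <= kap z) ->
  0 <= conv kap (\1_A : R3 R -> R) x.
Proof.
move=> k0; apply: Rintegral_ge0 => y _; apply: mulr_ge0; first exact: k0.
by rewrite indicE ler0n.
Qed.

Lemma nrm1_pos kap z : testf kap -> kap z != 0 -> 0 < nrm1 kap.
Proof.
move=> tk kz; rewrite lt_def nrm1_ge0 andbT; apply/eqP => H.
have mk := testf_measurable tk.
suff /(ae_eq0_continuous (smooth_continuous (test_function_smooth tk))) /(_ z) kz0 : {ae leb3, forall x : T3, kap x = 0}.
  by rewrite kz0 eqxx in kz.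
apply: (@test_orth_ae0 R kap); first by have := L2c_int (testf_L2c tk).
move=> phi tphi; have [M M0 HM] := test_bounded tphi.
apply/eqP; rewrite -normr_le0.
have Lr := (testf_L2c tk).1; have Lp := (testf_L2c tphi).1.
apply: le_trans (le_normr_Rintegral measurableT (L2_mul Lr Lp)) _.
have -> : 0 = M * nrm1 kap by rewrite H mulr0.
have In := testf_int_norm tk.
rewrite -RintegralZl//; apply: le_Rintegral => //.
- by have := integrable_norm (L2_mul Lr Lp).
- have -> : EFin \o (fun t => M * `|kap t|) = (fun t : T3 => M%:E * (`|kap t|)%:E)%E by apply/funext.
  exact: integrableZl.
- by move=> x _; rewrite normrM mulrC ler_wpM2r.
Qed.

(* [theta] is a mollification at scale [2^-N] of the indicator of the points of
   [D] lying at distance [3 * 2^-N] from its complement. *)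
Lemma cutoff (D : set (R3 R)) : bounded_set D -> exists2 B0 : R, 0 <= B0 &
  forall N : nat, exists theta : R3 R -> R,
    [/\ smooth theta, forall x, 0 <= theta x <= 1,
        forall k x, `|'D_(basis3 k) theta x| <= B0 * 2 ^+ N,
        forall x, ~ D x -> theta x = 0 /\ forall k, 'D_(basis3 k) theta x = 0 &
        forall x, (forall y, `|y - x| < 6 * 2^-1 ^+ N -> D y) ->
          theta x = 1 /\ forall k, 'D_(basis3 k) theta x = 0].
Proof.
move=> [M [_ HM]]; have MM : M < `|M| + 1 by have := ler_norm M; lra.
pose b := bump (0 : R3 R) 1; have tb : testf b by exact: bump_test.
have b0 z : 0 <= b z by exact: bump_ge0.
have c0 : 0 < nrm1 b.
  by apply: (nrm1_pos (z := 0) tb); rewrite /b bump_eq1 ?oner_eq0// subrr normr0.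
pose c := nrm1 b; exists (\sum_k c^-1 * nrm1 ('D_(basis3 k) b)).
  by apply: sumr_ge0 => k _; rewrite mulr_ge0 ?nrm1_ge0// invr_ge0 ltW.
move=> N; pose t : R := 2 ^+ N; have t0 : 0 < t by exact: exprn_gt0.
have tE : 2^-1 ^+ N = t^-1 by rewrite exprVn.
rewrite !tE; have ti0 : 0 < t^-1 by rewrite invr_gt0.
pose kap (z : R3 R) := (c^-1 * t ^+ 3) * b (0 + t *: z).
have a0 : 0 <= c^-1 * t ^+ 3 by rewrite mulr_ge0 ?invr_ge0 ?exprn_ge0 ?ltW.
have tk : testf kap by exact: testf_dilate.
have k0 z : 0 <= kap z by exact: mulr_ge0.
have k1 : nrm1 kap = 1.
  rewrite nrm1_dilate// ger0_norm// -/c; field.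
  by rewrite !gt_eqF.
have ks z : kap z != 0 -> `|z| < 2 * t^-1.
  rewrite mulf_eq0 negb_or => /andP[_ bz]; rewrite ltNge; apply/negP => h; move: bz.
  rewrite /b bump_eq0 ?eqxx// subr0 add0r normrZ (gtr0_norm t0) mulr1.
  by rewrite -ler_pdivrMl// mulrC.
(* In units of [2^-N] the kernel has radius 2 and [A] is [D] eroded by 3. The unit [3 - 2] makes
   [theta] vanish near each point outside [D], and [6 = 3 + 2 + 1] makes it constantly 1 near points
   of depth 6; so its gradient vanishes in both cases. *)
pose A : set T3 := [set x : R3 R | forall y, `|y - x| < 3 * t^-1 -> D y].
have AD x : A x -> D x by move=> /(_ x); rewrite subrr normr0; apply; exact: mulr_gt0.
have mA : measurable A.
  rewrite -[A]setCK; apply: measurableC; apply: open_measurable3.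
  have -> : ~` A = \bigcup_(y in ~` D) ball y (3 * t^-1).
    apply/seteqP; split=> x.
      move=> nA; apply: contrapT => H; apply: nA => y yx; apply: contrapT => nD; apply: H.
      by exists y => //; rewrite -ball_normE.
    by move=> [y nD]; rewrite -ball_normE /ball_ /= => yx Ax; apply: nD; exact: Ax.
  by apply: bigcup_open => y _; apply: ball_open; exact: mulr_gt0.
have LA : L2c (\1_A : R3 R -> R).
  by apply: (L2c_indic (M := `|M| + 1)) mA _ => x /AD; exact: HM.
pose theta := conv kap (\1_A : R3 R -> R).
have th0 x : (forall y, A y -> 2 * t^-1 <= `|x - y|) -> theta x = 0.
  move=> H; apply: conv_eq0 => y; have [ay|ay] := pselect (A y); last by right; rewrite indicE memNset.
  by left; apply/eqP; apply: contrapT => /negP /ks; rewrite ltNge (H y ay).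
have th1 x : (forall y, `|x - y| < 2 * t^-1 -> A y) -> theta x = 1.
  by move=> H; apply: etrans k1; apply: (conv_indic_full tk k0) => y /ks; exact: H.
exists theta; split.
- exact: conv_smooth.
- move=> x; apply/andP; split.
    exact: (conv_indic_ge0 A x k0).
  apply: le_trans (ler_norm _) _; apply: le_trans (conv_indic_le x tk LA) _.
    by rewrite k1.
- move=> k x; rewrite (conv_derive x _ tk LA).2.
  apply: le_trans (conv_indic_le _ (test_derive _ tk) LA) _.
  have sb : smooth b := test_function_smooth tb.
  have -> : 'D_(basis3 k) kap = (fun z => (c^-1 * t ^+ 3 * t) * 'D_(basis3 k) b (0 + t *: z)).
    by apply/funext => z; exact: (derive_scaled_dilate _ t (basis3 k) z sb).
  rewrite [X in X <= _](nrm1_dilate (c^-1 * t ^+ 3 * t) t0 (test_derive (basis3 k) tb)).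
  rewrite ger0_norm; last by rewrite mulr_ge0// ltW.
  have -> : c^-1 * t ^+ 3 * t * t^-1 ^+ 3 = c^-1 * t by field; rewrite !gt_eqF.
  rewrite -/t mulr_suml (bigD1 k)//= mulrAC lerDl.
  by apply: sumr_ge0 => j _; rewrite !mulr_ge0 ?nrm1_ge0// ?invr_ge0 ltW.
- move=> x nD.
  have h y : A y -> 3 * t^-1 <= `|x - y|.
    by move=> Ay; rewrite leNgt; apply/negP => xy; apply: nD; exact: Ay.
  split; first by apply: th0 => y /h; lra.
  move=> k; apply: (@near_cst_derive _ _ 0 _ _ t^-1) => // x' xx'; apply: th0 => y /h.
  by have := ler_distD x' x y; lra.
- move=> x H.
  split.
    apply: th1 => y xy y' yy'; apply: H; have := ler_distD y y' x; rewrite (distrC y x); lra.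
  move=> k; apply: (@near_cst_derive _ _ 1 _ _ t^-1) => // x' xx'; apply: th1 => y xy y' yy'.
  by apply: H; have := ler_distD y y' x; have := ler_distD x' y x; rewrite (distrC y x') (distrC x' x); lra.
Qed.

Lemma nrm_cover (I : Type) (s : seq I) (D : I -> set T3) (f : T3 -> R) :
  (forall i, measurable (D i)) -> L2_3 f ->
  (forall x, f x != 0 -> \big[orb/false]_(i <- s) `[< D i x >]) ->
  nrm3 f <= \sum_(i <- s) nrm3 (res (D i) f).
Proof.
move=> mD; elim: s f => [|i s IH] f Lf Hf.
  have -> : f = 0 by apply/funext => x; apply/eqP; apply: contrapT => /negP /Hf; rewrite big_nil.
  by rewrite nrm0 big_nil.
have mC : measurable (~` D i) by exact: measurableC.
have E : f = res (D i) f + res (~` D i) f.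
  apply/funext => x; rewrite -[RHS]/(res (D i) f x + res (~` D i) f x).
  have [h|h] := pselect (D i x); first by rewrite (res_in _ h) res_out ?addr0//= => /(_ h).
  by rewrite (res_out _ h) res_in ?add0r.
have L1 : L2_3 (res (D i) f) by exact: L2_res.
have L2 : L2_3 (res (~` D i) f) by exact: L2_res.
rewrite {1}E big_cons; apply: le_trans (nrmD L1 L2) _; rewrite lerD2l.
apply: le_trans (IH _ L2 _) _.
  move=> x; have [h|h] := pselect (D i x); first by rewrite res_out ?eqxx//= => /(_ h).
  rewrite res_in// => /Hf; rewrite big_cons; case: asboolP => //.
apply: ler_sum => j _.
have -> : res (D j) (res (~` D i) f) = res (~` D i) (res (D j) f).
  by apply/funext => x; rewrite /res mulrCA.
by apply: nrm_res => //; exact: L2_res.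
Qed.

Lemma dyadic_below (q : R) : 1 <= q -> exists N : nat, 2 ^+ N <= q < 2 ^+ N.+1.
Proof.
move=> q1; have q0 : 0 <= q by lra.
exists (trunc_log 2 (Num.truncn q)); have tq : (0 < Num.truncn q)%N by rewrite truncn_gt0.
have /andP[h1 h2] := trunc_log_bounds (isT : 1 < 2)%N tq.
apply/andP; split.
  apply: le_trans (_ : (Num.truncn q)%:R <= q); first by rewrite -natrX ler_nat.
  by have /andP[] := truncn_itv q0.
by apply: lt_le_trans (truncnS_gt q) _; rewrite -natrX ler_nat.
Qed.

End Cutoff.

Lemma res_split d (T' : measurableType d) (R : realType) (B D : set T') (f : T' -> R) :
  res B f = res (B `\` D) f + res B (res D f).
Proof.
apply/funext => x; rewrite -[RHS]/(res (B `\` D) f x + res B (res D f) x).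
have [h1|h1] := pselect (B x); last by rewrite !res_out ?addr0//= => -[].
rewrite !(res_in _ h1); have [h2|h2] := pselect (D x).
  by rewrite (res_in _ h2) res_out ?add0r//= => -[].
by rewrite (res_out _ h2) res_in ?addr0.
Qed.

(** * Energy identities and strong convergence *)

Section StrongLimit.
Context {R : realType}.
Notation T3 := (measurableTypeR R * measurableTypeR R * measurableTypeR R)%type.
Notation L2_3 := (@L2 _ T3 R leb3).
Notation ip3 := (@ip _ T3 R leb3).
Notation nrm3 := (@nrm _ T3 R leb3).
Notation testf := (@test_function R R setT).

Definition cball (x0 : R3 R) (r : R) : set T3 := [set x : R3 R | `|x - x0| < r].

Lemma measurable_cball x0 r : measurable (cball x0 r).
Proof.
apply: open_measurable3; have [r0|r0] := ltP 0 r.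
  have -> : cball x0 r = ball x0 r by apply/seteqP; split=> x; rewrite -ball_normE /ball_ /= distrC.
  exact: ball_open.
have -> : cball x0 r = set0; last exact: open0.
by apply/seteqP; split=> // x /(le_lt_trans (normr_ge0 _)); rewrite ltNge r0.
Qed.

Lemma cvg0_le (F : set_system nat) {FF : Filter F} (a b : nat -> R) : (forall n, 0 <= a n <= b n) ->
  b n @[n --> F] --> (0 : R) -> a n @[n --> F] --> (0 : R).
Proof.
move=> ab /cvgrPdist_le b0; apply/cvgrPdist_le => e /b0; apply: filterS => n.
rewrite !sub0r !normrN; have /andP[a0 h] := ab n; rewrite !ger0_norm//; last exact: le_trans h.
exact: le_trans h.
Qed.

Lemma cvg0D (F : set_system nat) (FF : Filter F) (f g : nat -> R) : f n @[n --> F] --> (0 : R) ->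
  g n @[n --> F] --> (0 : R) -> f n + g n @[n --> F] --> (0 : R).
Proof. by move=> cf cg; have := cvgD cf cg; rewrite addr0; apply. Qed.

Lemma cvg0_sqr (F : set_system nat) {FF : Filter F} (a b : nat -> R) : (forall n, 0 <= a n) ->
  (forall n, a n ^+ 2 <= b n) -> b n @[n --> F] --> (0 : R) -> a n @[n --> F] --> (0 : R).
Proof.
move=> a0 ab /cvgrPdist_le b0; apply/cvgrPdist_le => e e0.
have e2 : 0 < e ^+ 2 by exact: exprn_gt0.
apply: filterS (b0 _ e2) => n; rewrite !sub0r !normrN => h.
have e0' := ltW e0; rewrite ger0_norm// -(@ler_pXn2r _ 2)// ?nnegrE//.
exact: le_trans (ab n) (le_trans (ler_norm _) h).
Qed.

Lemma decay_nrm (F : set_system nat) {FF : Filter F} (u : nat -> 'I_3 -> R3 R -> R) (psi : nat -> R3 R -> R)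
    (D : set T3) : measurable D -> (forall n k, L2_3 (u n k)) -> (forall n, testf (psi n)) ->
  (forall n x, 0 <= psi n x) -> (forall n x, D x -> psi n x = 1) ->
  \sum_k ip3 (u n k) (mulfield (psi n) (u n) k) @[n --> F] --> (0 : R) ->
  forall k, nrm3 (res D (u n k)) @[n --> F] --> (0 : R).
Proof.
move=> mD Lu tp p0 p1 c k; apply: cvg0_sqr c => n; first exact: nrm_ge0.
have pt j x : 0 <= u n j x * mulfield (psi n) (u n) j x.
  by rewrite /mulfield mulrCA -expr2 mulr_ge0// sqr_ge0.
have i0 j : 0 <= ip3 (u n j) (mulfield (psi n) (u n) j) by apply: Rintegral_ge0 => x _; exact: pt.
rewrite (bigD1 k)//= -[X in X <= _]addr0; apply: lerD; last by apply: sumr_ge0.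
have Lr := L2_res mD (Lu n k); have Lm := L2_mulfield (tp n) (Lu n k).
rewrite sqr_nrm; apply: le_Rintegral => //; [exact: (L2_mul Lr Lr)|exact: (L2_mul (Lu n k) Lm)|].
move=> x _; have [h|h] := pselect (D x).
  by rewrite (res_in _ h) /mulfield p1// mul1r.
by rewrite (res_out _ h) mul0r; exact: pt.
Qed.

Lemma bump_le1 (x0 : R3 R) r x : `|bump x0 r x| <= 1.
Proof.
suff /andP[h0 h1] : 0 <= bump x0 r x <= 1 by rewrite ger0_norm.
rewrite /bump; apply: (big_ind (fun y : R => 0 <= y <= 1)) => [|y z /andP[? ?] /andP[? ?]|k _].
- by rewrite ler01 lexx.
- by rewrite mulr_ge0// mulr_ile1.
- by rewrite plateau_ge0 plateau_le1.
Qed.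

Lemma bump_far (x0 : R3 R) r x : 0 < r -> 2 * r < `|x - x0| ->
  bump x0 r x = 0 /\ forall k, 'D_(basis3 k) (bump x0 r) x = 0.
Proof.
move=> r0 h; split; first by apply: bump_eq0 => //; exact: ltW.
move=> k; apply: (@near_cst_derive _ _ 0 _ _ (`|x - x0| - 2 * r)); first lra.
move=> y xy; apply: bump_eq0 => //; have := ler_distD y x x0; lra.
Qed.

Lemma bump_derive_le (x0 : R3 R) r : 0 < r -> exists2 B : R, 0 <= B &
  forall k x, `|'D_(basis3 k) (bump x0 r) x| <= B.
Proof.
move=> r0; have tb : testf (bump x0 r) by exact: bump_test.
have /choice[M HM] k : exists M : R, 0 <= M /\ forall x, `|'D_(basis3 k) (bump x0 r) x| <= M.
  by have [M M0 H] := test_bounded (test_derive (basis3 k) tb); exists M.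
exists (\sum_k M k); first by apply: sumr_ge0 => k _; case: (HM k).
move=> k x; apply: le_trans ((HM k).2 x) _; rewrite (bigD1 k)//= lerDl.
by apply: sumr_ge0 => j _; case: (HM j).
Qed.

Lemma shell_radius (W : 'I_3 -> R3 R) (e : R) (m1 : nat) : 0 < e -> exists2 m0 : nat, (m1 <= m0)%N &
  forall m a, (m0 <= m)%N -> in_shell m a -> `|\sum_k a k *: W k| <= e.
Proof.
move=> e0; set S := 2 * \sum_k `|W k|; have S0 : 0 <= S by apply: mulr_ge0 => //; apply: sumr_ge0.
have S1 : 0 < S + 1 by apply: ltr_wpDl.
have [N HN] := half_pow_small (divr_gt0 e0 S1).
exists (maxn m1 N); first exact: leq_maxl.
move=> m a mm Ha; apply: le_trans (sum_shell_small W Ha) _; rewrite -/S.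
have := HN m (leq_trans (leq_maxr _ _) mm); rewrite ler_pdivlMr// => h.
by apply: le_trans h; rewrite ler_wpM2l ?exprn_ge0// lerDl.
Qed.

Variables (Om Omm : set (R3 R)) (a : bool -> R) (hb : bool).
Hypothesis oOm : open Om.
Hypothesis bOm : bounded_set Om.
Hypothesis oOmm : open Omm.
Hypothesis cOmm : closure Omm `<=` Om.
Hypothesis coneOm : forall x0, closure Om x0 -> exists W l, dual_basis W l /\ cone_at Om W x0.
Hypothesis coneOmm : forall x0, closure Omm x0 -> exists W l, dual_basis W l /\ cone_at Omm W x0.
Hypothesis a0 : forall h, 0 < a h.

Let mOmm : measurable (Omm : set T3) := open_measurable3 oOmm.

Lemma cone_kernelOm x0 : closure Om x0 ->
  exists W K rho C, cone_kernel W K rho C /\ cone_at Om W x0.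
Proof.
move=> cx; have [W [l [dW Hc]]] := coneOm cx.
by have [K [rho [C ck]]] := dual_basis_kernel dW; exists W, K, rho, C.
Qed.

Lemma rhs_out s (u f : @fields R) h c k x : (forall h c k x, ~ Om x -> u h c k x = 0) ->
  (forall h c k x, ~ Om x -> f h c k x = 0) -> ~ Om x -> rhs Omm a s u f h c k x = 0.
Proof.
move=> uO fO nO; rewrite -[LHS]/((if h then s else 0) * res Omm (u false c k) x
  + (sgn h c * a h) * u (~~ h) (~~ c) k x + f h c k x).
by rewrite /res !uO// fO// !mulr0 !addr0.
Qed.

(** One of the two fields has its curl on the whole space, the other on [Om] only; [hb] decides
    which of them plays the first role in [green]. *)
Lemma green_sys s (u f : @fields R) c c' : L2f u -> L2f f ->
  (forall h c k x, ~ Om x -> u h c k x = 0) -> (forall h c k x, ~ Om x -> f h c k x = 0) ->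
  msys Om Omm a hb s f u ->
  \sum_k ip3 (rhs Omm a s u f true c k) (u false c' k)
  = \sum_k ip3 (u true c k) (rhs Omm a s u f false c' k).
Proof.
move=> Lu Lf uO fO sys.
have Lr h d k : L2_3 (rhs Omm a s u f h d k) by apply: L2_rhs.
have Lk h d k : L2_3 (u h d k) by exact: Lu.
have rO h d k x : ~ Om x -> rhs Omm a s u f h d k x = 0 by exact: rhs_out.
have := sys true c; have := sys false c'; rewrite /dom; case: (hb) => /= sE sH.
  by apply: (green bOm cone_kernelOm _ _ _ _ sH sE) => // j x; [exact: uO|exact: rO].
have := green bOm cone_kernelOm (Lk false c') (Lr false c') (Lk true c) (Lr true c) sE sH
  (uO false c') (rO false c') => E.
transitivity (\sum_k ip3 (u false c' k) (rhs Omm a s u f true c k)).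
  by apply: eq_bigr => k _; exact: ip_sym.
by rewrite -E; apply: eq_bigr => k _; exact: ip_sym.
Qed.

Lemma sgn_cases : [/\ sgn false false = -1 :> R, sgn false true = 1 :> R, sgn true false = 1 :> R & sgn true true = -1 :> R].
Proof. by []. Qed.

Lemma green_sys_expand s (u f : @fields R) c c' : L2f u -> L2f f ->
  (forall h c k x, ~ Om x -> u h c k x = 0) -> (forall h c k x, ~ Om x -> f h c k x = 0) ->
  msys Om Omm a hb s f u ->
  s * \sum_k ip3 (res Omm (u false c k)) (u false c' k)
   + sgn true c * a true * \sum_k ip3 (u false (~~ c) k) (u false c' k)
   + \sum_k ip3 (f true c k) (u false c' k)
  = sgn false c' * a false * \sum_k ip3 (u true c k) (u true (~~ c') k)
    + \sum_k ip3 (u true c k) (f false c' k).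
Proof.
move=> Lu Lf uO fO sys; have := green_sys c c' Lu Lf uO fO sys.
under eq_bigr do rewrite (ip_rhs a mOmm s true _ _ Lu Lf (Lu _ _ _)) /=.
rewrite !big_split /= -!mulr_sumr => ->.
have E k : ip3 (u true c k) (rhs Omm a s u f false c' k) =
    sgn false c' * a false * ip3 (u true c k) (u true (~~ c') k) + ip3 (u true c k) (f false c' k).
  rewrite ip_sym (ip_rhs a mOmm s false _ _ Lu Lf (Lu _ _ _)) /= mul0r add0r.
  by congr (_ * _ + _); exact: ip_sym.
by under eq_bigr do rewrite E; rewrite big_split /= -mulr_sumr.
Qed.

(** The real part of the energy identity. In the sum of the two diagonal cases [c = c'] the products
    of real with imaginary parts cancel, and only dissipation and sources remain. *)
Lemma energy_dissipated s (u f : @fields R) : L2f u -> L2f f ->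
  (forall h c k x, ~ Om x -> u h c k x = 0) -> (forall h c k x, ~ Om x -> f h c k x = 0) ->
  msys Om Omm a hb s f u ->
  s * \sum_c \sum_k nrm3 (res Omm (u false c k)) ^+ 2 =
  \sum_c \sum_k (ip3 (u true c k) (f false c k) - ip3 (f true c k) (u false c k)).
Proof.
move=> Lu Lf uO fO sys.
have E c k : nrm3 (res Omm (u false c k)) ^+ 2 = ip3 (res Omm (u false c k)) (u false c k).
  by rewrite sqr_nrm -ip_res2.
under eq_bigr do under eq_bigr do rewrite E.
have H1 := green_sys_expand true true Lu Lf uO fO sys.
have H0 := green_sys_expand false false Lu Lf uO fO sys.
have [s1 s2 s3 s4] := sgn_cases; rewrite s2 s4 /= in H1; rewrite s1 s3 /= in H0.
rewrite !big_bool /= !sumrB.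
have e1 : \sum_k ip3 (u false false k) (u false true k) = \sum_k ip3 (u false true k) (u false false k).
  by apply: eq_bigr => k _; exact: ip_sym.
have e2 : \sum_k ip3 (u true true k) (u true false k) = \sum_k ip3 (u true false k) (u true true k).
  by apply: eq_bigr => k _; exact: ip_sym.
rewrite e1 e2 in H1; move: H0 H1.
move: (\sum_k ip3 (res Omm (u false false k)) _) (\sum_k ip3 (res Omm (u false true k)) _) => D0 D1.
move: (\sum_k ip3 (u false true k) _) (\sum_k ip3 (u true false k) (u true true k)) => X Y.
move: (\sum_k ip3 (f true _ k) _) (\sum_k ip3 (f true _ k) _) (\sum_k ip3 (u true _ k) (f _ _ _)) (\sum_k ip3 (u true _ k) (f _ _ _)) => b1 b2 b3 b4.
by rewrite mulrDr; move: (s * D0) (s * D1) => p0 p1; nra.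
Qed.

(** The imaginary part: in the difference of the two cases [c' = ~~ c] the conductivity terms
    cancel, being symmetric in the two parts of the electric field. *)
Lemma energy_balance s (u f : @fields R) : L2f u -> L2f f ->
  (forall h c k x, ~ Om x -> u h c k x = 0) -> (forall h c k x, ~ Om x -> f h c k x = 0) ->
  msys Om Omm a hb s f u ->
  a false * \sum_c \sum_k nrm3 (u true c k) ^+ 2 = a true * \sum_c \sum_k nrm3 (u false c k) ^+ 2
  + \sum_c \sum_k (sgn true c * (ip3 (f true c k) (u false (~~ c) k) - ip3 (u true c k) (f false (~~ c) k))).
Proof.
move=> Lu Lf uO fO sys.
under eq_bigr do under eq_bigr do rewrite sqr_nrm.
under [X in _ = a true * X + _]eq_bigr do under eq_bigr do rewrite sqr_nrm.
have H1 := green_sys_expand true false Lu Lf uO fO sys.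
have H0 := green_sys_expand false true Lu Lf uO fO sys.
have [s1 s2 s3 s4] := sgn_cases; rewrite s1 s4 /= in H1; rewrite s2 s3 /= in H0.
rewrite !big_bool /= -!mulr_sumr !sumrB s3 s4.
have e1 : \sum_k ip3 (res Omm (u false true k)) (u false false k) = \sum_k ip3 (res Omm (u false false k)) (u false true k).
  by apply: eq_bigr => k _; rewrite ip_res; exact: ip_sym.
rewrite e1 in H1; move: H0 H1.
move: (\sum_k ip3 (res Omm _) _) (\sum_k ip3 (u true true k) (u true true k)) (\sum_k ip3 (u true false k) (u true false k)) => D0 h1 h0.
move: (\sum_k ip3 (u false true k) _) (\sum_k ip3 (u false false k) _) => E1 E0.
move: (\sum_k ip3 (f true _ k) _) (\sum_k ip3 (f true _ k) _) (\sum_k ip3 (u true _ k) (f _ _ _)) (\sum_k ip3 (u true _ k) (f _ _ _)) => b1 b2 b3 b4.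
by move: (a true) (a false) (s * D0) => A1 A0 sD; nra.
Qed.

(** * Decay near each point of the closure of Omega *)

Section Sequence.
Variables (F : set_system nat) (q : nat -> R) (u f : nat -> @fields R).
Hypothesis PF : ProperFilter F.
Hypothesis q1 : forall n, 1 <= q n.
Hypothesis Lu : forall n, L2f (u n).
Hypothesis Lf : forall n, L2f (f n).
Hypothesis u1 : forall n h c k, nrm3 (u n h c k) <= 1.
Hypothesis f1 : forall n h c k, nrm3 (f n h c k) <= 1.
Hypothesis d1 : forall n c k, q n * nrm3 (res Omm (u n false c k)) <= 1.
Hypothesis uO : forall n h c k x, ~ Om x -> u n h c k x = 0.
Hypothesis fO : forall n h c k x, ~ Om x -> f n h c k x = 0.
Hypothesis weak : forall h c k v, L2_3 v -> ip3 v (u n h c k) @[n --> F] --> (0 : R).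
Hypothesis diss : forall c k, q n * nrm3 (res Omm (u n false c k)) @[n --> F] --> (0 : R).
Hypothesis f0 : forall h c k, nrm3 (f n h c k) @[n --> F] --> (0 : R).
Hypothesis sys : forall n, msys Om Omm a hb (q n ^+ 2) (f n) (u n).
Hypothesis qoo : forall A : R, \forall n \near F, A <= q n.

(** Away from [Omm] a fixed bump serves as cutoff and blindness is plain distance. At a boundary
    point of [Om] only the field [h = hb] is treated: it may be cut across the boundary, and the
    cone keeps its potential inside [Om], where the other equation holds. *)
Lemma local_far h x0 : closure Om x0 -> ~ closure Omm x0 -> (h == hb) || `[< Om x0 >] ->
  exists2 r : R, 0 < r & cball x0 r `&` Omm = set0 /\
    forall c k, nrm3 (res (cball x0 r) (u n h c k)) @[n --> F] --> (0 : R).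
Proof.
move=> cx ncx hx.
have FF : Filter F by exact: _.
have [R2 R20 HR2] : exists2 R2 : R, 0 < R2 & forall x, Omm x -> R2 <= `|x - x0|.
  have nO : (~` closure Omm) x0 by [].
  have := open_nbhs_nbhs (conj (closed_openC (@closed_closure _ Omm)) nO) => /nbhs_ballP[e /= e0 He].
  exists e => // x Ox; rewrite leNgt; apply/negP => h'; apply: (He x); last exact: subset_closure.
  by rewrite -ball_normE /ball_ /= distrC.
have [R1 R10 HR1] : exists2 R1 : R, 0 < R1 & (h == hb) \/ forall x, `|x - x0| < R1 -> Om x.
  have [hh|hn] := boolP (h == hb); first by exists 1 => //; left.
  move: hx; rewrite (negbTE hn) /= => /asboolP Ox.
  have /nbhs_ballP[e /= e0 He] : nbhs x0 Om by exact: open_nbhs_nbhs.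
  by exists e => //; right => x xx; apply: He; rewrite -ball_normE /ball_ /= distrC.
have [W [l [dW [m1 [r1 [d [r10 d0 Hc]]]]]]] := coneOm cx.
have [K [rho [C ck]]] := dual_basis_kernel dW.
(* The bump lives in radius [2 r] and the shells have size at most [r], so what is seen lies within
   [3 r] of [x0], clear of [Omm]; the support must also fit where the cone condition and, if used,
   [Om] hold. *)
pose r := Num.min (Num.min (R2 / 8) (R1 / 4)) (r1 / 4).
have r0 : 0 < r by rewrite !lt_min !divr_gt0.
have rR2 : 8 * r <= R2 by have : r <= R2 / 8; [rewrite !ge_min lexx|lra].
have rR1 : 4 * r <= R1 by have : r <= R1 / 4; [rewrite !ge_min lexx orbT|lra].
have rr1 : 4 * r <= r1 by have : r <= r1 / 4; [rewrite !ge_min lexx orbT|lra].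
have [m0 m10 Hm0] := shell_radius W m1 r0.
pose chi := bump x0 r; have tchi : testf chi by exact: bump_test.
have [B B0 HB] := bump_derive_le x0 r0.
have tchi' : test_function (dom Om hb h) chi.
  apply: bump_test => // x /= xr; rewrite /dom; case: HR1 => [->//|H].
  by case: ifP => // _; apply: H; lra.
exists r => //; split.
  apply/seteqP; split=> // x [xr /HR2 h2]; suff : False by []; move: xr; rewrite /cball /=; lra.
move=> c; apply: (decay_nrm (psi := fun=> chi)) => //.
- exact: measurable_cball.
- by move=> n k; exact: Lu.
- by move=> _ x; exact: bump_ge0.
- by move=> _ x xr; apply: bump_eq1 => //; exact: ltW.
(* As no shell from [Omm] reaches the bump, any [M n] with [2 ^ M n >= q n] will do; here it follows
   from [2 ^ M n >= M n]. *)
pose M n := (m0.+1 + (Num.truncn (q n)).+1)%N.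
apply: (local_decay mOmm ck PF q1 Lu Lf u1 f1 d1 uO weak diss f0 sys a0 (chi := chi)
  (B := B + 1) (d := d) (r0 := `|x0| + 2 * r) (m0 := m0) (M := M)) => //.
- by move=> _ x; exact: bump_le1.
- by move=> x; exact: bump_le1.
- by move=> _ k x _; apply: le_trans (HB k x) _; rewrite lerDl.
- move=> n k x; apply: le_trans (HB k x) _; have := q1 n => qn.
  by apply: (@le_trans _ _ (B + 1)); [rewrite lerDl|rewrite ler_peMr// addr_ge0].
- move=> _ _ x; split=> // Ox; apply: bump_far => //; have := HR2 x Ox; lra.
- move=> _ x xr; apply: bump_far => //; have := ler_normD (x - x0) x0; rewrite subrK; lra.
- by move=> n; rewrite /M addSn ltnS leq_addr.
- move=> n; apply: (@le_trans _ _ 1); last by rewrite lerDr.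
  have p0 : 0 < 2 ^+ M n :> R by exact: exprn_gt0.
  rewrite exprVn mulrC ler_pdivrMr// mul1r.
  have := ltW (truncnS_gt (q n)) => /le_trans; apply.
  apply: (@le_trans _ _ (M n)%:R); first by rewrite ler_nat leq_addl.
  by rewrite -natrX ler_nat ltnW// ltn_expl.
- apply: nearW => n x m b Ox /andP[mm _] Hb; apply: bump_far => //.
  have := HR2 x Ox; have := Hm0 m b mm Hb.
  have := ler_distD (x - \sum_k b k *: W k) x x0; rewrite subKr.
  lra.
- move=> n y m b x cy Oy mm Hb xq; rewrite /dom; case: ifP => // _.
  apply: (Hc y m b x Oy _ (leq_trans m10 mm) Hb xq).
  have : `|y - x0| <= 2 * r.
    by rewrite leNgt; apply/negP => h2; move: cy; rewrite /chi (bump_far r0 h2).1 eqxx.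
  lra.
Qed.

(** The kernel uses the reversed cone [- W']. A convolution at [x] in [Omm] then reads the field at
    points shifted along the inward cone, deeper in [Omm], where [theta] is 1 and the cutoff
    [(1 - theta) * chi] vanishes. The scale of [theta] is comparable to [1 / q n]. *)
Lemma local_near x0 : closure Omm x0 ->
  exists2 r : R, 0 < r &
    forall c k, nrm3 (res (cball x0 r) (u n false c k)) @[n --> F] --> (0 : R).
Proof.
move=> cx; have FF : Filter F by exact: _.
have Ox0 := cOmm cx.
have [R1 R10 HR1] : exists2 R1 : R, 0 < R1 & forall x, `|x - x0| < R1 -> Om x.
  have /nbhs_ballP[e /= e0 He] : nbhs x0 Om by exact: open_nbhs_nbhs.
  by exists e => // x xx; apply: He; rewrite -ball_normE /ball_ /= distrC.
have [W' [l [dW [m1 [r1 [d [r10 d0 Hc]]]]]]] := coneOmm cx.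
have [K [rho [C ck]]] := dual_basis_kernel (dual_basis_opp dW).
have sW (b : 'I_3 -> R) : \sum_k b k *: - W' k = - \sum_k b k *: W' k.
  by rewrite -sumrN; apply: eq_bigr => k _; rewrite scalerN.
pose r := Num.min (R1 / 4) (r1 / 4).
have r0 : 0 < r by rewrite !lt_min !divr_gt0.
have rR1 : 4 * r <= R1 by have : r <= R1 / 4; [rewrite !ge_min lexx|lra].
have rr1 : 4 * r <= r1 by have : r <= r1 / 4; [rewrite !ge_min lexx orbT|lra].
have r2 : 0 < r / 2 by lra.
have [m0 m10 Hm0] := shell_radius (fun k => - W' k) m1 r2.
(* From [2^-c0 <= d / 6]: a point reached by shell [m] has depth at least [d * 2^-m], which is at
   least [6 * 2^-(N n)] as soon as [m + c0 <= N n]. *)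
have [c0 Hc0] := half_pow_small (divr_gt0 d0 (ltr0n R 6)).
pose chi := bump x0 r; have tchi : testf chi by exact: bump_test.
have [B B0 HB] := bump_derive_le x0 r0.
have bOmm : bounded_set Omm.
  have [Mb [Mr HMb]] := bOm; exists Mb; split=> // x /HMb H y /(@subset_closure _ Omm) /cOmm; exact: H.
have [B1 B10 Hcut] := cutoff bOmm.
have /choice[N HN] n := dyadic_below (q1 n).
have /choice[th Hth] n := Hcut (N n).
have sth n : smooth (fun x => 1 + (-1) * th n x).
  by have [s _ _ _ _] := Hth n; exact: (smoothD (@smooth_cst R (R3 R) R 1) (smoothZ (-1) s)).
pose psi n x := (1 + (-1) * th n x) * chi x.
have th01 n x : 0 <= 1 + (-1) * th n x <= 1.
  by have [_ h _ _ _] := Hth n; have /andP[h1 h2] := h x; apply/andP; split; lra.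
have schi := test_function_smooth tchi.
have Dpsi n k x : 'D_(basis3 k) (psi n) x =
    (1 + (-1) * th n x) * 'D_(basis3 k) chi x + chi x * (- 'D_(basis3 k) (th n) x).
  have [s _ _ _ _] := Hth n.
  rewrite /psi (derive_mul (smooth_derivable (sth n)) (smooth_derivable schi)).
  rewrite (derive_add (smooth_derivable (@smooth_cst R (R3 R) R 1)) (smooth_derivable (smoothZ (-1) s))).
  rewrite derive_cst add0r (derive_scal _ _ _ s); congr (_ + chi x * _); exact: mulN1r.
have qN n : 2 ^+ N n <= q n by have /andP[] := HN n.
have tchid : test_function (dom Om hb false) chi.
  apply: (bump_test r0) => x /= xr; rewrite /dom; case: ifP => // _.
  by apply: HR1; lra.
exists r => // c.
have cD : \sum_k ip3 (u n false c k) (mulfield (psi n) (u n false c) k) @[n --> F] --> (0 : R).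
  (* Every [m < N n - c0] satisfies the depth condition of [c0]. The bound [m0.+1] only secures
     [m0 < M n]; for large [n] the maximum is [N n - c0], since [q n] tends to infinity. *)
  pose M n := maxn m0.+1 (N n - c0).
  pose B2 : R := B + B1 + 2 ^+ c0.+1.
  have p20 : 0 <= 2 ^+ c0.+1 :> R by exact: exprn_ge0.
  apply: (local_decay mOmm ck PF q1 Lu Lf u1 f1 d1 uO weak diss f0 sys a0 (chi := chi)
    (B := B2) (d := r) (r0 := `|x0| + 2 * r) (m0 := m0) (M := M)).
  - exact: tchi.
  - by move=> n; exact: (test_mul tchid (sth n)).
  - move=> n x; rewrite normrM; have /andP[h1 h2] := th01 n x.
    by rewrite mulr_ile1// ?bump_le1// ger0_norm.
  - by move=> x; exact: bump_le1.
  - move=> n x nO; have [_ _ _ h _] := Hth n; have [e0 _] := h x nO.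
    by rewrite /psi e0 mulr0 addr0 mul1r.
  - move=> n k x nO; have [_ _ _ h _] := Hth n; have [e0 e1] := h x nO.
    by rewrite Dpsi e0 e1 oppr0 !mulr0 !addr0 mul1r; apply: le_trans (HB k x) _; rewrite /B2; lra.
  - move=> n k x; rewrite Dpsi; have [_ _ h _ _] := Hth n; have /andP[h1 h2] := th01 n x.
    apply: le_trans (ler_normD _ _) _.
    have t1 : `|(1 + -1 * th n x) * 'D_(basis3 k) chi x| <= B.
      by rewrite normrM (ger0_norm h1); apply: le_trans (HB k x); rewrite ler_piMl.
    have t2 : `|chi x * - 'D_(basis3 k) (th n) x| <= B1 * 2 ^+ N n.
      by rewrite normrM normrN; apply: le_trans (h k x); rewrite ler_piMl// bump_le1.
    apply: (@le_trans _ _ (B * q n + B1 * q n)).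
      apply: lerD; first by apply: le_trans t1 _; rewrite ler_peMr.
      by apply: le_trans t2 _; rewrite ler_wpM2l.
    rewrite -mulrDl ler_wpM2r//; first by have := q1 n; lra.
    by rewrite /B2; lra.
  - by [].
  - move=> n x xr; have [e0 e1] : chi x = 0 /\ forall k, 'D_(basis3 k) chi x = 0.
      apply: bump_far => //; have := ler_normD (x - x0) x0; rewrite subrK; lra.
    split; first by rewrite /psi e0 mulr0.
    by move=> k; rewrite Dpsi e0 e1 mulr0 mul0r addr0.
  - by move=> n; rewrite /M leq_max leqnn.
  - move=> n; apply: (@le_trans _ _ (2 ^+ c0.+1)); last by rewrite /B2; lra.
    have /andP[_ q2] := HN n.
    apply: (@le_trans _ _ (2^-1 ^+ M n * 2 ^+ (N n).+1)); first by rewrite ler_wpM2l ?exprn_ge0 ?ltW.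
    rewrite exprVn mulrC ler_pdivrMr ?exprn_gt0// -exprD ler_weXn2l//; first lra.
    rewrite addSn ltnS; apply: leq_trans (leq_add (leqnn c0) (leq_maxr m0.+1 _)).
    by rewrite -leq_subLR.
  - apply: filterS (qoo (2 ^+ (m0 + c0).+2)) => n qn x m b Ox /andP[mm mM] Hb.
    have Nb : ((m0 + c0).+1 <= N n)%N.
      rewrite -ltnS; have /andP[_ q2] := HN n; have := le_lt_trans qn q2.
      rewrite ltr_eXn2l//; last lra.
      exact: ltnW.
    have EM : M n = (N n - c0)%N by apply/maxn_idPr; rewrite ltn_subRL addnC -addSn addnC addnS addnC.
    rewrite EM in mM.
    have mN : (m + c0 <= N n)%N by apply: ltnW; rewrite addnC -ltn_subRL.
    have dN : 6 * 2^-1 ^+ N n <= d * 2^-1 ^+ m.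
      apply: (@le_trans _ _ (6 * 2^-1 ^+ (m + c0))).
        by rewrite ler_wpM2l// ler_wiXn2l// ?invr_ge0//; lra.
      have := Hc0 c0 (leqnn _); rewrite ler_pdivlMr// => hd.
      by rewrite exprD mulrCA mulrC ler_wpM2r ?exprn_ge0// mulrC.
    rewrite sW opprK.
    have [xr|xr] := ltP `|x - x0| r1.
      have [_ _ _ _ h] := Hth n.
      have [e1 e2] : th n (x + \sum_k b k *: W' k) = 1 /\
          forall k, 'D_(basis3 k) (th n) (x + \sum_k b k *: W' k) = 0.
        apply: h => z hz; apply: (Hc x m b z Ox xr (leq_trans m10 mm) Hb).
        exact: lt_le_trans hz dN.
      split; first by rewrite /psi e1 mulr1 subrr mul0r.
      by move=> k; rewrite Dpsi e1 e2 mulr1 subrr mul0r oppr0 mulr0 addr0.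
    have [e1 e2] : chi (x + \sum_k b k *: W' k) = 0 /\
          forall k, 'D_(basis3 k) chi (x + \sum_k b k *: W' k) = 0.
      apply: bump_far => //.
      have := Hm0 m b mm Hb; rewrite sW normrN => hh.
      have := ler_distD (x + \sum_k b k *: W' k) x x0; rewrite opprD addrA subrr sub0r normrN; lra.
    split; first by rewrite /psi e1 mulr0.
    by move=> k; rewrite Dpsi e1 e2 mulr0 mul0r addr0.
  - exact: r0.
  move=> n y m b x cy Oy mm Hb xq; rewrite /dom; case: ifP => // _; apply: HR1.
  have yr : `|y - x0| <= 2 * r.
    rewrite leNgt; apply/negP => h2; move: cy; rewrite /psi /chi (bump_far r0 h2).1 mulr0 eqxx//.
  have hh := Hm0 m b mm Hb.
  have pm : r * 2^-1 ^+ m <= r.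
    by rewrite ler_piMr// ?(ltW r0)// exprn_ile1//; lra.
  have := ler_distD (y + \sum_k b k *: - W' k) x x0.
  have : `|y + \sum_k b k *: - W' k - x0| <= `|y - x0| + `|\sum_k b k *: - W' k|.
    by rewrite addrAC ler_normD.
  lra.
(* Off [Omm] the cutoff is 1 on this ball; inside [Omm] the dissipation already gives the decay. *)
have mB : measurable (cball x0 r `\` Omm).
  by apply: measurableD => //; exact: measurable_cball.
have d2 := @decay_nrm F FF (fun n => u n false c) psi (cball x0 r `\` Omm) mB.
have {}d2 : forall k, nrm3 (res (cball x0 r `\` Omm) (u n false c k)) @[n --> F] --> (0 : R).
  apply: d2; last exact: cD.
  - by move=> n k; exact: Lu.
  - by move=> n; exact: (test_mul tchi (sth n)).
  - by move=> n x; rewrite mulr_ge0// ?bump_ge0//; have /andP[] := th01 n x.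
  - move=> n x [xr nO]; have [_ _ _ h _] := Hth n; have [e0 _] := h x nO.
    by rewrite /psi e0 mulr0 addr0 mul1r; apply: bump_eq1 => //; exact: ltW.
move=> k; have s0 := cvg0D FF (d2 k) (diss c k).
apply: cvg0_le s0 => n; rewrite nrm_ge0 /=.
have Lk : L2_3 (u n false c k) by exact: Lu.
rewrite (res_split (cball x0 r) Omm (u n false c k)).
have Lm : L2_3 (res Omm (u n false c k)) by exact: L2_res.
apply: le_trans (nrmD (L2_res mB Lk) (L2_res (measurable_cball _ _) Lm)) _; rewrite lerD2l.
apply: le_trans (nrm_res (measurable_cball _ _) Lm) _.
by rewrite ler_peMl// nrm_ge0.
Qed.

Lemma cvg0_const (A : R) (g : nat -> R) : g n @[n --> F] --> (0 : R) ->
  A * g n @[n --> F] --> (0 : R).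
Proof. by move=> cg; rewrite -(mulr0 A); apply: cvgMr. Qed.

(** With [hb = true] the cut field [chi H] is admissible in Green's formula up to the boundary. Its
    pairing with curl E tends to 0 with H, and its curl is a multiple of [chi E] plus terms in H and
    the source; so E paired with [chi E] tends to 0. *)
Lemma magnetic_to_electric x0 r : hb = true -> 0 < r -> cball x0 r `&` Omm = set0 ->
  (forall c k, nrm3 (res (cball x0 r) (u n true c k)) @[n --> F] --> (0 : R)) ->
  exists2 r' : R, 0 < r' &
    forall c k, nrm3 (res (cball x0 r') (u n false c k)) @[n --> F] --> (0 : R).
Proof.
move=> hbT r0 rO cH; have FF : Filter F by exact: _.
pose r' := r / 4; have r'0 : 0 < r' by rewrite /r'; lra.
pose chi := bump x0 r'; have tchi : testf chi by exact: bump_test.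
have [B B0 HB] := bump_derive_le x0 r'0.
have mchi := testf_measurable tchi.
have chi_in x : chi x != 0 -> cball x0 r x.
  rewrite /chi => cx; rewrite /cball /= ltNge; apply/negP => h; move: cx.
  by rewrite (bump_far r'0 _).1 ?eqxx// /r'; lra.
have Dchi_in k x : 'D_(basis3 k) chi x != 0 -> cball x0 r x.
  rewrite /chi => cx; rewrite /cball /= ltNge; apply/negP => h; move: cx.
  by rewrite (bump_far r'0 _).2 ?eqxx// /r'; lra.
have mb := measurable_cball x0 r.
exists r' => // c; apply: (decay_nrm (psi := fun=> chi)) => //.
- exact: measurable_cball.
- by move=> n k; exact: Lu.
- by move=> _ x; exact: bump_ge0.
- by move=> _ x xr; apply: bump_eq1 => //; exact: ltW.
pose H n := u n true (~~ c); pose E n := u n false c.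
pose rH n := rhs Omm a (q n ^+ 2) (u n) (f n) true (~~ c).
pose rE n := rhs Omm a (q n ^+ 2) (u n) (f n) false c.
have LrH n k : L2_3 (rH n k) by apply: L2_rhs.
have LrE n k : L2_3 (rE n k) by apply: L2_rhs.
have G n : \sum_k ip3 (mulcurl chi (H n) (rH n) k) (E n k) = \sum_k ip3 (mulfield chi (H n) k) (rE n k).
  apply: (green bOm cone_kernelOm).
  - by move=> k; apply: L2_mulfield => //; exact: Lu.
  - by move=> k; apply: L2_mulcurl => // j; exact: Lu.
  - by move=> k; exact: Lu.
  - by move=> k; exact: LrE.
  - apply: (wcurl_mul (U := setT)) => // [|j]; last exact: Lu.
    by have := @sys n true (~~ c); rewrite /dom hbT.
  - by have := @sys n false c; rewrite /dom hbT.
  - by move=> j x nO; rewrite /mulfield /H uO// mulr0.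
  - move=> j x nO; apply: mulcurl_eq0 => [k|]; first exact: uO.
    by apply: rhs_out nO => *; [exact: uO|exact: fO].
pose g1 n k := fun x => chi x * f n true (~~ c) k x.
pose g2 n i j := fun x => 'D_(basis3 i) chi x * H n j x.
pose T n k := g1 n k + (g2 n (k + 1) (k + 2) - g2 n (k + 2) (k + 1)).
have Lg1 n k : L2_3 (g1 n k) by apply: L2_mult => //; exact: Lf.
have Lg2 n i j : L2_3 (g2 n i j) by apply: L2_mult; [exact: test_derive|exact: Lu].
have LE n k : L2_3 (fun x => chi x * E n k x) by apply: L2_mult => //; exact: Lu.
have LT n k : L2_3 (T n k) by apply: L2D => //; exact: L2B.
have Ecurl n k : mulcurl chi (H n) (rH n) k = (sgn true (~~ c) * a true) *: (fun x => chi x * E n k x) + T n k.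
  apply/funext => x; rewrite -[RHS]/((sgn true (~~ c) * a true) * (chi x * E n k x) +
     (chi x * f n true (~~ c) k x + ('D_(basis3 (k + 1)) chi x * H n (k + 2) x - 'D_(basis3 (k + 2)) chi x * H n (k + 1) x))).
  rewrite -[LHS]/(chi x * (q n ^+ 2 * res Omm (u n false (~~ c) k) x + (sgn true (~~ c) * a true) * u n false (~~ (~~ c)) k x + f n true (~~ c) k x)
     + ('D_(basis3 (k + 1)) chi x * H n (k + 2) x - 'D_(basis3 (k + 2)) chi x * H n (k + 1) x)).
  have z : chi x * res Omm (u n false (~~ c) k) x = 0.
    have [->|/chi_in cx] := eqVneq (chi x) 0; first by rewrite mul0r.
    rewrite res_out ?mulr0// => ox.
    by have : (cball x0 r `&` Omm) x; [|rewrite rO].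
  have alg (X e s S m y t : R) : X * e = 0 -> X * (s * e + S * y + m) + t = S * (X * y) + (X * m + t).
    by move=> h; rewrite !mulrDr mulrCA h; ring.
  by rewrite negbK; exact: alg z.
pose bd n := \sum_k (nrm3 (res (cball x0 r) (H n k)) * (a false + 1) + (nrm3 (f n true (~~ c) k)
   + B * (nrm3 (res (cball x0 r) (H n (k + 2))) + nrm3 (res (cball x0 r) (H n (k + 1)))))).
have cb : bd n @[n --> F] --> (0 : R).
  apply: cvg0_sum => k.
  have h1 : nrm3 (res (cball x0 r) (H n k)) * (a false + 1) @[n --> F] --> (0 : R).
    by rewrite -(mul0r (a false + 1)); apply: cvgMl; exact: cH.
  have h2 := cvg0_const B (_ : nrm3 (res (cball x0 r) (H n (k + 2))) + nrm3 (res (cball x0 r) (H n (k + 1))) @[n --> F] --> (0 : R)).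
  have h3 := cvg0D FF (cH (~~ c) (k + 2)) (cH (~~ c) (k + 1)).
  exact: (cvg0D FF h1 (cvg0D FF (f0 true (~~ c) k) (h2 h3))).
pose S n := \sum_k ip3 (E n k) (mulfield chi (E n) k).
suff le n : `|S n| <= (a true)^-1 * bd n.
  apply/cvgrPdist_le => e e0; move/cvgrPdist_le: (cvg0_const (a true)^-1 cb) => /(_ _ e0); apply: filterS => n.
  rewrite !sub0r !normrN => /(le_trans (ler_norm _)); exact: le_trans (le n).
have nT k : nrm3 (T n k) <= nrm3 (f n true (~~ c) k)
   + B * (nrm3 (res (cball x0 r) (H n (k + 2))) + nrm3 (res (cball x0 r) (H n (k + 1)))).
  apply: le_trans (nrmD (Lg1 n k) (L2B (Lg2 n _ _) (Lg2 n _ _))) _; apply: lerD.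
    have := (nrm_mulb mchi (bump_le1 x0 r') (Lf n true (~~ c) k)).2; rewrite mul1r; apply.
  apply: le_trans (nrmB (Lg2 n _ _) (Lg2 n _ _)) _; rewrite mulrDr.
  have h i j : nrm3 (g2 n i j) <= B * nrm3 (res (cball x0 r) (H n j)).
    have -> : g2 n i j = (fun x => 'D_(basis3 i) chi x * res (cball x0 r) (H n j) x).
      apply/funext => x; rewrite /g2; have [->|/Dchi_in cx] := eqVneq ('D_(basis3 i) chi x) 0.
        by rewrite !mul0r.
      by rewrite res_in.
    have Lrb : L2_3 (res (cball x0 r) (H n j)) by apply: L2_res => //; exact: Lu.
    exact: (nrm_mulb (testf_measurable (test_derive (basis3 i) tchi)) (HB i) Lrb).2.
  by apply: lerD.
have nE k : `|ip3 (mulfield chi (H n) k) (rE n k)| <= nrm3 (res (cball x0 r) (H n k)) * (a false + 1).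
  have Lrb : L2_3 (res (cball x0 r) (H n k)) by apply: L2_res => //; exact: Lu.
  have Lm : L2_3 (mulfield chi (H n) k) by apply: L2_mulfield => //; exact: Lu.
  apply: le_trans (ip_nrm Lm (LrE n k)) _; apply: ler_pM; rewrite ?nrm_ge0//.
    have -> : mulfield chi (H n) k = (fun x => chi x * res (cball x0 r) (H n k) x).
      apply/funext => x; rewrite /mulfield; have [->|/chi_in cx] := eqVneq (chi x) 0.
        by rewrite !mul0r.
      by rewrite res_in.
    by have := (nrm_mulb mchi (bump_le1 x0 r') Lrb).2; rewrite mul1r.
  have -> : rE n k = (sgn false c * a false) *: u n true (~~ c) k + f n false c k.
    by rewrite /rE /rhs scale0r add0r.
  apply: le_trans (nrmD (L2Z _ (Lu n true (~~ c) k)) (Lf n false c k)) _; apply: lerD; last exact: f1.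
  rewrite nrmZ ?normrM ?normr_sgn ?mul1r; last exact: Lu.
  by rewrite (gtr0_norm (a0 false)) ler_piMr ?(ltW (a0 false))//; exact: u1.
rewrite ler_pdivlMl//.
have -> : a true * `|S n| = `|sgn true (~~ c) * a true * S n|.
  by rewrite !normrM normr_sgn mul1r (gtr0_norm (a0 true)).
have -> : sgn true (~~ c) * a true * S n =
    \sum_k (ip3 (mulfield chi (H n) k) (rE n k) - ip3 (T n k) (E n k)).
  rewrite sumrB -G -sumrB /S mulr_sumr; apply: eq_bigr => k _.
  rewrite Ecurl (ip_Dl (L2Z _ (LE n k)) (LT n k) (Lu n false c k)) addrK.
  rewrite (ip_Zl _ (LE n k) (Lu n false c k)); congr (_ * _); exact: ip_sym.
apply: le_trans (ler_norm_sum _ _ _) _; apply: ler_sum => k _.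
apply: le_trans (ler_normB _ _) _; apply: lerD; first exact: nE.
apply: le_trans (ip_nrm (LT n k) (Lu n false c k)) _.
by apply: le_trans (nT k); rewrite ler_piMr ?nrm_ge0//; exact: u1.
Qed.

(** A finite cover of the closure of [Om]. The points not reached directly are the outer boundary
    points when [hb = true], where the magnetic field decays first and carries the electric one
    along. *)
Lemma electric_decay c k : nrm3 (u n false c k) @[n --> F] --> (0 : R).
Proof.
have FF : Filter F by exact: _.
pose good (x0 : R3 R) (r : R) := 0 < r /\
  forall c k, nrm3 (res (cball x0 r) (u n false c k)) @[n --> F] --> (0 : R).
have /choice[r Hr] (x0 : R3 R) : exists r : R, closure Om x0 -> good x0 r.
  have [cx|cx] := pselect (closure Om x0); last by exists 0.
  have [cm|ncm] := pselect (closure Omm x0).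
    by have [r r0 H] := local_near cm; exists r.
  have [hO|hO] := boolP ((false == hb) || `[< Om x0 >]).
    by have [r r0 [_ H]] := local_far cx ncm hO; exists r.
  move: hO; rewrite negb_or => /andP[hh _]; have hbT : hb = true by move: hh; case: (hb).
  have hT : (true == hb) || `[< Om x0 >] by rewrite hbT.
  have [r r0 [rO H]] := local_far cx ncm hT.
  by have [r' r'0 H'] := magnetic_to_electric hbT r0 rO H; exists r'.
have cOm := compact_closure bOm.
have [s [sO sC]] := finite_cover cOm (fun y cy => (Hr y cy).1).
have c0 : \sum_(y <- s) nrm3 (res (cball y (r y)) (u n false c k)) @[n --> F] --> (0 : R).
  have -> : (fun n => \sum_(y <- s) nrm3 (res (cball y (r y)) (u n false c k))) =
     (fun n => \sum_(y <- s) (if y \in s then nrm3 (res (cball y (r y)) (u n false c k)) else 0)).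
    by apply/funext => n; rewrite [LHS]big_seq [RHS]big_seq; apply: eq_bigr => y ->.
  apply: cvg0_sum => y; have [ys|ys] := boolP (y \in s); last exact: cvg_cst.
  exact: (Hr y (sO y ys)).2.
apply: cvg0_le c0 => n; rewrite nrm_ge0 /=.
apply: nrm_cover; [by move=> y; exact: measurable_cball|exact: Lu|].
move=> x ux; have Ox : Om x by apply: contrapT => nO; rewrite uO ?eqxx in ux.
have [y ys xy] := sC x (@subset_closure _ Om x Ox).
by rewrite (big_rem y)//=; apply/orP; left; apply/asboolP.
Qed.

(** The energy balance bounds the magnetic norm by the electric norm and the sources, so the decay
    of E decides both. *)
Lemma magnetic_decay c k : nrm3 (u n true c k) @[n --> F] --> (0 : R).
Proof.
have FF : Filter F by exact: _.
pose e n := \sum_d \sum_j (a true * nrm3 (u n false d j) + (nrm3 (f n true d j) + nrm3 (f n false (~~ d) j))).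
have ce : e n @[n --> F] --> (0 : R).
  apply: cvg0_sum => d; apply: cvg0_sum => j.
  exact: (cvg0D FF (cvg0_const (a true) (electric_decay d j)) (cvg0D FF (f0 true d j) (f0 false (~~ d) j))).
apply: cvg0_sqr (cvg0_const (a false)^-1 ce) => n; first exact: nrm_ge0.
rewrite ler_pdivlMl//.
apply: (@le_trans _ _ (a false * \sum_d \sum_j nrm3 (u n true d j) ^+ 2)).
  rewrite ler_wpM2l ?(ltW (a0 false))// (bigD1 c)//= (bigD1 k)//= -addrA lerDl.
  apply: addr_ge0; first by apply: sumr_ge0 => j _; exact: sqr_ge0.
  by apply: sumr_ge0 => d _; apply: sumr_ge0 => j _; exact: sqr_ge0.
rewrite (energy_balance (Lu n) (Lf n) (@uO n) (@fO n) (sys n)).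
rewrite mulr_sumr -big_split; apply: ler_sum => d _ /=.
rewrite mulr_sumr -big_split; apply: ler_sum => j _ /=; apply: lerD.
  rewrite ler_wpM2l ?(ltW (a0 true))// expr2 ler_piMr ?nrm_ge0//; exact: u1.
apply: le_trans (ler_norm _) _; rewrite normrM normr_sgn mul1r.
apply: le_trans (ler_normB _ _) _; apply: lerD.
  apply: le_trans (ip_nrm (Lf n true d j) (Lu n false (~~ d) j)) _.
  by rewrite ler_piMr ?nrm_ge0//; exact: u1.
apply: le_trans (ip_nrm (Lu n true d j) (Lf n false (~~ d) j)) _.
by rewrite ler_piMl ?nrm_ge0//; exact: u1.
Qed.

End Sequence.
End StrongLimit.

(** * The a priori estimate *)

Section APriori.
Context {R : realType}.
Notation T3 := (measurableTypeR R * measurableTypeR R * measurableTypeR R)%type.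
Notation L2_3 := (@L2 _ T3 R leb3).
Notation ip3 := (@ip _ T3 R leb3).
Notation nrm3 := (@nrm _ T3 R leb3).
Notation testf := (@test_function R R setT).
Notation flds := (@fields R).

Lemma ip0l (v : T3 -> R) : ip3 0 v = 0.
Proof. by apply: ip_disjoint => x; rewrite mul0r. Qed.

Lemma ip0r (v : T3 -> R) : ip3 v 0 = 0.
Proof. by apply: ip_disjoint => x; rewrite mulr0. Qed.

Lemma wcurl_lin U (t : R) (u g v h : 'I_3 -> R3 R -> R) : (forall j, L2_3 (u j)) -> (forall j, L2_3 (g j)) ->
  (forall j, L2_3 (v j)) -> (forall j, L2_3 (h j)) -> wcurl U u g -> wcurl U v h ->
  wcurl U (fun k => t *: u k + v k) (fun k => t *: g k + h k).
Proof.
move=> Lu Lg Lv Lh wu wv phi tphi k.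
have tp : testf phi := test_function_sub (@subsetT _ U) tphi.
have Lphi := (testf_L2c tp).1; have LD j := (testf_L2c (test_derive (basis3 j) tp)).1.
rewrite (ip_bilin t (Lg k) (Lh k) Lphi) (ip_bilin t (Lu _) (Lv _) (LD _)) (ip_bilin t (Lu _) (Lv _) (LD _)).
by rewrite (wu _ tphi k) (wv _ tphi k); move: (ip3 _ _) (ip3 _ _) (ip3 _ _) (ip3 _ _) => *; ring.
Qed.

Lemma nrm_eq0_ip (w v : T3 -> R) : L2_3 w -> L2_3 v -> nrm3 w = 0 -> ip3 w v = 0.
Proof. by move=> Lw Lv w0; apply/eqP; rewrite -normr_le0 -(mul0r (nrm3 v)) -w0; exact: ip_nrm. Qed.

Variables (Om Omm : set (R3 R)) (a : bool -> R) (hb : bool).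
Hypothesis oOm : open Om.
Hypothesis bOm : bounded_set Om.
Hypothesis oOmm : open Omm.
Hypothesis cOmm : closure Omm `<=` Om.
Hypothesis coneOm : forall x0, closure Om x0 -> exists W l, dual_basis W l /\ cone_at Om W x0.
Hypothesis coneOmm : forall x0, closure Omm x0 -> exists W l, dual_basis W l /\ cone_at Omm W x0.
Hypothesis a0 : forall h, 0 < a h.
Hypothesis null : leb3 (boundary Omm : set T3) = 0%E.

Let mOmm : measurable (Omm : set T3) := open_measurable3 oOmm.
Let mOm : measurable (Om : set T3) := open_measurable3 oOm.

Definition Omp : set (R3 R) := Om `\` closure Omm.

(** The limit problem for zero extensions. The equation of E is tested across Sigma although E
    vanishes beyond it: this encodes the tangential condition on Sigma. The equation of H is tested
    only away from [closure Omm]. *)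
Definition lsys (u : flds) : Prop :=
  (forall c, wcurl (dom Om hb false) (u false c) (rhs Omm a 0 u (fun _ _ _ => 0) false c)) /\
  (forall c, wcurl (dom Om hb true `\` closure Omm) (u true c) (rhs Omm a 0 u (fun _ _ _ => 0) true c)).

Definition vanish (u : flds) := forall h c k x, ~ Om x -> u h c k x = 0.

Hypothesis uniq : forall u : flds, L2f u -> (forall h c k x, ~ Omp x -> u h c k x = 0) -> lsys u ->
  forall h c k, {ae leb3, forall x : T3, u h c k x = 0}.

Lemma rhs_lin s t (u v f g : flds) h c k :
  rhs Omm a s (fun h c k => t *: u h c k + v h c k) (fun h c k => t *: f h c k + g h c k) h c k =
  t *: rhs Omm a s u f h c k + rhs Omm a s v g h c k.
Proof.
apply/funext => x; pose z : R := if h then s else 0.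
rewrite -[LHS]/(z * (\1_Omm x * (t * u false c k x + v false c k x)) +
  (sgn h c * a h) * (t * u (~~ h) (~~ c) k x + v (~~ h) (~~ c) k x) + (t * f h c k x + g h c k x)).
rewrite -[RHS]/(t * (z * (\1_Omm x * u false c k x) + (sgn h c * a h) * u (~~ h) (~~ c) k x + f h c k x) +
   (z * (\1_Omm x * v false c k x) + (sgn h c * a h) * v (~~ h) (~~ c) k x + g h c k x)).
ring.
Qed.

Lemma L2f_lin t (u v : flds) : L2f u -> L2f v -> L2f (fun h c k => t *: u h c k + v h c k).
Proof. by move=> Lu Lv h c k; exact: L2_lin. Qed.

Lemma vanish_lin t (u v : flds) : vanish u -> vanish v -> vanish (fun h c k => t *: u h c k + v h c k).
Proof.
by move=> u0 v0 h c k x nO; rewrite -[LHS]/(t * u h c k x + v h c k x) u0// v0// mulr0 addr0.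
Qed.

Lemma msys_lin s t (u v f g : flds) : L2f u -> L2f v -> L2f f -> L2f g ->
  msys Om Omm a hb s f u -> msys Om Omm a hb s g v ->
  msys Om Omm a hb s (fun h c k => t *: f h c k + g h c k) (fun h c k => t *: u h c k + v h c k).
Proof.
move=> Lu Lv Lf Lg su sv h c.
have -> : rhs Omm a s (fun h c k => t *: u h c k + v h c k) (fun h c k => t *: f h c k + g h c k) h c =
  (fun k => t *: rhs Omm a s u f h c k + rhs Omm a s v g h c k) by apply/funext => k; exact: rhs_lin.
by apply: wcurl_lin; [move=> j; exact: Lu|move=> j; exact: L2_rhs|move=> j; exact: Lv|move=> j; exact: L2_rhs|exact: su|exact: sv].
Qed.

Lemma msys0 s : msys Om Omm a hb s (fun _ _ _ => 0) (fun _ _ _ => 0).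
Proof.
have Z : L2f (fun _ _ _ => 0 : R3 R -> R) by move=> *; exact: L2_0.
move=> h1 c1 phi tp k1; rewrite !ip0l subr0 (ip_rhs a mOmm _ h1 c1 k1 Z Z); last first.
  exact: (testf_L2c (test_function_sub (@subsetT _ _) tp)).1.
rewrite (_ : res Omm 0 = 0) ?ip0l ?mulr0 ?addr0//.
by apply/funext => x; rewrite /res mulr0.
Qed.

Section WeakLimit.
Variables (F : set_system nat) (q : nat -> R) (u f : nat -> flds) (l : flds).
Hypothesis PF : ProperFilter F.
Hypothesis Lu : forall n, L2f (u n).
Hypothesis Lf : forall n, L2f (f n).
Hypothesis Ll : L2f l.
Hypothesis uO : forall n, vanish (u n).
Hypothesis weak : forall h c k v, L2_3 v -> ip3 v (u n h c k) @[n --> F] --> (ip3 v (l h c k) : R).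
Hypothesis E0 : forall c k, nrm3 (res Omm (u n false c k)) @[n --> F] --> (0 : R).
Hypothesis f0 : forall h c k, nrm3 (f n h c k) @[n --> F] --> (0 : R).
Hypothesis sys : forall n, msys Om Omm a hb (q n) (f n) (u n).

Let FF : Filter F := _.

Lemma cvg0_abs (s b : nat -> R) : (forall n, `|s n| <= b n) -> b n @[n --> F] --> (0 : R) ->
  s n @[n --> F] --> (0 : R).
Proof.
move=> sb /cvgrPdist_le b0; apply/cvgrPdist_le => e /b0; apply: filterS => n.
rewrite !sub0r !normrN => /(le_trans (ler_norm _)); exact: le_trans (sb n).
Qed.

Lemma source_weak h c k v : L2_3 v -> ip3 (f n h c k) v @[n --> F] --> (0 : R).
Proof.
move=> Lv; apply: (cvg0_abs (b := fun n => nrm3 (f n h c k) * nrm3 v)).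
  by move=> n; apply: ip_nrm => //; exact: Lf.
by rewrite -(mul0r (nrm3 v)); apply: cvgMl; exact: f0.
Qed.

Lemma limit_uniq h c k v (b : R) : L2_3 v -> ip3 v (u n h c k) @[n --> F] --> b -> ip3 v (l h c k) = b.
Proof. by move=> Lv c1; have w := @weak h c k v Lv; have := @cvg_uniqR R nat F PF _ _ _ w c1. Qed.

Lemma limit_outside h c k v : L2_3 v -> ip3 (res (~` Om) v) (l h c k) = 0.
Proof.
move=> Lv; apply: limit_uniq; first by apply: L2_res => //; exact: measurableC.
have -> : (fun n => ip3 (res (~` Om) v) (u n h c k)) = cst 0; last exact: cvg_cst.
apply/funext => n; apply: ip_disjoint => x; have [Ox|Ox] := pselect (Om x).
  by rewrite res_out ?mul0r//= => /(_ Ox).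
by rewrite uO// mulr0.
Qed.

Lemma limit_electric c k v : L2_3 v -> ip3 (res Omm v) (l false c k) = 0.
Proof.
move=> Lv; apply: limit_uniq; first exact: L2_res.
apply: (cvg0_abs (b := fun n => nrm3 v * nrm3 (res Omm (u n false c k)))).
  by move=> n; rewrite ip_res; apply: ip_nrm => //; apply: L2_res => //; exact: Lu.
by rewrite -(mulr0 (nrm3 v)); apply: cvgMr; exact: E0.
Qed.

Lemma electric_test c k phi : test_function Omm phi -> ip3 (u n false c k) phi @[n --> F] --> (0 : R).
Proof.
move=> tp; have Lp := (testf_L2c (test_function_sub (@subsetT _ Omm) tp)).1.
have E n : ip3 (u n false c k) phi = ip3 (res Omm (u n false c k)) phi.
  congr Rintegral; apply/funext => x; have [Ox|Ox] := pselect (Omm x); first by rewrite res_in.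
  by rewrite (test_function0 tp Ox) !mulr0.
under eq_fun do rewrite E.
apply: (cvg0_abs (b := fun n => nrm3 (res Omm (u n false c k)) * nrm3 phi)).
  by move=> n; apply: ip_nrm => //; apply: L2_res => //; exact: Lu.
by rewrite -(mul0r (nrm3 phi)); apply: cvgMl; exact: E0.
Qed.

(** In [Omm] the magnetic field is, up to the source, a multiple of the curl of the electric field,
    which tends to 0 there. *)
Lemma limit_magnetic c k v : L2_3 v -> ip3 (res Omm v) (l true c k) = 0.
Proof.
move=> Lv; have mB : measurable_fun setT (res Omm (l true c k)).
  by apply: measurable_res => //; case: (Ll true c k).
have Lr : L2_3 (res Omm (l true c k)) by apply: L2_res => //; exact: Ll.
suff ae : {ae leb3, forall x : T3, res Omm (l true c k) x = 0}.
  by rewrite ip_res ip_sym; apply: nrm_eq0_ip => //; exact: nrm_ae0.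
have : {ae leb3, forall x : T3, Omm x -> l true c k x = 0}.
  apply: (test_orth_ae0_on oOmm (Ll true c k)) => phi tp.
  have tpT : testf phi := test_function_sub (@subsetT _ Omm) tp.
  have Lp := (testf_L2c tpT).1.
  have tpd : test_function (dom Om hb false) phi.
    apply: test_function_sub tp => x Ox; rewrite /dom; case: ifP => // _.
    by apply: cOmm; exact: subset_closure.
  rewrite ip_sym; apply: limit_uniq => //.
  pose cc := ~~ c; pose A := (sgn false cc * a false)^-1 : R.
  have An : sgn false cc * a false != 0.
    by rewrite mulf_neq0 ?(gt_eqF (a0 false))// -normr_gt0 normr_sgn.
  have E n : ip3 phi (u n true c k) = A * (ip3 (u n false cc (k + 1)) ('D_(basis3 (k + 2)) phi)
     - ip3 (u n false cc (k + 2)) ('D_(basis3 (k + 1)) phi) - ip3 (f n false cc k) phi).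
    have := @sys n false cc phi tpd k; rewrite (ip_rhs a mOmm _ false _ _ (Lu n) (Lf n) Lp) /= mul0r add0r /cc negbK => <-.
    by rewrite addrK mulrA /A mulVf// mul1r; exact: ip_sym.
  under eq_fun do rewrite E.
  have c1 := electric_test cc (k + 1) (test_derive (basis3 (k + 2)) tp).
  have c2 := electric_test cc (k + 2) (test_derive (basis3 (k + 1)) tp).
  have c3 := source_weak false cc k Lp.
  rewrite -(mulr0 A); apply: cvgMr.
  by have := cvgB (cvgB c1 c2) c3; rewrite !subr0; apply.
apply: ae_imp => x H; have [Ox|Ox] := pselect (Omm x); first by rewrite res_in// H.
by rewrite res_out.
Qed.

Lemma mOmp : measurable (Omp : set T3).
Proof.
apply: measurableD => //; rewrite -[closure Omm]setCK; apply: measurableC; apply: open_measurable3.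
by apply: closed_openC; exact: closed_closure.
Qed.

(** The space is split into [Omp], the complement of [Om], [Omm] and its boundary. The limit
    vanishes on the second and third pieces, and the fourth is a null set. *)
Lemma limit_restrict h c k v : L2_3 v -> ip3 v (res Omp (l h c k)) = ip3 v (l h c k).
Proof.
move=> Lv; have mB : measurable (boundary Omm : set T3).
  apply: measurableD; last by apply: open_measurable3; exact: open_interior.
  rewrite -[closure Omm]setCK; apply: measurableC; apply: open_measurable3.
  by apply: closed_openC; exact: closed_closure.
have Lk : L2_3 (l h c k) by exact: Ll.
have L1 : L2_3 (res Omp v) by apply: L2_res => //; exact: mOmp.
have L2 : L2_3 (res (~` Om) v) by apply: L2_res => //; exact: measurableC.
have L3 : L2_3 (res Omm v) by exact: L2_res.
have L4 : L2_3 (res (boundary Omm) v) by exact: L2_res.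
have iO : interior Omm = Omm by apply/interior_id.
have E : v = res Omp v + (res (~` Om) v + (res Omm v + res (boundary Omm) v)).
  apply/funext => x; rewrite -[RHS]/(res Omp v x + (res (~` Om) v x + (res Omm v x + res (boundary Omm) v x))).
  have [Ox|Ox] := pselect (Om x); last first.
    have nm : ~ closure Omm x by move=> /cOmm.
    rewrite (res_out _ (D := Omp)) => [|[]//]; rewrite (res_in _ (D := ~` Om))//.
    rewrite (res_out _ (D := Omm)) => [|h']; last by apply: nm; exact: subset_closure.
    by rewrite res_out ?addr0 ?add0r// => -[].
  rewrite (res_out _ (D := ~` Om)) => [|/(_ Ox)//].
  have [cx|cx] := pselect (closure Omm x); last first.
    rewrite (res_in _ (D := Omp))//; rewrite (res_out _ (D := Omm)) => [|h']; last by apply: cx; exact: subset_closure.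
    by rewrite res_out ?addr0// => -[].
  rewrite (res_out _ (D := Omp)) => [|[_ /(_ cx)]//].
  have [mx|mx] := pselect (Omm x).
    rewrite (res_in _ (D := Omm))// (res_out _ (D := boundary Omm)) => [|[_]]; last by rewrite iO.
    by rewrite addr0 !add0r.
  rewrite (res_out _ (D := Omm))// (res_in _ (D := boundary Omm)) ?add0r//; split=> //; by rewrite iO.
rewrite -ip_res {2}E (ip_Dl L1 (L2D L2 (L2D L3 L4)) Lk) (ip_Dl L2 (L2D L3 L4) Lk) (ip_Dl L3 L4 Lk).
rewrite limit_outside// add0r.
have -> : ip3 (res Omm v) (l h c k) = 0.
  by case: (h); [exact: limit_magnetic|exact: limit_electric].
rewrite add0r.
have -> : ip3 (res (boundary Omm) v) (l h c k) = 0; last by rewrite addr0.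
apply: nrm_eq0_ip => //; apply: nrm_ae0; first by case: L4.
exists (boundary Omm); split=> // x /= nx; apply: contrapT => nb; apply: nx; exact: res_out.
Qed.

(** The test functions for the magnetic equation vanish on [Omm], so the unbounded factor [q n]
    disappears before the limit, which then solves the limit problem. *)
Lemma weak_limit_null h c k v : L2_3 v -> ip3 v (l h c k) = 0.
Proof.
move=> Lv; rewrite -limit_restrict//; pose l' : flds := fun h c k => res Omp (l h c k).
have Ll' : L2f l' by move=> *; apply: L2_res; [exact: mOmp|exact: Ll].
have Lz : L2f (fun _ _ _ => 0 : R3 R -> R) by move=> *; exact: L2_0.
suff ae : {ae leb3, forall x : T3, l' h c k x = 0}.
  rewrite ip_sym; apply: nrm_eq0_ip => //; first exact: Ll'.
  by apply: nrm_ae0 => //; case: (Ll' h c k).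
apply: uniq => //; first by move=> h1 c1 k1 x nO; exact: res_out.
have cvl h1 c1 k1 (phi : R3 R -> R) : L2_3 phi -> ip3 (u n h1 c1 k1) phi @[n --> F] --> (ip3 (l' h1 c1 k1) phi : R).
  move=> Lp; rewrite ip_sym limit_restrict//.
  have -> : (fun n => ip3 (u n h1 c1 k1) phi) = (fun n => ip3 phi (u n h1 c1 k1)) by apply/funext => n; exact: ip_sym.
  exact: weak.
have main h1 c1 k1 (phi : R3 R -> R) : test_function (dom Om hb h1) phi ->
    (h1 -> forall x, Omm x -> phi x = 0) ->
    ip3 (rhs Omm a 0 l' (fun _ _ _ => 0) h1 c1 k1) phi =
    ip3 (l' h1 c1 (k1 + 1)) ('D_(basis3 (k1 + 2)) phi) - ip3 (l' h1 c1 (k1 + 2)) ('D_(basis3 (k1 + 1)) phi).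
  move=> tp p0; have tpT : testf phi := test_function_sub (@subsetT _ _) tp.
  have Lp := (testf_L2c tpT).1; have LD j := (testf_L2c (test_derive (basis3 j) tpT)).1.
  rewrite (ip_rhs a mOmm 0 h1 c1 k1 Ll' Lz Lp) ip0l addr0.
  have -> : (if h1 then 0 else 0) * ip3 (res Omm (l' false c1 k1)) phi = 0 :> R by case: (h1); rewrite mul0r.
  rewrite add0r.
  apply: (@cvg_uniqR _ nat F _ (fun n => ip3 (u n h1 c1 (k1 + 1)) ('D_(basis3 (k1 + 2)) phi)
     - ip3 (u n h1 c1 (k1 + 2)) ('D_(basis3 (k1 + 1)) phi))); last first.
    by apply: cvgB; exact: cvl.
  have -> : (fun n => ip3 (u n h1 c1 (k1 + 1)) ('D_(basis3 (k1 + 2)) phi)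
     - ip3 (u n h1 c1 (k1 + 2)) ('D_(basis3 (k1 + 1)) phi)) =
     (fun n => sgn h1 c1 * a h1 * ip3 (u n (~~ h1) (~~ c1) k1) phi + ip3 (f n h1 c1 k1) phi).
    apply/funext => n; rewrite -(@sys n h1 c1 phi tp k1) (ip_rhs a mOmm _ h1 c1 k1 (Lu n) (Lf n) Lp).
    suff -> : (if h1 then q n else 0) * ip3 (res Omm (u n false c1 k1)) phi = 0 by rewrite add0r.
    case: (h1) p0 => [/(_ isT) p0|_]; last by rewrite mul0r.
    rewrite ip_disjoint ?mulr0// => x; have [Ox|Ox] := pselect (Omm x); first by rewrite p0// mulr0.
    by rewrite res_out// mul0r.
  rewrite -[X in _ --> X]addr0; apply: cvgD; last exact: source_weak.
  by apply: cvgMr; exact: cvl.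
split=> c1 phi tp k1; first by apply: main.
apply: main; first by apply: test_function_sub tp => x [].
move=> _ x Ox; apply: (test_function0 tp) => -[_]; apply; exact: subset_closure.
Qed.

End WeakLimit.

Definition nsum (u : flds) : R := \sum_h \sum_c \sum_k nrm3 (u h c k).
Definition nsumE (u : flds) : R := \sum_c \sum_k nrm3 (res Omm (u false c k)).

Lemma nsum_ge0 u : 0 <= nsum u.
Proof. by do 3 (apply: sumr_ge0 => ? _); exact: nrm_ge0. Qed.

Lemma nsumE_ge0 u : 0 <= nsumE u.
Proof. by do 2 (apply: sumr_ge0 => ? _); exact: nrm_ge0. Qed.

Lemma le_nsum u h c k : nrm3 (u h c k) <= nsum u.
Proof.
rewrite /nsum (bigD1 h)//= (bigD1 c)//= (bigD1 k)//= -!addrA lerDl.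
by rewrite !addr_ge0//; do ?(apply: sumr_ge0 => ? _); exact: nrm_ge0.
Qed.

Lemma le_nsumE u c k : nrm3 (res Omm (u false c k)) <= nsumE u.
Proof.
rewrite /nsumE (bigD1 c)//= (bigD1 k)//= -!addrA lerDl.
by rewrite !addr_ge0//; do ?(apply: sumr_ge0 => ? _); exact: nrm_ge0.
Qed.

Lemma nsumZ t u : L2f u -> nsum (fun h c k => t *: u h c k) = `|t| * nsum u.
Proof.
move=> Lu; rewrite /nsum mulr_sumr; apply: eq_bigr => h _; rewrite mulr_sumr; apply: eq_bigr => c _.
by rewrite mulr_sumr; apply: eq_bigr => k _; rewrite nrmZ//; exact: Lu.
Qed.

Lemma nsumEZ t u : L2f u -> nsumE (fun h c k => t *: u h c k) = `|t| * nsumE u.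
Proof.
move=> Lu; rewrite /nsumE mulr_sumr; apply: eq_bigr => c _; rewrite mulr_sumr; apply: eq_bigr => k _.
by rewrite resZ nrmZ//; apply: L2_res => //; exact: Lu.
Qed.

(** After normalisation the quantity to be estimated is 1 along the sequence, while every one of its
    terms tends to 0 along the filter of the weak limit. *)
Theorem apriori : exists s0 C : R, [/\ 0 < s0, 0 < C & forall s, s0 <= s -> forall u f : flds,
  L2f u -> L2f f -> vanish u -> vanish f -> msys Om Omm a hb s f u ->
  nsum u + Num.sqrt s * nsumE u <= C * nsum f].
Proof.
apply: contrapT => neg.
(* The negation with both constants equal to [n + 1]. The strict inequality makes the normalising
   factor [N n] positive even when the source vanishes. *)
have /choice[S HS] (n : nat) : exists p : R * flds * flds, [/\ n.+1%:R <= p.1.1, L2f p.1.2, L2f p.2,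
    vanish p.1.2 & vanish p.2 /\ msys Om Omm a hb p.1.1 p.2 p.1.2 /\
    n.+1%:R * nsum p.2 < nsum p.1.2 + Num.sqrt p.1.1 * nsumE p.1.2].
  apply: contrapT => H; apply: neg; exists n.+1%:R, n.+1%:R; split=> // s ns u f Lu Lf vu vf suf.
  by rewrite leNgt; apply/negP => h; apply: H; exists (s, u, f).
pose s n := (S n).1.1; pose N n : R := nsum (S n).1.2 + Num.sqrt (s n) * nsumE (S n).1.2.
have N0 n : 0 < N n.
  have [_ _ _ _ [_ [_ h]]] := HS n; apply: le_lt_trans h; rewrite mulr_ge0//; exact: nsum_ge0.
pose q n := Num.sqrt (s n).
have s1 n : n.+1%:R <= s n by have [] := HS n.
have s0 n : 0 <= s n by apply: le_trans (s1 n).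
have q1 n : 1 <= q n.
  by rewrite -[1]sqrtr1 ler_wsqrtr//; apply: le_trans (s1 n); rewrite ler1n.
have q2 n : q n ^+ 2 = s n by rewrite sqr_sqrtr.
pose u n : flds := fun h c k => (N n)^-1 *: (S n).1.2 h c k.
pose f n : flds := fun h c k => (N n)^-1 *: (S n).2 h c k.
have Lu n : L2f (u n) by move=> h c k; apply: L2Z; have [_ L _ _ _] := HS n; exact: L.
have Lf n : L2f (f n) by move=> h c k; apply: L2Z; have [_ _ L _ _] := HS n; exact: L.
have uO n : vanish (u n).
  move=> h c k x nO; have [_ _ _ v _] := HS n.
  by rewrite -[LHS]/((N n)^-1 * (S n).1.2 h c k x) v// mulr0.
have fO n : vanish (f n).
  move=> h c k x nO; have [_ _ _ _ [v _]] := HS n.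
  by rewrite -[LHS]/((N n)^-1 * (S n).2 h c k x) v// mulr0.
have Ni n : `|(N n)^-1| = (N n)^-1 by rewrite ger0_norm// invr_ge0 ltW.
have one n : nsum (u n) + q n * nsumE (u n) = 1.
  have [_ L _ _ _] := HS n; rewrite nsumZ// nsumEZ// Ni mulrCA -mulrDr.
  by rewrite mulVf// gt_eqF.
have fs n : nsum (f n) <= n.+1%:R^-1.
  have [_ _ L _ [_ [_ h]]] := HS n; rewrite nsumZ// Ni.
  rewrite ler_pdivrMl// mulrC ler_pdivlMl//; exact: ltW.
have sys n : msys Om Omm a hb (q n ^+ 2) (f n) (u n).
  have [_ L1 L2 _ [_ [h _]]] := HS n; rewrite q2.
  have Z : L2f (fun _ _ _ => 0 : R3 R -> R) by move=> *; exact: L2_0.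
  have := msys_lin (N n)^-1 L1 Z L2 Z h (msys0 _).
  congr msys; apply/funext => h1; apply/funext => c1; apply/funext => k1; exact: addr0.
have ug0 n : 0 <= q n * nsumE (u n) by rewrite mulr_ge0 ?nsumE_ge0//; have := q1 n; lra.
have u1 n h c k : nrm3 (u n h c k) <= 1.
  by apply: le_trans (le_nsum _ h c k) _; have := one n; have := ug0 n; lra.
have d1 n c k : q n * nrm3 (res Omm (u n false c k)) <= 1.
  apply: (@le_trans _ _ (q n * nsumE (u n))).
    by rewrite ler_wpM2l ?le_nsumE//; have := q1 n; lra.
  by have := one n; have := nsum_ge0 (u n); lra.
have f1' n h c k : nrm3 (f n h c k) <= n.+1%:R^-1 by apply: le_trans (le_nsum _ h c k) (fs n).
have f1 n h c k : nrm3 (f n h c k) <= 1.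
  by apply: le_trans (f1' n h c k) _; rewrite invf_le1// ler1n.
have inv0 : (n.+1%:R^-1 : R) @[n --> \oo] --> (0 : R) by exact: cvg_harmonic.
have f0 h c k : nrm3 (f n h c k) @[n --> \oo] --> (0 : R).
  by apply: cvg0_le inv0 => n; rewrite nrm_ge0 f1'.
have H := @L2_semi_hilbert _ T3 R leb3.
pose I : finType := (bool * bool * 'I_3)%type.
have HI := sh_fam H I.
pose U n : I -> T3 -> R := fun i => u n i.1.1 i.1.2 i.2.
have [||F [PF ooF [l Ll wl]]] := @sh_weak_limit _ _ _ _ HI U #|I|%:R _ _.
- by move=> n i; exact: Lu.
- move=> n; apply: (@le_trans _ _ (\sum_(i : I) 1)); last by rewrite sumr_const.
  by apply: ler_sum => i _; rewrite -sqr_nrm expr_le1// ?nrm_ge0//; exact: u1.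
have cF (g : nat -> R) (b : R) : g n @[n --> \oo] --> b -> g n @[n --> F] --> b.
  by move=> c A /c; exact: ooF.
pose L : flds := fun h c k => l (h, c, k).
have weak h c k v : L2_3 v -> ip3 v (u n h c k) @[n --> F] --> (ip3 v (L h c k) : R).
  move=> Lv; pose V : I -> T3 -> R := fun i => if i == (h, c, k) then v else 0.
  have LV i : L2_3 (V i) by rewrite /V; case: ifP => // _; exact: L2_0.
  have E (w : I -> T3 -> R) : \sum_i ip3 (w i) (V i) = ip3 v (w (h, c, k)).
    rewrite (bigD1 (h, c, k))//= big1 => [|i /negbTE ih]; last by rewrite /V ih ip0r.
    by rewrite addr0 /V eqxx; exact: ip_sym.
  have Eq : (fun n => \sum_i ip3 (U n i) (V i)) = (fun n => ip3 v (u n h c k)) by apply/funext => n; exact: E.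
  by have := wl V LV; rewrite E Eq.
have FF : Filter F by exact: _.
(* The dissipation identity with fields of norm at most 1: sigma times the squared norm on [Omm] is
   bounded by the norm of the sources. *)
have bd n c k : (q n * nrm3 (res Omm (u n false c k))) ^+ 2 <=
    \sum_d \sum_j (nrm3 (f n false d j) + nrm3 (f n true d j)).
  rewrite exprMn; apply: (@le_trans _ _ (q n ^+ 2 * \sum_d \sum_j nrm3 (res Omm (u n false d j)) ^+ 2)).
    rewrite ler_wpM2l ?sqr_ge0// (bigD1 c)//= (bigD1 k)//= -addrA lerDl.
    by rewrite addr_ge0//; do ?(apply: sumr_ge0 => ? _); exact: sqr_ge0.
  rewrite (energy_dissipated bOm oOmm coneOm (Lu n) (Lf n) (uO n) (fO n) (sys n)).
  apply: ler_sum => d _; apply: ler_sum => j _.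
  apply: le_trans (ler_norm _) _; apply: le_trans (ler_normB _ _) _; apply: lerD.
    apply: le_trans (ip_nrm (Lu n true d j) (Lf n false d j)) _.
    by rewrite ler_piMl ?nrm_ge0//; exact: u1.
  apply: le_trans (ip_nrm (Lf n true d j) (Lu n false d j)) _.
  by rewrite ler_piMr ?nrm_ge0//; exact: u1.
have f0F h c k : nrm3 (f n h c k) @[n --> F] --> (0 : R) by exact: cF (f0 h c k).
have diss c k : q n * nrm3 (res Omm (u n false c k)) @[n --> F] --> (0 : R).
  apply: (cvg0_sqr _ (fun n => bd n c k)).
    by move=> n; rewrite mulr_ge0 ?nrm_ge0//; have := q1 n; lra.
  apply: cvg0_sum => d; apply: cvg0_sum => j.
  exact: (cvg0D FF (f0F false d j) (f0F true d j)).
have E0 c k : nrm3 (res Omm (u n false c k)) @[n --> F] --> (0 : R).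
  by apply: cvg0_le (diss c k) => n; rewrite nrm_ge0 /= ler_peMl ?nrm_ge0.
have weak0 h c k v : L2_3 v -> ip3 v (u n h c k) @[n --> F] --> (0 : R).
  move=> Lv; have LL : L2f L by move=> *; exact: Ll.
  by rewrite -(weak_limit_null PF Lu Lf LL uO weak E0 f0F sys h c k Lv); exact: weak.
have qoo (A : R) : \forall n \near F, A <= q n.
  apply: ooF; exists (Num.truncn (A ^+ 2)).+1 => // n /= An.
  have [A0|A0] := leP 0 A; last by have := q1 n; lra.
  rewrite -[A]ger0_norm// -sqrtr_sqr ler_wsqrtr//; apply: le_trans (s1 n).
  apply: le_trans (ltW (truncnS_gt _)) _; rewrite ler_nat; exact: leqW.
have eD := electric_decay oOm bOm oOmm cOmm coneOm coneOmm a0 PF q1 Lu Lf u1 f1 d1 uO fO weak0 diss f0F sys qoo.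
have mD := magnetic_decay oOm bOm oOmm cOmm coneOm coneOmm a0 PF q1 Lu Lf u1 f1 d1 uO fO weak0 diss f0F sys qoo.
have : (fun=> 1 : R) n @[n --> F] --> (0 : R).
  have -> : (fun=> 1 : R) = (fun n => nsum (u n) + q n * nsumE (u n)) by apply/funext => n; rewrite one.
  apply: (cvg0D FF).
    by apply: cvg0_sum => h; apply: cvg0_sum => c; apply: cvg0_sum => k; case: (h); [exact: mD|exact: eD].
  have -> : (fun n => q n * nsumE (u n)) = (fun n => \sum_c \sum_k q n * nrm3 (res Omm (u n false c k))).
    apply/funext => n; rewrite mulr_sumr; apply: eq_bigr => c _; exact: mulr_sumr.
  by apply: cvg0_sum => c; apply: cvg0_sum => k; exact: diss.
move=> c10; have := @cvg_uniqR R nat F PF (fun=> 1) 1 0 (cvg_cst _) c10.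
by move=> /(_ FF)/eqP; rewrite oner_eq0.
Qed.

End APriori.

(** * Integration by parts between test functions *)

Section Parts.
Context {R : realType}.
Notation T3 := (measurableTypeR R * measurableTypeR R * measurableTypeR R)%type.
Notation L2_3 := (@L2 _ T3 R leb3).
Notation ip3 := (@ip _ T3 R leb3).
Notation nrm3 := (@nrm _ T3 R leb3).
Notation testf := (@test_function R R setT).

(* A convolution with the indicator of a large cube is constant near the origin. *)
Lemma ip_derive_cube_ge0 (phi : R3 R -> R) (v : R3 R) (r : R) : testf phi -> (forall x, 0 <= phi x) ->
  (forall x, phi x != 0 -> `|x| <= r) -> ip3 ('D_v phi) (\1_(cube (r + 1) : set T3)) = 0.
Proof.
move=> tp p0 pr; pose kap := refl phi 0; have tk : testf kap by exact: refl_testf.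
have LA : L2c (\1_(cube (r + 1) : set T3) : R3 R -> R).
  apply: (@L2c_indic R _ (r + 1)); first exact: measurable_cube.
  by move=> x /cubeP /ltW.
have kc x : `|x| < 1 -> conv kap (\1_(cube (r + 1) : set T3) : R3 R -> R) x = nrm1 kap.
  move=> x1; apply: conv_indic_full => // [z|y]; first exact: p0.
  rewrite /kap /refl => /pr; rewrite sub0r opprB => yx; apply/cubeP.
  by rewrite -(subrK x y); apply: le_lt_trans (ler_normD _ _) _; lra.
have [_] := conv_derive (0 : R3 R) v tk LA.
have -> : 'D_v (conv kap (\1_(cube (r + 1) : set T3) : R3 R -> R)) 0 = 0.
  by apply: (@near_cst_derive _ _ (nrm1 kap) 0 v 1) => // y; rewrite sub0r normrN; exact: kc.
rewrite /conv => E.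
have -> : 'D_v phi = - refl ('D_v kap) 0.
  apply/funext => y; rewrite -[RHS]/(- ('D_v kap (0 - y))).
  rewrite /kap (refl_derive _ _ _ (test_function_smooth tp)) opprK; congr ('D_v phi _).
  by rewrite opprB addrC subrK.
rewrite -scaleN1r (@ip_Zl _ T3 R leb3 (-1)); first by rewrite -E mulr0.
  exact: (testf_L2c (refl_testf 0 (test_derive v tk))).1.
exact: LA.1.
Qed.

(** A large multiple of a wide bump is added to make [phi] nonnegative; the result follows by
    difference of two nonnegative cases. *)
Lemma ip_derive_cube (phi : R3 R -> R) (v : R3 R) : testf phi -> exists r0 : R, forall r, r0 <= r ->
  ip3 ('D_v phi) (\1_(cube r : set T3)) = 0.
Proof.
move=> tp; have [M M0 HM] := test_bounded tp; have [r0 Hr] := testf_bsupp tp.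
pose r1 : R := `|r0| + 1; have r10 : 0 < r1 by rewrite ltr_wpDl.
pose b := bump (0 : R3 R) r1; have tb : testf b by exact: bump_test.
have tMb : testf (fun x => M * b x).
  by apply: (@test_mul R setT b (cst M)) => //; exact: (@smooth_cst R (R3 R) R M).
have b0 z : 0 <= b z by exact: bump_ge0.
pose p x := phi x + M * b x; have tpp : testf p by exact: test_add.
have bs x : b x != 0 -> `|x| <= 2 * r1.
  move=> bx; rewrite leNgt; apply/negP => h; move: bx.
  by rewrite /b bump_eq0 ?eqxx// subr0; lra.
have ps x : phi x != 0 -> `|x| <= r0 by move=> px; rewrite leNgt; apply/negP => h; rewrite Hr ?eqxx in px.
have r01 : r0 <= r1 by have := ler_norm r0; rewrite /r1; lra.
exists (2 * r1 + 1) => r hr; have -> : r = (r - 1) + 1 by rewrite subrK.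
have LA : L2_3 (\1_(cube (r - 1 + 1) : set T3)).
  apply: (L2c_indic (M := r) _ _).1; first exact: measurable_cube.
  by move=> x /cubeP; rewrite subrK => /ltW.
have LD (f : R3 R -> R) : testf f -> L2_3 ('D_v f) by move=> tf; exact: (testf_L2c (test_derive v tf)).1.
have i1 : ip3 ('D_v p) (\1_(cube (r - 1 + 1) : set T3)) = 0.
  apply: ip_derive_cube_ge0 => // x; rewrite /p.
    have [px|px] := leP 0 (phi x); first by rewrite addr_ge0// mulr_ge0.
    have := HM x; rewrite ltr0_norm// => h.
    have px0 : phi x != 0 by rewrite lt_eqF.
    rewrite /b bump_eq1//; first by lra.
    by rewrite subr0; have := ps x px0; lra.
  have [px|/ps h _] := eqVneq (phi x) 0; last by lra.
  rewrite px add0r mulf_eq0 negb_or => /andP[_ /bs h]; lra.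
have i2 : ip3 ('D_v (fun x => M * b x)) (\1_(cube (r - 1 + 1) : set T3)) = 0.
  apply: ip_derive_cube_ge0 => // x; first exact: mulr_ge0.
  rewrite mulf_eq0 negb_or => /andP[_ /bs h]; lra.
have sp := test_function_smooth tp; have sMb := test_function_smooth tMb.
have E : 'D_v p = 'D_v phi + 'D_v (fun x => M * b x).
  by apply/funext => x; rewrite (derive_add (smooth_derivable sp) (smooth_derivable sMb)).
move: i1; rewrite E (ip_Dl (LD _ tp) (LD _ tMb) LA) i2 addr0; exact.
Qed.

Lemma parts (phi eta : R3 R -> R) (v : R3 R) : testf phi -> testf eta ->
  ip3 ('D_v phi) eta = - ip3 phi ('D_v eta).
Proof.
move=> tp te; have sp := test_function_smooth tp; have se := test_function_smooth te.
pose p x := eta x * phi x; have tpe : testf p by apply: test_mul => //; exact: se.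
have [r0 H] := ip_derive_cube v tpe; have [r1 H1] := testf_bsupp tp.
pose r := Num.max r0 (`|r1| + 1).
have E : 'D_v p = (fun x => eta x * 'D_v phi x) + (fun x => phi x * 'D_v eta x).
  by apply/funext => x; rewrite (derive_mul (smooth_derivable se) (smooth_derivable sp)).
have Lp := (testf_L2c tp).1; have Le := (testf_L2c te).1.
have LDp := (testf_L2c (test_derive v tp)).1; have LDe := (testf_L2c (test_derive v te)).1.
have LA : L2_3 (\1_(cube r : set T3)).
  apply: (L2c_indic (M := r) _ _).1; first exact: measurable_cube.
  by move=> x /cubeP /ltW.
have r0r : r0 <= r by rewrite le_max lexx.
have := H r r0r; rewrite E (ip_Dl (L2_mult te LDp) (L2_mult tp LDe) LA).
have pin x : phi x != 0 -> \1_(cube r : set T3) x = 1 :> R.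
  move=> px; rewrite indicE mem_set//; apply/cubeP; rewrite lt_max; apply/orP; right.
  apply: (@le_lt_trans _ _ r1); last by have := ler_norm r1; lra.
  by rewrite leNgt; apply/negP => h; rewrite H1 ?eqxx in px.
have -> : ip3 (fun x => phi x * 'D_v eta x) (\1_(cube r : set T3)) = ip3 phi ('D_v eta).
  rewrite /ip; congr fine; apply: eq_integral => x _; congr EFin.
  have [->|/pin ->] := eqVneq (phi x) 0; first by rewrite !mul0r.
  by rewrite mulr1.
have -> : ip3 (fun x => eta x * 'D_v phi x) (\1_(cube r : set T3)) = ip3 ('D_v phi) eta.
  rewrite /ip; congr fine; apply: eq_integral => x _; congr EFin.
  have [Dx|Dx] := eqVneq ('D_v phi x) 0; first by rewrite Dx mulr0 !mul0r.
  suff -> : \1_(cube r : set T3) x = 1 :> R by rewrite mulr1; exact: mulrC.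
  rewrite indicE mem_set//; apply/cubeP; rewrite lt_max; apply/orP; right.
  rewrite ltNge; apply/negP => h; move/eqP: Dx; apply.
  apply: (@near_cst_derive _ _ 0 x v 1) => // y xy; apply: H1.
  have : `|x| <= `|x - y| + `|y| by rewrite -{1}[x](subrK y) ler_normD.
  by have := ler_norm r1; lra.
by move=> /eqP; rewrite addr_eq0 => /eqP.
Qed.

Lemma parts_on (Om : set (R3 R)) (phi eta : R3 R -> R) (v : R3 R) : testf phi -> testf eta ->
  test_function Om phi \/ test_function Om eta ->
  ip3 (res Om ('D_v phi)) eta = - ip3 (res Om phi) ('D_v eta).
Proof.
have res_test (f : R3 R -> R) : test_function Om f -> res Om f = f.
  move=> tf; apply/funext => x; have [Ox|Ox] := pselect (Om x); first exact: res_in.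
  by rewrite res_out// (test_function0 tf).
move=> tp te [to|to].
  by rewrite (res_test _ to) (res_test _ (test_derive v to)); exact: parts.
have -> : ip3 (res Om ('D_v phi)) eta = ip3 ('D_v phi) eta by rewrite ip_res; congr (ip3 _ _); exact: res_test.
have -> : ip3 (res Om phi) ('D_v eta) = ip3 phi ('D_v eta) by rewrite ip_res; congr (ip3 _ _); apply: res_test; exact: test_derive.
exact: parts.
Qed.

End Parts.

(** * Existence by closed range *)

Section Existence.
Context {R : realType}.
Notation T3 := (measurableTypeR R * measurableTypeR R * measurableTypeR R)%type.
Notation L2_3 := (@L2 _ T3 R leb3).
Notation ip3 := (@ip _ T3 R leb3).
Notation nrm3 := (@nrm _ T3 R leb3).
Notation testf := (@test_function R R setT).
Notation flds := (@fields R).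
Variables (Om Omm : set (R3 R)) (a : bool -> R) (hb : bool) (s C : R).
Hypothesis oOm : open Om.
Hypothesis oOmm : open Omm.
Hypothesis cOmm : Omm `<=` Om.
Hypothesis C0 : 0 <= C.
Hypothesis est : forall u f : flds, L2f u -> L2f f -> vanish Om u -> vanish Om f ->
  msys Om Omm a hb s f u -> nsum u <= C * nsum f.

Let mOmm : measurable (Omm : set T3) := open_measurable3 oOmm.
Let mOm : measurable (Om : set T3) := open_measurable3 oOm.

Let I : finType := (bool * bool * 'I_3)%type.
Let B (u v : I -> T3 -> R) : R := \sum_i ip3 (u i) (v i).
Let fl (v : I -> T3 -> R) : flds := fun h c k => v (h, c, k).
Let L2I (v : I -> T3 -> R) := forall i, L2_3 (v i).
Let HI : semi_hilbert L2I B := sh_fam (@L2_semi_hilbert _ T3 R leb3) I.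

Definition solvable (v : I -> T3 -> R) :=
  [/\ L2I v, vanish Om (fl v) & exists u, [/\ L2f u, vanish Om u & msys Om Omm a hb s (fl v) u]].

Lemma nrm_le_form v i : L2I v -> nrm3 (v i) ^+ 2 <= B v v.
Proof.
move=> Lv; rewrite /B (bigD1 i)//= sqr_nrm lerDl; apply: sumr_ge0 => j _; exact: ip_ge0.
Qed.

Lemma form_le_nsum v : L2I v -> B v v <= #|I|%:R * nsum (fl v) ^+ 2.
Proof.
move=> Lv; apply: (@le_trans _ _ (\sum_(i : I) nsum (fl v) ^+ 2)).
  apply: ler_sum => -[[h c] k] _; rewrite -sqr_nrm.
  rewrite lerXn2r ?nnegrE ?nrm_ge0 ?nsum_ge0//; exact: (le_nsum (fl v)).
by rewrite sumr_const mulr_natl.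
Qed.

Lemma nsum_le_form v (e : R) : L2I v -> 0 <= e -> B v v <= e ^+ 2 -> nsum (fl v) <= 12 * e.
Proof.
move=> Lv e0 ve; have le i : nrm3 (v i) <= e.
  rewrite -(@ler_pXn2r _ 2)// ?nnegrE ?nrm_ge0//; apply: le_trans ve; exact: nrm_le_form.
have -> : 12 * e = \sum_(h : bool) \sum_(c : bool) \sum_(k < 3) e.
  by rewrite !sumr_const card_bool card_ord -!mulrnA mulr_natl.
by do 3 (apply: ler_sum => ? _); exact: le.
Qed.

Lemma form_cvg (v : nat -> I -> T3 -> R) l h c k (w : T3 -> R) : (forall n, L2I (v n)) -> L2I l -> L2_3 w ->
  (forall e : R, 0 < e -> exists N, forall n, (N <= n)%N -> B (v n - l) (v n - l) <= e) ->
  ip3 (v n (h, c, k)) w @[n --> \oo] --> (ip3 (l (h, c, k)) w : R).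
Proof.
move=> Lv Ll Lw vl; apply/cvgrPdist_le => e e0; set i := (h, c, k).
pose d := e / (nrm3 w + 1); have w1 : 0 < nrm3 w + 1 by rewrite ltr_wpDl// nrm_ge0.
have d0 : 0 < d by exact: divr_gt0.
have [N HN] := vl (d ^+ 2) (exprn_gt0 2 d0); exists N => // n /= /HN h1.
have Ld : L2I (v n - l) by move=> j; exact: (L2B (Lv n j) (Ll j)).
have hd : nrm3 (v n i - l i) <= d.
  rewrite -(@ler_pXn2r _ 2)// ?nnegrE ?nrm_ge0// ?(ltW d0)//; apply: le_trans h1; exact: (nrm_le_form i Ld).
rewrite distrC -(ip_Bl (Lv n i) (Ll i) Lw).
apply: le_trans (ip_nrm (L2B (Lv n i) (Ll i)) Lw) _.
apply: (@le_trans _ _ (d * (nrm3 w + 1))); last by rewrite /d divfK// gt_eqF.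
by rewrite ler_pM ?nrm_ge0// lerDl.
Qed.

Lemma form_res v l : L2I v -> L2I l -> vanish Om (fl v) ->
  B (v - (fun i => res Om (l i))) (v - (fun i => res Om (l i))) <= B (v - l) (v - l).
Proof.
move=> Lv Ll v0; apply: ler_sum => -[[h c] k] _; set i := (h, c, k).
have -> : (v - (fun i => res Om (l i))) i = res Om (v i - l i).
  rewrite resB; congr (_ - _); apply/funext => x; have [Ox|Ox] := pselect (Om x); first by rewrite res_in.
  by rewrite res_out//; exact: (v0 h c k x Ox).
rewrite -!sqr_nrm lerXn2r ?nnegrE ?nrm_ge0//; exact: (nrm_res mOm (L2B (Lv i) (Ll i))).
Qed.

Lemma msys_cvg (u f : nat -> flds) (u1 f1 : flds) : (forall n, L2f (u n)) -> (forall n, L2f (f n)) ->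
  L2f u1 -> L2f f1 ->
  (forall h c k w, L2_3 w -> ip3 (u n h c k) w @[n --> \oo] --> (ip3 (u1 h c k) w : R)) ->
  (forall h c k w, L2_3 w -> ip3 (f n h c k) w @[n --> \oo] --> (ip3 (f1 h c k) w : R)) ->
  (forall n, msys Om Omm a hb s (f n) (u n)) -> msys Om Omm a hb s f1 u1.
Proof.
move=> Lu Lf Lu1 Lf1 cu cf sys h c phi tp k.
have tpT : testf phi := test_function_sub (@subsetT _ _) tp.
have Lp := (testf_L2c tpT).1; have LD j := (testf_L2c (test_derive (basis3 j) tpT)).1.
rewrite (ip_rhs a mOmm s h c k Lu1 Lf1 Lp) ip_res.
have Lr : L2_3 (res Omm phi) by exact: L2_res.
have c1 : (if h then s else 0) * ip3 (u n false c k) (res Omm phi) + sgn h c * a h * ip3 (u n (~~ h) (~~ c) k) phi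
    + ip3 (f n h c k) phi @[n --> \oo] --> (if h then s else 0) * ip3 (u1 false c k) (res Omm phi) +
  sgn h c * a h * ip3 (u1 (~~ h) (~~ c) k) phi + ip3 (f1 h c k) phi.
  by apply: cvgD; [apply: cvgD; apply: cvgMr; exact: cu|exact: cf].
apply: (@cvg_uniqR R nat \oo _ _ _ _ c1).
have -> : (fun n => (if h then s else 0) * ip3 (u n false c k) (res Omm phi) + sgn h c * a h * ip3 (u n (~~ h) (~~ c) k) phi
    + ip3 (f n h c k) phi) =
    (fun n => ip3 (u n h c (k + 1)) ('D_(basis3 (k + 2)) phi) - ip3 (u n h c (k + 2)) ('D_(basis3 (k + 1)) phi)).
  by apply/funext => n; rewrite -(@sys n h c phi tp k) (ip_rhs a mOmm _ h c k (Lu n) (Lf n) Lp) ip_res.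
by apply: cvgB; exact: cu.
Qed.

(** The range is closed: by the estimate, a Cauchy sequence of sources has a Cauchy sequence of
    solutions, and the weak equations pass to the limit. *)
Lemma solvable_semi_hilbert : semi_hilbert solvable B.
Proof.
split.
- split; [by move=> i; exact: L2_0|by []|].
  by exists (fun _ _ _ => 0); split=> //; [move=> *; exact: L2_0|exact: msys0].
- move=> t v w [Lv v0 [p [Lp p0 sp]]] [Lw w0 [q [Lq q0 sq]]]; split.
  + by move=> i; exact: L2_lin.
  + by have := vanish_lin t v0 w0.
  + exists (fun h c k => t *: p h c k + q h c k); split.
    * exact: L2f_lin.
    * exact: vanish_lin.
    * exact: (msys_lin oOmm t Lp Lq (fun h c k => Lv (h, c, k)) (fun h c k => Lw (h, c, k)) sp sq).
- exact: (sh_sym HI).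
- by move=> t u v w [Lu _ _] [Lv _ _] [Lw _ _]; exact: (sh_bilin HI).
- by move=> u [Lu _ _]; exact: (sh_ge0 HI).
move=> v Sv cau.
have Lv n : L2I (v n) by have [] := Sv n.
have v0 n : vanish Om (fl (v n)) by have [] := Sv n.
have [l Ll vl] := sh_complete HI Lv cau.
have /choice[u Hu] n : exists u, [/\ L2f u, vanish Om u & msys Om Omm a hb s (fl (v n)) u] by have [] := Sv n.
pose U n : I -> T3 -> R := fun i => u n i.1.1 i.1.2 i.2.
have LU n : L2I (U n) by move=> i; have [L _ _] := Hu n; exact: L.
have U0 n : vanish Om (fl (U n)) by have [_ h _] := Hu n; exact: h.
have sU n : msys Om Omm a hb s (fl (v n)) (fl (U n)) by have [_ _ h] := Hu n; exact: h.
have [|p Lp Up] := sh_complete HI LU.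
  move=> e e0; pose d := e / (#|I|%:R + 1); have I1 : 0 < #|I|%:R + 1 :> R by rewrite ltr_wpDl.
  have d0 : 0 < d by exact: divr_gt0.
  (* The 12 counts the real components lost between the sum of norms and the form [B]; [C + 1] is
     positive also for [C = 0]. *)
  pose t := Num.sqrt d / (12 * (C + 1)); have t0 : 0 < t.
    by rewrite divr_gt0 ?sqrtr_gt0// mulr_gt0// ltr_wpDl.
  have [N HN] := cau _ (exprn_gt0 2 t0); exists N => m n Nm Nn.
  have Lmn : L2I (U m - U n) by move=> i; exact: (L2B (LU m i) (LU n i)).
  have Lvmn : L2I (v m - v n) by move=> i; exact: (L2B (Lv m i) (Lv n i)).
  have sys : msys Om Omm a hb s (fl (v m - v n)) (fl (U m - U n)).
    have := msys_lin oOmm (-1) (fun h c k => LU n (h, c, k)) (fun h c k => LU m (h, c, k))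
      (fun h c k => Lv n (h, c, k)) (fun h c k => Lv m (h, c, k)) (sU n) (sU m).
    congr msys; apply/funext => h; apply/funext => c; apply/funext => k; by rewrite scaleN1r addrC.
  have van (x y : I -> T3 -> R) : vanish Om (fl x) -> vanish Om (fl y) -> vanish Om (fl (x - y)).
    move=> x0 y0 h c k z nO; rewrite -[LHS]/(fl x h c k z - fl y h c k z) x0// y0// subr0//.
  have := est (fun h c k => Lmn (h, c, k)) (fun h c k => Lvmn (h, c, k)) (van _ _ (U0 m) (U0 n)) (van _ _ (v0 m) (v0 n)) sys.
  have := nsum_le_form Lvmn (ltW t0) (HN m n Nm Nn).
  have := form_le_nsum Lmn; have := nsum_ge0 (fl (U m - U n)).
  move: (nsum (fl (U m - U n))) (nsum (fl (v m - v n))) (B _ _) => x y z x0 zx yt xy.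
  have xd : x <= Num.sqrt d.
    apply: le_trans xy _; apply: (@le_trans _ _ ((C + 1) * (12 * t))).
      by apply: le_trans (ler_wpM2l C0 yt) _; rewrite ler_wpM2r ?lerDl//; lra.
    rewrite (_ : (C + 1) * (12 * t) = Num.sqrt d)// /t.
    by move: (Num.sqrt d) => w; field; rewrite gt_eqF// ltr_wpDl.
  have x2 : x ^+ 2 <= d by rewrite -(sqr_sqrtr (ltW d0)) lerXn2r ?nnegrE ?sqrtr_ge0.
  apply: le_trans zx _; apply: (@le_trans _ _ ((#|I|%:R + 1) * d)); first by rewrite ler_pM ?sqr_ge0// lerDl.
  by rewrite /d mulrC divfK// gt_eqF.
(* Limits are determined only up to null functions; the restriction makes them vanish pointwise off
   [Om], and by [form_res] it does not increase distances. *)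
pose l' i := res Om (l i); pose p' i := res Om (p i).
have Ll' : L2I l' by move=> i; exact: L2_res.
have Lp' : L2I p' by move=> i; exact: L2_res.
have vl' e : 0 < e -> exists N, forall n, (N <= n)%N -> B (v n - l') (v n - l') <= e.
  by move=> /vl[N HN]; exists N => n /HN; apply: le_trans; exact: form_res.
have Up' e : 0 < e -> exists N, forall n, (N <= n)%N -> B (U n - p') (U n - p') <= e.
  by move=> /Up[N HN]; exists N => n /HN; apply: le_trans; exact: form_res.
exists l' => //; split=> //; first by move=> h c k x nO; exact: res_out.
exists (fl p'); split; [by move=> *; exact: Lp'|by move=> h c k x nO; exact: res_out|].
apply: (@msys_cvg (fun n => fl (U n)) (fun n => fl (v n))) => //.
- by move=> n h c k; exact: LU.
- by move=> n h c k; exact: Lv.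
- by move=> h c k; exact: Lp'.
- by move=> h c k; exact: Ll'.
- by move=> h c k w Lw; exact: form_cvg.
- by move=> h c k w Lw; exact: form_cvg.
Qed.

Lemma I3_shift (j k : 'I_3) : [\/ j = k, j = k + 1 | j = k + 2].
Proof.
by case: (I3_cases j) (I3_cases k) => [|[]] -> [|[]] ->; (try by constructor 1); (try by constructor 2; apply/val_inj);
  constructor 3; apply/val_inj.
Qed.

Lemma I3_neq (k : 'I_3) : [/\ (k + 1 == k) = false, (k + 2 == k) = false, (k + 1 == k + 2) = false &
  (k + 2 == k + 1) = false /\ (k == k + 1) = false /\ (k == k + 2) = false].
Proof. by case: (I3_cases k) => [|[]] ->. Qed.

Lemma sum_pick (i : I) (F : I -> R) : (forall j, j != i -> F j = 0) -> \sum_j F j = F i.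
Proof. by move=> F0; rewrite (bigD1 i)//= big1 ?addr0// => j ji; exact: F0. Qed.

Section Residual.
Variables (r : I -> T3 -> R).
Hypothesis Lr : L2I r.
Hypothesis r0 : vanish Om (fl r).
Hypothesis orth : forall v, solvable v -> B r v = 0.

Lemma ip_res_residual i (w : T3 -> R) : ip3 (res Om w) (r i) = ip3 (r i) w.
Proof.
case: i => -[h c] k; rewrite ip_res; rewrite [RHS]ip_sym; congr (ip3 _ _).
apply/funext => x; have [Ox|Ox] := pselect (Om x); first by rewrite res_in.
by rewrite res_out//; exact: (esym (r0 h c k Ox)).
Qed.

(** A test function placed in one component and cut off to [Om] is itself a solution, for the source
    given by its curl minus the lower order terms. Orthogonality of [r] to this source is the
    adjoint equation, in weak form. *)
Lemma residual h c k phi : test_function (dom Om hb (~~ h)) phi ->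
  ip3 (r (h, c, k + 1)) ('D_(basis3 (k + 2)) phi) - ip3 (r (h, c, k + 2)) ('D_(basis3 (k + 1)) phi)
  = (if h then 0 else s) * ip3 (res Omm (r (true, c, k))) phi
    + sgn h c * a (~~ h) * ip3 (r (~~ h, ~~ c, k)) phi.
Proof.
move=> tp; have tpT : testf phi := test_function_sub (@subsetT _ _) tp.
have Lp := (testf_L2c tpT).1; have LD j := (testf_L2c (test_derive (basis3 j) tpT)).1.
pose w := res Om phi; have Lw : L2_3 w by exact: L2_res.
pose D j := res Om ('D_(basis3 j) phi); have LDO j : L2_3 (D j) by exact: L2_res.
pose u : flds := fun h' c' k' => if (h', c', k') == (h, c, k) then w else 0.
(* The components of the curl of the field whose only component is [phi], in position [k]. *)
pose g (j : 'I_3) : T3 -> R := if j == k + 1 then D (k + 2) else if j == k + 2 then - D (k + 1) else 0.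
pose G : flds := fun h' c' j => if (h', c') == (h, c) then g j else 0.
pose Z : flds := fun _ _ _ => 0.
pose f : flds := fun h' c' j => G h' c' j - rhs Omm a s u Z h' c' j.
have Lu : L2f u by move=> h' c' j; rewrite /u; case: ifP => // _; exact: L2_0.
have Lg j : L2_3 (g j).
  by rewrite /g; case: ifP => // _; case: ifP => // _; [exact: L2N|exact: L2_0].
have LG : L2f G by move=> h' c' j; rewrite /G; case: ifP => // _; exact: L2_0.
have LZ : L2f Z by move=> h' c' j; exact: L2_0.
have Lf : L2f f by move=> h' c' j; apply: L2B => //; exact: L2_rhs.
have vu : vanish Om u by move=> h' c' j x nO; rewrite /u; case: ifP => // _; exact: res_out.
have vD j x : ~ Om x -> D j x = 0 by move=> nO; exact: res_out.
have vG : vanish Om G.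
  move=> h' c' j x nO; rewrite /G; case: ifP => // _; rewrite /g; case: ifP => _; first exact: vD.
  by case: ifP => // _; rewrite -[LHS]/(- D (k + 1) x) vD// oppr0.
have vf : vanish Om f.
  move=> h' c' j x nO; rewrite -[LHS]/(G h' c' j x - rhs Omm a s u Z h' c' j x) vG// sub0r.
  rewrite -[X in - X]/((if h' then s else 0) * (\1_Omm x * u false c' j x) + sgn h' c' * a h' * u (~~ h') (~~ c') j x + 0).
  by rewrite !vu// !mulr0 !addr0 oppr0.
have rf h' c' j : rhs Omm a s u f h' c' j = G h' c' j.
  apply/funext => x; rewrite /f -[LHS]/((if h' then s else 0) * (\1_Omm x * u false c' j x)
     + sgn h' c' * a h' * u (~~ h') (~~ c') j x + (G h' c' j x - ((if h' then s else 0) * (\1_Omm x * u false c' j x)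
     + sgn h' c' * a h' * u (~~ h') (~~ c') j x + 0))).
  move: (G _ _ _ x) (_ * _) (_ * _ * _) => ? ? ?; ring.
have [k1 k2 k12 [k21 [kk1 kk2]]] := I3_neq k.
have [s1 s2 s3 s4] := I3_cyc k.
have sys : msys Om Omm a hb s f u.
  move=> h' c' eta te j; rewrite rf.
  have teT : testf eta := test_function_sub (@subsetT _ _) te.
  have [e|ne] := eqVneq (h', c') (h, c); last first.
    rewrite /G (negbTE ne) /u ifN ?ifN ?ip0l ?subr0//; apply: contra ne => /eqP[-> -> _]; exact: eqxx.
  move: te; case: e => -> -> te.
  have to (i : 'I_3) : ip3 (D i) eta = - ip3 w ('D_(basis3 i) eta).
    apply: parts_on => //; move: tp te; rewrite /dom; case: (h) (hb) => -[] /= tp te; by [left|right].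
  have uE i : u h c i = if i == k then w else 0.
    by rewrite /u !xpair_eqE !eqxx.
  rewrite /G eqxx !uE /g; case: (I3_shift j k) => ->.
  - by rewrite kk1 kk2 k1 k2 !ip0l subr0.
  - by rewrite eqxx s1 s2 k2 eqxx ip0l sub0r; exact: to.
  - rewrite k21 eqxx s3 s4 eqxx k1 ip0l subr0 -scaleN1r.
    rewrite (ip_Zl (-1) (LDO (k + 1)) (testf_L2c teT).1) mulN1r (to (k + 1)); exact: opprK.
pose v : I -> T3 -> R := fun i => f i.1.1 i.1.2 i.2.
have Sv : solvable v.
  by split; [move=> i; exact: Lf|exact: vf|exists u].
have := orth Sv; rewrite /B.
pose S1 (i : I) := ip3 (G i.1.1 i.1.2 i.2) (r i).
pose S2 (i : I) := (if i.1.1 then s else 0) * ip3 (u false i.1.2 i.2) (res Omm (r i)).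
pose S3 (i : I) := sgn i.1.1 i.1.2 * a i.1.1 * ip3 (u (~~ i.1.1) (~~ i.1.2) i.2) (r i).
have E i : ip3 (r i) (v i) = S1 i - (S2 i + S3 i).
  rewrite ip_sym /v /f (ip_Bl (LG _ _ _) (L2_rhs a mOmm s _ _ _ Lu LZ) (Lr i)).
  rewrite (ip_rhs a mOmm s _ _ _ Lu LZ (Lr i)) ip0l addr0 ip_res; exact.
rewrite (eq_bigr _ (fun i _ => E i)) sumrB big_split /=.
have e1 : \sum_i S1 i = ip3 (r (h, c, k + 1)) ('D_(basis3 (k + 2)) phi) - ip3 (r (h, c, k + 2)) ('D_(basis3 (k + 1)) phi).
  have n12 : (h, c, k + 2) != (h, c, k + 1) by rewrite xpair_eqE k21 andbF.
  rewrite (bigD1 (h, c, k + 1))//= (bigD1 (h, c, k + 2))//= big1 => [|[[h' c'] j] /andP[n1 n2]].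
    rewrite addr0 /S1 /G /= !eqxx /g eqxx k21 eqxx ip_res_residual; congr (_ + _).
    rewrite -scaleN1r (ip_Zl (-1) (LDO (k + 1)) (Lr _)) mulN1r; congr (- _); exact: ip_res_residual.
  rewrite /S1 /G /=; have [[e1 e2]|ne] := eqVneq (h', c') (h, c); last by rewrite ip0l.
  rewrite /g ifN ?ifN ?ip0l//; first by apply: contra n2 => /eqP ->; rewrite e1 e2.
  by apply: contra n1 => /eqP ->; rewrite e1 e2.
have e2 : \sum_i S2 i = (if h then 0 else s) * ip3 (res Omm (r (true, c, k))) phi.
  rewrite (sum_pick (i := (true, c, k))) => [|[[h' c'] j] ne].
    rewrite /S2 /u /=; case: (h) => /=; first by rewrite ip0l mulr0 mul0r.
    rewrite eqxx; congr (_ * _); rewrite /w ip_res [RHS]ip_sym; congr (ip3 _ _).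
    apply/funext => x; have [Ox|Ox] := pselect (Om x); first by rewrite res_in.
    by rewrite res_out// res_out// => /cOmm.
  rewrite /S2 /=; case: h' ne => ne; last by rewrite mul0r.
  rewrite /u ifN ?ip0l ?mulr0//; apply: contra ne => /eqP[_ <- ->]; exact: eqxx.
have e3 : \sum_i S3 i = sgn h c * a (~~ h) * ip3 (r (~~ h, ~~ c, k)) phi.
  rewrite (sum_pick (i := (~~ h, ~~ c, k))) => [|[[h' c'] j] ne].
    rewrite /S3 /u /= !negbK eqxx ip_res_residual; congr (_ * _ * _); by case: (h) (c) => -[].
  rewrite /S3 /= /u ifN ?ip0l ?mulr0//; apply: contra ne => /eqP[<- <- ->]; by rewrite !negbK eqxx.
by rewrite e1 e2 e3 => /eqP; rewrite subr_eq0 => /eqP.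
Qed.

End Residual.

(* The residual [r] of the projection on the solvable right-hand sides solves,
   up to signs and exchange of the two fields, the homogeneous system. *)
Theorem solvability (f : flds) : L2f f -> vanish Om f ->
  exists u, [/\ L2f u, vanish Om u & msys Om Omm a hb s f u].
Proof.
move=> Lf vf; pose v : I -> T3 -> R := fun i => f i.1.1 i.1.2 i.2.
have Lv : L2I v by move=> i; exact: Lf.
have [g Sg og] := sh_proj HI solvable_semi_hilbert Lv (fun v Sv => let: And3 L _ _ := Sv in L).
have [Lg vg [u [Lu vu su]]] := Sg; exists u; split=> //.
pose r := v - g; have Lr : L2I r by move=> i; exact: (L2B (Lv i) (Lg i)).
have r0 : vanish Om (fl r).
  by move=> h c k x nO; rewrite -[LHS]/(f h c k x - fl g h c k x) vf// vg// subr0.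
(* Complex conjugation, combined with the exchange of E and H: the two sign changes compensate and
   the adjoint equation becomes the original one. *)
pose e (c : bool) : R := if c then -1 else 1.
pose w : flds := fun h c k => e c *: r (~~ h, c, k).
have Lw : L2f w by move=> h c k; exact: L2Z.
have vw : vanish Om w by move=> h c k x nO; rewrite -[LHS]/(e c * fl r (~~ h) c k x) r0// mulr0.
have LZ : L2f (fun _ _ _ => 0 : R3 R -> R) by move=> *; exact: L2_0.
have sw : msys Om Omm a hb s (fun _ _ _ => 0) w.
  move=> h c phi tp k; have tpT : testf phi := test_function_sub (@subsetT _ _) tp.
  have Lp := (testf_L2c tpT).1; have LD j := (testf_L2c (test_derive (basis3 j) tpT)).1.
  rewrite (ip_rhs a mOmm s h c k Lw LZ Lp) ip0l addr0 /w resZ.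
  rewrite (ip_Zl (e c) (Lr _) (LD (k + 2))) (ip_Zl (e c) (Lr _) (LD (k + 1))).
  rewrite (ip_Zl (e c) (L2_res mOmm (Lr _)) Lp) (ip_Zl (e (~~ c)) (Lr _) Lp).
  have := @residual r Lr r0 og (~~ h) c k phi; rewrite negbK => /(_ tp).
  move: (ip3 _ _) (ip3 _ _) (ip3 _ _) (ip3 _ _) (a h) => x1 x2 x3 x4 y E.
  by rewrite -mulrBr {}E /e /sgn; case: (h) (c) => -[] /=; ring.
have r00 h c k : nrm3 (fl r h c k) = 0.
  have := le_nsum w (~~ h) c k; have := est Lw LZ vw (fun _ _ _ _ _ => erefl) sw.
  have -> : nsum (fun _ _ _ => 0 : R3 R -> R) = 0.
    by rewrite /nsum; do 3 (apply: big1 => ? _); exact: nrm0.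
  rewrite mulr0 => h1 h2; have := le_trans h2 h1.
  rewrite /w (nrmZ (e c) (Lr _)) negbK /e.
  have -> : `|(if c then -1 else 1) : R| = 1 by case: (c); rewrite ?normrN normr1.
  by rewrite mul1r => h3; apply/eqP; rewrite eq_le h3 nrm_ge0.
move=> h c phi tp k; have tpT : testf phi := test_function_sub (@subsetT _ _) tp.
have Lp := (testf_L2c tpT).1.
rewrite -(su h c phi tp k) (ip_rhs a mOmm s h c k Lu Lf Lp) (ip_rhs a mOmm s h c k Lu (fun h c k => Lg (h, c, k)) Lp).
congr (_ + _); apply/eqP; rewrite -subr_eq0 -(ip_Bl (Lf h c k) (Lg (h, c, k)) Lp).
by apply/eqP; apply: nrm_eq0_ip => //; [exact: (Lr (h, c, k))|exact: r00].
Qed.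

End Existence.

(** * Vector-valued test functions and their coordinates *)

Section LinearImage.
Context {R : realType} {V W W' : normedModType R} (L : W -> W').
Hypothesis lL : forall (c : R) u v, L (c *: u + v) = c *: L u + L v.
Hypothesis cL : continuous L.

Let L0 : L 0 = 0.
Proof. by have := lL (-1) 0 0; rewrite scaler0 addr0 scaleN1r addNr. Qed.

Let LB u v : L (u - v) = L u - L v.
Proof. by rewrite addrC -scaleN1r lL scaleN1r addrC. Qed.

Let LZ c u : L (c *: u) = c *: L u.
Proof. by rewrite -[c *: u]addr0 lL L0 addr0. Qed.

Lemma derive_linear (f : V -> W) x v : derivable f x v ->
  derivable (fun y => L (f y)) x v /\ 'D_v (fun y => L (f y)) x = L ('D_v f x).
Proof.
move=> df; have c : h^-1 *: (L (f (h *: v + x)) - L (f x)) @[h --> (0 : R)^'] --> L ('D_v f x).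
  have -> : (fun h : R => h^-1 *: (L (f (h *: v + x)) - L (f x))) = L \o (fun h : R => h^-1 *: (f (h *: v + x) - f x)).
    by apply/funext => h; rewrite /= LZ LB.
  by apply: (cvg_comp _ _ df); exact: cL.
by split; [apply: cvgP c|exact: cvg_lim c].
Qed.

Lemma smooth_linear (f : V -> W) : smooth f -> smooth (fun y => L (f y)).
Proof.
move=> sf; apply: (@smooth_class R V W' (fun h => exists2 g : V -> W, smooth g & h = fun y => L (g y))); last by exists f.
  move=> _ [g sg ->]; split.
    by move=> x; apply: continuous_comp; [exact: smooth_continuous|exact: cL].
  by move=> x v; exact: (derive_linear (smooth_derivable sg)).1.
move=> _ v [g sg ->]; exists ('D_v g); first exact: smooth_derive.
by apply/funext => x; exact: (derive_linear (smooth_derivable sg)).2.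
Qed.

End LinearImage.

Section VectorTests.
Context {R : realType}.

Lemma test_linear (W W' : normedModType R) (L : W -> W') (U : set (R3 R)) (f : R3 R -> W) :
  (forall (c : R) u v, L (c *: u + v) = c *: L u + L v) -> continuous L ->
  test_function U f -> test_function U (fun x => L (f x)).
Proof.
move=> lL cL [sf cf Uf]; have L0 : L 0 = 0 by have := lL (-1) 0 0; rewrite scaler0 addr0 scaleN1r addNr.
have sub : closure [set x | L (f x) != 0] `<=` closure [set x | f x != 0].
  by apply: closureS => x /=; apply: contra_neq => ->.
split; first exact: smooth_linear.
  by apply: subclosed_compact cf sub; exact: closed_closure.
exact: subset_trans Uf.
Qed.

Lemma mxE_lin (k : 'I_3) (c : R) (u v : 'rV[R]_3) : (c *: u + v) 0 k = c *: u 0 k + v 0 k.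
Proof. by rewrite !mxE. Qed.

Lemma row_lin (k : 'I_3) (c t t' : R) : (c *: t + t') *: delta_mx 0 k = c *: (t *: delta_mx 0 k) + t' *: delta_mx 0 k :> 'rV[R]_3.
Proof. by rewrite scalerDl scalerA. Qed.

Lemma test_coord U (Phi : R3 R -> 'rV[R]_3) k : test_function U Phi -> test_function U (fun x => Phi x 0 k).
Proof. apply: (test_linear (L := fun M : 'rV[R]_3 => M 0 k)); first exact: mxE_lin.
exact: matrix_normedtype.coord_continuous. Qed.

Lemma derive_coord U (Phi : R3 R -> 'rV[R]_3) (v : R3 R) k x : test_function U Phi ->
  'D_v Phi x 0 k = 'D_v (fun x => Phi x 0 k) x.
Proof.
move=> [sP _ _]; apply/esym.
exact: (derive_linear (L := fun M : 'rV[R]_3 => M 0 k) (mxE_lin k) (@matrix_normedtype.coord_continuous _ _ _ 0 k) (smooth_derivable sP)).2.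
Qed.

Definition axis (phi : R3 R -> R) (k : 'I_3) (x : R3 R) : 'rV[R]_3 := phi x *: delta_mx 0 k.

Lemma test_axis U (phi : R3 R -> R) k : test_function U phi -> test_function U (axis phi k).
Proof.
apply: (test_linear (L := fun t : R => t *: delta_mx 0 k : 'rV[R]_3)); first exact: row_lin.
exact: scalel_continuous.
Qed.

Lemma axisE phi k x j : axis phi k x 0 j = if j == k then phi x else 0.
Proof. by rewrite !mxE eqxx /=; case: (j == k); rewrite ?mulr1 ?mulr0. Qed.

Lemma curlE U (Phi : R3 R -> 'rV[R]_3) x k : test_function U Phi ->
  curl Phi x 0 k = 'D_(basis3 (k + 1)) (fun x => Phi x 0 (k + 2)) x - 'D_(basis3 (k + 2)) (fun x => Phi x 0 (k + 1)) x.
Proof. by move=> tP; rewrite mxE !(derive_coord _ _ _ tP). Qed.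

End VectorTests.

(** * Real and imaginary parts of complex fields *)

Section Parts.
Context {R : realType}.
Notation T3 := (measurableTypeR R * measurableTypeR R * measurableTypeR R)%type.
Notation L2_3 := (@L2 _ T3 R leb3).
Notation ip3 := (@ip _ T3 R leb3).
Notation nrm3 := (@nrm _ T3 R leb3).
Notation testf := (@test_function R R setT).
Notation integ f := ((leb3 : {measure set T3 -> \bar R}).-integrable setT (EFin \o f)).

Definition part (c : bool) (z : R[i]) : R := if c then complex.Im z else complex.Re z.

(** Extension by zero turns integrals over [D] into inner products on the whole space. *)
Definition pt (D : set (R3 R)) (f : R3 R -> R[i]) (c : bool) : T3 -> R := res D (fun x => part c (f x)).

Definition comp D (u : vfield R) c k := pt D (fun x => u x 0 k) c.

Lemma patch_res (D : set T3) (f : T3 -> R) : f \_ D = res D f.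
Proof. by rewrite patch_indic; apply/funext => x; rewrite /res /= mulrC. Qed.

Lemma partP (z w : R[i]) : (forall c, part c z = part c w) -> z = w.
Proof. by case: z w => [x y] [x' y'] H; rewrite (H false : x = x') (H true : y = y'). Qed.

Lemma inL2P (D : set (R3 R)) f : measurable (D : set T3) -> inL2 D f <-> forall c, L2_3 (pt D f c).
Proof.
move=> mD; split.
  move=> [mr mi int].
  have m c : measurable_fun setT (pt D f c).
    have -> : pt D f c = (fun x => part c (f x)) \_ (D : set T3) by apply/esym; exact: patch_res.
    have mm : measurable_fun (D : set T3) (fun x : T3 => part c (f x)) by case: c; [exact: mi|exact: mr].
    exact: (measurable_restrictT _ mD).1 mm.
  have int' := (integrable_mkcond _ mD).1 int.
  move=> c; split; first exact: m.
  apply: le_integrable int' => //.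
    by apply/measurable_EFinP; apply: measurable_funX; exact: m.
  move=> x _; rewrite /patch /pt; case: ifPn => [/set_mem Dx|/negP nD].
    rewrite res_in// !abse_EFin lee_fin !ger0_norm ?addr_ge0 ?sqr_ge0//.
    by rewrite /part; case: (c); rewrite ?lerDl ?lerDr sqr_ge0.
  by rewrite res_out ?expr0n//= => Dx; apply: nD; exact: mem_set.
move=> H; have mr c : measurable_fun (D : set T3) (fun x => part c (f x)).
  apply/measurable_restrictT => //; rewrite patch_res; exact: (H c).1.
split; [exact: (mr false)|exact: (mr true)|].
apply/(integrable_mkcond _ mD).
have := integrableD measurableT (H false).2 (H true).2; apply: eq_integrable => // x _.
rewrite /patch /pt /=; case: ifPn => [/set_mem Dx|/negP nD]; first by rewrite !res_in.
by rewrite !res_out ?expr0n ?adde0// => Dx; apply: nD; exact: mem_set.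
Qed.

Lemma cintegralE (D : set (R3 R)) f : cintegral D f =
  Complex (\int[leb3]_x pt D f false x) (\int[leb3]_x pt D f true x).
Proof. by rewrite /cintegral (Rintegral_mkcond _ (D : set T3)) [X in Complex _ X](Rintegral_mkcond _ (D : set T3)) !patch_res. Qed.

Lemma part_cintegral D f c : part c (cintegral D f) = \int[leb3]_x pt D f c x.
Proof. by rewrite cintegralE; case: c. Qed.

Lemma partD c (z w : R[i]) : part c (z + w) = part c z + part c w.
Proof. by case: z w c => [x y] [x' y'] []. Qed.

Lemma partN c (z : R[i]) : part c (- z) = - part c z.
Proof. by case: z c => [x y] []. Qed.

Lemma partZ c (z : R[i]) (r : R) : part c (z * r%:C%C) = part c z * r.
Proof. by case: z c => [x y] [] /=; rewrite mulr0 ?subr0 ?add0r. Qed.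

Lemma ptD D f g c : pt D (fun x => f x + g x) c = pt D f c + pt D g c.
Proof. by rewrite /pt -resD; congr res; apply/funext => x; exact: partD. Qed.

Lemma ptN D f c : pt D (fun x => - f x) c = - pt D f c.
Proof. by rewrite /pt -resN; congr res; apply/funext => x; exact: partN. Qed.

Lemma pt_mul D f (phi : R3 R -> R) c x : pt D (fun x => f x * (phi x)%:C%C) c x = pt D f c x * phi x.
Proof. by rewrite /pt /res partZ mulrA. Qed.

Lemma pt_dotc D (u : vfield R) (F : R3 R -> 'rV[R]_3) c x :
  pt D (fun x => dotc (u x) (F x)) c x = \sum_k comp D u c k x * F x 0 k.
Proof. by rewrite /pt /res /dotc !sum3 !partD !partZ !mulrDr !mulrA. Qed.

Lemma int_mul (u v : T3 -> R) : L2_3 u -> L2_3 v -> integ (fun x => u x * v x).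
Proof. exact: L2_mul. Qed.

Lemma int_dotc D (u : vfield R) (F : R3 R -> 'rV[R]_3) c :
  (forall k, L2_3 (comp D u c k)) -> (forall k, L2_3 (fun x => F x 0 k)) ->
  integ (pt D (fun x => dotc (u x) (F x)) c) /\
  \int[leb3]_x pt D (fun x => dotc (u x) (F x)) c x = \sum_k ip3 (comp D u c k) (fun x => F x 0 k).
Proof.
move=> Lu LF; have I k := int_mul (Lu k) (LF k).
have E : pt D (fun x => dotc (u x) (F x)) c = fun x => comp D u c 0 x * F x 0 0 + comp D u c 1 x * F x 0 1 + comp D u c 2 x * F x 0 2.
  by apply/funext => x; rewrite pt_dotc sum3.
rewrite E; have I2 := integrableD measurableT (I 0) (I 1).
split; first exact: (integrableD measurableT I2 (I 2)).
by rewrite (RintegralD measurableT I2 (I 2)) (RintegralD measurableT (I 0) (I 1)) sum3.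
Qed.

Lemma int_scalar D f (phi : R3 R -> R) c : L2_3 (pt D f c) -> L2_3 phi ->
  integ (pt D (fun x => f x * (phi x)%:C%C) c) /\
  \int[leb3]_x pt D (fun x => f x * (phi x)%:C%C) c x = ip3 (pt D f c) phi.
Proof.
move=> Lf Lp; have -> : pt D (fun x => f x * (phi x)%:C%C) c = fun x => pt D f c x * phi x.
  by apply/funext => x; exact: pt_mul.
by split; [exact: int_mul|].
Qed.

End Parts.

(** * Complex weak equations in real components *)

Section Conversion.
Context {R : realType}.
Notation T3 := (measurableTypeR R * measurableTypeR R * measurableTypeR R)%type.
Notation L2_3 := (@L2 _ T3 R leb3).
Notation ip3 := (@ip _ T3 R leb3).
Notation nrm3 := (@nrm _ T3 R leb3).
Notation testf := (@test_function R R setT).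
Notation integ f := ((leb3 : {measure set T3 -> \bar R}).-integrable setT (EFin \o f)).
Implicit Types (D U G : set (R3 R)) (u v g : vfield R).

Definition L2comp D u := forall c k, L2_3 (comp D u c k).

Lemma inL2vP D u : measurable (D : set T3) -> inL2v D u <-> L2comp D u.
Proof.
move=> mD; split=> [H c k|H k]; first exact: ((inL2P _ mD).1 (H k)).
by apply/(inL2P _ mD) => c; exact: H.
Qed.

Lemma L2_coord U (Phi : R3 R -> 'rV[R]_3) k : test_function U Phi -> L2_3 (fun x => Phi x 0 k).
Proof. by move=> tP; apply: (testf_L2c (test_function_sub (@subsetT _ _) (test_coord k tP))).1. Qed.

Lemma L2_curl U (Phi : R3 R -> 'rV[R]_3) k : test_function U Phi -> L2_3 (fun x => curl Phi x 0 k).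
Proof.
move=> tP; have t j := test_function_sub (@subsetT _ _) (test_coord j tP).
have -> : (fun x => curl Phi x 0 k) = 'D_(basis3 (k + 1)) (fun x => Phi x 0 (k + 2)) - 'D_(basis3 (k + 2)) (fun x => Phi x 0 (k + 1)).
  by apply/funext => x; rewrite (curlE _ _ tP).
by apply: L2B; apply: (testf_L2c (test_derive _ (t _))).1.
Qed.

Lemma sum_curl (A : 'I_3 -> 'I_3 -> 'I_3 -> R) :
  \sum_k (A k (k + 1) (k + 2) - A k (k + 2) (k + 1)) = \sum_k (A (k + 1) (k + 2) k - A (k + 2) (k + 1) k).
Proof.
rewrite !big_split /= (reindex_inj (addIr 1)) /= [X in _ + X = _](reindex_inj (addIr 2)) /=.
by congr (_ + _); apply: eq_bigr => k _; have [E1 E2 E3 E4] := I3_cyc k; rewrite ?E1 ?E2 ?E3 ?E4.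
Qed.

Lemma ip_curl U D u (Phi : R3 R -> 'rV[R]_3) c : L2comp D u -> test_function U Phi ->
  \sum_k ip3 (comp D u c k) (fun x => curl Phi x 0 k) =
  \sum_k (ip3 (comp D u c (k + 1)) ('D_(basis3 (k + 2)) (fun x => Phi x 0 k))
          - ip3 (comp D u c (k + 2)) ('D_(basis3 (k + 1)) (fun x => Phi x 0 k))).
Proof.
move=> Lu tP; have t j := test_function_sub (@subsetT _ _) (test_coord j tP).
have LD i j : L2_3 ('D_(basis3 i) (fun x => Phi x 0 j)) := (testf_L2c (test_derive _ (t j))).1.
have E k : ip3 (comp D u c k) (fun x => curl Phi x 0 k) =
   ip3 (comp D u c k) ('D_(basis3 (k + 1)) (fun x => Phi x 0 (k + 2))) - ip3 (comp D u c k) ('D_(basis3 (k + 2)) (fun x => Phi x 0 (k + 1))).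
  rewrite -(ip_subr (LD _ _) (LD _ _) (Lu c k)); congr (ip3 _ _).
  by apply/funext => x; rewrite (curlE _ _ tP).
rewrite (eq_bigr _ (fun k _ => E k)); exact: (sum_curl (fun i j l => ip3 (comp D u c i) ('D_(basis3 j) (fun x => Phi x 0 l)))).
Qed.

(** The integrals extend over [D] but the test fields live in [U]. For [U = D] this is [is_wcurl];
    for a larger [U] it also says that the boundary term of Green's formula vanishes on the boundary
    of [D] inside [U]. *)
Definition vcurl U D u g := forall Phi : R3 R -> 'rV[R]_3, test_function U Phi ->
  cintegral D (fun x => dotc (g x) (Phi x)) = cintegral D (fun x => dotc (u x) (curl Phi x)).

Lemma vcurlP U D u g : L2comp D u -> L2comp D g ->
  vcurl U D u g <-> forall c, wcurl U (comp D u c) (comp D g c).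
Proof.
move=> Lu Lg; split=> [H c phi tp k|H Phi tP].
  have ta := test_axis k tp.
  have := congr1 (part c) (H _ ta); rewrite !part_cintegral.
  rewrite (int_dotc (Lg c) (fun j => L2_coord j ta)).2 (int_dotc (Lu c) (fun j => L2_curl j ta)).2.
  rewrite (ip_curl c Lu ta).
  have aE j : (fun x => axis phi k x 0 j) = if j == k then phi else 0.
    by apply/funext => x; rewrite axisE; case: (j == k).
  have D0 i : 'D_(basis3 i) (0 : R3 R -> R) = 0 by apply/funext => x; exact: derive_cst.
  have z j : j != k -> ip3 (comp D g c j) (fun x => axis phi k x 0 j) = 0.
    by move=> jk; rewrite aE (negbTE jk) ip0r.
  rewrite (bigD1 k)//= big1 ?addr0 => [|j jk]; last exact: z.
  rewrite (bigD1 k)//= [X in _ + X]big1 ?addr0 => [|j jk]; last first.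
    by rewrite aE (negbTE jk) !D0 !ip0r subrr.
  by rewrite aE eqxx.
apply: partP => c; rewrite !part_cintegral.
rewrite (int_dotc (Lg c) (fun j => L2_coord j tP)).2 (int_dotc (Lu c) (fun j => L2_curl j tP)).2.
rewrite (ip_curl c Lu tP); apply: eq_bigr => k _.
exact: (H c _ (test_coord k tP) k).
Qed.

Lemma vcurl0P U D u g : L2comp D u -> L2comp D g ->
  (forall Phi : R3 R -> 'rV[R]_3, test_function U Phi ->
    cintegral D (fun x => dotc (u x) (curl Phi x) - dotc (g x) (Phi x)) = 0) <-> vcurl U D u g.
Proof.
move=> Lu Lg.
have E Phi : test_function U Phi -> cintegral D (fun x => dotc (u x) (curl Phi x) - dotc (g x) (Phi x)) =
    cintegral D (fun x => dotc (u x) (curl Phi x)) - cintegral D (fun x => dotc (g x) (Phi x)).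
  move=> tP; apply: partP => c; rewrite partD partN !part_cintegral ptD ptN.
  exact: (RintegralB measurableT (int_dotc (Lu c) (fun j => L2_curl j tP)).1 (int_dotc (Lg c) (fun j => L2_coord j tP)).1).
split=> H Phi tP; have := H Phi tP; rewrite ?E//.
  by move=> /eqP; rewrite subr_eq0 => /eqP.
by move=> ->; rewrite subrr.
Qed.

Lemma L2_grad U (phi : R3 R -> R) k : test_function U phi -> L2_3 (fun x => grad phi x 0 k).
Proof.
move=> tp; have -> : (fun x => grad phi x 0 k) = 'D_(basis3 k) phi by apply/funext => x; rewrite mxE.
exact: (testf_L2c (test_derive _ (test_function_sub (@subsetT _ _) tp))).1.
Qed.

Definition rdiv U D u (f : R3 R -> R[i]) := forall (phi : R3 R -> R), test_function U phi ->
  forall c, \sum_k ip3 (comp D u c k) ('D_(basis3 k) phi) = - ip3 (pt D f c) phi.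

Lemma part_int_grad U D u (phi : R3 R -> R) c : L2comp D u -> test_function U phi ->
  integ (pt D (fun x => dotc (u x) (grad phi x)) c) /\
  part c (cintegral D (fun x => dotc (u x) (grad phi x))) = \sum_k ip3 (comp D u c k) ('D_(basis3 k) phi).
Proof.
move=> Lu tp; have [I E] := int_dotc (Lu c) (fun k => L2_grad k tp); split=> //.
rewrite part_cintegral E; apply: eq_bigr => k _; congr (ip3 _ _).
by apply/funext => x; rewrite mxE.
Qed.

Lemma rdivP U D u f : L2comp D u -> (forall c, L2_3 (pt D f c)) ->
  (forall phi : R3 R -> R, test_function U phi ->
    cintegral D (fun x => f x * (phi x)%:C%C) = - cintegral D (fun x => dotc (u x) (grad phi x))) <-> rdiv U D u f.
Proof.
move=> Lu Lf; split=> [H phi tp c|H phi tp].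
  have := congr1 (part c) (H phi tp); rewrite partN (part_int_grad c Lu tp).2 part_cintegral.
  have Lp := (testf_L2c (test_function_sub (@subsetT _ _) tp)).1.
  by rewrite (int_scalar (Lf c) Lp).2 => ->; rewrite opprK.
apply: partP => c; rewrite partN (part_int_grad c Lu tp).2 part_cintegral.
have Lp := (testf_L2c (test_function_sub (@subsetT _ _) tp)).1.
by rewrite (int_scalar (Lf c) Lp).2 (H phi tp) opprK.
Qed.

Lemma rdiv0P U D u f : L2comp D u -> (forall c, L2_3 (pt D f c)) ->
  (forall phi : R3 R -> R, test_function U phi ->
    cintegral D (fun x => dotc (u x) (grad phi x) + f x * (phi x)%:C%C) = 0) <-> rdiv U D u f.
Proof.
move=> Lu Lf.
have E phi c : test_function U phi -> part c (cintegral D (fun x => dotc (u x) (grad phi x) + f x * (phi x)%:C%C)) =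
    \sum_k ip3 (comp D u c k) ('D_(basis3 k) phi) + ip3 (pt D f c) phi.
  move=> tp; have Lp := (testf_L2c (test_function_sub (@subsetT _ _) tp)).1.
  rewrite part_cintegral ptD; have [I1 <-] := part_int_grad c Lu tp.
  have [I2 <-] := int_scalar (Lf c) Lp; rewrite part_cintegral.
  exact: (RintegralD measurableT I1 I2).
split=> [H phi tp c|H phi tp].
  by have := E phi c tp; rewrite H// => /esym; rewrite (_ : part c 0 = 0) => [/eqP|]; [rewrite addr_eq0 => /eqP|case: c].
apply: partP => c; rewrite E// (H phi tp) addNr; by case: c.
Qed.

Lemma pt_supp D U f c (phi : R3 R -> R) : (forall x, ~ U x -> phi x = 0) ->
  ip3 (pt (D `&` U) f c) phi = ip3 (pt D f c) phi.
Proof.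
move=> p0; rewrite /ip; congr fine; apply: eq_integral => x _; congr EFin.
have [Ux|Ux] := pselect (U x); last by rewrite p0// !mulr0.
rewrite /pt; have [Dx|Dx] := pselect (D x); first by rewrite !res_in.
by rewrite !res_out// => -[].
Qed.

Lemma comp_supp D U u c k (phi : R3 R -> R) : (forall x, ~ U x -> phi x = 0) ->
  ip3 (comp (D `&` U) u c k) phi = ip3 (comp D u c k) phi.
Proof. exact: pt_supp. Qed.

(* A partition of unity [1 = sum_i b_i prod_(j < i) (1 - b_j) + prod_j (1 - b_j)]
   by bumps, whose last term vanishes near [K]. *)
Lemma wcurl_local (K : set (R3 R)) (w z : 'I_3 -> R3 R -> R) : compact K ->
  (forall j, L2_3 (w j)) -> (forall j, L2_3 (z j)) ->
  (forall j x, ~ K x -> w j x = 0) -> (forall j x, ~ K x -> z j x = 0) ->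
  (forall x, K x -> exists2 r, 0 < r & wcurl [set y | `|y - x| < r] w z) -> wcurl setT w z.
Proof.
move=> cK Lw Lz w0 z0 loc.
have /choice[r Hr] (x : R3 R) : exists r : R, K x -> 0 < r /\ wcurl [set y | `|y - x| < r] w z.
  by have [/loc[r r0 H]|] := pselect (K x); [exists r|exists 0].
have r40 y : K y -> 0 < r y / 4 by move=> /Hr[? _]; lra.
have [s [sK sC]] := finite_cover cK r40.
pose good (phi : R3 R -> R) := forall k, ip3 (z k) phi =
  ip3 (w (k + 1)) ('D_(basis3 (k + 2)) phi) - ip3 (w (k + 2)) ('D_(basis3 (k + 1)) phi).
have main (s' : seq (R3 R)) : (forall x, x \in s' -> K x) -> forall phi : R3 R -> R, testf phi ->
    (forall x, K x -> (exists2 y, y \in s' & `|x - y| < r y / 4) \/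
      (exists2 e, 0 < e & forall t, `|x - t| < e -> phi t = 0)) -> good phi.
  elim: s' => [_|y s' IH ys'] phi tp cov.
    have p0 x : K x -> phi x = 0.
      by move=> /cov[[]//|[e e0 H]]; apply: H; rewrite subrr normr0.
    have D0 x (v : R3 R) : K x -> 'D_v phi x = 0.
      by move=> /cov[[]//|[e e0 H]]; exact: (@near_cst_derive _ _ 0 _ _ e e0 H).
    have zero (f p : R3 R -> R) : (forall x, ~ K x -> f x = 0) -> (forall x, K x -> p x = 0) -> ip3 f p = 0.
      move=> f0 q0; apply: ip_disjoint => x; have [Kx|Kx] := pselect (K x); first by rewrite q0// mulr0.
      by rewrite f0// mul0r.
    by move=> k; rewrite !zero ?subrr// => x; [exact: w0|exact: D0|exact: w0|exact: D0|exact: z0].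
  have [ry wy] := Hr y (ys' y (mem_head _ _)).
  pose b := bump y (r y / 4); have r4 : 0 < r y / 4 by lra.
  have tb : test_function [set t | `|t - y| < r y] b.
    by apply: bump_test => // t /=; lra.
  pose p x := phi x * b x; have tpb : test_function [set t | `|t - y| < r y] p.
    by apply: test_mul tb _; exact: test_function_smooth tp.
  have tpT : testf p := test_function_sub (@subsetT _ _) tpb.
  pose q x := phi x + -1 * p x; have tq : testf q.
    apply: (test_add tp); apply: (@test_mul R setT p (cst (-1))) => //; exact: (@smooth_cst R (R3 R) R (-1)).
  have gq : good q.
    apply: IH => // [x xs|x Kx]; first by apply: ys'; rewrite inE xs orbT.
    case: (cov x Kx) => [[y']|[e e0 He]]; last by right; exists e => // t /He; rewrite /q /p => ->; rewrite mul0r mulr0 addr0.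
    rewrite inE => /orP[/eqP ->|y's] xy; last by left; exists y'.
    right; exists (r y / 4 - `|x - y|); first by lra.
    move=> t xt; rewrite /q /p /b bump_eq1 ?mulr1 ?mulN1r ?subrr//.
    by have := ler_distD x t y; rewrite (distrC t x); lra.
  have gp : good p by move=> k; exact: wy.
  have qE : q = phi - p by apply/funext => x; rewrite /q mulN1r.
  have L f : testf f -> L2_3 f by move=> tf; exact: (testf_L2c tf).1.
  have LD (f : R3 R -> R) (v : R3 R) : testf f -> L2_3 ('D_v f) by move=> tf; exact: (testf_L2c (test_derive v tf)).1.
  have DqE (v : R3 R) : 'D_v q = 'D_v phi - 'D_v p.
    have sp := test_function_smooth tp; have sb := test_function_smooth tpT.
    apply/funext => x; rewrite /q (derive_add (smooth_derivable sp) (smooth_derivable (smoothZ (-1) sb))).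
    by rewrite (derive_scal _ _ _ sb) mulN1r.
  have e1 k : ip3 (z k) q = ip3 (z k) phi - ip3 (z k) p by rewrite qE; exact: ip_subr (L _ tp) (L _ tpT) (Lz k).
  have e2 i (v : R3 R) : ip3 (w i) ('D_v q) = ip3 (w i) ('D_v phi) - ip3 (w i) ('D_v p).
    by rewrite DqE; exact: ip_subr (LD _ _ tp) (LD _ _ tpT) (Lw i).
  move=> k; have := gq k; rewrite e1 (e2 (k + 1)) (e2 (k + 2)) (gp k).
  move: (ip3 (z k) phi) (ip3 (w (k + 1)) _) (ip3 (w (k + 1)) _) (ip3 (w (k + 2)) _) (ip3 (w (k + 2)) _) => x1 x2 x3 x4 x5; lra.
by move=> phi tp; apply: (main s sK phi tp) => x Kx; left; exact: sC.
Qed.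

End Conversion.

(** * Boundary conditions as equations for zero extensions *)

Section Traces.
Context {R : realType}.
Notation T3 := (measurableTypeR R * measurableTypeR R * measurableTypeR R)%type.
Notation L2_3 := (@L2 _ T3 R leb3).
Notation ip3 := (@ip _ T3 R leb3).
Notation nrm3 := (@nrm _ T3 R leb3).
Notation testf := (@test_function R R setT).
Implicit Types (D U G : set (R3 R)) (u v g X : vfield R).

Lemma res_setI (D U : set T3) (f : T3 -> R) : res (D `&` U) f = res U (res D f).
Proof. by rewrite /res; apply/funext => x; rewrite indicI /= mulrA [X in X * _]mulrC. Qed.

Lemma L2comp_setI D U u : measurable (U : set T3) -> L2comp D u -> L2comp (D `&` U) u.
Proof. move=> mU Lu c k; have -> : comp (D `&` U) u c k = res U (comp D u c k) by exact: res_setI.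
by apply: L2_res mU _; exact: Lu. Qed.

Lemma open_ball_sub (U : set (R3 R)) x : open U -> U x -> exists2 r : R, 0 < r & [set y | `|y - x| < r] `<=` U.
Proof.
move=> oU Ux; have /nbhs_ballP[r /= r0 H] := open_nbhs_nbhs (conj oU Ux).
by exists r => // y xy; apply: H; rewrite -ball_normE /ball_ /= distrC.
Qed.

(** The trace condition comes with its own neighbourhood [U] and its own curl [g']. Both curls
    represent the same distribution in [D] and [U], so they agree a.e. there; the local equations
    near interior and boundary points are then glued. *)
Lemma trace_wcurl D X g : open D -> bounded_set D -> L2comp D X -> L2comp D g ->
  (forall c, wcurl D (comp D X c) (comp D g c)) -> tangential_trace0 D (boundary D) X ->
  forall c, wcurl setT (comp D X c) (comp D g c).
Proof.
move=> oD bD LX Lg wX [U [g' [oU GU Lg' _ tr]]] c.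
have mU : measurable (U : set T3) by exact: open_measurable3.
have mD : measurable (D : set T3) by exact: open_measurable3.
have oDU : open (D `&` U) by exact: openI.
have mDU : measurable (D `&` U : set T3) by exact: open_measurable3.
have LX' := L2comp_setI mU LX; have Lgg := L2comp_setI mU Lg.
have {}Lg' : L2comp (D `&` U) g' by apply/(inL2vP _ mDU).
have wU : wcurl U (comp (D `&` U) X c) (comp (D `&` U) g' c).
  by apply: (vcurlP U LX' Lg').1; apply: (vcurl0P U LX' Lg').1.
have out (v : vfield R) k x : ~ closure D x -> comp D v c k x = 0.
  by move=> nc; apply: res_out => /subset_closure.
apply: (wcurl_local (compact_closure bD)) => // [j x|j x|x cx]; try exact: out.
have [Dx|nDx] := pselect (D x).
  have [r r0 H] := open_ball_sub oD Dx; exists r => //; exact: wcurl_sub H (wX c).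
have Ux : U x by apply: GU; split=> // /interior_subset.
have [r r0 H] := open_ball_sub oU Ux; exists r => // phi tp k.
have tU : test_function U phi := test_function_sub H tp.
have pU y : ~ U y -> phi y = 0 by exact: test_function0 tU.
have DU (v : R3 R) y : ~ U y -> 'D_v phi y = 0 by exact: test_function0 (test_derive v tU).
rewrite -(comp_supp (U := U) D g c k pU) -(comp_supp (U := U) D X c (k + 1) (DU _)) -(comp_supp (U := U) D X c (k + 2) (DU _)).
rewrite -(wU phi tU k).
pose d := comp (D `&` U) g c k - comp (D `&` U) g' c k.
have Ld : L2_3 d by apply: L2B; [exact: Lgg|exact: Lg'].
have Lp := (testf_L2c (test_function_sub (@subsetT _ _) tU)).1.
apply/eqP; rewrite -subr_eq0 -(ip_Bl (Lgg c k) (Lg' c k) Lp); apply/eqP.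
apply: nrm_eq0_ip => //; apply: nrm_ae0; first exact: Ld.1.
have h := test_orth_ae0_on oDU Ld; apply: (ae_imp _ (h _)) => [y hy|eta te].
  have [DUy|DUy] := pselect ((D `&` U) y); first exact: hy.
  by rewrite -[LHS]/(comp (D `&` U) g c k y - comp (D `&` U) g' c k y) /comp /pt !res_out// subrr.
have Le := (testf_L2c (test_function_sub (@subsetT _ _) te)).1.
rewrite (ip_Bl (Lgg c k) (Lg' c k) Le).
have teU : test_function U eta by apply: test_function_sub te => y [].
have teD : test_function D eta by apply: test_function_sub te => y [].
rewrite (wU eta teU k) (comp_supp D g c k (fun y => test_function0 teU)) (wX c eta teD k).
have e j (v : R3 R) : ip3 (comp (D `&` U) X c j) ('D_v eta) = ip3 (comp D X c j) ('D_v eta).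
  by apply: comp_supp => y; exact: test_function0 (test_derive v teU).
by rewrite !e subrr.
Qed.

Lemma tangential_of D G U X g : open U -> G `<=` U -> measurable (D : set T3) -> D `<=` U ->
  L2comp D X -> L2comp D g -> (forall c, wcurl U (comp D X c) (comp D g c)) -> tangential_trace0 D G X.
Proof.
move=> oU GU mD DU LX Lg w; exists U, g; rewrite (setIidl DU); split=> //.
- by apply/(inL2vP _ mD).
- by apply: (vcurlP D LX Lg).2 => c; exact: wcurl_sub DU (w c).
- by apply: (vcurl0P U LX Lg).2; exact: (vcurlP U LX Lg).2.
Qed.

Lemma normal_of D G U X f : open U -> G `<=` U -> measurable (D `&` U : set T3) ->
  L2comp (D `&` U) X -> (forall c, L2_3 (pt (D `&` U) f c)) -> rdiv U (D `&` U) X f -> normal_trace0 D G X.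
Proof.
move=> oU GU mD LX Lf r; exists U, f; split=> //.
- by apply/(inL2P _ mD).
- apply: (rdivP (D `&` U) LX Lf).2 => phi tp; apply: r; by apply: test_function_sub tp => x [].
- exact: (rdiv0P U LX Lf).2.
Qed.

Lemma normal0_of D G U X : open U -> G `<=` U -> measurable (D : set T3) -> D `<=` U ->
  L2comp D X -> rdiv U D X (fun=> 0) -> normal_trace0 D G X.
Proof.
move=> oU GU mD DU LX r; apply: (normal_of (f := fun=> 0) oU GU); rewrite ?(setIidl DU)// => c.
rewrite (_ : pt D (fun=> 0) c = 0); first exact: L2_0.
by apply/funext => x; rewrite /pt /res; case: c => /=; rewrite mulr0.
Qed.

(** Up to a factor [t] and a rotation of real and imaginary parts, [X] is a curl, and curls are
    orthogonal to gradients. *)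
Lemma div_free U D (w : bool -> 'I_3 -> R3 R -> R) X h (t : R) : t != 0 -> L2comp D X ->
  (forall c, wcurl U (w c) (fun k => (sgn h c * t) *: comp D X (~~ c) k)) -> rdiv U D X (fun=> 0).
Proof.
move=> t0 LX wc phi tp c; have := curl_grad (wc (~~ c)) tp; rewrite negbK.
have Lp k := (testf_L2c (test_derive (basis3 k) (test_function_sub (@subsetT _ _) tp))).1.
under eq_bigr do rewrite (ip_Zl _ (LX _ _) (Lp _)).
have -> : pt D (fun=> 0) c = 0 by apply/funext => x; rewrite /pt /res; case: c => /=; rewrite mulr0.
rewrite ip0l oppr0 -mulr_sumr => /eqP; rewrite mulf_eq0 => /orP[|/eqP//].
by rewrite mulf_eq0 (negbTE t0) orbF /sgn; case: ifP; rewrite ?oppr_eq0 oner_eq0.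
Qed.

Lemma pt_scale D (t : R) (f : R3 R -> R[i]) c :
  pt D (fun x => Complex 0 t * f x) c = (sgn false c * t) *: pt D f (~~ c).
Proof.
apply/funext => x; rewrite -[RHS]/(sgn false c * t * (\1_D x * part (~~ c) (f x))) /pt /res.
case: (f x) => p q; move: (\1_D x) => i; rewrite /sgn; case: c => /=; ring.
Qed.

Lemma comp_scale D (t : R) X c k : comp D (fun x => Complex 0 t *: X x) c k = (sgn false c * t) *: comp D X (~~ c) k.
Proof.
rewrite -pt_scale /comp; congr (pt D _ c); apply/funext => x; exact: mxE.
Qed.

Lemma comp_current D Omm (s t : R) (E j : vfield R) c k : Omm `<=` D ->
  comp D (fun x => j x - Complex (- conductivity Omm s x) t *: E x) c k =
  s *: res Omm (comp D E c k) + (sgn true c * t) *: comp D E (~~ c) k + comp D j c k.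
Proof.
move=> sub; apply/funext => x.
rewrite -[RHS]/(s * (\1_Omm x * (\1_D x * part c (E x 0 k))) + sgn true c * t * (\1_D x * part (~~ c) (E x 0 k))
  + \1_D x * part c (j x 0 k)) /comp /pt /res !mxE /conductivity.
have -> : (if x \in Omm then s else 0) = s * \1_Omm x by rewrite indicE; case: (x \in Omm); rewrite ?mulr1 ?mulr0.
case: (E x 0 k) (j x 0 k) => p q [p' q']; move: (\1_D x) (\1_Omm x) => i o; rewrite /sgn; case: c => /=; ring.
Qed.

Definition vec (w : bool -> 'I_3 -> R3 R -> R) : vfield R :=
  fun x => \row_k Complex (w false k x) (w true k x).

Lemma comp_vec D (w : bool -> 'I_3 -> R3 R -> R) c k : comp D (vec w) c k = res D (w c k).
Proof. by rewrite /comp /pt; congr res; apply/funext => x; rewrite mxE; case: c. Qed.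

Lemma sqr_L2norm D f : measurable (D : set T3) -> inL2 D f ->
  L2norm D f ^+ 2 = \sum_c nrm3 (pt D f c) ^+ 2.
Proof.
move=> mD Lf; have Lp := (inL2P f mD).1 Lf; rewrite /L2norm sqr_sqrtr; last first.
  by apply: Rintegral_ge0 => x _; rewrite addr_ge0 ?sqr_ge0.
rewrite (Rintegral_mkcond _ (D : set T3)) big_bool /= !sqr_nrm.
apply: etrans (RintegralD measurableT (L2_mul (Lp true) (Lp true)) (L2_mul (Lp false) (Lp false))).
apply: eq_Rintegral => x _; rewrite /patch /pt; case: ifPn => [/set_mem Dx|/negP nD].
  by rewrite !res_in// /sqnormc addrC -!expr2.
by rewrite !res_out ?mulr0 ?addr0// => Dx; apply: nD; exact: mem_set.
Qed.

Lemma sqr_L2vnorm D u : measurable (D : set T3) -> inL2v D u ->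
  L2vnorm D u ^+ 2 = \sum_k \sum_c nrm3 (comp D u c k) ^+ 2.
Proof.
move=> mD Lu; rewrite sqr_sqrtr; last by apply: sumr_ge0 => k _; exact: sqr_ge0.
by apply: eq_bigr => k _; exact: sqr_L2norm.
Qed.

Lemma L2vnorm_ge0 D u : 0 <= L2vnorm D u.
Proof. exact: sqrtr_ge0. Qed.

Lemma nrm_le_L2vnorm D u c k : measurable (D : set T3) -> inL2v D u -> nrm3 (comp D u c k) <= L2vnorm D u.
Proof.
move=> mD Lu; rewrite -(@ler_pXn2r _ 2)// ?nnegrE ?nrm_ge0 ?L2vnorm_ge0// sqr_L2vnorm//.
rewrite (bigD1 k)//= (bigD1 c)//= -addrA lerDl addr_ge0//; do ?(apply: sumr_ge0 => ? _); exact: sqr_ge0.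
Qed.

Lemma sum_sqr_le (I : Type) (r : seq I) (P : pred I) (F : I -> R) : (forall i, 0 <= F i) ->
  \sum_(i <- r | P i) F i ^+ 2 <= (\sum_(i <- r | P i) F i) ^+ 2.
Proof.
move=> F0; suff [] : 0 <= \sum_(i <- r | P i) F i /\ \sum_(i <- r | P i) F i ^+ 2 <= (\sum_(i <- r | P i) F i) ^+ 2 by [].
elim/big_ind2: _ => [|x y x' y' [x0 xy] [x'0 xy']|i _].
- by rewrite expr0n.
- by split; [exact: addr_ge0|nra].
- by split.
Qed.

Lemma L2vnorm_le D u : measurable (D : set T3) -> inL2v D u -> L2vnorm D u <= \sum_c \sum_k nrm3 (comp D u c k).
Proof.
move=> mD Lu; have s0 : 0 <= \sum_c \sum_k nrm3 (comp D u c k).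
  by do 2 (apply: sumr_ge0 => ? _); exact: nrm_ge0.
rewrite -(@ler_pXn2r _ 2)// ?nnegrE ?L2vnorm_ge0// sqr_L2vnorm// exchange_big /=.
have n0 c : 0 <= \sum_k nrm3 (comp D u c k) by apply: sumr_ge0 => ? _; exact: nrm_ge0.
apply: le_trans (sum_sqr_le _ _ n0).
by apply: ler_sum => c _; apply: sum_sqr_le => k; exact: nrm_ge0.
Qed.

End Traces.

(** * The Maxwell problem and the limit problem in components *)

Section Maxwell.
Context {R : realType}.
Notation T3 := (measurableTypeR R * measurableTypeR R * measurableTypeR R)%type.
Notation L2_3 := (@L2 _ T3 R leb3).
Notation ip3 := (@ip _ T3 R leb3).
Notation nrm3 := (@nrm _ T3 R leb3).
Notation testf := (@test_function R R setT).
Notation flds := (@fields R).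
Variables (b : bc) (Om Omm : set (R3 R)) (omega eps0 mu0 : R).
Hypothesis oOm : open Om.
Hypothesis bOm : bounded_set Om.
Hypothesis oOmm : open Omm.
Hypothesis cOmm : closure Omm `<=` Om.
Hypothesis omega0 : 0 < omega.
Hypothesis eps00 : 0 < eps0.
Hypothesis mu00 : 0 < mu0.

Let mOm : measurable (Om : set T3) := open_measurable3 oOm.
Let mOmm : measurable (Omm : set T3) := open_measurable3 oOmm.

Let subO : Omm `<=` Om.
Proof. by move=> x /subset_closure /cOmm. Qed.

Let oC : open (~` closure Omm).
Proof. exact/closed_openC/closed_closure. Qed.

Definition coef (h : bool) : R := if h then omega * eps0 else omega * mu0.

Lemma coef_gt0 h : 0 < coef h.
Proof. by case: h; exact: mulr_gt0. Qed.

Definition hbc : bool := if b is Insulating then true else false.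

Definition pair_fields D (E H : vfield R) : flds := fun h c k => comp D (if h then H else E) c k.

Definition current (j : vfield R) : flds := fun h c k => if h then comp Om j c k else 0.

Lemma rhs_pair s E H j h c : rhs Omm coef s (pair_fields Om E H) (current j) h c =
  comp Om (if h then fun x => j x - Complex (- conductivity Omm s x) (omega * eps0) *: E x
           else fun x => Complex 0 (omega * mu0) *: H x) c.
Proof.
apply/funext => k; case: h; first by rewrite comp_current.
by rewrite comp_scale /rhs /current /pair_fields scale0r add0r addr0.
Qed.

Lemma L2f_pair D E H : L2comp D E -> L2comp D H -> L2f (pair_fields D E H).
Proof. by move=> LE LH [] c k; [exact: LH|exact: LE]. Qed.

Lemma L2f_current j : L2comp Om j -> L2f (current j).
Proof. by move=> Lj [] c k; [exact: Lj|exact: L2_0]. Qed.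

Lemma vanish_pair E H : vanish Om (pair_fields Om E H).
Proof. by move=> h c k x; exact: res_out. Qed.

Lemma vanish_current j : vanish Om (current j).
Proof. by move=> [] c k x nO //; exact: res_out. Qed.

Lemma maxwell_msys s j E H : L2comp Om j -> maxwell_solution b Om Omm omega eps0 mu0 s j E H ->
  msys Om Omm coef hbc s (current j) (pair_fields Om E H).
Proof.
move=> Lj [/(inL2vP _ mOm) LE /(inL2vP _ mOm) LH wE wH bd].
have Lu := L2f_pair LE LH; have Lf := L2f_current Lj.
pose J x := j x - Complex (- conductivity Omm s x) (omega * eps0) *: E x.
pose K x := Complex 0 (omega * mu0) *: H x.
have LJ : L2comp Om J by move=> c k; have := L2_rhs coef mOmm s true c k Lu Lf; rewrite rhs_pair.
have LK : L2comp Om K by move=> c k; have := L2_rhs coef mOmm s false c k Lu Lf; rewrite rhs_pair.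
have cE := (vcurlP Om LE LK).1 wE; have cH := (vcurlP Om LH LJ).1 wH.
move: bd; rewrite /hbc => bd h c; rewrite rhs_pair /dom.
case: b bd => -[b1 b2]; case: h => /=.
- exact: (trace_wcurl oOm bOm LH LJ cH b2).
- exact: cE.
- exact: cH.
- exact: (trace_wcurl oOm bOm LE LK cE b1).
Qed.

Lemma comp_vanish D (u : flds) h c k : (forall x, ~ D x -> u h c k x = 0) -> comp D (vec (u h)) c k = u h c k.
Proof.
move=> u0; rewrite comp_vec; apply/funext => x; have [Dx|Dx] := pselect (D x); first exact: res_in.
by rewrite res_out// u0.
Qed.

Lemma pair_vec (u : flds) : vanish Om u -> pair_fields Om (vec (u false)) (vec (u true)) = u.
Proof.
move=> u0; apply/funext => h; apply/funext => c; apply/funext => k; rewrite /pair_fields.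
by case: h; apply: comp_vanish => x; exact: u0.
Qed.

(** Off [closure Omm] the curl of H is j minus i omega eps0 E. It is orthogonal to gradients up to
    the outer boundary, so E inherits from j the vanishing normal trace, with divergence
    [g / (i omega eps0)]. The neighbourhood [V] leaves [closure Omm] out to avoid the
    conductivity. *)
Lemma electric_normal s j (u : flds) : inH0div Om j -> L2f u -> vanish Om u ->
  (forall c, wcurl setT (u true c) (rhs Omm coef s u (current j) true c)) ->
  normal_trace0 Om (boundary Om) (vec (u false)).
Proof.
move=> [[/(inL2vP _ mOm) Lj _] [U [g [oU GU Lg _ tr]]]] Lu u0 w.
have mU : measurable (U : set T3) := open_measurable3 oU.
have mOU : measurable (Om `&` U : set T3) by exact: measurableI.
have {}Lg := (inL2P _ mOU).1 Lg.
have rj : rdiv U (Om `&` U) j g := (rdiv0P U (L2comp_setI mU Lj) Lg).1 tr.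
pose V := U `&` ~` closure Omm; have oV : open V by exact: openI.
have mV : measurable (V : set T3) := open_measurable3 oV.
have e0 : 0 < omega * eps0 by exact: mulr_gt0.
have LE : L2comp Om (vec (u false)) by move=> c k; rewrite comp_vanish => // x; exact: u0.
have Lf := L2f_current Lj.
have gE c : pt (Om `&` V) g c = res (~` closure Omm) (pt (Om `&` U) g c).
  by rewrite /pt /V setIA; exact: res_setI.
have mC : measurable (~` closure Omm : set T3) by exact: open_measurable3.
have LgV c : L2_3 (pt (Om `&` V) g c) by rewrite gE; exact: L2_res.
apply: (@normal_of R Om (boundary Om) V (vec (u false)) (fun x => Complex 0 (- (omega * eps0)^-1) * g x)) => //.
- move=> x bx; split; first exact: GU.
  by move=> /cOmm Ox; case: bx => _; rewrite (interior_id Om).1.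
- exact: measurableI.
- exact: L2comp_setI.
- by move=> c; rewrite pt_scale; exact: L2Z.
move=> phi tp c; pose d := ~~ c.
have tpT : testf phi := test_function_sub (@subsetT _ _) tp.
have Lp := (testf_L2c tpT).1; have LD k := (testf_L2c (test_derive (basis3 k) tpT)).1.
have pV x : ~ V x -> phi x = 0 by exact: test_function0 tp.
have DV (v : R3 R) x : ~ V x -> 'D_v phi x = 0 by exact: test_function0 (test_derive v tp).
have tU : test_function U phi by apply: test_function_sub tp => x [].
have DU (v : R3 R) x : ~ U x -> 'D_v phi x = 0 by exact: test_function0 (test_derive v tU).
rewrite pt_scale (ip_Zl _ (LgV (~~ c)) Lp) (pt_supp Om g (~~ c) pV) -(pt_supp Om g (~~ c) (fun x => test_function0 tU)).
have S k : ip3 (comp (Om `&` V) (vec (u false)) c k) ('D_(basis3 k) phi) = ip3 (u false c k) ('D_(basis3 k) phi).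
  rewrite (comp_supp Om (vec (u false)) c k (DV _)) comp_vanish// => x; exact: u0.
rewrite (eq_bigr _ (fun k _ => S k)).
have T k : ip3 (rhs Omm coef s u (current j) true d k) ('D_(basis3 k) phi) =
    sgn true d * (omega * eps0) * ip3 (u false c k) ('D_(basis3 k) phi) + ip3 (comp (Om `&` U) j d k) ('D_(basis3 k) phi).
  rewrite (ip_rhs coef mOmm s true d k Lu Lf (LD k)) ip_disjoint ?mulr0 ?add0r => [|x].
    rewrite negbK; congr (_ + _); apply/esym; exact: comp_supp (DU _).
  have [Ox|Ox] := pselect (Omm x); last by rewrite res_out// mul0r.
  by rewrite DV ?mulr0// => -[_]; apply; exact: subset_closure.
have := curl_grad (w d) tpT; rewrite (eq_bigr _ (fun k _ => T k)) big_split /= -mulr_sumr (rj phi tU d).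
have e1 := lt0r_neq0 e0; move: e1; rewrite /d; move: (omega * eps0) (\sum_k _) (ip3 _ _) => t x y t0 h.
have -> : y = sgn true (~~ c) * t * x by move: h; move: (sgn true _ * t * x) => z; lra.
by rewrite /sgn; case: (c) => /=; field.
Qed.

(** The system encodes only the tangential condition. The normal one is regained from the equations:
    H is a multiple of a curl on the whole space in the conducting case, and E is treated by
    [electric_normal] in the insulating one. *)
Lemma msys_maxwell s j (u : flds) : source_space b Om j -> L2f u -> vanish Om u ->
  msys Om Omm coef hbc s (current j) u ->
  maxwell_solution b Om Omm omega eps0 mu0 s j (vec (u false)) (vec (u true)).
Proof.
move=> sj Lu u0 sys; pose E := vec (u false); pose H := vec (u true).
have Lj : L2comp Om j by apply/(inL2vP _ mOm); move: sj; case: b => [[[]]|[]].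
have LE : L2comp Om E by move=> c k; rewrite comp_vanish => // x; exact: u0.
have LH : L2comp Om H by move=> c k; rewrite comp_vanish => // x; exact: u0.
have Lf := L2f_current Lj; have pE := pair_vec u0.
pose J x := j x - Complex (- conductivity Omm s x) (omega * eps0) *: E x.
pose K x := Complex 0 (omega * mu0) *: H x.
have LJ : L2comp Om J by move=> c k; have := L2_rhs coef mOmm s true c k Lu Lf; rewrite -pE rhs_pair.
have LK : L2comp Om K by move=> c k; have := L2_rhs coef mOmm s false c k Lu Lf; rewrite -pE rhs_pair.
have wE c : wcurl (dom Om hbc false) (comp Om E c) (comp Om K c).
  by have := sys false c; rewrite -{1 2}pE rhs_pair.
have wH c : wcurl (dom Om hbc true) (comp Om H c) (comp Om J c).
  by have := sys true c; rewrite -{1 2}pE rhs_pair.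
have sub h : Om `<=` dom Om hbc h by move=> x Ox; rewrite /dom; case: ifP.
split; [exact/(inL2vP _ mOm)|exact/(inL2vP _ mOm)| | |].
- by apply: (vcurlP Om LE LK).2 => c; exact: wcurl_sub (sub false) (wE c).
- by apply: (vcurlP Om LH LJ).2 => c; exact: wcurl_sub (sub true) (wH c).
move: sys wE wH sj; rewrite /hbc /dom; case: b => /= sys wE wH sj; split.
- by apply: (electric_normal sj Lu u0 (sys true)).
- exact: (tangential_of openT (@subsetT _ _) mOm (@subsetT _ _) LH LJ wH).
- exact: (tangential_of openT (@subsetT _ _) mOm (@subsetT _ _) LE LK wE).
apply: (normal0_of openT (@subsetT _ _) mOm (@subsetT _ _) LH).
apply: (div_free (h := false) (t := omega * mu0) _ LH (w := fun c => comp Om E c)).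
  by rewrite lt0r_neq0// mulr_gt0.
move=> c; have := wE c; congr wcurl; apply/funext => k; exact: comp_scale.
Qed.

(** The neighbourhoods required by the traces are [Om] for Sigma and, for the outer boundary, the
    whole space or the complement of [closure Omm]: on each of them the extended field satisfies its
    equation, which gives the tangential traces, and the normal ones since curls have no
    divergence. *)
Lemma limit_unique : not_eigenfrequency b Om Omm omega eps0 mu0 ->
  forall u : flds, L2f u -> (forall h c k x, ~ Omp Om Omm x -> u h c k x = 0) -> lsys Om Omm coef hbc u ->
  forall h c k, {ae leb3, forall x : T3, u h c k x = 0}.
Proof.
move=> ne u Lu u0 [sE sH]; pose E := vec (u false); pose H := vec (u true).
pose D := Omp Om Omm; have oD : open D by exact: openI.
have mD : measurable (D : set T3) := open_measurable3 oD.
have DO : D `<=` Om by move=> x [].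
have DC : D `<=` ~` closure Omm by move=> x [].
have LE : L2comp D E by move=> c k; rewrite comp_vanish => // x; exact: u0.
have LH : L2comp D H by move=> c k; rewrite comp_vanish => // x; exact: u0.
have uE c k : comp D E c k = u false c k by apply: comp_vanish => x; exact: u0.
have uH c k : comp D H c k = u true c k by apply: comp_vanish => x; exact: u0.
have e0 : 0 < omega * eps0 by exact: mulr_gt0.
have m0 : 0 < omega * mu0 by exact: mulr_gt0.
pose K x := Complex 0 (omega * mu0) *: H x; pose J x := - (Complex 0 (omega * eps0) *: E x).
have KE c k : comp D K c k = (sgn false c * (omega * mu0)) *: comp D H (~~ c) k by exact: comp_scale.
have JE c k : comp D J c k = (sgn true c * (omega * eps0)) *: comp D E (~~ c) k.
  have -> : J = fun x => Complex 0 (- (omega * eps0)) *: E x.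
    by apply/funext => x; rewrite /J -scaleNr; congr (_ *: _); apply/eqP; rewrite eq_complex /= oppr0 !eqxx.
  by rewrite comp_scale; congr (_ *: _); rewrite /sgn; case: (c); rewrite /= ?mulN1r ?mul1r ?opprK.
have LK : L2comp D K by move=> c k; rewrite KE; exact: L2Z.
have LJ : L2comp D J by move=> c k; rewrite JE; exact: L2Z.
have wE c : wcurl (dom Om hbc false) (comp D E c) (comp D K c).
  have := sE c; congr wcurl; apply/funext => k; first by rewrite uE.
  by rewrite KE uH /rhs scale0r add0r addr0.
have wH c : wcurl (dom Om hbc true `\` closure Omm) (comp D H c) (comp D J c).
  have := sH c; congr wcurl; apply/funext => k; first by rewrite uH.
  by rewrite JE uE /rhs scale0r add0r addr0.
have subd h : Om `<=` dom Om hbc h by move=> x Ox; rewrite /dom; case: ifP.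
have bO : boundary Omm `<=` Om by move=> x [/cOmm].
have bC : boundary Om `<=` ~` closure Omm.
  by move=> x [_ nx] /cOmm Ox; apply: nx; rewrite (interior_id Om).1.
have divH U : U `<=` dom Om hbc false -> rdiv U D H (fun=> 0).
  move=> Ud; apply: (div_free (h := false) (t := omega * mu0) _ LH (w := fun c => comp D E c)); first exact: lt0r_neq0.
  by move=> c; have := wcurl_sub Ud (wE c); congr wcurl; apply/funext => k.
have divE U : U `<=` dom Om hbc true `\` closure Omm -> rdiv U D E (fun=> 0).
  move=> Ud; apply: (div_free (h := true) (t := omega * eps0) _ LE (w := fun c => comp D H c)); first exact: lt0r_neq0.
  by move=> c; have := wcurl_sub Ud (wH c); congr wcurl; apply/funext => k.
have sol : limit_solution b Om Omm omega eps0 mu0 E H.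
  split.
  - by split; apply/(inL2vP _ mD).
  - by apply: (vcurlP D LE LK).2 => c; apply: wcurl_sub (wE c); exact: subset_trans DO (subd false).
  - apply: (vcurlP D LH LJ).2 => c; apply: wcurl_sub (wH c) => x [Ox nx]; split=> //; exact: (subd true).
  - split.
      by apply: (tangential_of oOm bO mD DO LE LK) => c; exact: wcurl_sub (subd false) (wE c).
    by apply: (normal0_of oOm bO mD DO LH); apply: divH; exact: subd.
  move: wE wH divH divE; rewrite /hbc /dom; case: b => /= wE wH divH divE; split.
  - apply: (normal0_of oC bC mD DC LE); by apply: divE => x nx; split.
  - apply: (tangential_of oC bC mD DC LH LJ) => c; apply: wcurl_sub (wH c) => x nx; split=> //.
  - by apply: (tangential_of openT (@subsetT _ _) mD (@subsetT _ _) LE LK).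
  - exact: (normal0_of openT (@subsetT _ _) mD (@subsetT _ _) LH (divH _ (@subsetT _ _))).
have [aE aH] := ne E H sol.
have ae (X : vfield R) c k : ae_eq_on D X (fun=> 0) -> {ae leb3, forall x : T3, comp D X c k x = 0}.
  apply: ae_imp => x hx; rewrite /comp /pt; have [Dx|Dx] := pselect (D x); last exact: res_out.
  by rewrite res_in// hx// mxE; case: (c).
by move=> [] c k; [rewrite -uH|rewrite -uE]; exact: ae.
Qed.

End Maxwell.

(** * Existence, uniqueness and estimate for complex fields *)

Lemma nrm_eq0_ae {R : realType} (w : R3 R -> R) : L2 leb3 w -> nrm leb3 w = 0 ->
  {ae (@leb3 R), forall x, w x = 0}.
Proof. by move=> Lw w0; apply: ip_eq0 => //; rewrite -sqr_nrm w0 expr0n. Qed.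

Lemma ae_all_count d (T : measurableType d) (R : realType) (mu : {measure set T -> \bar R}) (I : countType)
  (P : I -> T -> Prop) : (forall i, {ae mu, forall x, P i x}) -> {ae mu, forall x i, P i x}.
Proof.
move=> aP; have : {ae mu, forall x (n : nat), if unpickle n is Some i then P i x else True}.
  apply: ae_all => n; case: (unpickle n) => [i|]; first exact: aP.
  exact: aeW.
by apply: ae_imp => x hx i; have := hx (pickle i); rewrite pickleK.
Qed.

Theorem theorem2p3 (R : realType) (Om Omm : set (R3 R))
    (omega eps0 mu0 : R) :
  is_domain Om -> bounded_set Om -> smooth_boundary Om -> simply_connected Om ->
  connected (boundary Om) ->
  is_domain Omm -> lipschitz_boundary Omm -> closure Omm `<=` Om ->
  0 < omega -> 0 < eps0 -> 0 < mu0 ->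
  forall b : bc, not_eigenfrequency b Om Omm omega eps0 mu0 ->
  exists sigma0 C : R, 0 < sigma0 /\ 0 < C /\
    forall sigma : R, sigma0 <= sigma ->
    forall j : vfield R, source_space b Om j ->
    exists E H : vfield R,
      [/\ maxwell_solution b Om Omm omega eps0 mu0 sigma j E H,
          forall E' H' : vfield R,
            maxwell_solution b Om Omm omega eps0 mu0 sigma j E' H' ->
            ae_eq_on Om E' E /\ ae_eq_on Om H' H &
          L2vnorm Om E + L2vnorm Om H + Num.sqrt sigma * L2vnorm Omm E
            <= C * Hdivnorm Om j].
Proof.
move=> [oOm _ _] bOm smOm _ _ [oOmm _ _] lipOmm cOmm omega0 eps00 mu00 b ne.
have subO : Omm `<=` Om by move=> x /subset_closure /cOmm.
have mOm := open_measurable3 oOm; have mOmm := open_measurable3 oOmm.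
have bOmm : bounded_set Omm.
  by have [M [Mr HM]] := bOm; exists M; split=> // N MN x /subO; exact: HM.
have coneOm x0 : closure Om x0 -> exists W l, dual_basis W l /\ cone_at Om W x0.
  by apply: cone_at_closure smOm => g z; exact: smooth_loc_lip.
have coneOmm x0 : closure Omm x0 -> exists W l, dual_basis W l /\ cone_at Omm W x0.
  by apply: cone_at_closure lipOmm => g z; exact: lipschitz_loc.
have null : leb3 (boundary Omm) = 0%E.
  apply: boundary_null => // x0 [/coneOmm[W [l [_ c]]] _]; by exists W.
have a0 := coef_gt0 omega0 eps00 mu00.
have uniq := limit_unique oOm cOmm omega0 eps00 mu00 ne.
have [s0 [C [s00 C0 est]]] := apriori oOm bOm oOmm cOmm coneOm coneOmm a0 null uniq.
(* The source has six nonzero real components, each bounded by the norm of [j]. *)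
exists s0, (6 * C); split=> //; split; first by rewrite mulr_gt0.
move=> s s0s j sj; have {}est := est s s0s.
have vj : inL2v Om j by move: sj; case: (b) => [[[]]|[]].
have Lj : L2comp Om j by apply/(inL2vP _ mOm).
have Lf := L2f_current Lj; have vf := @vanish_current R Om j.
have est' u f : L2f u -> L2f f -> vanish Om u -> vanish Om f ->
    msys Om Omm (coef omega eps0 mu0) (hbc b) s f u -> nsum u <= C * nsum f.
  move=> Lu Lf' u0 f0 sys; apply: le_trans (est u f Lu Lf' u0 f0 sys).
  by rewrite lerDl mulr_ge0 ?sqrtr_ge0 ?nsumE_ge0.
have [u [Lu u0 sys]] := solvability oOm oOmm subO (ltW C0) est' Lf vf.
exists (vec (u false)), (vec (u true)); split.
- exact: msys_maxwell.
- move=> E H sol; have [/(inL2vP _ mOm) LE /(inL2vP _ mOm) LH _ _ _] := sol.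
  have sol' := maxwell_msys oOm bOm oOmm cOmm Lj sol.
  have Lp := L2f_pair LE LH; have p0 := @vanish_pair R Om E H.
  (* The difference of two solutions solves the system with zero source, so the estimate annihilates
     its twelve components almost everywhere. *)
  pose d h c k := -1 *: u h c k + pair_fields Om E H h c k.
  have Ld : L2f d by exact: L2f_lin.
  have sd := msys_lin oOmm (-1) Lu Lp Lf Lf sys sol'.
  have z : (fun h c k => -1 *: current Om j h c k + current Om j h c k) = fun _ _ _ => 0.
    by do 3 (apply/funext => ?); rewrite scaleN1r addNr.
  have LZ : L2f (fun _ _ _ => 0 : R3 R -> R) by move=> *; exact: L2_0.
  have n0 : nsum d <= 0.
    have := est' _ _ Ld (L2f_lin (-1) Lf Lf) (vanish_lin (-1) u0 p0) (vanish_lin (-1) vf vf) sd.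
    rewrite z (_ : nsum (fun _ _ _ => 0) = 0) ?mulr0// /nsum.
    by do 3 (apply: big1 => ? _); exact: nrm0.
  have ae h c k : {ae leb3, forall x, d h c k x = 0}.
    apply: nrm_eq0_ae => //; apply/eqP; rewrite eq_le nrm_ge0 andbT.
    exact: le_trans (le_nsum d h c k) n0.
  have ae1 h : ae_eq_on Om (if h then H else E) (vec (u h)).
    have aek c : {ae leb3, forall x k, d h c k x = 0} by apply: ae_all_count => k; exact: ae.
    have : {ae leb3, forall x c k, d h c k x = 0} by apply: ae_all_count.
    apply: ae_imp => x hx Ox; apply/rowP => k; apply: partP => c; have := hx c k.
    rewrite -[LHS]/(-1 * u h c k x + pair_fields Om E H h c k x) /pair_fields /comp /pt res_in// mulN1r.
    move=> /eqP; rewrite addrC subr_eq0 => /eqP ->; rewrite mxE; by case: (c).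
  by split; [exact: (ae1 false)|exact: (ae1 true)].
have cv h c k : comp Om (vec (u h)) c k = u h c k by apply: comp_vanish => x; exact: u0.
have Lv h : inL2v Om (vec (u h)) by apply/(inL2vP _ mOm) => c k; rewrite cv.
have Lvm : inL2v Omm (vec (u false)).
  by apply/(inL2vP _ mOmm) => c k; rewrite comp_vec; exact: L2_res.
have bE : L2vnorm Om (vec (u false)) + L2vnorm Om (vec (u true)) <= nsum u.
  rewrite /nsum big_bool addrC; apply: lerD.
    by apply: le_trans (L2vnorm_le mOm (Lv true)) _; apply: ler_sum => c _; apply: ler_sum => k _; rewrite cv.
  by apply: le_trans (L2vnorm_le mOm (Lv false)) _; apply: ler_sum => c _; apply: ler_sum => k _; rewrite cv.
have bm : L2vnorm Omm (vec (u false)) <= nsumE Omm u.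
  by apply: le_trans (L2vnorm_le mOmm Lvm) _; apply: ler_sum => c _; apply: ler_sum => k _; rewrite comp_vec.
have bj : nsum (current Om j) <= 6 * Hdivnorm Om j.
  have jh : L2vnorm Om j <= Hdivnorm Om j.
    rewrite -[leLHS]ger0_norm ?L2vnorm_ge0// -sqrtr_sqr; apply: ler_wsqrtr; rewrite lerDl; exact: sqr_ge0.
  have z : \sum_(c : bool) \sum_(k < 3) nrm leb3 (current Om j false c k) = 0.
    by apply: big1 => c _; apply: big1 => k _; exact: nrm0.
  rewrite /nsum big_bool /= z addr0; apply: (@le_trans _ _ (\sum_(c : bool) \sum_(k < 3) Hdivnorm Om j)).
    apply: ler_sum => c _; apply: ler_sum => k _; exact: le_trans (nrm_le_L2vnorm c k mOm vj) jh.
  by rewrite !sumr_const card_bool card_ord -mulrnA mulr_natl.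
have := est u _ Lu Lf u0 vf sys.
have sb : Num.sqrt s * L2vnorm Omm (vec (u false)) <= Num.sqrt s * nsumE Omm u by rewrite ler_wpM2l ?sqrtr_ge0.
have := ler_wpM2l (ltW C0) bj.
move: (nsum (current Om j)) (Num.sqrt s * _) (Num.sqrt s * _) (nsum u) (L2vnorm _ _) (L2vnorm _ _) (Hdivnorm _ _) bE sb.
move=> x y t z p q r h1 h2 h3 h4; nra.
Qed.
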